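(* Let $Q_T=(0,T)\times\mathbb T^d$. Let $U_1,U_2$ be two classical solutions of the master equation (see context) with the same Hamiltonian $H$ and running cost $F$ and with terminal conditions $U_i(T,x,m)=G_i(x,m)$, $i=1,2$, and set $\overline U=U_1-U_2$. Let $\beta_1,\widehat b,\widehat A$, the operator $\mathcal D_{\beta_1}$ and the operator $\mathcal P$ be as defined in the context. Let $m_1=m_1(t,x)$ be a flow of probability densities generated by $U_1$, i.e. $m_1(0)=m_0$ and $$\partial_tm_1-\Delta m_1-\operatorname{div}\big(m_1\beta_1(t,x,m_1(t))\big)=0\quad\text{in }Q_T .$$ Let $V:[0,T]\times\mathbb T^d\times\mathcal P(\mathbb T^d)\to\mathbb R$ be continuously differentiable in $t$ and of class $C^1$ in $m$, with $\delta V/\delta m$ twice differentiable in $y$, the corresponding derivatives being continuous in all variables, and assume that $v(t,x):=V(t,x,m_1(t))$ satisfies $v\in L^2(0,T;H^2(\mathbb T^d))\cap H^1(0,T;L^2(\mathbb T^d))$. Assume that there is a constant $M>0$ such that $$\sup_{m\in\mathcal P(\mathbb T^d)}\|\widehat b(\cdot,\cdot,m)\|_{L^\infty(Q_T)}+\sup_{m\in\mathcal P(\mathbb T^d)}\|\widehat A(\cdot,\cdot,m)\|_{L^\infty(Q_T)}+\sup_{m\in\mathcal P(\mathbb T^d)}\|D_mU_2(\cdot,\cdot,m,\cdot)\|_{L^\infty((0,T)\times\mathbb T^d\times\mathbb T^d)}+\|m_1\|_{L^\infty(Q_T)}\le M .$$ Then for any $a>0$ and $\nu>1$ there exist constants $\lambda_0=\lambda_0(T,a,\nu,d,M)>0$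 and $C=C(T,a,\nu,d,M)>0$ such that for all $\lambda\ge\lambda_0$ $$\begin{aligned}&\lambda\int_{Q_T}e^{2\lambda(t+a)^\nu}|D_xV(t,x,m_1(t))|^2\,dx\,dt+\lambda^2\int_{Q_T}e^{2\lambda(t+a)^\nu}|V(t,x,m_1(t))|^2\,dx\,dt\\&\le C\int_{Q_T}e^{2\lambda(t+a)^\nu}|\mathcal PV(t,x,m_1(t))|^2\,dx\,dt\\&\quad+Ce^{2\lambda(T+a)^\nu}\int_{\mathbb T^d}\Big(|D_xV(T,x,m_1(T))|^2+\lambda|V(T,x,m_1(T))|^2\Big)dx .\end{aligned}$$ In particular, taking $V=\overline U$ (for which $\mathcal P\overline U=0$), $$\begin{aligned}&\lambda\int_{Q_T}e^{2\lambda(t+a)^\nu}|D_x\overline U(t,x,m_1(t))|^2\,dx\,dt+\lambda^2\int_{Q_T}e^{2\lambda(t+a)^\nu}|\overline U(t,x,m_1(t))|^2\,dx\,dt\\&\le Ce^{2\lambda(T+a)^\nu}\int_{\mathbb T^d}\Big(|D_x\overline U(T,x,m_1(T))|^2+\lambda|\overline U(T,x,m_1(T))|^2\Big)dx .\end{aligned}$$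
   Context: **Measure derivatives.** $\mathbb T^d$ is the flat torus, $\mathcal P(\mathbb T^d)$ the Borel probability measures on it (with the Monge–Kantorovich distance). $\Phi:\mathcal P(\mathbb T^d)\to\mathbb R$ is differentiable ($C^1$) in $m$ if there is a continuous $\frac{\delta\Phi}{\delta m}:\mathcal P(\mathbb T^d)\times\mathbb T^d\to\mathbb R$ with $\lim_{s\to0^+}\frac{\Phi((1-s)m+sm')-\Phi(m)}{s}=\int\frac{\delta\Phi}{\delta m}(m,y)\,d(m'-m)(y)$ for all $m,m'$, normalized by $\int\frac{\delta\Phi}{\delta m}(m,y)\,dm(y)=0$. The intrinsic derivative is $D_m\Phi(m,y)=D_y\frac{\delta\Phi}{\delta m}(m,y)$. The same symbol denotes an absolutely continuous measure and its density. **Master equation** (Hamiltonian $H(x,p)$ with continuous $D_pH,D^2_{pp}H$; running cost $F(x,m)$; terminal cost $G(x,m)$): for $(t,x,m)\in(0,T)\times\mathbb T^d\times\mathcal P(\mathbb T^d)$, $$-\partial_tU-\Delta_xU+H(x,D_xU)-\int\operatorname{div}_y(D_mU(t,x,m,y))\,dm(y)+\int D_mU(t,x,m,y)\cdot D_pH(y,D_xU(t,y,m))\,dm(y)=F(x,m),$$ with $U(T,x,m)=G(x,m)$. **Classical solution**: $U$ is continuous, $C^1$ in $t$ and $C^2$ in $x$ (derivatives continuous in all variables), $C^1$ in $m$ with $\delta U/\delta m$ continuous in all variables and twice differentiable in $y$ with derivatives continuous in all variables, and $U$ satisfies the master equation. **Coefficients and operators.** $\beta_i(t,y,m)=D_pH(y,D_yU_i(t,y,m))$;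 $$\widehat b(t,x,m)=\int_0^1D_pH(x,D_xU_2(t,x,m)+sD_x\overline U(t,x,m))\,ds,\quad \widehat A(t,y,m)=\int_0^1D^2_{pp}H(y,D_yU_2(t,y,m)+sD_y\overline U(t,y,m))\,ds;$$ $$\mathcal D_{\beta_1}V(t,x,m)=\partial_tV(t,x,m)+\int\operatorname{div}_y(D_mV(t,x,m,y))\,dm(y)-\int D_mV(t,x,m,y)\cdot\beta_1(t,y,m)\,dm(y);$$ $$\mathcal PV(t,x,m)=-\mathcal D_{\beta_1}V-\Delta_xV+\widehat b(t,x,m)\cdot D_xV+\int D_mU_2(t,x,m,y)\cdot\widehat A(t,y,m)D_yV(t,y,m)\,dm(y).$$ *)

(* Defs.v *)
From HB Require Import structures.
From mathcomp Require Import all_boot all_order all_algebra.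
From mathcomp Require Import all_classical all_reals all_analysis.

Set Implicit Arguments.
Unset Strict Implicit.
Unset Printing Implicit Defensive.

Import Order.TTheory GRing.Theory Num.Theory.
Import numFieldNormedType.Exports.

Local Open Scope classical_set_scope.
Local Open Scope ring_scope.

(* The flat torus T^d is R^d / Z^d: its points are represented by vectors
   x : 'rV[R]_d, functions on T^d by Z^d-periodic functions of x, and Borel
   probability measures on T^d by Borel probability measures on R^d carried by
   the fundamental domain [0, 1)^d. *)

(* The Borel sigma-algebra of R^n is the product sigma-algebra. *)
Section measurable_rV.
Variables (R : realType) (n : nat).

Let coords : 'I_n -> 'rV[R]_n -> R := fun i x => x ord0 i.

Let rV_set0 : g_sigma_preimage coords set0.
Proof. exact: sigma_algebra0. Qed.

Let rV_setC A : g_sigma_preimage coords A -> g_sigma_preimage coords (~` A).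
Proof. exact: sigma_algebraC. Qed.

Let rV_bigcup (F : (set 'rV[R]_n)^nat) :
  (forall i, g_sigma_preimage coords (F i)) ->
  g_sigma_preimage coords (\bigcup_i F i).
Proof. exact: sigma_algebra_bigcup. Qed.

HB.instance Definition _ := @isMeasurable.Build default_measure_display
  'rV[R]_n (g_sigma_preimage coords) rV_set0 rV_setC rV_bigcup.

Lemma measurable_coord (i : 'I_n) :
  measurable_fun [set: 'rV[R]_n] (fun x : 'rV[R]_n => x ord0 i).
Proof.
move=> _ Y mY; rewrite setTI; apply: sub_sigma_algebra => /=.
rewrite -bigcup_seq/=; exists i => /=; first by rewrite mem_index_enum.
by exists Y => //; rewrite setTI.
Qed.

Lemma measurable_fun_rV d (T : measurableType d) (f : T -> 'rV[R]_n) :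
  (forall i, measurable_fun [set: T] (fun x => f x ord0 i)) ->
  measurable_fun [set: T] f.
Proof.
move=> mf _ A mA; rewrite setTI.
suff : (g_sigma_preimage (fun i => coords i \o f)) `<=` measurable.
  by rewrite g_sigma_preimage_comp; apply; exists A => //; rewrite setTI.
apply: smallest_sub; first exact: sigma_algebra_measurable.
rewrite -bigcup_seq/=; apply: bigcup_sub => i _ B [C mC <-].
exact: mf.
Qed.

End measurable_rV.

Section torus_lebesgue.
Variable R : realType.

Definition row_cons n (z : measurableTypeR R * 'rV[R]_n) : 'rV[R]_n.+1 :=
  \row_i (if unlift ord0 i is Some j then z.2 ord0 j else z.1).

Lemma measurable_row_cons n : measurable_fun setT (@row_cons n).
Proof.
apply: measurable_fun_rV => i.
rewrite /row_cons; under eq_fun do rewrite mxE.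
case: (unlift ord0 i) => [j|]; last exact: measurable_fst.
apply: (measurableT_comp (measurable_coord j)).
exact: measurable_snd.
Qed.

HB.instance Definition _ n := isMeasurableFun.Build _ _ _ _
  (@row_cons n) (@measurable_row_cons n).

(* Lebesgue measure restricted to [0, 1]^n, that is, the normalized Lebesgue
   measure of the torus. *)
Fixpoint torus_leb (n : nat) : probability 'rV[R]_n R :=
  match n with
  | 0 => dirac (0 : 'rV[R]_0)
  | n'.+1 => distribution (uniform_prob (@ltr01 R) \x torus_leb n')%E
               (@row_cons n')
  end.

End torus_lebesgue.

Section calculus.
Variables (R : realType) (d : nat).
Implicit Types (f : 'rV[R]_d -> R) (x : 'rV[R]_d).

Definition dot (u v : 'rV[R]_d) : R := (u *m v^T) ord0 ord0.

(* Euclidean (Frobenius) norm; the norm `|A| of the library is the sup norm. *)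
Definition enorm m n (A : 'M[R]_(m, n)) : R :=
  Num.sqrt (\sum_i \sum_j A i j ^+ 2).

Definition basis_vec (i : 'I_d) : 'rV[R]_d := delta_mx ord0 i.

Definition grad f x : 'rV[R]_d := \row_i 'D_(basis_vec i) f x.

Definition hess f x : 'M[R]_d :=
  \matrix_(i, j) 'D_(basis_vec j) ('D_(basis_vec i) f) x.

Definition lap f x : R := \sum_i 'D_(basis_vec i) ('D_(basis_vec i) f) x.

Definition dvg (b : 'rV[R]_d -> 'rV[R]_d) x : R :=
  \sum_i 'D_(basis_vec i) (fun y => b y ord0 i) x.

Definition has_partials f : Prop := forall x i, derivable f x (basis_vec i).

Definition has_partials2 f : Prop :=
  has_partials f /\ forall i, has_partials ('D_(basis_vec i) f).

Definition Zperiodic (S : Type) (f : 'rV[R]_d -> S) : Prop :=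
  forall x (k : 'rV[int]_d), f (x + map_mx intr k) = f x.

End calculus.

Section prob_torus.
Variables (R : realType) (d : nat).

Definition unit_cube : set 'rV[R]_d :=
  [set x | forall i, 0 <= x ord0 i < 1].

Record prob_torus := ProbTorus {
  prob_torus_measure :> probability 'rV[R]_d R ;
  prob_torus_cube : prob_torus_measure unit_cube = 1%E }.

HB.instance Definition _ := gen_eqMixin prob_torus.
HB.instance Definition _ := gen_choiceMixin prob_torus.

(* Monge-Kantorovich distance, as the supremum over 1-Lipschitz functions on
   the torus: a Z^d-periodic function is 1-Lipschitz for the torus distance iff
   it is so for the Euclidean distance of R^d. *)
Definition lip1 (phi : 'rV[R]_d -> R) : Prop :=
  Zperiodic phi /\ forall x y, `|phi x - phi y| <= enorm (x - y).

Definition mk_dist (m m' : prob_torus) : \bar R :=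
  ereal_sup [set (\int[m]_y phi y - \int[m']_y phi y)%:E | phi in lip1].

Let mk_ball (m : prob_torus) (e : R) : set prob_torus :=
  [set m' | (mk_dist m m' < e%:E)%E].

Lemma mk_distxx m : mk_dist m m = 0%E.
Proof.
apply/eqP; rewrite eq_le; apply/andP; split.
  by apply: ge_ereal_sup => _ [phi _ <-]; rewrite subrr.
apply: ereal_sup_ubound; exists (cst 0); last by rewrite subrr.
by split=> // x y; rewrite subrr normr0 sqrtr_ge0.
Qed.

Lemma RintegralN_gen (m : prob_torus) (phi : 'rV[R]_d -> R) :
  \int[m]_y (- phi y) = - \int[m]_y phi y.
Proof.
rewrite /Rintegral [in LHS]integralE [in RHS]integralE.
have -> : (fun y => (- phi y)%:E) = (\- (EFin \o phi))%E by [].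
rewrite funeposN funenegN.
set a := (\int[m]_x ((EFin \o phi)^\+ x))%E.
set b := (\int[m]_x ((EFin \o phi)^\- x))%E.
by case: a => [a| |]; case: b => [b| |] //=; rewrite ?oppr0 // opprB.
Qed.

Lemma mk_dist_sym m m' : mk_dist m m' = mk_dist m' m.
Proof.
suff le n n' : (mk_dist n n' <= mk_dist n' n)%E.
  by apply/eqP; rewrite eq_le !le.
apply: ge_ereal_sup => _ [phi [pp lp] <-].
apply: ereal_sup_ubound; exists (fun y => - phi y).
  split=> [x k|x y]; first by rewrite pp.
  by rewrite -opprD normrN.
by rewrite !RintegralN_gen opprK addrC.
Qed.

Lemma mk_dist_triangle m m' m'' :
  (mk_dist m m'' <= mk_dist m m' + mk_dist m' m'')%E.
Proof.
apply: ge_ereal_sup => _ [phi lphi <-].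
rewrite -[X in (X%:E <= _)%E](subrKA (\int[m']_y phi y)) EFinD.
by apply: leeD; apply: ereal_sup_ubound; exists phi.
Qed.

Let mk_ball_center m (e : R) : 0 < e -> mk_ball m e m.
Proof. by move=> e0; rewrite /mk_ball/= mk_distxx lte_fin. Qed.

Let mk_ball_sym m m' (e : R) : mk_ball m e m' -> mk_ball m' e m.
Proof. by rewrite /mk_ball/= mk_dist_sym. Qed.

Let mk_ball_triangle m m' m'' (e1 e2 : R) :
  mk_ball m e1 m' -> mk_ball m' e2 m'' -> mk_ball m (e1 + e2) m''.
Proof.
rewrite /mk_ball/= => h1 h2; apply: le_lt_trans (mk_dist_triangle m m' m'') _.
by rewrite EFinD lteD.
Qed.

Let mk_ent : set_system (prob_torus * prob_torus) := entourage_ mk_ball.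

HB.instance Definition _ := hasNbhs.Build prob_torus (nbhs_ mk_ent).
HB.instance Definition _ := @Nbhs_isPseudoMetric.Build R prob_torus
  mk_ent erefl mk_ball mk_ball_center mk_ball_sym mk_ball_triangle erefl.

(* The mixture (1 - s) m + s m', for s clipped to [0, 1]. *)
Section mixture.
Variables (s : R) (m m' : prob_torus).

Let w : R := Num.max 0 (Num.min s 1).

Let w_ge0 : 0 <= w.
Proof. by rewrite /w le_max lexx. Qed.

Let w_le1 : 0 <= 1 - w.
Proof. by rewrite subr_ge0 /w ge_max ler01 ge_min lexx orbT. Qed.

Definition mixture_measure : set 'rV[R]_d -> \bar R :=
  measure_add (mscale (NngNum w_le1) m) (mscale (NngNum w_ge0) m').

HB.instance Definition _ := Measure.on mixture_measure.

Lemma mixture_measureE A :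
  mixture_measure A = ((1 - w)%:E * m A + w%:E * m' A)%E.
Proof. by rewrite /mixture_measure measure_addE. Qed.

Let mixture_setT : mixture_measure [set: 'rV[R]_d] = 1%E.
Proof. by rewrite mixture_measureE !probability_setT !mule1 -EFinD subrK. Qed.

HB.instance Definition _ :=
  Measure_isProbability.Build _ _ _ mixture_measure mixture_setT.

Let mixture_cube : mixture_measure unit_cube = 1%E.
Proof. by rewrite mixture_measureE !prob_torus_cube !mule1 -EFinD subrK. Qed.

Definition mixture : prob_torus :=
  @ProbTorus (mixture_measure : probability _ _) mixture_cube.

End mixture.

End prob_torus.

Section measure_derivative.
Variables (R : realType) (d : nat).
Local Notation P := (prob_torus R d).
Implicit Types (Phi : P -> R) (m : P) (y : 'rV[R]_d).

Definition is_lfd Phi (delta : P -> 'rV[R]_d -> R) : Prop :=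
  [/\ forall m, Zperiodic (delta m),
      continuous (fun z : P * 'rV[R]_d => delta z.1 z.2),
      forall m m',
        s^-1 * (Phi (mixture s m m') - Phi m) @[s --> 0^'+] -->
          \int[m']_y delta m y - \int[m]_y delta m y
    & forall m, \int[m]_y delta m y = 0].

Definition C1_measure Phi : Prop := exists delta, is_lfd Phi delta.

(* The normalized linear functional derivative; is_lfd determines it
   uniquely. *)
Definition lfd Phi : P -> 'rV[R]_d -> R := xget (fun _ _ => 0) (is_lfd Phi).

Definition Dm Phi m y : 'rV[R]_d := grad (lfd Phi m) y.

End measure_derivative.

Section master_equation.
Variables (R : realType) (d : nat).
Local Notation P := (prob_torus R d).
Local Notation txm_fun := (R -> 'rV[R]_d -> P -> R).
Implicit Types (T t : R) (x y p : 'rV[R]_d) (m : P) (U V : txm_fun).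

Definition cont_txm (S : topologicalType) T (f : R -> 'rV[R]_d -> P -> S) :=
  {within [set z : R * 'rV[R]_d * P | 0 <= z.1.1 <= T],
    continuous (fun z => f z.1.1 z.1.2 z.2)}.

Definition cont_txmy (S : topologicalType) T
    (f : R -> 'rV[R]_d -> P -> 'rV[R]_d -> S) :=
  {within [set z : R * 'rV[R]_d * P * 'rV[R]_d | 0 <= z.1.1.1 <= T],
    continuous (fun z => f z.1.1.1 z.1.1.2 z.1.2 z.2)}.

Definition Dt U t x m : R := derive1 (fun s => U s x m) t.

Definition Dx U t x m : 'rV[R]_d := grad (fun y => U t y m) x.

Definition Dxx U t x m : 'M[R]_d := hess (fun y => U t y m) x.

Definition Lapx U t x m : R := lap (fun y => U t y m) x.

(* C^1 on the closed interval [0, T]: the derivative on (0, T), continuous in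
   all variables, extends continuously up to t = 0 and t = T. *)
Definition C1_time T U : Prop :=
  [/\ forall x m, {within `[0, T], continuous (fun t => U t x m)},
      forall t x m, 0 < t < T -> derivable (fun s => U s x m) t 1
    & exists2 dU, cont_txm T dU
        & forall t x m, 0 < t < T -> Dt U t x m = dU t x m].

Definition C2_space T U : Prop :=
  [/\ forall t m, 0 <= t <= T -> has_partials2 (fun x => U t x m),
      cont_txm T (Dx U)
    & cont_txm T (Dxx U)].

Definition C1_measure_C2 T U : Prop :=
  [/\ forall t x, 0 <= t <= T -> C1_measure (U t x),
      forall t x m, 0 <= t <= T -> has_partials2 (lfd (U t x) m),
      cont_txmy T (fun t x => lfd (U t x)),
      cont_txmy T (fun t x => Dm (U t x))
    & cont_txmy T (fun t x m => hess (lfd (U t x) m))].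

Definition DpH (H : 'rV[R]_d -> 'rV[R]_d -> R) x p : 'rV[R]_d := grad (H x) p.

Definition DppH (H : 'rV[R]_d -> 'rV[R]_d -> R) x p : 'M[R]_d := hess (H x) p.

Definition hamiltonian (H : 'rV[R]_d -> 'rV[R]_d -> R) : Prop :=
  [/\ Zperiodic H,
      forall x, has_partials2 (H x),
      continuous (fun z : 'rV[R]_d * 'rV[R]_d => DpH H z.1 z.2)
    & continuous (fun z : 'rV[R]_d * 'rV[R]_d => DppH H z.1 z.2)].

Definition beta (H : 'rV[R]_d -> 'rV[R]_d -> R) U t y m : 'rV[R]_d :=
  DpH H y (Dx U t y m).

Definition master_eq (H : 'rV[R]_d -> 'rV[R]_d -> R)
    (F : 'rV[R]_d -> P -> R) U t x m : Prop :=
  - Dt U t x m - Lapx U t x m + H x (Dx U t x m)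
  - \int[m]_y dvg (Dm (U t x) m) y
  + \int[m]_y dot (Dm (U t x) m y) (DpH H y (Dx U t y m)) = F x m.

Record classical_solution T (H : 'rV[R]_d -> 'rV[R]_d -> R)
    (F G : 'rV[R]_d -> P -> R) U : Prop := {
  cs_periodic : forall t, Zperiodic (U t) ;
  cs_continuous : cont_txm T U ;
  cs_C1_time : C1_time T U ;
  cs_C2_space : C2_space T U ;
  cs_C1_measure : C1_measure_C2 T U ;
  cs_equation : forall t x m, 0 < t < T -> master_eq H F U t x m ;
  cs_terminal : forall x m, U T x m = G x m }.

Definition Udiff (U1 U2 : txm_fun) : txm_fun :=
  fun t x m => U1 t x m - U2 t x m.

Definition bhat (H : 'rV[R]_d -> 'rV[R]_d -> R) (U1 U2 : txm_fun) t x m :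
    'rV[R]_d :=
  \row_i \int[lebesgue_measure]_(s in `[0, 1])
    DpH H x (Dx U2 t x m + s *: Dx (Udiff U1 U2) t x m) ord0 i.

Definition Ahat (H : 'rV[R]_d -> 'rV[R]_d -> R) (U1 U2 : txm_fun) t y m :
    'M[R]_d :=
  \matrix_(i, j) \int[lebesgue_measure]_(s in `[0, 1])
    DppH H y (Dx U2 t y m + s *: Dx (Udiff U1 U2) t y m) i j.

Definition Dbeta (b : R -> 'rV[R]_d -> P -> 'rV[R]_d) V t x m : R :=
  Dt V t x m + \int[m]_y dvg (Dm (V t x) m) y
  - \int[m]_y dot (Dm (V t x) m y) (b t y m).

(* PV(t, x, m). The spatial gradient and Laplacian of V are arguments, since
   along the flow m_1 they are only weak derivatives. *)
Definition Pop (H : 'rV[R]_d -> 'rV[R]_d -> R) (U1 U2 V : txm_fun)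
    (DxV : R -> 'rV[R]_d -> P -> 'rV[R]_d) (LapV : txm_fun) t x m : R :=
  - Dbeta (beta H U1) V t x m - LapV t x m
  + dot (bhat H U1 U2 t x m) (DxV t x m)
  + \int[m]_y (Dm (U2 t x) m y *m Ahat H U1 U2 t y m *m (DxV t y m)^T)
                ord0 ord0.

End master_equation.

Section cylinder.
Variables (R : realType) (d : nat).
Local Notation P := (prob_torus R d).
Implicit Types (T t : R) (x : 'rV[R]_d).

Definition cylinder T : set (measurableTypeR R * 'rV[R]_d) :=
  [set z | 0 < z.1 < T].

Definition cyl_leb : set (measurableTypeR R * 'rV[R]_d) -> \bar R :=
  (lebesgue_measure \x torus_leb R d)%E.

HB.instance Definition _ := Measure.on cyl_leb.

Definition Linf_QT T (f : R -> 'rV[R]_d -> R) : \bar R :=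
  Lnorm cyl_leb +oo%E ((fun z => (f z.1 z.2)%:E) \_ (cylinder T)).

Definition Linf_QT_Td T (f : R -> 'rV[R]_d -> 'rV[R]_d -> R) : \bar R :=
  Lnorm (cyl_leb \x torus_leb R d)%E +oo%E
    ((fun z => (f z.1.1 z.1.2 z.2)%:E) \_ [set z | cylinder T z.1]).

(* C^1 functions with compact support in (0, T) x T^d. Weak derivatives are
   tested against this class (and distributional solutions against its C^{1,2}
   version); by mollification this is the same as testing against smooth
   functions with compact support. *)
Definition test_C1 T (phi : R -> 'rV[R]_d -> R) : Prop :=
  [/\ forall t, Zperiodic (phi t),
      exists2 e, 0 < e &
        forall t x, ~~ (e <= t <= T - e) -> phi t x = 0,
      continuous (fun z : R * 'rV[R]_d => phi z.1 z.2),
      (forall x t, derivable (fun s => phi s x) t 1) /\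
      continuous (fun z : R * 'rV[R]_d => derive1 (fun s => phi s z.2) z.1)
    & (forall t, has_partials (phi t)) /\
      continuous (fun z : R * 'rV[R]_d => grad (phi z.1) z.2)].

Definition test_C12 T (phi : R -> 'rV[R]_d -> R) : Prop :=
  [/\ test_C1 T phi,
      forall t, has_partials2 (phi t)
    & continuous (fun z : R * 'rV[R]_d => hess (phi z.1) z.2)].

Definition L2_QT T (f : R -> 'rV[R]_d -> R) : Prop :=
  measurable_fun (cylinder T) (fun z => f z.1 z.2) /\
  (\int[cyl_leb]_(z in cylinder T) (f z.1 z.2 ^+ 2)%:E < +oo)%E.

Definition weak_dt T (f g : R -> 'rV[R]_d -> R) : Prop :=
  forall phi, test_C1 T phi ->
    \int[cyl_leb]_(z in cylinder T)
        (f z.1 z.2 * derive1 (fun s => phi s z.2) z.1) =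
    - \int[cyl_leb]_(z in cylinder T) (g z.1 z.2 * phi z.1 z.2).

Definition weak_dx T (i : 'I_d) (f g : R -> 'rV[R]_d -> R) : Prop :=
  forall phi, test_C1 T phi ->
    \int[cyl_leb]_(z in cylinder T)
        (f z.1 z.2 * 'D_(basis_vec R i) (phi z.1) z.2) =
    - \int[cyl_leb]_(z in cylinder T) (g z.1 z.2 * phi z.1 z.2).

(* v is in L^2(0, T; H^2(T^d)), with weak gradient g and weak Hessian h, and in
   H^1(0, T; L^2(T^d)). *)
Definition L2H2_H1L2 T (v : R -> 'rV[R]_d -> R)
    (g : R -> 'rV[R]_d -> 'rV[R]_d) (h : R -> 'rV[R]_d -> 'M[R]_d) : Prop :=
  [/\ L2_QT T v,
      forall i, L2_QT T (fun t x => g t x ord0 i) /\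
        weak_dx T i v (fun t x => g t x ord0 i),
      forall i j, L2_QT T (fun t x => h t x i j) /\
        weak_dx T j (fun t x => g t x ord0 i) (fun t x => h t x i j)
    & exists2 w, L2_QT T w & weak_dt T v w].

(* g is the weak gradient of f. *)
Definition H1_torus (f : 'rV[R]_d -> R) (g : 'rV[R]_d -> 'rV[R]_d) : Prop :=
  [/\ measurable_fun setT f,
      (\int[torus_leb R d]_x (f x ^+ 2)%:E < +oo)%E,
      forall i, measurable_fun setT (fun x => g x ord0 i),
      forall i, (\int[torus_leb R d]_x (g x ord0 i ^+ 2)%:E < +oo)%E
    & forall i (phi : 'rV[R]_d -> R), Zperiodic phi -> has_partials phi ->
        continuous phi -> continuous (grad phi) ->
        \int[torus_leb R d]_x (f x * 'D_(basis_vec R i) phi x) =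
        - \int[torus_leb R d]_x (g x ord0 i * phi x)].

(* A flow of probability densities rho = rho(t, x), with associated measures
   m1(t) = rho(t, .) dx, solving
     d_t m1 - Lap m1 - div (m1 b(t, x, m1(t))) = 0 in Q_T,  m1(0) = m0,
   in the sense of distributions. *)
Record density_flow T (b : R -> 'rV[R]_d -> P -> 'rV[R]_d) (m0 : P)
    (m1 : R -> P) (rho : R -> 'rV[R]_d -> R) : Prop := {
  df_measurable : measurable_fun
    [set z : measurableTypeR R * 'rV[R]_d | 0 <= z.1 <= T]
    (fun z => rho z.1 z.2) ;
  df_ge0 : forall t x, 0 <= t <= T -> 0 <= rho t x ;
  df_density : forall t, 0 <= t <= T -> forall A : set 'rV[R]_d,
    measurable A -> m1 t A = (\int[torus_leb R d]_(x in A) (rho t x)%:E)%E ;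
  df_continuous : {within `[0, T], continuous m1} ;
  df_initial : m1 0 = m0 ;
  df_equation : forall phi, test_C12 T phi ->
    \int[lebesgue_measure]_(t in `]0, T[) \int[m1 t]_x
      (derive1 (fun s => phi s x) t + lap (phi t) x
       - dot (grad (phi t) x) (b t x (m1 t))) = 0 }.

Definition carleman_weight (lambda a nu t : R) : R :=
  expR (2 * lambda * (t + a) `^ nu).

Definition weighted_QT T (lambda a nu : R) (f : R -> 'rV[R]_d -> R) : \bar R :=
  (\int[cyl_leb]_(z in cylinder T)
    (carleman_weight lambda a nu z.1 * f z.1 z.2 ^+ 2)%:E)%E.

End cylinder.

(* Main.v *)
Require Import Defs.
From HB Require Import structures.
From mathcomp Require Import all_boot all_order all_algebra.
From mathcomp Require Import all_classical all_reals all_analysis.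
From mathcomp Require Import measurable_realfun.
From mathcomp Require Import ring lra.

Set Implicit Arguments.
Unset Strict Implicit.
Unset Printing Implicit Defensive.

Import Order.TTheory GRing.Theory Num.Theory.
Import numFieldNormedType.Exports.

Local Open Scope classical_set_scope.
Local Open Scope ring_scope.

(* Write v(t, x) = V(t, x, m1(t)). The Fokker-Planck equation of the flow gives the
   chain rule d_t v = D_beta1 V along the flow: in the distributional sense first, then
   classically, since t |-> int psi dm1(t) has a continuous weak derivative. So v solves
   the backward equation - d_t v - Lap v = PV - bhat . Dv - N, where the nonlocal term N
   satisfies N^2 <= M^6 int |Dv|^2 because |D_m U2|, |Ahat| <= M and m1(t) <= M dx.
   Let W = exp(2 lambda (t + a)^nu), with logarithmic derivative at least
   2 lambda nu a^(nu - 1). Integrating the derivative of W(t) int v(t)^2 over (0, T) and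
   replacing d_t v by the equation bounds lambda int W |Dv|^2 + lambda^2 int W v^2 by the
   final value and the source; the terms with Dv on the right are absorbed on the left
   for large lambda. Only int v(T)^2 is needed at the final time, but the statement also
   asks for a weak gradient of v(T): it is the limit of the gradients of v(t_n) along
   suitable t_n -> T.

   Weak derivatives are handled through the kernels
   K_n(x, y) = prod_j c_n cos(pi (x_j - y_j))^(2n): integrating u(x) w(y) d_i K_n(x, y) in
   both orders gives the integration by parts of two weakly differentiable functions
   without differentiating under an integral sign.

   For the last estimate, the integrals defining bhat and Ahat along the segment from
   Dx U2 to Dx U1 turn the difference of the two master equations into P Udiff = 0. *)

(** * Measurability of continuous functions *)

(** Along the flow, [V] is C^1 in time at each fixed x, but its spatial derivatives are weak and
    meaningful only for almost every t. Time is therefore integrated by the fundamental theorem of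
    calculus at fixed x, space by pairing weak derivatives at fixed t, and Fubini on a product of
    two probabilities joins the two. The weight depends on time only, so it does not disturb the
    spatial step. Measurability of PV along the flow is not established, so the integral of its
    square is bounded from below through a measurable minorant. The coefficient bounds hold almost
    everywhere for each measure separately, while the flow meets a continuum of measures; continuity
    first makes them pointwise. With c = nu a^(nu - 1), the energy inequality carries the gradient
    integral twice on the left. The source returns at most 3 (M^2 + M^6) / (lambda c) copies of it,
    the 3 coming from the square of a sum of three terms; lambda0 is the value of lambda at which
    this is one copy. The factor T of the normalization cancels, so the constants depend only on a,
    nu and M. *)

(** The near-covering form of compactness makes continuity at the points of {z0} x K uniform over K.
    On the fundamental cube this is what passes limits under integral signs. *)
Lemma tube_near (R : realType) (Z Y : topologicalType) (K : set Y)
    (f : Z -> Y -> R) (z0 : Z) : compact K ->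
  (forall y, K y -> {for (z0, y), continuous (fun z : Z * Y => f z.1 z.2)}) ->
  forall e, 0 < e ->
    \forall z \near z0, forall y, K y -> `|f z0 y - f z y| < e.
Proof.
move=> /compact_near_coveringP cK cf e e0.
have := cK Z (nbhs z0) (fun z y => `|f z0 y - f z y| < e) _.
apply => y Ky.
have /cvgrPdist_lt/(_ (e / 2)) := cf y Ky.
rewrite divr_gt0// => /(_ isT) [[/= A B]] [Az By] AB.
exists (B, A) => //= -[y' z] /= [By' Az'].
have h1 : `|f z0 y - f z0 y'| < e / 2.
  by apply: (AB (z0, y')); split => //; exact: nbhs_singleton.
have h2 : `|f z0 y - f z y'| < e / 2 by exact: (AB (z, y')).
rewrite (splitr e) -(subrKA (f z0 y)).
by rewrite (le_lt_trans (ler_normD _ _))// ltrD// distrC.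
Qed.

Section discretization.
Context d (X : measurableType d) (Y : topologicalType).

(* [h] is a pointwise limit of measurable maps with countable range; composed
   with a continuous function it is then measurable. *)
Definition cdisc (h : X -> Y) := exists (c : nat -> X -> nat)
    (e : nat -> nat -> Y),
  (forall n k, measurable (c n @^-1` [set k])) /\
  forall x, e n (c n x) @[n --> \oo] --> h x.

(** The sigma-algebra on vectors is generated by the coordinates, not by open sets. A map with
    countable range stays measurable after composition with any function, and continuity of [f]
    carries the pointwise limit through. *)
Lemma cdisc_measurable (R : realType) (h : X -> Y) (f : Y -> R) : cdisc h ->
  continuous f -> measurable_fun setT (f \o h).
Proof.
move=> [c [e [mc ce]]] cf.
apply: (@measurable_fun_cvg _ _ _ _ (fun n => (f \o e n) \o c n)) => [n|x _].
  move=> _ A mA; rewrite setTI comp_preimage.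
  rewrite (_ : _ @^-1` _ =
     \bigcup_(k in (f \o e n) @^-1` A) (c n @^-1` [set k])).
    by apply: bigcup_measurable => k _; exact: mc.
  by apply/seteqP; split => [x /= Ax|x /= [k Ak /= ->//]]; exists (c n x).
exact: (continuous_cvg _ (cf _) (ce x)).
Qed.

End discretization.

Lemma cdisc_prod d1 (X1 : measurableType d1) (Y1 : topologicalType)
    d2 (X2 : measurableType d2) (Y2 : topologicalType)
    (h1 : X1 -> Y1) (h2 : X2 -> Y2) : cdisc h1 -> cdisc h2 ->
  cdisc (fun z : X1 * X2 => (h1 z.1, h2 z.2)).
Proof.
move=> [c1 [e1 [m1 ce1]]] [c2 [e2 [m2 ce2]]].
exists (fun n z => pickle (c1 n z.1, c2 n z.2)).
exists (fun n k => let p := odflt (0, 0)%N (unpickle k) in (e1 n p.1, e2 n p.2)).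
split=> [n k|x]; last first.
  by under eq_fun do rewrite pickleK /=; exact: cvg_pair.
(* A number that codes no pair has an empty fiber, so the default (0, 0) above is never taken. *)
have [[[a b] E]|E] := pselect (exists p : nat * nat, pickle p = k); last first.
  rewrite (_ : _ @^-1` _ = set0)//.
  by apply/seteqP; split => // z /= zk; apply: E; exists (c1 n z.1, c2 n z.2).
rewrite (_ : _ @^-1` _ = (c1 n @^-1` [set a]) `*` (c2 n @^-1` [set b])).
  by apply: measurableX.
rewrite -E; apply/seteqP; split => [z /= /(pcan_inj pickleK)[]//|z /= [-> ->//]].
Qed.

Lemma measurable_floor_fiber (R : realType) (n : nat) (k : int) :
  measurable [set x : measurableTypeR R | Num.floor (n.+1%:R * x) = k].
Proof.
rewrite (_ : [set _ | _] = `[k%:~R / n.+1%:R, (k + 1)%:~R / n.+1%:R[%classic).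
  exact: measurable_itv.
apply/seteqP; split => x /=; rewrite in_itv/= ler_pdivrMr// ltr_pdivlMr// mulrC.
  by move=> <-; exact: floor_itv.
by move=> h; apply/eqP; rewrite floor_eq.
Qed.

Lemma floor_approx (R : realType) (n : nat) (x : R) :
  `|x - (n.+1%:R)^-1 * (Num.floor (n.+1%:R * x))%:~R| <= (n.+1%:R)^-1.
Proof.
have n0 : (0 : R) < n.+1%:R by [].
have /andP[h1 h2] := floor_itv (n.+1%:R * x).
rewrite -[X in `|X - _|](mulKf (lt0r_neq0 n0)) -mulrBr normrM gtr0_norm ?invr_gt0//.
rewrite ger_pMr ?invr_gt0// ler_norml.
by move: h1 h2; rewrite intrD; lra.
Qed.

Lemma cdisc_R (R : realType) : cdisc (fun x : measurableTypeR R => x : R).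
Proof.
exists (fun n x => pickle (Num.floor (n.+1%:R * x))).
exists (fun n k => (n.+1%:R)^-1 * (odflt 0 (unpickle k : option int))%:~R).
split=> [n k|x]; last first.
  under eq_fun do rewrite pickleK /=.
  apply/cvgrPdist_le => e e0; near=> n.
  apply: (le_trans (floor_approx _ _)); apply: ltW.
  by near: n; exact: (near_infty_natSinv_lt (PosNum e0)).
have [[a E]|E] := pselect (exists p : int, pickle p = k); last first.
  rewrite (_ : _ @^-1` _ = set0)//.
  by apply/seteqP; split => // z /= zk; apply: E; eexists; exact: zk.
rewrite (_ : _ @^-1` _ = [set x | Num.floor (n.+1%:R * x) = a]).
  exact: measurable_floor_fiber.
rewrite -E; apply/seteqP; split => [z /= /(pcan_inj pickleK)//|z /= -> //].
Unshelve. all: by end_near. Qed.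

Lemma cdisc_rV (R : realType) (d : nat) : cdisc (fun x : 'rV[R]_d => x).
Proof.
exists (fun n x => pickle (map_mx (fun a => Num.floor (n.+1%:R * a)) x)).
exists (fun n k => (n.+1%:R)^-1 *:
   map_mx intr (odflt 0 (unpickle k : option 'rV[int]_d))).
split=> [n k|x]; last first.
  under eq_fun do rewrite pickleK /=.
  apply/cvg_ballP => e e0; near=> n; split=> // i j; rewrite /ball/= !mxE ord1.
  apply: (le_lt_trans (floor_approx _ _)).
  by near: n; exact: (near_infty_natSinv_lt (PosNum e0)).
have [[a E]|E] := pselect (exists p : 'rV[int]_d, pickle p = k); last first.
  rewrite (_ : _ @^-1` _ = set0)//.
  by apply/seteqP; split => // z /= zk; apply: E; eexists; exact: zk.
rewrite (_ : _ @^-1` _ = \bigcap_(i in [set: 'I_d])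
   ((fun x : 'rV[R]_d => x ord0 i) @^-1`
     [set x | Num.floor (n.+1%:R * x) = a ord0 i])).
  apply: fin_bigcap_measurable => // i _; rewrite -[X in measurable X]setTI.
  by apply: measurable_coord => //; exact: measurable_floor_fiber.
rewrite -E; apply/seteqP; split => [z /= /(pcan_inj pickleK) <- i _/=|z /= h].
  by rewrite mxE.
by congr pickle; apply/rowP => i; rewrite mxE h.
Unshelve. all: by end_near. Qed.

Lemma measurable_rV_continuous (R : realType) d (f : 'rV[R]_d -> R) :
  continuous f -> measurable_fun setT f.
Proof. by move=> cf; exact: (cdisc_measurable (@cdisc_rV R d)). Qed.

Lemma measurable_RrV_continuous (R : realType) d (f : R * 'rV[R]_d -> R) :
  continuous f -> measurable_fun [set: measurableTypeR R * 'rV[R]_d] f.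
Proof.
move=> cf; have := cdisc_measurable (cdisc_prod (@cdisc_R R) (@cdisc_rV R d)) cf.
by congr measurable_fun; apply/funext => -[].
Qed.

(** * Integration *)

Section integral_toolkit.
Context d (T : measurableType d) (R : realType).
Implicit Types (mu : {measure set T -> \bar R}) (f g : T -> R).

Definition itg mu f := mu.-integrable setT (EFin \o f).

Lemma itg_measurable mu f : itg mu f -> measurable_fun setT f.
Proof. by move=> /integrableP[/measurable_EFinP]. Qed.

Lemma itg_le mu f g : measurable_fun setT f -> (forall x, `|f x| <= `|g x|) ->
  itg mu g -> itg mu f.
Proof.
move=> mf fg; apply: le_integrable => //; first exact/measurable_EFinP.
by move=> x _; rewrite /= lee_fin.
Qed.

Lemma itgD mu f g : itg mu f -> itg mu g -> itg mu (fun x => f x + g x).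
Proof. by move=> hf hg; exact: (integrableD measurableT hf hg). Qed.

Lemma itgB mu f g : itg mu f -> itg mu g -> itg mu (fun x => f x - g x).
Proof. by move=> hf hg; exact: (integrableB measurableT hf hg). Qed.

Lemma itgZ mu (k : R) f : itg mu f -> itg mu (fun x => k * f x).
Proof. by move=> hf; exact: (integrableZl measurableT k hf). Qed.

Lemma itgN mu f : itg mu f -> itg mu (fun x => - f x).
Proof. by move=> hf; exact: (integrableN hf). Qed.

Lemma itg_abs mu f : itg mu f -> itg mu (fun x => `|f x|).
Proof.
move=> h; apply: (itg_le _ _ h) => [|x]; last by rewrite normr_id.
by apply: measurableT_comp => //; exact: itg_measurable h.
Qed.

Lemma itg_sum mu (I : finType) (f : I -> T -> R) :
  (forall i, itg mu (f i)) -> itg mu (fun x => \sum_i f i x).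
Proof.
move=> h; rewrite /itg (_ : _ \o _ = fun x => (\sum_i (EFin \o f i) x)%E).
  by apply: integrable_sum => // i _; exact: h.
by apply/funext => x; rewrite /= sumEFin.
Qed.

Lemma itg_EFin mu f : itg mu f ->
  (\int[mu]_x (f x)%:E)%E = (\int[mu]_x f x)%:E.
Proof. by move=> h; rewrite /Rintegral fineK//; exact: integrable_fin_num. Qed.

Lemma Rint_sum mu (I : finType) (f : I -> T -> R) :
  (forall i, itg mu (f i)) ->
  \int[mu]_x (\sum_i f i x) = \sum_i \int[mu]_x f i x.
Proof.
move=> h; apply: EFin_inj; rewrite -itg_EFin; last exact: itg_sum.
under eq_integral do rewrite -sumEFin.
rewrite integral_sum//; first by rewrite -sumEFin; apply: eq_bigr => i _; exact: itg_EFin.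
Qed.

Lemma itgM_bounded mu f g (C : R) : itg mu f -> measurable_fun setT g ->
  (forall x, `|g x| <= C) -> itg mu (fun x => f x * g x).
Proof.
move=> hf mg gC; apply: (@itg_le _ _ (fun x => C * f x)).
- by apply: measurable_funM => //; exact: itg_measurable hf.
- move=> x; rewrite !normrM mulrC ler_wpM2r//.
  by rewrite (le_trans (gC x))// ler_norm.
- exact: itgZ.
Qed.

Lemma ge0_itg mu f : measurable_fun setT f -> (forall x, 0 <= f x) ->
  (\int[mu]_x (f x)%:E < +oo)%E -> itg mu f.
Proof.
move=> mf f0 foo; apply/integrableP; split; first exact/measurable_EFinP.
by under eq_integral do rewrite /= ger0_norm//.
Qed.

Lemma Rint_le mu f g : itg mu f -> itg mu g -> (forall x, f x <= g x) ->
  \int[mu]_x f x <= \int[mu]_x g x.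
Proof. by move=> hf hg fg; apply: le_Rintegral. Qed.

Lemma RintD mu f g : itg mu f -> itg mu g ->
  \int[mu]_x (f x + g x) = \int[mu]_x f x + \int[mu]_x g x.
Proof. by move=> hf hg; rewrite RintegralD. Qed.

Lemma RintB mu f g : itg mu f -> itg mu g ->
  \int[mu]_x (f x - g x) = \int[mu]_x f x - \int[mu]_x g x.
Proof. by move=> hf hg; rewrite RintegralB. Qed.

Lemma RintZ mu k f : itg mu f ->
  \int[mu]_x (k * f x) = k * \int[mu]_x f x.
Proof. by move=> hf; rewrite RintegralZl. Qed.

Lemma RintN mu f : itg mu f -> \int[mu]_x (- f x) = - \int[mu]_x f x.
Proof.
by move=> hf; under eq_Rintegral do rewrite -mulN1r; rewrite RintZ// mulN1r.
Qed.

Lemma Rint_normr_le mu f : itg mu f ->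
  `|\int[mu]_x f x| <= \int[mu]_x `|f x|.
Proof. by move=> hf; apply: le_normr_Rintegral. Qed.

Lemma Rint_ae mu f g : measurable_fun setT f -> measurable_fun setT g ->
  {ae mu, forall x, f x = g x} -> \int[mu]_x f x = \int[mu]_x g x.
Proof.
move=> mf mg fg; congr fine; apply: ae_eq_integral => //;
  [exact/measurable_EFinP|exact/measurable_EFinP|].
by apply: filterS fg => x + _ /= => ->.
Qed.

Lemma Rint_ae_le mu f g : itg mu f -> itg mu g ->
  {ae mu, forall x, f x <= g x} -> \int[mu]_x f x <= \int[mu]_x g x.
Proof.
move=> hf hg fg.
(* Replacing [f] by its minimum with [g] turns the almost everywhere inequality into one valid
   everywhere. *)
rewrite (@Rint_ae _ f (fun x => Num.min (f x) (g x))); last 3 first.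
- exact: itg_measurable hf.
- by apply: measurable_minr; [exact: itg_measurable hf|exact: itg_measurable hg].
- by apply: filterS fg => x /min_idPl ->.
apply: Rint_le => //; last by move=> x; rewrite ge_min lexx orbT.
apply: (@itg_le _ _ (fun x => `|f x| + `|g x|)).
- by apply: measurable_minr; [exact: itg_measurable hf|exact: itg_measurable hg].
- move=> x; rewrite [leRHS]ger0_norm ?addr_ge0// /Num.min.
  by case: ifP => _; [rewrite lerDl|rewrite lerDr].
- by apply: itgD; exact: itg_abs.
Qed.

Lemma Rint_dct mu (f_ : nat -> T -> R) f G :
  (forall n, measurable_fun setT (f_ n)) -> measurable_fun setT f ->
  {ae mu, forall x, f_ n x @[n --> \oo] --> f x} -> itg mu G ->
  {ae mu, forall x, forall n, `|f_ n x| <= G x} ->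
  itg mu f /\ (\int[mu]_x f_ n x) @[n --> \oo] --> \int[mu]_x f x.
Proof.
move=> mf_ mf cf hG fG.
have h1 n : measurable_fun setT (EFin \o f_ n) by exact/measurable_EFinP.
have h2 : measurable_fun setT (EFin \o f) by exact/measurable_EFinP.
have h3 : {ae mu, forall x, setT x -> (EFin \o f_ n) x @[n --> \oo] --> (EFin \o f) x}.
  by apply: filterS cf => x cx _; apply/fine_cvgP; split; [exact: nearW|exact: cx].
have h4 : {ae mu, forall x, forall n, setT x -> (`|(EFin \o f_ n) x| <= (EFin \o G) x)%E}.
  by apply: filterS fG => x h n _ /=; rewrite lee_fin.
have [hf _ h] := dominated_convergence measurableT h1 h2 h3 hG h4.
by split=> //; move: h; rewrite /= (itg_EFin hf) => /fine_cvg.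
Qed.

(** Measurability of [f] is a separate component because that of its square does not imply it. *)
Definition sqi mu f := measurable_fun setT f /\ itg mu (fun x => f x ^+ 2).

Lemma sqi_mul mu f g : sqi mu f -> sqi mu g -> itg mu (fun x => f x * g x).
Proof.
move=> [mf hf] [mg hg].
apply: (@itg_le _ _ (fun x => f x ^+ 2 + g x ^+ 2)).
- exact: measurable_funM.
- move=> x; rewrite [leRHS]ger0_norm ?addr_ge0 ?sqr_ge0//.
  rewrite normrM -(real_normK (num_real (f x))) -(real_normK (num_real (g x))).
  have := sqr_ge0 (`|f x| - `|g x|); have := normr_ge0 (f x).
  have := normr_ge0 (g x); nra.
- exact: itgD.
Qed.

Lemma sqiD mu f g : sqi mu f -> sqi mu g -> sqi mu (fun x => f x + g x).
Proof.
move=> hf hg; split; first by apply: measurable_funD; [exact: hf.1|exact: hg.1].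
have -> : (fun x => (f x + g x) ^+ 2) =
   (fun x => f x ^+ 2 + (2 * (f x * g x)) + g x ^+ 2).
  by apply/funext => x; ring.
apply: itgD; last exact: hg.2; apply: itgD; first exact: hf.2.
by apply: itgZ; exact: sqi_mul.
Qed.

Lemma sqiZ mu (k : R) f : sqi mu f -> sqi mu (fun x => k * f x).
Proof.
move=> [mf hf]; split; first exact: measurable_funM.
by under eq_fun do rewrite exprMn; exact: itgZ.
Qed.

Lemma sqiN mu f : sqi mu f -> sqi mu (fun x => - f x).
Proof.
by move=> hf; under eq_fun do rewrite -mulN1r; exact: sqiZ.
Qed.

Lemma sqiB mu f g : sqi mu f -> sqi mu g -> sqi mu (fun x => f x - g x).
Proof. by move=> hf hg; apply: sqiD => //; exact: sqiN. Qed.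

Lemma sqi_sum mu (I : finType) (f : I -> T -> R) :
  (forall i, sqi mu (f i)) -> sqi mu (fun x => \sum_i f i x).
Proof.
move=> h; rewrite (_ : (fun _ => _) = \sum_i f i); last first.
  by apply/funext => x; rewrite fct_sumE.
elim/big_ind : _ => // [|u v hu hv]; last exact: sqiD.
split; first exact: measurable_cst.
rewrite (_ : (fun _ => _) = fun=> 0); last by apply/funext => x; rewrite expr0n.
exact: integrable0.
Qed.

Lemma sqiM_bounded mu f g (C : R) : sqi mu f -> measurable_fun setT g ->
  (forall x, `|g x| <= C) -> sqi mu (fun x => f x * g x).
Proof.
move=> [mf hf] mg gC; split; first exact: measurable_funM.
under eq_fun do rewrite exprMn.
apply: (@itgM_bounded _ _ _ (C ^+ 2)) => //.
  exact: measurable_funX.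
by move=> x; rewrite normrX lerXn2r// ?nnegrE// (le_trans _ (gC x)).
Qed.

Lemma Rint_CauchySchwarz mu f g : sqi mu f -> sqi mu g ->
  (\int[mu]_x (f x * g x)) ^+ 2 <=
  (\int[mu]_x (f x ^+ 2)) * \int[mu]_x (g x ^+ 2).
Proof.
move=> hf hg.
set A := \int[mu]_x (f x ^+ 2); set B := \int[mu]_x (f x * g x).
set C := \int[mu]_x (g x ^+ 2).
(* The integral of (f + s g)^2 is a nonnegative quadratic polynomial in s. *)
have q s : 0 <= A + 2 * s * B + s ^+ 2 * C.
  have -> : A + 2 * s * B + s ^+ 2 * C = \int[mu]_x ((f x + s * g x) ^+ 2).
    transitivity (\int[mu]_x (f x ^+ 2 + (s *+ 2) * (f x * g x) + s ^+ 2 * g x ^+ 2)).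
      rewrite RintegralD//; last 2 first.
      - by apply: itgD; [exact: hf.2|apply: itgZ; exact: sqi_mul].
      - by apply: itgZ; exact: hg.2.
      rewrite RintegralD//; [|exact: hf.2|apply: itgZ; exact: sqi_mul].
      rewrite !RintegralZl//; [by rewrite mulr_natl|exact: hg.2|exact: sqi_mul].
    by apply: eq_Rintegral => x _; ring.
  by apply: Rintegral_ge0 => x _; exact: sqr_ge0.
have C0 : 0 <= C by apply: Rintegral_ge0 => x _; exact: sqr_ge0.
have [C1|C1] := eqVneq C 0.
  have [->|B0] := eqVneq B 0; first by rewrite expr0n/= C1 mulr0.
  (* With C = 0 the polynomial is affine; this s would give it the value -1. *)
  have := q (- (A + 1) / (2 * B)); rewrite C1 mulr0 addr0.
  have -> : A + 2 * (- (A + 1) / (2 * B)) * B = -1 by field.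
  by lra.
have := q (- B / C).
have -> : A + 2 * (- B / C) * B + (- B / C) ^+ 2 * C = (A * C - B ^+ 2) / C.
  by field.
by rewrite pmulr_lge0 ?subr_ge0// invr_gt0 lt_def C1.
Qed.

End integral_toolkit.

Section probability_toolkit.
Context d (T : measurableType d) (R : realType) (P : probability T R).
Implicit Types (f g : T -> R).

Lemma itg_cst (c : R) : itg P (fun=> c).
Proof.
exact: finite_measure_integrable_cst.
Qed.

Lemma itg_bounded f (C : R) : measurable_fun setT f ->
  (forall x, `|f x| <= C) -> itg P f.
Proof.
move=> mf fC; apply: (itg_le (g := fun=> C)) => //; last exact: itg_cst.
by move=> x; rewrite (le_trans (fC x))// ler_norm.
Qed.

Lemma Rint_cst (c : R) : \int[P]_x c = c.
Proof. by rewrite Rintegral_cst// [X in fine X]probability_setT mulr1. Qed.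

Lemma sqi_cst (c : R) : sqi P (fun=> c).
Proof. by split; [exact: measurable_cst|exact: itg_cst]. Qed.

Lemma sqi_bounded f (C : R) : measurable_fun setT f ->
  (forall x, `|f x| <= C) -> sqi P f.
Proof.
move=> mf fC; split => //; apply: (@itg_bounded _ (C ^+ 2)).
  exact: measurable_funX.
by move=> x; rewrite normrX lerXn2r// ?nnegrE// (le_trans _ (fC x)).
Qed.

Lemma sqi_itg f : sqi P f -> itg P f.
Proof.
move=> hf; have := sqi_mul hf (sqi_cst 1).
by under eq_fun do rewrite mulr1.
Qed.

Lemma sqr_Rint_le f : sqi P f ->
  (\int[P]_x f x) ^+ 2 <= \int[P]_x (f x ^+ 2).
Proof.
move=> hf; have := Rint_CauchySchwarz hf (sqi_cst 1).
under eq_Rintegral do rewrite mulr1.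
by under [X in _ <= _ * X]eq_Rintegral do rewrite expr1n; rewrite Rint_cst mulr1.
Qed.

Lemma ae_prob1 (A : set T) : measurable A -> P A = 1%E -> {ae P, forall x, A x}.
Proof.
move=> mA PA; exists (~` A); split => //; first exact: measurableC.
by rewrite probability_setC// PA subee.
Qed.

End probability_toolkit.

Section fubini_toolkit.
Context d1 d2 (T1 : measurableType d1) (T2 : measurableType d2) (R : realType).
Variables (P1 : probability T1 R) (P2 : probability T2 R).
Implicit Types f : T1 * T2 -> R.

Lemma itg_section1 f : itg (P1 \x P2)%E f ->
  {ae P1, forall x, itg P2 (fun y => f (x, y))}.
Proof. exact: ae_integrable1. Qed.

(** A section with infinite integral gets the real value 0, so the real partial integral is
    dominated everywhere by the extended one. *)
Lemma itg_fubini1 f : itg (P1 \x P2)%E f ->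
  itg P1 (fun x => \int[P2]_y f (x, y)).
Proof.
move=> hf; have hF := integrable_fubini_F hf.
apply: le_integrable hF => //.
  apply/measurable_EFinP; apply: measurableT_comp => //.
  exact: (measurable_int _ (integrable_fubini_F hf)).
move=> x _ /=; rewrite /fubini_F /=.
by rewrite /Rintegral; case: (integral _ _ _) => //= ; rewrite ?normr0 ?lee_fin// leey.
Qed.

Lemma Rint_fubini1 f : itg (P1 \x P2)%E f ->
  \int[(P1 \x P2)%E]_z f z = \int[P1]_x \int[P2]_y f (x, y).
Proof.
move=> hf; rewrite {1}/Rintegral -integral12_prod_meas1//.
congr fine; apply: ae_eq_integral => //.
- exact: (measurable_int _ (integrable_fubini_F hf)).
- exact: (measurable_int _ (itg_fubini1 hf)).
apply: filterS (itg_section1 hf) => x hx _ /=.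
by rewrite -itg_EFin.
Qed.

Lemma itg_prod_ge0 f : measurable_fun setT f -> (forall z, 0 <= f z) ->
  {ae P1, forall x, itg P2 (fun y => f (x, y))} ->
  itg P1 (fun x => \int[P2]_y f (x, y)) -> itg (P1 \x P2)%E f.
Proof.
move=> mf f0 ae1 h; apply: ge0_itg => //.
rewrite fubini_tonelli1//; last exact/measurable_EFinP.
rewrite (@ae_eq_integral _ _ _ P1 setT
  (EFin \o fun x => \int[P2]_y f (x, y)))//.
- by have /integrable_fin_num := h; rewrite fin_numE => /(_ measurableT)/andP[_]; rewrite ltey.
- apply: measurable_fun_fubini_tonelli_F => //; exact/measurable_EFinP.
- exact: measurable_int h.
- by apply: filterS ae1 => x hx _ /=; rewrite -itg_EFin.
Qed.

Lemma sqi_section f : sqi (P1 \x P2)%E f ->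
  {ae P1, forall x, sqi P2 (fun y => f (x, y))}.
Proof.
move=> [mf hf]; apply: filterS (itg_section1 hf) => x hx; split => //.
exact: measurableT_comp.
Qed.

End fubini_toolkit.

Section fubini_swap.
Context d1 d2 (T1 : measurableType d1) (T2 : measurableType d2) (R : realType).
Variables (P1 : probability T1 R) (P2 : probability T2 R).
Implicit Types f : T1 * T2 -> R.

Lemma itg_swap f : itg (P1 \x P2)%E f ->
  itg (P2 \x P1)%E (fun z => f (z.2, z.1)).
Proof.
move=> hf; have mf := itg_measurable hf.
apply/integrable12ltyP.
  apply/measurable_EFinP; apply: (measurableT_comp mf).
  exact: measurable_fun_pair.
apply/(integrable21ltyP P1 P2 (f := EFin \o f)) => //; exact/measurable_EFinP.
Qed.

Lemma itg_fubini2 f : itg (P1 \x P2)%E f ->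
  itg P2 (fun y => \int[P1]_x f (x, y)).
Proof. by move=> /itg_swap/itg_fubini1. Qed.

Lemma Rint_fubini2 f : itg (P1 \x P2)%E f ->
  \int[(P1 \x P2)%E]_z f z = \int[P2]_y \int[P1]_x f (x, y).
Proof.
move=> hf; have hs := itg_swap hf.
have := Rint_fubini1 hs => /= <-; congr fine.
by rewrite -(integral21_prod_meas1 hf) -(integral12_prod_meas1 hs).
Qed.

End fubini_swap.

(** * Lebesgue measure on the torus *)

Section uniform.
Variables (R : realType) (a b : R) (ab : a < b).
Notation leb := (@lebesgue_measure R).

(** Infinite integrals are covered too: a positive factor preserves infinite positive and negative
    parts, and both sides then fall back to the same default value. *)
Lemma Rint_uniform (f : measurableTypeR R -> R) : measurable_fun setT f ->
  \int[uniform_prob ab]_x f x = (b - a)^-1 * \int[leb]_(x in `[a, b]) f x.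
Proof.
move=> mf; rewrite /Rintegral integralE [in RHS]integralE.
have c0 : 0 < (b - a)^-1 by rewrite invr_gt0 subr_gt0.
rewrite !integral_uniform//; last 2 first.
- by apply: measurable_funeneg; exact/measurable_EFinP.
- by apply: measurable_funepos; exact/measurable_EFinP.
set u := (\int[_]_(_ in _) _)%E; set v := (\int[_]_(_ in _) _)%E.
have u0 : (0 <= u)%E by apply: integral_ge0.
have v0 : (0 <= v)%E by apply: integral_ge0.
move: u v u0 v0 => [u| |] [v| |] //= _ _;
  rewrite ?gt0_muley ?gt0_muleNy ?lte_fin//= ?mulr0//.
by rewrite -mulrBr.
Qed.

Lemma uniform_probE (A : set (measurableTypeR R)) : measurable A ->
  uniform_prob ab A = ((b - a)^-1%:E * leb (A `&` `[a, b]))%E.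
Proof.
move=> mA; rewrite -[A in LHS]setIT -(integral_indic _ measurableT)//.
rewrite integral_uniform//; last exact/measurable_EFinP.
by congr (_ * _)%E; rewrite integral_indic.
Qed.

Lemma uniform_prob_itv (x y : R) (l r : bool) : a <= x -> x <= y -> y <= b ->
  uniform_prob ab [set` Interval (BSide l x) (BSide r y)] = ((y - x) / (b - a))%:E.
Proof.
move=> ax xy yb; rewrite uniform_probE; last exact: measurable_itv.
rewrite setIidl; last first.
  move=> z /=; rewrite !itv_boundlr /= => /andP[h1 h2].
  rewrite (le_trans _ h1) ?(le_trans h2)// bnd_simp//.
rewrite lebesgue_measure_itv/= lte_fin; case: ltP => [_|yx].
  by rewrite -EFinB -EFinM mulrC.
have -> : x = y by apply/eqP; rewrite eq_le xy.
by rewrite subrr mul0r mule0.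
Qed.

Lemma Rint_uniform_derive (f F : R -> R) : continuous f ->
  (forall x, derivable F x 1 /\ derive1 F x = f x) ->
  \int[uniform_prob ab]_x f x = (b - a)^-1 * (F b - F a).
Proof.
move=> cf dF; rewrite Rint_uniform; last exact: continuous_measurable_fun.
congr (_ * _).
have cF : continuous F.
  by move=> x; apply: differentiable_continuous; apply/derivable1_diffP; exact: (dF x).1.
rewrite /Rintegral (@continuous_FTC2 _ f F)//.
- exact: continuous_subspaceT.
- split; [by move=> x _; case: (dF x)| |].
    by apply: cvg_at_right_filter; exact: cF.
  by apply: cvg_at_left_filter; exact: cF.
- by move=> x _; rewrite (dF x).2.
Qed.

End uniform.

Section torus.
Variable R : realType.
Notation u01 := (uniform_prob (@ltr01 R)).

Lemma row_cons0 n (z : R * 'rV[R]_n) : row_cons z ord0 ord0 = z.1.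
Proof. by rewrite mxE unlift_none. Qed.

Lemma row_consS n (z : R * 'rV[R]_n) j : row_cons z ord0 (lift ord0 j) = z.2 ord0 j.
Proof. by rewrite mxE liftK. Qed.

Lemma torusS_ge0 n (f : 'rV[R]_n.+1 -> \bar R) : measurable_fun setT f ->
  (forall x, 0 <= f x)%E ->
  (\int[torus_leb R n.+1]_x f x =
   \int[u01]_s \int[torus_leb R n]_z f (row_cons (s, z)))%E.
Proof.
move=> mf f0 /=.
have := @ge0_integral_pushforward _ _ _ _ R _ (@measurable_row_cons R n)
  (u01 \x torus_leb R n)%E setT f measurableT mf (fun x _ => f0 x).
rewrite /distribution => ->.
rewrite preimage_setT fubini_tonelli1//; last by move=> z; exact: f0.
exact: (measurableT_comp mf (@measurable_row_cons R n)).
Qed.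

Lemma measurable_prod_coord n (f : 'I_n -> R -> R) :
  (forall j, measurable_fun [set: measurableTypeR R] (f j)) ->
  measurable_fun setT (fun x : 'rV[R]_n => \prod_j f j (x ord0 j)).
Proof.
move=> mf; apply: measurable_prod => j _.
exact: (measurableT_comp (mf j) (@measurable_coord R n j)).
Qed.

(** Tonelli, one coordinate at a time. It evaluates both the measures of boxes and the moments of
    the product kernels. *)
Lemma torus_prod n (f : 'I_n -> R -> R) (c : 'I_n -> R) :
  (forall j, measurable_fun [set: measurableTypeR R] (f j)) ->
  (forall j x, 0 <= f j x) ->
  (forall j, \int[u01]_s (f j s)%:E = (c j)%:E)%E ->
  (\int[torus_leb R n]_x (\prod_j f j (x ord0 j))%:E = (\prod_j c j)%:E)%E.
Proof.
elim: n f c => [|n IH] f c mf f0 fc.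
  rewrite /= integral_dirac//=.
    by rewrite diracE in_setT mul1e !big_ord0.
  by apply/measurable_EFinP; exact: measurable_prod_coord.
rewrite torusS_ge0; last 2 first.
- by apply/measurable_EFinP; exact: measurable_prod_coord.
- by move=> x; rewrite lee_fin prodr_ge0.
rewrite big_ord_recl.
under eq_integral => s _.
  under eq_integral => z _.
    rewrite big_ord_recl row_cons0 /=.
    under eq_bigr do rewrite row_consS /=.
    rewrite EFinM; over.
  rewrite ge0_integralZl_EFin//; last 2 first.
  - by move=> z _; rewrite lee_fin prodr_ge0.
  - by apply/measurable_EFinP; exact: (measurable_prod_coord (f := fun j => f (lift ord0 j))).
  rewrite (IH (fun j => f (lift ord0 j)) (fun j => c (lift ord0 j)))//.
  over.
have c0 j : 0 <= c j.
  by rewrite -lee_fin -fc integral_ge0// => x _; rewrite lee_fin.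
rewrite ge0_integralZr//.
- by rewrite fc EFinM.
- exact/measurable_EFinP.
- by move=> x _; rewrite lee_fin.
- by rewrite lee_fin prodr_ge0.
Qed.

Lemma torus_box n (A : 'I_n -> set (measurableTypeR R)) (c : 'I_n -> R) :
  (forall j, measurable (A j)) -> (forall j, u01 (A j) = (c j)%:E) ->
  torus_leb R n [set x : 'rV[R]_n | forall j, A j (x ord0 j)] = (\prod_j c j)%:E.
Proof.
move=> mA Ac; pose B := [set x : 'rV[R]_n | forall j, A j (x ord0 j)].
rewrite -/B; have mB : measurable B.
  rewrite (_ : B = \bigcap_(i in [set: 'I_n])
    ((fun x : 'rV[R]_n => x ord0 i) @^-1` A i)); last first.
    by apply/seteqP; split => [x h i _|x h i]; exact: h.
  apply: fin_bigcap_measurable => // i _; rewrite -[X in measurable X]setTI.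
  exact: (@measurable_coord R n i measurableT _ (mA i)).
rewrite -[B]setIT -(integral_indic _ measurableT)//.
rewrite -(torus_prod (f := fun j => \1_(A j)))//.
- apply: eq_integral => x _; congr EFin; rewrite indicE.
  have [/set_mem xB|xB] := boolP (x \in B).
    by rewrite big1// => j _; rewrite indicE mem_set.
  have [j Aj] : exists j, ~ A j (x ord0 j).
    by apply/existsNP => h; move/negP: xB; apply; exact/mem_set.
  by rewrite (bigD1 j)//= indicE memNset// mul0r.
- move=> j; rewrite (integral_indic _ measurableT)//.
  rewrite setIT; exact: Ac.
Qed.

Lemma torus_unit_cube n : torus_leb R n (@unit_cube R n) = 1%E.
Proof.
rewrite (_ : @unit_cube R n =
    [set x : 'rV[R]_n | forall j, `[0, 1[%classic (x ord0 j)]).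
  rewrite (@torus_box n (fun=> `[0, 1[%classic) (fun=> 1)) ?big1// => j.
  by rewrite uniform_prob_itv// subr0 divr1.
by apply/seteqP; split => x /= + j => /(_ j); rewrite in_itv.
Qed.

(** Open boxes are charged, which later upgrades essential bounds of continuous functions to
    pointwise ones. *)
Lemma torus_open_box n (l r : 'I_n -> R) :
  (forall j, [/\ 0 <= l j, l j < r j & r j <= 1]) ->
  (0 < torus_leb R n [set x : 'rV[R]_n | forall j, (l j < x ord0 j < r j)%R])%E.
Proof.
move=> h.
rewrite (_ : [set _ | _] = [set x : 'rV[R]_n | forall j, `]l j, r j[%classic (x ord0 j)]).
  rewrite (@torus_box n (fun j => `]l j, r j[%classic) (fun j => r j - l j))//.
    by rewrite lte_fin prodr_gt0// => j _; rewrite subr_gt0; case: (h j).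
  move=> j; have [h1 h2 h3] := h j.
  by rewrite uniform_prob_itv// ?ltW// subr0 divr1.
by apply/seteqP; split => x /= + j => /(_ j); rewrite in_itv.
Qed.

End torus.

(** * Calculus on the torus *)

Section continuity.
Variables (X Y Z : topologicalType).

Lemma continuousT_pair (f : X -> Y) (g : X -> Z) : continuous f ->
  continuous g -> continuous (fun x => (f x, g x)).
Proof. by move=> cf cg x; apply: (@cvg_pair _ _ _ (nbhs x)); [exact: cf|exact: cg]. Qed.

Lemma continuousT_comp (f : X -> Y) (g : Y -> Z) : continuous f ->
  continuous g -> continuous (fun x => g (f x)).
Proof. by move=> cf cg x; apply: continuous_comp; [exact: cf|exact: cg]. Qed.

Lemma continuousT_id : continuous (fun x : X => x).
Proof. by move=> x; exact: cvg_id. Qed.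

Lemma continuousT_cst (z : Z) : continuous (fun _ : X => z).
Proof. by move=> x; exact: cvg_cst. Qed.

End continuity.

Section continuity_prod.
Variables (X Y Z : topologicalType).

Lemma continuousT_fst : continuous (fun z : X * Y => z.1).
Proof. by move=> z; exact: cvg_fst. Qed.

Lemma continuousT_snd : continuous (fun z : X * Y => z.2).
Proof. by move=> z; exact: cvg_snd. Qed.

End continuity_prod.

Section quotients.
Variables (R : realType) (V W : normedModType R).

(** A directional derivative depends only on its difference quotients, so translations and slices
    are handled without a chain rule. *)
Lemma eq_derive_quotient (f : V -> R) (g : W -> R) x y v w :
  (forall h : R, f (h *: v + x) = g (h *: w + y)) -> 'D_v f x = 'D_w g y.
Proof.
move=> fg; rewrite /derive.
have h0 : f x = g y by have := fg 0; rewrite !scale0r !add0r.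
by under eq_fun do rewrite /= fg h0.
Qed.

Lemma eq_derivable_quotient (f : V -> R) (g : W -> R) x y v w :
  (forall h : R, f (h *: v + x) = g (h *: w + y)) ->
  derivable f x v -> derivable g y w.
Proof.
move=> fg; rewrite /derivable.
have h0 : f x = g y by have := fg 0; rewrite !scale0r !add0r.
by under eq_fun do rewrite /= fg h0.
Qed.

End quotients.

Section directional.
Variables (R : realType) (d : nat).
Implicit Types (f : 'rV[R]_d -> R) (x v : 'rV[R]_d).

Lemma line_quotient f x v s h :
  h^-1 *: ((f \o shift (x + s *: v)) (h *: v) - f (x + s *: v)) =
  h^-1 *: (((fun a : R => f (x + a *: v)) \o shift s) (h *: (1 : R)) -
    f (x + s *: v)).
Proof.
congr (_ *: (f _ - _)); rewrite /= addrCA; congr (_ + _).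
by rewrite -scalerDl [h *: 1]mulr1.
Qed.

Lemma derivable_line f x v s : derivable f (x + s *: v) v ->
  derivable (fun h : R => f (x + h *: v)) s 1.
Proof. by rewrite /derivable; under eq_fun do rewrite line_quotient. Qed.

Lemma line_derivable f x v s :
  derivable (fun h : R => f (x + h *: v)) s 1 -> derivable f (x + s *: v) v.
Proof. by rewrite /derivable; under [in X in _ -> X]eq_fun do rewrite line_quotient. Qed.

Lemma derive_line f x v s :
  'D_v f (x + s *: v) = derive1 (fun h : R => f (x + h *: v)) s.
Proof. by rewrite derive1E /derive; under eq_fun do rewrite line_quotient. Qed.

Lemma Zperiodic_derive f v : Zperiodic f -> Zperiodic ('D_v f).
Proof.
by move=> pf x k; apply: eq_derive_quotient => h; rewrite addrA pf.
Qed.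

Definition tcube : set 'rV[R]_d := [set x | forall i, 0 <= x ord0 i <= 1].

Lemma tcube_compact : compact tcube.
Proof.
have := @rV_compact R d (fun=> `[0, 1]%classic) (fun=> @segment_compact R 0 1).
congr compact; apply/seteqP; split => x /= h i; have := h i; rewrite ?in_itv//.
Qed.

Lemma unit_cubeW : @unit_cube R d `<=` tcube.
Proof. by move=> x h i; have /andP[-> /ltW] := h i. Qed.

Lemma unit_cube_repr x : exists k : 'rV[int]_d, unit_cube (x + map_mx intr k).
Proof.
exists (map_mx (fun a => - Num.floor a) x) => i; rewrite !mxE.
have /andP[h1 h2] := floor_itv (x ord0 i).
by move: h1 h2; rewrite intrD rmorphN; lra.
Qed.

Lemma periodic_bounded f : continuous f -> Zperiodic f ->
  exists C, forall x, `|f x| <= C.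
Proof.
move=> cf pf.
have /compact_bounded[C [_ /(_ (C + 1))]] :=
  continuous_compact (continuous_subspaceT (A := tcube) cf) tcube_compact.
rewrite ltrDl ltr01 => /(_ isT) h; exists (C + 1) => x.
have [k xk] := unit_cube_repr x.
by rewrite -(pf x k); apply: h; exists (x + map_mx intr k) => //; exact: unit_cubeW.
Qed.

Lemma measurable_unit_cube : measurable (@unit_cube R d).
Proof.
rewrite (_ : @unit_cube R d = \bigcap_(i in [set: 'I_d])
    ((fun x : 'rV[R]_d => x ord0 i) @^-1` `[0, 1[)); last first.
  by apply/seteqP; split => [x h i _|x h i] /=; [rewrite in_itv; exact: h|
    have := h i I; rewrite /= in_itv].
apply: fin_bigcap_measurable => // i _; rewrite -[X in measurable X]setTI.
by apply: (@measurable_coord R d i measurableT); exact: measurable_itv.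
Qed.

Lemma ae_unit_cube (P : probability 'rV[R]_d R) : P (@unit_cube R d) = 1%E ->
  {ae P, forall x, unit_cube x}.
Proof. by move=> P1; apply: ae_prob1 => //; exact: measurable_unit_cube. Qed.

End directional.

Section torus_derivative.
Variable R : realType.
Notation u01 := (uniform_prob (@ltr01 R)).

Lemma itg_continuous_periodic d (P : probability 'rV[R]_d R) (f : 'rV[R]_d -> R) :
  continuous f -> Zperiodic f -> itg P f.
Proof.
move=> cf pf; have [C hC] := periodic_bounded cf pf.
by apply: itg_bounded hC; exact: measurable_rV_continuous.
Qed.

Lemma torusS_itg n (f : 'rV[R]_n.+1 -> R) : itg (torus_leb R n.+1) f ->
  itg (u01 \x torus_leb R n)%E (f \o @row_cons R n).
Proof.
move=> hf; have mf := itg_measurable hf; apply/integrableP; split.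
  by apply/measurable_EFinP; exact: (measurableT_comp mf (@measurable_row_cons R n)).
move/integrableP : hf => [_].
have := @ge0_integral_pushforward _ _ _ _ R _ (@measurable_row_cons R n)
  (u01 \x torus_leb R n)%E setT (fun x => `|(f x)%:E|%E) measurableT.
rewrite preimage_setT /= /distribution => -> //.
by apply/measurable_EFinP; exact: measurableT_comp.
Qed.

Lemma torusS_Rint n (f : 'rV[R]_n.+1 -> R) : itg (torus_leb R n.+1) f ->
  \int[torus_leb R n.+1]_x f x =
  \int[(u01 \x torus_leb R n)%E]_z f (row_cons z).
Proof.
move=> hf; congr fine; have mf := itg_measurable hf.
have := @integral_pushforward _ _ _ _ R _ (@measurable_row_cons R n)
  (u01 \x torus_leb R n)%E setT (EFin \o f).
rewrite preimage_setT /= /distribution => -> //.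
- exact/measurable_EFinP.
- exact: torusS_itg.
Qed.

Lemma row_cons_continuous n : continuous (@row_cons R n : R * 'rV[R]_n -> _).
Proof.
move=> z; apply/cvg_ballP => e e0.
have : \forall w \near z, ball z e w by exact: nbhsx_ballx.
apply: filterS => w [h1 [_ h2]]; split=> // i j; rewrite !mxE.
by case: unliftP => [k _|_] //; exact: (h2 ord0 k).
Qed.

Lemma row_cons_line0 n s (z : 'rV[R]_n) :
  row_cons (s, z) = row_cons (0, z) + s *: basis_vec R ord0.
Proof.
apply/rowP => i; rewrite !mxE /=; case: unliftP => [j ->|->] /=.
  by rewrite mulr0 addr0.
by rewrite mulr1 add0r.
Qed.

Lemma row_cons_lineS n s (z : 'rV[R]_n) h j :
  row_cons (s, h *: basis_vec R j + z) =
  h *: basis_vec R (lift ord0 j) + row_cons (s, z).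
Proof.
apply/rowP => i; rewrite !mxE /=; case: unliftP => [k ->|->] /=.
  by rewrite !mxE /= (inj_eq lift_inj).
by rewrite mulr0 add0r.
Qed.

Lemma Zperiodic_row_cons n (f : 'rV[R]_n.+1 -> R) s : Zperiodic f ->
  Zperiodic (fun z : 'rV[R]_n => f (row_cons (s, z))).
Proof.
move=> pf z k; rewrite -[RHS](pf _ (\row_i (if unlift ord0 i is Some j then k ord0 j else 0))).
congr f; apply/rowP => i; rewrite !mxE /=.
by case: (unlift _ _) => [j|] //=; rewrite ?mxE// addr0.
Qed.

(** Induction on the dimension. If [i] is the first coordinate, integrating it first leaves a
    difference of values one period apart; otherwise the derivative is that of a slice. *)
Lemma torus_int_derive n (i : 'I_n) (q : 'rV[R]_n -> R) : continuous q ->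
  Zperiodic q -> (forall x, derivable q x (basis_vec R i)) ->
  continuous ('D_(basis_vec R i) q) ->
  \int[torus_leb R n]_x 'D_(basis_vec R i) q x = 0.
Proof.
elim: n i q => [[]//|n IH] i q cq pq dq cdq.
have pdq := Zperiodic_derive (basis_vec R i) pq.
have iq : itg (torus_leb R n.+1) ('D_(basis_vec R i) q).
  exact: itg_continuous_periodic.
have iqr := torusS_itg iq.
rewrite torusS_Rint//.
have [j ij|i0] := unliftP ord0 i.
  rewrite (Rint_fubini1 iqr) -[RHS](Rint_cst u01 0); apply: eq_Rintegral => s _.
  have eD (z : 'rV[R]_n) : 'D_(basis_vec R i) q (row_cons (s, z)) =
      'D_(basis_vec R j) (fun z => q (row_cons (s, z))) z.
    by apply: eq_derive_quotient => h; rewrite row_cons_lineS ij.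
  under eq_Rintegral do rewrite /= eD.
  have crs : continuous (fun z : 'rV[R]_n => row_cons (s, z)).
    apply: continuousT_comp (@row_cons_continuous n).
    exact: continuousT_pair (@continuousT_cst _ _ _) (@continuousT_id _).
  apply: IH.
  - by move=> z; apply: continuous_comp; [exact: crs|exact: cq].
  - exact: Zperiodic_row_cons.
  - move=> z; apply: eq_derivable_quotient (dq (row_cons (s, z))) => h.
    by rewrite row_cons_lineS ij.
  - rewrite (_ : 'D__ _ = 'D_(basis_vec R i) q \o (fun z => row_cons (s, z))).
      by move=> z; apply: continuous_comp; [exact: crs|exact: cdq].
    by apply/funext => z /=; rewrite eD.
rewrite (Rint_fubini2 iqr) -[RHS](Rint_cst (torus_leb R n) 0).
apply: eq_Rintegral => z _.
have cl : continuous (fun s : R => row_cons (s, z)).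
  apply: continuousT_comp (@row_cons_continuous n).
  exact: continuousT_pair (@continuousT_id _) (@continuousT_cst _ _ _).
rewrite (@Rint_uniform_derive R 0 1 _ _ (fun s => q (row_cons (s, z)))).
- have -> : row_cons (1, z) = row_cons (0, z) +
     map_mx intr (\row_(k < n.+1) (k == ord0)%:R : 'rV[int]_n.+1).
    apply/rowP => k; rewrite !mxE /=; case: unliftP => [l ->|->] /=.
      by rewrite addr0.
    by rewrite add0r.
  by rewrite pq subrr mulr0.
- exact: (continuousT_comp cl cdq).
- move=> s; have -> : (fun s0 : R => q (row_cons (s0, z))) =
     (fun h : R => q (row_cons (0, z) + h *: basis_vec R i)).
    by apply/funext => h; rewrite row_cons_line0 i0.
  have -> : ('D_(basis_vec R i) q \o @row_cons R n) (s, z) =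
      'D_(basis_vec R i) q (row_cons (0, z) + s *: basis_vec R i).
    by rewrite /= [in LHS](row_cons_line0 s z) i0.
  by rewrite derive_line; split => //; apply: derivable_line; exact: dq.
Qed.

End torus_derivative.

(** * Mollification kernels *)

Lemma measurable_R_continuous (R : realType) (f : R -> R) : continuous f ->
  measurable_fun [set: measurableTypeR R] f.
Proof. by move=> cf; exact: (cdisc_measurable (@cdisc_R R)). Qed.

Section kernel1.
Variable R : realType.
Notation u01 := (uniform_prob (@ltr01 R)).

(** Wallis product (2n - 1)!! / (2n)!!, the mean of cos^(2n) over a period. *)
Definition wallis (n : nat) : R := \prod_(j < n) ((j.*2.+1)%:R / (j.*2.+2)%:R).

Lemma wallisS n : wallis n.+1 = wallis n * ((n.*2.+1)%:R / (n.*2.+2)%:R).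
Proof. by rewrite /wallis big_ord_recr. Qed.

Lemma wallis_gt0 n : 0 < wallis n.
Proof. by apply: prodr_gt0 => j _; rewrite divr_gt0. Qed.

(** The frequency is pi rather than 2 pi: the even powers then have period 1 and a single peak per
    period, at s = r. *)
Definition cosr (r s : R) : R := cos (pi * (s - r)).
Definition sinr (r s : R) : R := sin (pi * (s - r)).

Lemma is_derive_cosr (r s : R) : is_derive s 1 (cosr r) (- pi * sinr r s).
Proof.
rewrite /cosr /sinr.
have h : is_derive s 1 (fun s : R => pi * (s - r)) pi.
  by apply: is_derive_eq; rewrite subr0 [_ *: _]mulr1.
have := @is_derive1_comp R cos (fun s => pi * (s - r)) s _ _ (is_derive_cos _) h.
by congr is_derive; rewrite mulrC mulrN mulNr.
Qed.

Lemma is_derive_sinr (r s : R) : is_derive s 1 (sinr r) (pi * cosr r s).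
Proof.
rewrite /cosr /sinr.
have h : is_derive s 1 (fun s : R => pi * (s - r)) pi.
  by apply: is_derive_eq; rewrite subr0 [_ *: _]mulr1.
have := @is_derive1_comp R sin (fun s => pi * (s - r)) s _ _ (is_derive_sin _) h.
by congr is_derive; rewrite mulrC.
Qed.

Lemma cosr_continuous : continuous (fun z : R * R => cosr z.1 z.2).
Proof.
move=> z; apply: (continuous_comp (f := fun z : R * R => pi * (z.2 - z.1)) (g := cos)).
  by apply: cvgM; [exact: cvg_cst|apply: cvgB; [exact: cvg_snd|exact: cvg_fst]].
exact: continuous_cos.
Qed.

Lemma sinr_continuous : continuous (fun z : R * R => sinr z.1 z.2).
Proof.
move=> z; apply: (continuous_comp (f := fun z : R * R => pi * (z.2 - z.1)) (g := sin)).
  by apply: cvgM; [exact: cvg_cst|apply: cvgB; [exact: cvg_snd|exact: cvg_fst]].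
exact: continuous_sin.
Qed.

Lemma cosr_continuous1 r : continuous (cosr r).
Proof.
by move=> s; apply: differentiable_continuous; apply/derivable1_diffP;
  have [] := is_derive_cosr r s.
Qed.

Lemma cosr1 r s : cosr r (s + 1) = - cosr r s.
Proof. by rewrite /cosr addrAC mulrDr mulr1 cosDpi. Qed.

Lemma sinr1 r s : sinr r (s + 1) = - sinr r s.
Proof. by rewrite /sinr addrAC mulrDr mulr1 sinDpi. Qed.

Lemma cosr_cont_pow r n : continuous (fun s => cosr r s ^+ n).
Proof. exact: continuousT_comp (@cosr_continuous1 r) (@exprn_continuous _ n). Qed.

Lemma is_derive_cosr_pow n (r s : R) : is_derive s 1 (fun s => cosr r s ^+ n)
  (- (pi * n%:R * cosr r s ^+ n.-1 * sinr r s)).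
Proof.
have h := is_derive_cosr r s.
case: n => [|n].
  rewrite (_ : (fun _ => _) = cst 1); last by apply/funext => x; rewrite expr0.
  by apply: is_derive_eq; rewrite mulr0 !mul0r oppr0.
have := @is_deriveX R _ _ n.+1 s 1 _ h.
rewrite (_ : (cosr r) ^+ n.+1 = fun s => cosr r s ^+ n.+1); last first.
  by apply/funext => x; rewrite exprfctE.
by move=> h'; apply: (is_derive_eq h'); rewrite /GRing.scale /=; ring.
Qed.

Lemma int_cosr n r : \int[u01]_s (cosr r s ^+ n.*2) = wallis n.
Proof.
elim: n => [|n IH].
  by under eq_Rintegral do rewrite expr0; rewrite Rint_cst /wallis big_ord0.
(* [F] takes the same value at 0 and 1, so its derivative [f] has mean zero; this is the reduction
   formula for cos^(2n+2). *)
pose F s := cosr r s ^+ n.*2.+1 * sinr r s.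
pose f s := pi * ((n.*2.+2)%:R * cosr r s ^+ n.*2.+2 - (n.*2.+1)%:R * cosr r s ^+ n.*2).
have dF (s : R) : is_derive s 1 F (f s).
  have h1 := is_derive_cosr_pow n.*2.+1 r s; have h2 := is_derive_sinr r s.
  have := is_deriveM h1 h2; congr is_derive.
  rewrite /f /GRing.scale /=.
  have := sin2cos2 (pi * (s - r)); rewrite -/(cosr r s) -/(sinr r s).
  set c := cosr r s; set t := sinr r s => h.
  have -> : c ^+ n.*2.+2 = c ^+ n.*2 * c ^+ 2 by rewrite -exprD addn2.
  have e : c ^+ n.*2.+1 = c ^+ n.*2 * c by rewrite exprSr.
  rewrite e -[n.*2.+2]addn2 -[n.*2.+1]addn1 !natrD.
  transitivity (pi * (c ^+ n.*2 * c ^+ 2 - (n.*2%:R + 1) * (c ^+ n.*2 * t ^+ 2))).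
    by rewrite /=; ring.
  by rewrite h; ring.
have /= := @Rint_uniform_derive R 0 1 (@ltr01 R) f F.
have -> : F 1 = F 0.
  rewrite /F -(add0r 1) cosr1 sinr1 exprNn -signr_odd /= odd_double /=.
  by ring.
rewrite subrr mulr0.
have i1 k : itg u01 (fun s => cosr r s ^+ k).
  apply: (@itg_bounded _ _ _ _ _ 1).
    exact: measurable_R_continuous (@cosr_cont_pow _ _).
  by move=> s; rewrite normrX exprn_ile1// ler_norml cos_geN1 cos_le1.
rewrite /f RintegralZl//; last by apply: itgB; exact: itgZ.
rewrite RintegralB//; [|exact: itgZ|exact: itgZ].
have e1 c k : \int[u01]_s (c * cosr r s ^+ k) = c * \int[u01]_s (cosr r s ^+ k).
  by rewrite RintZ.
rewrite !e1 IH => /(_ _ _)/eqP.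
rewrite mulf_eq0 gt_eqF ?pi_gt0//= subr_eq0 => h.
have hc : continuous f.
  move=> s; apply: cvgM; first exact: cvg_cst.
  by apply: cvgB; (apply: cvgM; [exact: cvg_cst|exact: cosr_cont_pow]).
have hd (x : R) : derivable F x 1 /\ derive1 F x = f x.
  by have [? ?] := dF x; split => //; rewrite derive1E.
move/eqP: (h hc hd) => {}h; rewrite wallisS -doubleS.
have -> : \int[u01]_s cosr r s ^+ n.+1.*2 = (n.*2.+1)%:R * wallis n / (n.*2.+2)%:R.
  by rewrite -h mulrAC mulfV ?mul1r// pnatr_eq0.
by ring.
Qed.

Definition kap (n : nat) (r s : R) : R := (wallis n)^-1 * cosr r s ^+ n.*2.

Lemma kap_ge0 n r s : 0 <= kap n r s.
Proof.
by rewrite mulr_ge0 ?invr_ge0 ?(ltW (wallis_gt0 _))// -mul2n exprM exprn_ge0 ?sqr_ge0.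
Qed.

Lemma kap_sym n r s : kap n r s = kap n s r.
Proof. by rewrite /kap /cosr -(opprB s r) mulrN cosN. Qed.

Lemma kap_le n r s : kap n r s <= (wallis n)^-1.
Proof.
rewrite /kap ger_pMr ?invr_gt0 ?wallis_gt0// (le_trans (ler_norm _))//.
by rewrite normrX exprn_ile1// ler_norml cos_geN1 cos_le1.
Qed.

Lemma kap1 n r s : kap n r (s + 1) = kap n r s.
Proof. by rewrite /kap cosr1 exprNn -signr_odd odd_double expr0 mul1r. Qed.

Lemma kap_int n r s (k : int) : kap n r (s + k%:~R) = kap n r s.
Proof.
have h (m : nat) s' : kap n r (s' + m%:R) = kap n r s'.
  by elim: m => [|m IH]; rewrite ?addr0// -addn1 natrD addrA kap1.
case: k => m; first exact: h.
by rewrite NegzE rmorphN /= -[LHS](h m.+1) subrK.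
Qed.

Lemma kap_continuous n : continuous (fun z : R * R => kap n z.1 z.2).
Proof.
move=> z; apply: cvgM; first exact: cvg_cst.
exact: (continuousT_comp cosr_continuous (@exprn_continuous _ _)).
Qed.

Lemma kap_continuous1 n r : continuous (kap n r).
Proof.
by move=> s; apply: cvgM; [exact: cvg_cst|exact: cosr_cont_pow].
Qed.

Lemma int_kap n r : \int[u01]_s kap n r s = 1.
Proof.
rewrite /kap RintegralZl//.
  by rewrite int_cosr mulVf// gt_eqF// wallis_gt0.
apply: (@itg_bounded _ _ _ _ _ 1).
  exact: measurable_R_continuous (@cosr_cont_pow _ _).
by move=> s; rewrite normrX exprn_ile1// ler_norml cos_geN1 cos_le1.
Qed.

(** Writing sin^2 = 1 - cos^2 leaves two consecutive kernels, each of mass one. The moment 1/(2n +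
    2) measures how fast the mass concentrates on the diagonal. *)
Lemma int_kap_sin n r : \int[u01]_s (kap n r s * sinr r s ^+ 2) = (n.*2.+2)%:R^-1.
Proof.
have -> : (fun s => kap n r s * sinr r s ^+ 2) =
  (fun s => kap n r s - (n.*2.+1)%:R / (n.*2.+2)%:R * kap n.+1 r s).
  apply/funext => s; rewrite /kap wallisS.
  rewrite /sinr sin2cos2 doubleS ![cosr r s ^+ _.+1]exprS -/(cosr r s).
  have p0 : (n.*2.+1)%:R != 0 :> R by rewrite pnatr_eq0.
  have q0 : (n.*2.+2)%:R != 0 :> R by rewrite pnatr_eq0.
  have w0 : wallis n != 0 by rewrite gt_eqF// wallis_gt0.
  move: (n.*2.+1)%:R (n.*2.+2)%:R (wallis n) p0 q0 w0 => p q w p0 q0 w0.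
  by field; rewrite p0 q0 w0.
have ik m : itg u01 (kap m r).
  apply: (@itg_bounded _ _ _ _ _ (wallis m)^-1).
    exact: measurable_R_continuous (@kap_continuous1 _ _).
  by move=> s; rewrite ger0_norm ?kap_ge0// kap_le.
rewrite RintB//; last exact: itgZ.
rewrite (RintZ _ (ik n.+1)) !int_kap mulr1.
have q0 : (n.*2.+2)%:R != 0 :> R by rewrite pnatr_eq0.
by rewrite -natr1 in q0 *; field.
Qed.

Lemma is_derive_kap n (r s : R) :
  is_derive s 1 (kap n r)
    (- ((wallis n)^-1 * pi * n.*2%:R * cosr r s ^+ n.*2.-1 * sinr r s)).
Proof.
have := @is_deriveZ R _ _ _ (wallis n)^-1 _ _ _ (is_derive_cosr_pow n.*2 r s).
by congr is_derive; rewrite /GRing.scale /=; ring.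
Qed.

(** Derivative of the kernel in its second variable. At n = 0 the factor [n.*2%:R] vanishes, so the
    truncated exponent is harmless. *)
Definition dkap (n : nat) (r s : R) : R :=
  - ((wallis n)^-1 * pi * n.*2%:R * cosr r s ^+ n.*2.-1 * sinr r s).

Lemma dkap_continuous n : continuous (fun z : R * R => dkap n z.1 z.2).
Proof.
move=> z; apply: cvgN; apply: cvgM; last exact: sinr_continuous.
by apply: cvgM; [exact: cvg_cst|exact: (continuousT_comp cosr_continuous (@exprn_continuous _ _))].
Qed.

(** The kernel is an even function of s - r, so a derivative in one variable is minus the derivative
    in the other. The weak integration by parts rests on this. *)
Lemma dkap_antisym n r s : dkap n r s = - dkap n s r.
Proof.
rewrite /dkap /cosr /sinr -(opprB s r) mulrN cosN sinN mulrN.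
by rewrite opprK.
Qed.

End kernel1.

Section product_probability.
Context d1 d2 (T1 : measurableType d1) (T2 : measurableType d2) (R : realType).
Variables (P1 : probability T1 R) (P2 : probability T2 R).

Lemma itg_fst (f : T1 -> R) : itg P1 f -> itg (P1 \x P2)%E (fun z => f z.1).
Proof.
move=> hf; have mf := itg_measurable hf.
have mf1 : measurable_fun setT (fun z : T1 * T2 => f z.1) by exact: measurableT_comp.
have ha := itg_abs hf.
apply: (itg_le (g := fun z => `|f z.1|)) => //; first by move=> z; rewrite normr_id.
apply: itg_prod_ge0 => //.
- exact: measurableT_comp.
- by apply: aeW => x /=; exact: itg_cst.
- by under eq_fun do rewrite /= Rint_cst.
Qed.

Lemma sqi_fst (f : T1 -> R) : sqi P1 f -> sqi (P1 \x P2)%E (fun z => f z.1).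
Proof.
move=> [mf hf]; split; first exact: measurableT_comp.
exact: (itg_fst hf).
Qed.

End product_probability.

Section product_probability2.
Context d1 d2 (T1 : measurableType d1) (T2 : measurableType d2) (R : realType).
Variables (P1 : probability T1 R) (P2 : probability T2 R).

Lemma itg_snd (f : T2 -> R) : itg P2 f -> itg (P1 \x P2)%E (fun z => f z.2).
Proof. by move=> /(itg_fst P1)/itg_swap. Qed.

Lemma sqi_snd (f : T2 -> R) : sqi P2 f -> sqi (P1 \x P2)%E (fun z => f z.2).
Proof.
move=> [mf hf]; split; first exact: measurableT_comp.
exact: (itg_snd hf).
Qed.

End product_probability2.

Section kernel.
Variables (R : realType) (d : nat).
Notation u01 := (uniform_prob (@ltr01 R)).
Notation mu := (torus_leb R d).
Implicit Types x y : 'rV[R]_d.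

Definition ker n x y : R := \prod_j kap n (x ord0 j) (y ord0 j).

Definition dker n (i : 'I_d) x y : R :=
  dkap n (x ord0 i) (y ord0 i) * \prod_(j | j != i) kap n (x ord0 j) (y ord0 j).

Lemma ker_ge0 n x y : 0 <= ker n x y.
Proof. by apply: prodr_ge0 => j _; exact: kap_ge0. Qed.

Lemma ker_sym n x y : ker n x y = ker n y x.
Proof. by apply: eq_bigr => j _; exact: kap_sym. Qed.

Lemma dker_antisym n i x y : dker n i x y = - dker n i y x.
Proof.
rewrite /dker dkap_antisym mulNr; congr (- (_ * _)).
by apply: eq_bigr => j _; exact: kap_sym.
Qed.

Lemma coord2_continuous (k : 'I_d) :
  continuous (fun z : 'rV[R]_d * 'rV[R]_d => (z.1 ord0 k, z.2 ord0 k)).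
Proof.
apply: continuousT_pair.
  exact: (continuousT_comp (@continuousT_fst _ _) (@coord_continuous _ _ _ _ _)).
exact: (continuousT_comp (@continuousT_snd _ _) (@coord_continuous _ _ _ _ _)).
Qed.

Lemma continuous_prod_fun (X : topologicalType) (I : Type) (s : seq I) (P : pred I)
    (f : I -> X -> R) : (forall i, continuous (f i)) ->
  continuous (fun z => \prod_(i <- s | P i) f i z).
Proof.
move=> cf; elim: s => [|i s IH].
  by under eq_fun do rewrite big_nil; exact: continuousT_cst.
under eq_fun do rewrite big_cons.
by case: (P i) => // z; apply: cvgM; [exact: cf|exact: IH].
Qed.

Lemma continuous_sum_fun (X : topologicalType) (I : Type) (s : seq I)
    (f : I -> X -> R) : (forall i, continuous (f i)) ->
  continuous (fun z => \sum_(i <- s) f i z).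
Proof.
move=> cf; elim: s => [|i s IH].
  by under eq_fun do rewrite big_nil; exact: continuousT_cst.
under eq_fun do rewrite big_cons.
by move=> z; apply: cvgD; [exact: cf|exact: IH].
Qed.

Lemma ker_continuous n :
  continuous (fun z : 'rV[R]_d * 'rV[R]_d => ker n z.1 z.2).
Proof.
apply: continuous_prod_fun => j.
exact: (continuousT_comp (@coord2_continuous j) (@kap_continuous R n)).
Qed.

Lemma dker_continuous n i :
  continuous (fun z : 'rV[R]_d * 'rV[R]_d => dker n i z.1 z.2).
Proof.
move=> z; apply: cvgM.
  exact: (continuousT_comp (@coord2_continuous i) (@dkap_continuous R n)).
apply: continuous_prod_fun => j.
exact: (continuousT_comp (@coord2_continuous j) (@kap_continuous R n)).
Qed.

Lemma measurable_rV2_continuous (f : 'rV[R]_d * 'rV[R]_d -> R) : continuous f ->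
  measurable_fun setT f.
Proof.
move=> cf; have := cdisc_measurable (cdisc_prod (@cdisc_rV R d) (@cdisc_rV R d)) cf.
by congr measurable_fun; apply/funext => -[].
Qed.

Lemma ker_bounded n : exists C, forall x y, `|ker n x y| <= C.
Proof.
exists ((wallis R n)^-1 ^+ d) => x y; rewrite ger0_norm ?ker_ge0//.
rewrite -[X in _ <= _ ^+ X]card_ord -prodr_const; apply: ler_prod => j _.
by rewrite kap_ge0 kap_le.
Qed.

Lemma dker_bounded n i : exists C, forall x y, `|dker n i x y| <= C.
Proof.
exists ((wallis R n)^-1 * pi * n.*2%:R * \prod_(j < d | j != i) (wallis R n)^-1) => x y.
rewrite /dker normrM ler_pM//.
  rewrite /dkap normrN !normrM.
  rewrite ger0_norm ?invr_ge0 ?(ltW (wallis_gt0 _ _))// (ger0_norm (pi_ge0 _)) normr_nat.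
  rewrite -[leRHS]mulr1 -[leRHS]mulr1 ler_pM// ?mulr_ge0 ?invr_ge0 ?(ltW (wallis_gt0 _ _)) ?pi_ge0//.
    rewrite ler_pM// ?mulr_ge0 ?invr_ge0 ?(ltW (wallis_gt0 _ _)) ?pi_ge0//.
    by rewrite normrX exprn_ile1// ler_norml cos_geN1 cos_le1.
  by rewrite ler_norml sin_geN1 sin_le1.
rewrite normr_prod; apply: ler_prod => j _.
by rewrite normr_ge0 ger0_norm ?kap_ge0// kap_le.
Qed.

Lemma ker_line n (i : 'I_d) x y h :
  ker n x (y + h *: basis_vec R i) =
  kap n (x ord0 i) (y ord0 i + h) * \prod_(j | j != i) kap n (x ord0 j) (y ord0 j).
Proof.
rewrite /ker (bigD1 i)//= !mxE !eqxx mulr1; congr (_ * _).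
by apply: eq_bigr => j ji; rewrite !mxE (negbTE ji) mulr0 addr0.
Qed.

Lemma is_derive_ker_line n i x y : is_derive (0 : R) (1 : R)
  (fun h => ker n x (y + h *: basis_vec R i)) (dker n i x y).
Proof.
under eq_fun do rewrite ker_line mulrC.
rewrite /dker mulrC; apply: is_deriveZ.
have h : is_derive (0 : R) (1 : R) (fun h => y ord0 i + h) 1.
  have := is_deriveD (is_derive_cst (y ord0 i) (0 : R) (1 : R)) (is_derive_id (0 : R) (1 : R)).
  by rewrite add0r.
have := @is_derive1_comp R (kap n (x ord0 i)) (fun h => y ord0 i + h) 0 _ _ _ h.
rewrite addr0 => /(_ _ (is_derive_kap _ _ _)).
by rewrite mulr1.
Qed.

Lemma derivable_ker n x y i : derivable (ker n x) y (basis_vec R i).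
Proof.
have := @line_derivable R d (ker n x) y (basis_vec R i) 0.
by rewrite scale0r addr0; apply; have [] := is_derive_ker_line n i x y.
Qed.

Lemma derive_ker n x y i : 'D_(basis_vec R i) (ker n x) y = dker n i x y.
Proof.
have := @derive_line R d (ker n x) y (basis_vec R i) 0.
rewrite scale0r addr0 => ->; rewrite derive1E.
by have [_ ->] := is_derive_ker_line n i x y.
Qed.

Lemma Zperiodic_ker n x : Zperiodic (ker n x).
Proof.
by move=> y k; apply: eq_bigr => j _; rewrite !mxE kap_int.
Qed.

Lemma ker_continuous2 n x : continuous (ker n x).
Proof.
exact: (continuousT_comp (continuousT_pair (@continuousT_cst _ _ x) (@continuousT_id _))
  (@ker_continuous n)).
Qed.

Lemma dker_continuous2 n i x : continuous (dker n i x).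
Proof.
exact: (continuousT_comp (continuousT_pair (@continuousT_cst _ _ x) (@continuousT_id _))
  (@dker_continuous n i)).
Qed.

Lemma itg_ker n x : itg mu (ker n x).
Proof. exact: itg_continuous_periodic (@ker_continuous2 n x) (@Zperiodic_ker n x). Qed.

Lemma kap_measurable n r : measurable_fun [set: measurableTypeR R] (kap n r).
Proof. exact: measurable_R_continuous (@kap_continuous1 R n r). Qed.

Lemma int_kapE n (r : R) : (\int[u01]_s (kap n r s)%:E = 1)%E.
Proof.
rewrite itg_EFin ?int_kap//; apply: (@itg_bounded _ _ _ _ _ (wallis R n)^-1).
  exact: kap_measurable.
by move=> s; rewrite ger0_norm ?kap_ge0// kap_le.
Qed.

Lemma int_ker n x : \int[mu]_y ker n x y = 1.
Proof.
apply: EFin_inj; rewrite -itg_EFin; last exact: itg_ker.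
rewrite (torus_prod (f := fun j => kap n (x ord0 j)) (c := fun=> 1)) ?big1//.
- by move=> j; exact: kap_measurable.
- by move=> j s; exact: kap_ge0.
- by move=> j; exact: int_kapE.
Qed.

Lemma int_ker_sin n x i :
  (\int[mu]_y (ker n x y * sinr (x ord0 i) (y ord0 i) ^+ 2)%:E =
  ((n.*2.+2)%:R^-1)%:E)%E.
Proof.
pose f j s := kap n (x ord0 j) s * (if j == i then sinr (x ord0 i) s ^+ 2 else 1).
have ms : continuous (fun s : R => sinr (x ord0 i) s ^+ 2).
  apply: (continuousT_comp _ (@exprn_continuous _ _)).
  exact: (continuousT_comp (continuousT_pair (@continuousT_cst _ _ _) (@continuousT_id _))
    (@sinr_continuous R)).
have mf j : measurable_fun [set: measurableTypeR R] (f j).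
  apply: measurable_funM; first exact: kap_measurable.
  by case: eqP => // _; exact: measurable_R_continuous.
have := torus_prod (f := f) (c := fun j => if j == i then (n.*2.+2)%:R^-1 else 1) mf.
rewrite (bigD1 i)//= eqxx big1 ?mulr1 => [|j /negbTE ->//].
move=> <-.
- apply: eq_integral => y _; congr EFin; rewrite /f big_split/=; congr (_ * _).
  by rewrite (bigD1 i)//= eqxx big1 ?mulr1// => j /negbTE ->.
- by move=> j s; rewrite mulr_ge0 ?kap_ge0//; case: ifP => // _; exact: sqr_ge0.
- move=> j; rewrite /f; have [->|ji] := eqVneq j i; last first.
    by under eq_integral do rewrite mulr1; exact: int_kapE.
  rewrite itg_EFin ?int_kap_sin//.
  apply: (@itg_bounded _ _ _ _ _ ((wallis R n)^-1 * 1)).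
    by apply: measurable_funM; [exact: kap_measurable|exact: measurable_R_continuous].
  move=> s; rewrite normrM ler_pM// ger0_norm ?kap_ge0 ?kap_le ?sqr_ge0//.
  by rewrite -(cos2Dsin2 (pi * (s - x ord0 i))) lerDr sqr_ge0.
Qed.

(* The mollification error; it tends to [0] for indicators of half-spaces, hence by a
   monotone class argument for all square integrable functions. *)
Definition osc n (k : 'rV[R]_d -> R) : R :=
  \int[(mu \x mu)%E]_z (ker n z.1 z.2 * (k z.1 - k z.2) ^+ 2).

Lemma measurable_ker n :
  measurable_fun setT (fun z : 'rV[R]_d * 'rV[R]_d => ker n z.1 z.2).
Proof. exact: measurable_rV2_continuous (@ker_continuous n). Qed.

Lemma itg_ker_mul n f : itg (mu \x mu)%E f ->
  itg (mu \x mu)%E (fun z => ker n z.1 z.2 * f z).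
Proof.
move=> hf; have [C hC] := ker_bounded n; under eq_fun do rewrite mulrC.
by apply: (itgM_bounded (C := C)) => //; exact: measurable_ker.
Qed.

Lemma sqi_diff (k : 'rV[R]_d -> R) : sqi mu k ->
  sqi (mu \x mu)%E (fun z => k z.1 - k z.2).
Proof. by move=> hk; apply: sqiB; [exact: sqi_fst|exact: sqi_snd]. Qed.

Lemma osc_itg n k : sqi mu k ->
  itg (mu \x mu)%E (fun z => ker n z.1 z.2 * (k z.1 - k z.2) ^+ 2).
Proof. by move=> /sqi_diff[_]; exact: itg_ker_mul. Qed.

Lemma osc_ge0 n k : 0 <= osc n k.
Proof. by apply: Rintegral_ge0 => z _; rewrite mulr_ge0 ?ker_ge0 ?sqr_ge0. Qed.

Lemma int_ker_fst n (f : 'rV[R]_d -> R) : itg mu f ->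
  \int[(mu \x mu)%E]_z (ker n z.1 z.2 * f z.1) = \int[mu]_x f x.
Proof.
move=> hf; rewrite Rint_fubini1; last exact: itg_ker_mul (itg_fst mu hf).
apply: eq_Rintegral => x _ /=; under eq_Rintegral do rewrite mulrC.
by rewrite (RintZ _ (itg_ker n x)) int_ker mulr1.
Qed.

Lemma int_ker_snd n (f : 'rV[R]_d -> R) : itg mu f ->
  \int[(mu \x mu)%E]_z (ker n z.1 z.2 * f z.2) = \int[mu]_x f x.
Proof.
move=> hf; rewrite Rint_fubini2; last exact: itg_ker_mul (itg_snd mu hf).
apply: eq_Rintegral => x _ /=; under eq_Rintegral do rewrite mulrC ker_sym.
by rewrite (RintZ _ (itg_ker n x)) int_ker mulr1.
Qed.

Lemma oscD n k l : sqi mu k -> sqi mu l ->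
  osc n (fun x => k x + l x) <= 2 * osc n k + 2 * osc n l.
Proof.
move=> hk hl.
have ik := osc_itg n hk; have il := osc_itg n hl.
rewrite -!RintZ// -RintD//; [|exact: itgZ|exact: itgZ].
apply: Rint_le => [|| z].
- exact: (osc_itg n (sqiD hk hl)).
- by apply: itgD; exact: itgZ.
have := ker_ge0 n z.1 z.2; set K := ker _ _ _ => K0.
rewrite !(mulrCA 2) -mulrDr ler_wpM2l//.
have := sqr_ge0 (k z.1 - k z.2 - (l z.1 - l z.2)); nra.
Qed.

(** From (a - b)^2 <= 2 a^2 + 2 b^2 and mass one in each variable. The bound is uniform in n, so
    smallness of the error survives L^2 limits. *)
Lemma osc_le_norm n k : sqi mu k -> osc n k <= 4 * \int[mu]_x (k x ^+ 2).
Proof.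
move=> hk; have h2 := hk.2.
have -> : 4 * \int[mu]_x (k x ^+ 2) = 2 * \int[mu]_x (k x ^+ 2) + 2 * \int[mu]_x (k x ^+ 2).
  by ring.
rewrite -{1}(int_ker_fst n h2) -(int_ker_snd n h2).
have i1 := itg_ker_mul n (itg_fst mu h2); have i2 := itg_ker_mul n (itg_snd mu h2).
rewrite -!RintZ// -RintD//; [|exact: itgZ|exact: itgZ].
apply: Rint_le => [|| z].
- exact: (osc_itg n hk).
- by apply: itgD; exact: itgZ.
have := ker_ge0 n z.1 z.2; set K := ker _ _ _ => K0.
rewrite !(mulrCA 2) -mulrDr ler_wpM2l//.
have := sqr_ge0 (k z.1 + k z.2); nra.
Qed.

Lemma oscZ n c k : sqi mu k -> osc n (fun x => c * k x) = c ^+ 2 * osc n k.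
Proof.
move=> hk; rewrite -RintZ; last exact: osc_itg.
by apply: eq_Rintegral => z _; ring.
Qed.

Definition osc_small (k : 'rV[R]_d -> R) :=
  sqi mu k /\ forall e, 0 < e -> exists N, forall n, (N <= n)%N -> osc n k <= e.

Lemma osc_smallD k l : osc_small k -> osc_small l ->
  osc_small (fun x => k x + l x).
Proof.
move=> [hk sk] [hl sl]; split; first exact: sqiD.
move=> e e0; have e4 : 0 < e / 4 by rewrite divr_gt0.
have [N hN] := sk _ e4; have [N' hN'] := sl _ e4.
exists (maxn N N') => n; rewrite geq_max => /andP[n1 n2].
rewrite (le_trans (oscD n hk hl))//.
by have := hN _ n1; have := hN' _ n2; lra.
Qed.

Lemma osc_smallZ c k : osc_small k -> osc_small (fun x => c * k x).
Proof.
move=> [hk sk]; split; first exact: sqiZ.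
move=> e e0; have c0 : 0 < c ^+ 2 + 1 by rewrite ltr_wpDl ?sqr_ge0.
have [N hN] := sk (e / (c ^+ 2 + 1)) (divr_gt0 e0 c0).
exists N => n /hN h; rewrite oscZ//.
have := osc_ge0 n k; move: h; rewrite ler_pdivlMr// => h1 h2.
by rewrite (le_trans _ h1)// mulrC ler_wpM2l// lerDl.
Qed.

Lemma osc_small_sum (I : choiceType) (s : seq I) (f : I -> 'rV[R]_d -> R) :
  (forall i, osc_small (f i)) -> osc_small (fun x => \sum_(i <- s) f i x).
Proof.
move=> h; elim: s => [|i s IH].
  under eq_fun do rewrite big_nil.
  split; first exact: sqi_cst.
  move=> e e0; exists 0%N => n _; rewrite (le_trans (osc_le_norm n _))//.
    exact: sqi_cst.
  by under eq_Rintegral do rewrite expr0n/=; rewrite Rint_cst mulr0 ltW.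
by under eq_fun do rewrite big_cons; exact: osc_smallD.
Qed.

Lemma osc_small_lim k : sqi mu k ->
  (forall e, 0 < e -> exists2 l, osc_small l &
    \int[mu]_x ((k x - l x) ^+ 2) <= e) -> osc_small k.
Proof.
move=> hk h; split=> // e e0.
(* The error of [k] is at most 2 (e / 4) from [l] plus 2 * 4 * (e / 16) from k - l. *)
have [l [hl sl] kl] := h (e / 16) (divr_gt0 e0 (ltr0n _ 16)).
have [N hN] := sl (e / 4) (divr_gt0 e0 (ltr0n _ 4)).
exists N => n /hN {}hN.
have hkl : sqi mu (fun x => k x - l x) by exact: sqiB.
have -> : k = fun x => l x + (k x - l x) by apply/funext => x; rewrite addrC subrK.
rewrite (le_trans (oscD n hl hkl))//.
by have := osc_le_norm n hkl; lra.
Qed.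

(** The difference of the two integrals is the integral of ker * u(x) * (k(y) - k(x));
    Cauchy-Schwarz bounds its square by the squared norm of [u] times the mollification error of
    [k]. *)
Lemma osc_small_cvg u k : sqi mu u -> osc_small k -> forall e, 0 < e ->
  exists N, forall n, (N <= n)%N ->
  `|\int[(mu \x mu)%E]_z (ker n z.1 z.2 * (u z.1 * k z.2)) -
    \int[mu]_x (u x * k x)| <= e.
Proof.
move=> hu [hk sk] e e0.
pose A := \int[mu]_x (u x ^+ 2); have A0 : 0 <= A by apply: Rintegral_ge0 => x _; exact: sqr_ge0.
have A1 : 0 < A + 1 by rewrite ltr_wpDl.
have [N hN] := sk (e ^+ 2 / (A + 1)) (divr_gt0 (exprn_gt0 2 e0) A1).
exists N => n /hN {}hN.
have iuk := sqi_mul hu hk.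
rewrite -(int_ker_fst n iuk).
have i1 : itg (mu \x mu)%E (fun z => ker n z.1 z.2 * (u z.1 * k z.2)).
  by apply: itg_ker_mul; apply: sqi_mul; [exact: sqi_fst|exact: sqi_snd].
have i2 := itg_ker_mul n (itg_fst mu iuk).
rewrite -RintB//.
(* The kernel is shared equally between the two factors of Cauchy-Schwarz. *)
pose s z := Num.sqrt (ker n z.1 z.2).
have ms : measurable_fun setT s.
  apply: measurable_rV2_continuous; apply: continuousT_comp (@ker_continuous n) _.
  exact: sqrt_continuous.
have [C hC] := ker_bounded n.
have sC z : `|s z| <= Num.sqrt C.
  rewrite ger0_norm ?sqrtr_ge0// ler_wsqrtr//.
  by rewrite (le_trans (ler_norm _)).
have hu1 : sqi (mu \x mu)%E (fun z => u z.1 * s z).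
  exact: (sqiM_bounded (sqi_fst mu hu) ms sC).
have hk1 : sqi (mu \x mu)%E (fun z => (k z.2 - k z.1) * s z).
  by apply: (sqiM_bounded _ ms sC); apply: sqiB; [exact: sqi_snd|exact: sqi_fst].
have ss z : s z ^+ 2 = ker n z.1 z.2 by rewrite sqr_sqrtr ?ker_ge0.
have h := Rint_CauchySchwarz hu1 hk1.
have e1 : \int[(mu \x mu)%E]_z (u z.1 * s z * ((k z.2 - k z.1) * s z)) =
    \int[(mu \x mu)%E]_z
   (ker n z.1 z.2 * (u z.1 * k z.2) - ker n z.1 z.2 * (u z.1 * k z.1)).
  by apply: eq_Rintegral => z _; rewrite -ss; ring.
have e2 : \int[(mu \x mu)%E]_z (u z.1 * s z) ^+ 2 = A.
  transitivity (\int[(mu \x mu)%E]_z (ker n z.1 z.2 * u z.1 ^+ 2)); last first.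
    exact: (int_ker_fst n hu.2).
  by apply: eq_Rintegral => z _; rewrite -ss; ring.
have e3 : \int[(mu \x mu)%E]_z ((k z.2 - k z.1) * s z) ^+ 2 = osc n k.
  by apply: eq_Rintegral => z _; rewrite -ss; ring.
move: h; rewrite e1 e2 e3.
move=> h; rewrite -ler_sqr ?nnegrE ?(ltW e0)// real_normK ?num_real//.
rewrite (le_trans h)//.
have := osc_ge0 n k; move: hN; rewrite ler_pdivlMr// => h1 h2.
by nra.
Qed.

End kernel.

(** * Convergence of mollified pairings and weak integration by parts *)

Section density.
Variables (R : realType) (d : nat).
Notation u01 := (uniform_prob (@ltr01 R)).
Notation mu := (torus_leb R d).
Implicit Types (A B : set 'rV[R]_d).

Definition osc_set A := measurable A /\ osc_small (\1_A : 'rV[R]_d -> R).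

Lemma sqi_indic A : measurable A -> sqi mu (\1_A).
Proof.
move=> mA; apply: (@sqi_bounded _ _ _ _ _ 1) => //.
by move=> x; rewrite indicE; case: (_ \in _); rewrite ?normr1 ?normr0.
Qed.

Lemma osc_setC A : osc_set A -> osc_set (~` A).
Proof.
move=> [mA [_ sA]]; split; first exact: measurableC.
split; first by apply: sqi_indic; exact: measurableC.
move=> e /sA[N hN]; exists N => n /hN; congr (_ <= _).
apply: eq_Rintegral => z _; congr (_ * _).
by rewrite !indicE !in_setC; case: (_ \in _); case: (_ \in _) => /=; ring.
Qed.

Lemma osc_set0 : osc_set set0.
Proof.
split => //; split; first exact: sqi_indic.
move=> e e0; exists 0%N => n _; rewrite /osc.
under eq_Rintegral do rewrite !indicE !in_set0 subrr expr0n mulr0.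
by rewrite Rint_cst ltW.
Qed.

(** The indicator of a union jumps between two points only if one of the two indicators does. *)
Lemma osc_setU A B : osc_set A -> osc_set B -> osc_set (A `|` B).
Proof.
move=> [mA [hA sA]] [mB [hB sB]]; split; first exact: measurableU.
have hAB : sqi mu (\1_(A `|` B)) by apply: sqi_indic; exact: measurableU.
split=> // e e0; have e2 : 0 < e / 2 by rewrite divr_gt0.
have [N hN] := sA _ e2; have [N' hN'] := sB _ e2.
exists (maxn N N') => n; rewrite geq_max => /andP[/hN h1 /hN' h2].
rewrite (splitr e) (le_trans _ (lerD h1 h2))// /osc -RintD; last 2 first.
- exact: osc_itg.
- exact: osc_itg.
apply: Rint_le; [exact: osc_itg|by apply: itgD; exact: osc_itg|move=> z].
rewrite -mulrDr ler_wpM2l ?ker_ge0// !indicE !in_setU.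
by case: (z.1 \in A); case: (z.1 \in B); case: (z.2 \in A); case: (z.2 \in B);
  rewrite /=; lra.
Qed.

Lemma osc_set_bigsetU (F : nat -> set 'rV[R]_d) N : (forall n, osc_set (F n)) ->
  osc_set (\big[setU/set0]_(i < N) F i).
Proof.
move=> hF; elim: N => [|N IH]; first by rewrite big_ord0; exact: osc_set0.
by rewrite big_ord_recr; exact: osc_setU.
Qed.

(** Finite unions approximate the countable one in L^2, since the measures of the remainders
    decrease to zero. *)
Lemma osc_set_bigcup (F : nat -> set 'rV[R]_d) : (forall n, osc_set (F n)) ->
  osc_set (\bigcup_n F n).
Proof.
move=> hF; pose G N := \big[setU/set0]_(i < N) F i.
have hG N : osc_set (G N) by exact: osc_set_bigsetU.
have mU : measurable (\bigcup_n F n) by apply: bigcup_measurable => n _; exact: (hF n).1.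
split => //; apply: osc_small_lim; first exact: sqi_indic.
move=> e e0; pose D N := (\bigcup_n F n) `\` G N.
have mD N : measurable (D N) by apply: measurableD => //; exact: (hG N).1.
have D0 : \bigcap_N D N = set0.
  apply/seteqP; split => // x Dx; have [[n _ Fnx] _] := Dx 0%N I.
  have [_] := Dx n.+1 I; apply; rewrite /G -bigcup_mkord; exists n => //=.
have cD : mu (D n) @[n --> \oo] --> mu (\bigcap_N D N).
  apply: nonincreasing_cvg_mu => //.
  - by rewrite (le_lt_trans (probability_le1 _ (mD _)))// ltry.
  - by rewrite D0.
  - move=> m n mn; apply/subsetPset; apply: setDS.
    by rewrite /G -!bigcup_mkord; apply: bigcup_sub => i /= im; apply: bigcup_sup => /=; exact: leq_trans im mn.
move: cD; rewrite D0 measure0 => /fine_cvgP[_] /cvgrPdist_le/(_ _ e0)[N _ hN].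
exists (\1_(G N)); first exact: (hG N).2.
have := hN N (leqnn N); rewrite sub0r normrN => /(le_trans (ler_norm _)).
apply: le_trans; rewrite le_eqVlt; apply/orP; left; apply/eqP.
transitivity (\int[mu]_x (\1_(D N) x : R)).
  apply: eq_Rintegral => x _; rewrite !indicE.
  have GU : G N `<=` \bigcup_n F n.
    by rewrite /G -bigcup_mkord; apply: bigcup_sub => i _; exact: bigcup_sup.
  rewrite in_setD.
  have [/set_mem xU|xU] := boolP (x \in \bigcup_n F n).
    by case: (x \in G N) => /=; ring.
  have -> : (x \in G N) = false.
    by apply/negbTE; apply: contra xU => /set_mem xG; apply/mem_set/GU.
  by rewrite /=; ring.
by rewrite /Rintegral integral_indic// setIT.
Qed.

(** On the circle a half-space has two boundary points, c and the cut 0 = 1. A point of the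
    half-space outside these neighbourhoods is at circle distance at least e from every point of the
    complement. *)
Definition bad (c e : R) : set (measurableTypeR R) :=
  `]c - e, c + e[%classic `|` `[0, e[%classic `|` `]1 - e, 1]%classic.

Lemma measurable_bad c e : measurable (bad c e).
Proof. by apply: measurableU; [apply: measurableU|]; exact: measurable_itv. Qed.

Lemma u01_itv_le (x y : R) (l r : bool) : x <= y ->
  (u01 [set` Interval (BSide l x) (BSide r y)] <= (y - x)%:E)%E.
Proof.
move=> xy; rewrite uniform_probE; last exact: measurable_itv.
rewrite subr0 invr1 mul1e.
apply: (@le_trans _ _ (lebesgue_measure [set` Interval (BSide l x) (BSide r y)])).
  by apply: le_measure; rewrite ?inE; [apply: measurableI; exact: measurable_itv|exact: measurable_itv|exact: subIsetl].
rewrite lebesgue_measure_itv/= lte_fin; case: ltP => //.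
by rewrite lee_fin subr_ge0.
Qed.

Lemma bad_le c e : 0 < e -> (u01 (bad c e) <= (4 * e)%:E)%E.
Proof.
move=> e0.
have m1 := measurable_itv `]c - e, c + e[; have m2 := measurable_itv `[0, e[.
have m3 := measurable_itv `]1 - e, 1].
apply: (le_trans (measureU2 _ _ _)) => //; first exact: measurableU.
rewrite (_ : 4 * e = (c + e - (c - e)) + (e - 0) + (1 - (1 - e))); last by ring.
rewrite 2!EFinD; apply: leeD; last first.
  by apply: u01_itv_le; rewrite gerBl ltW.
apply: (le_trans (measureU2 _ _ _)) => //; apply: leeD.
  by apply: u01_itv_le; rewrite lerD2l; lra.
by apply: u01_itv_le; exact: ltW.
Qed.

Lemma torus_coord (i : 'I_d) (B : set (measurableTypeR R)) : measurable B ->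
  mu [set x : 'rV[R]_d | B (x ord0 i)] = u01 B.
Proof.
move=> mB; pose A j := if j == i then B else setT.
pose c j := if j == i then fine (u01 B) else 1.
have uf : u01 B \is a fin_num by exact: fin_num_measure.
have -> : [set x : 'rV[R]_d | B (x ord0 i)] = [set x : 'rV[R]_d | forall j, A j (x ord0 j)].
  apply/seteqP; split => x /=; rewrite /A.
    by move=> Bx j; case: eqP => // ->.
  by move=> /(_ i); rewrite eqxx.
rewrite (@torus_box R d A c).
- rewrite (bigD1 i)//= /c eqxx big1 ?mulr1 ?fineK// => j /negbTE -> //.
- by move=> j; rewrite /A; case: ifP => _.
- by move=> j; rewrite /A /c; case: ifP => _; rewrite ?fineK// probability_setT.
Qed.

Lemma sin2_lower (e : R) : 0 < e -> e < 1 / 2 -> exists2 m : R, 0 < m &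
  forall t, e <= t <= 1 - e -> m <= sin (pi * t) ^+ 2.
Proof.
move=> e0 e1.
have cs : continuous (fun t : R => sin (pi * t) ^+ 2).
  apply: (continuousT_comp _ (@exprn_continuous _ _)).
  apply: (continuousT_comp _ (@continuous_sin R)).
  by move=> t; apply: cvgM; [exact: cvg_cst|exact: cvg_id].
have ee : e <= 1 - e by lra.
have [c ce hc] := EVT_min ee (continuous_subspaceT cs).
exists (sin (pi * c) ^+ 2); last by move=> t te; apply: hc; rewrite in_itv.
move: ce; rewrite in_itv/= => /andP[c1 c2].
rewrite exprn_gt0// sin_gt0_pi// mulr_gt0 ?pi_gt0 ?(lt_le_trans e0)//=.
by rewrite -[ltRHS]mulr1 ltr_pM2l ?pi_gt0// (le_lt_trans c2)//; lra.
Qed.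

Lemma ae_unit_cube2 : {ae (mu \x mu)%E, forall z, unit_cube z.1 /\ unit_cube z.2}.
Proof.
have mQ := @measurable_unit_cube R d.
have := @ae_prob1 _ _ _ (mu \x mu)%E (@unit_cube R d `*` @unit_cube R d) (measurableX mQ mQ).
apply; apply: (etrans (product_measure1E _ _ mQ mQ)).
transitivity (1 * 1 : \bar R)%E; last by rewrite mule1.
by congr (_ * _)%E; exact: torus_unit_cube.
Qed.

(** Two points on opposite sides either include one with a bad coordinate or have sin^2 at least m.
    Bad coordinates have small measure, and the kernel integrates sin^2 to 1/(2n + 2). *)
Lemma osc_halfspace (i : 'I_d) (c : R) : osc_set [set x : 'rV[R]_d | x ord0 i <= c].
Proof.
pose A := [set x : 'rV[R]_d | x ord0 i <= c].
rewrite -/A; have mA : measurable A.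
  rewrite -[A]setTI; apply: (@measurable_coord R d i measurableT `]-oo, c]%classic).
  exact: measurable_itv.
split => //; split; first exact: sqi_indic.
(* Bad coordinates have measure at most 4 t <= e / 4 in each variable, which leaves e / 2 for the
   sine term; t <= 1/4 keeps t below 1/2 for [sin2_lower]. *)
move=> e e0; pose t := Num.min (e / 16) (1 / 4).
have t0 : 0 < t by rewrite lt_min !divr_gt0.
have te : t <= e / 16 by rewrite ge_min lexx.
have t2 : t < 1 / 2 by rewrite (@le_lt_trans _ _ (1 / 4)) ?ge_min ?lexx ?orbT//; lra.
have [m m0 hm] := sin2_lower t0 t2.
have em : 0 < e * m / 2 by rewrite divr_gt0// mulr_gt0.
have [N _ hN] := near_infty_natSinv_lt (PosNum em).
exists N => n Nn.
have mB := measurable_bad c t.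
have mBx : measurable [set x : 'rV[R]_d | bad c t (x ord0 i)].
  by rewrite -[X in measurable X]setTI; exact: (@measurable_coord R d i measurableT).
set b : 'rV[R]_d -> R := \1_[set x : 'rV[R]_d | bad c t (x ord0 i)].
have hb : itg mu b by apply: sqi_itg; exact: sqi_indic.
have ib : \int[mu]_x b x <= e / 4.
  have -> : \int[mu]_x b x = fine (u01 (bad c t)).
    by rewrite /Rintegral integral_indic// setIT; congr fine; exact: torus_coord.
  rewrite -lee_fin fineK ?fin_num_measure// (le_trans (bad_le c t0))// lee_fin.
  by lra.
pose s (z : 'rV[R]_d * 'rV[R]_d) := sinr (z.1 ord0 i) (z.2 ord0 i) ^+ 2 : R.
have ms : measurable_fun setT s.
  apply: measurable_rV2_continuous; apply: (continuousT_comp _ (@exprn_continuous _ _)).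
  exact: (continuousT_comp (@coord2_continuous R d i) (@sinr_continuous R)).
have s1 z : `|s z| <= 1.
  rewrite ger0_norm ?sqr_ge0//.
  by rewrite -(cos2Dsin2 (pi * (z.2 ord0 i - z.1 ord0 i))) lerDr sqr_ge0.
have is' : itg (mu \x mu)%E s by exact: (itg_bounded _ ms s1).
have is_ := itg_ker_mul n is'.
have int_s : \int[(mu \x mu)%E]_z (ker n z.1 z.2 * s z) = (n.*2.+2)%:R^-1.
  rewrite (Rint_fubini1 is_) -[RHS](Rint_cst mu); apply: eq_Rintegral => x _.
  by rewrite /Rintegral int_ker_sin.
have ib1 := itg_ker_mul n (itg_fst mu hb); have ib2 := itg_ker_mul n (itg_snd mu hb).
have hA := sqi_indic mA.
apply: (@le_trans _ _ (\int[(mu \x mu)%E]_z (ker n z.1 z.2 * b z.1 +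
   ker n z.1 z.2 * b z.2 + m^-1 * (ker n z.1 z.2 * s z)))).
  apply: Rint_ae_le.
  - exact: osc_itg.
  - by apply: itgD; [exact: itgD|exact: itgZ].
  apply: filterS ae_unit_cube2 => -[x y] [/= /(_ i)/andP[x0 x1] /(_ i)/andP[y0 y1]].
  rewrite (mulrCA m^-1) -!mulrDr ler_wpM2l ?ker_ge0//.
  have b01 z : b z = 0 \/ b z = 1.
    by rewrite /b indicE; case: (_ \in _); [right|left].
  have bge0 z : 0 <= b z by case: (b01 z) => ->.
  have sge0 z : 0 <= m^-1 * s z by rewrite mulr_ge0 ?sqr_ge0// invr_ge0 ltW.
  (* If x' is not bad, then x' < c - t and x' >= t, so y' - x' lies between t and 1 - t. *)
  have key (x' y' : 'rV[R]_d) : 0 <= x' ord0 i -> y' ord0 i < 1 -> x' ord0 i <= c ->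
      c < y' ord0 i -> b x' = 1 \/ m <= s (x', y').
    move=> h1 h2 h3 h4; have [xB|xB] := pselect (bad c t (x' ord0 i)).
      by left; rewrite /b indicE mem_set.
    right; apply: hm => /=; apply/andP; split.
      rewrite leNgt; apply/negP => h5; apply: xB; left; left => /=; rewrite in_itv/=.
      by apply/andP; split; lra.
    rewrite leNgt; apply/negP => h5; apply: xB; left; right => /=; rewrite in_itv/= h1/=.
    by lra.
  have ssym : s (y, x) = s (x, y).
    by rewrite /s /sinr -(opprB (y ord0 i)) mulrN sinN sqrrN.
  have hms : m <= s (x, y) -> 1 <= m^-1 * s (x, y).
    by move=> h; rewrite ler_pdivlMl// mulr1.
  have := bge0 x; have := bge0 y; have := sge0 (x, y).
  rewrite !indicE /=.
  have [/set_mem /= xA|xA] := boolP (x \in A); have [/set_mem /= yA|yA] := boolP (y \in A).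
  - by rewrite subrr expr0n /=; lra.
  - have yc : c < y ord0 i by rewrite ltNge; apply/negP => h; move/negP: yA; apply; exact/mem_set.
    by rewrite subr0 expr1n; case: (key _ _ x0 y1 xA yc) => [->|/hms]; lra.
  - have xc : c < x ord0 i by rewrite ltNge; apply/negP => h; move/negP: xA; apply; exact/mem_set.
    rewrite sub0r sqrrN expr1n; case: (key _ _ y0 x1 yA xc) => [->|]; first lra.
    by rewrite ssym => /hms; lra.
  - by rewrite subrr expr0n /=; lra.
rewrite (RintD (itgD ib1 ib2) (itgZ m^-1 is_)) (RintD ib1 ib2) RintZ// int_s int_ker_fst// int_ker_snd//.
have : m^-1 * (n.*2.+2)%:R^-1 <= e / 2.
  rewrite mulrC ler_pdivrMr//; apply: (@le_trans _ _ n.+1%:R^-1).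
    by rewrite lef_pV2 ?posrE// ler_nat -addnn !ltnS leqW// leq_addr.
  by rewrite (le_trans (ltW (hN _ Nn)))//= mulrAC.
move=> h; apply: (le_trans (lerD (lerD ib ib) h)); rewrite le_eqVlt.
by apply/orP; left; apply/eqP; field.
Qed.

Lemma osc_setI A B : osc_set A -> osc_set B -> osc_set (A `&` B).
Proof.
move=> hA hB; rewrite -[A `&` B]setCK setCI; apply: osc_setC.
by apply: osc_setU; exact: osc_setC.
Qed.

Lemma osc_set_measurable A : measurable A -> osc_set A.
Proof.
suff : measurable `<=` [set A | osc_set A] by exact.
apply: smallest_sub.
  split; [exact: osc_set0|by move=> B /= hB; rewrite setTD; exact: osc_setC|].
  by move=> F hF; exact: osc_set_bigcup.
rewrite -bigcup_seq/=; apply: bigcup_sub => i _ _ [C mC <-].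
suff : measurable `<=` [set C : set (measurableTypeR R) |
    osc_set (setT `&` (fun x : 'rV[R]_d => x ord0 i) @^-1` C)] by apply.
apply: smallest_sub.
  split => /=.
  - by rewrite setTI preimage_set0; exact: osc_set0.
  - by move=> B /=; rewrite !setTI setTD => hB; rewrite preimage_setC; exact: osc_setC.
  - move=> F /= hF; rewrite setTI preimage_bigcup; apply: osc_set_bigcup => k.
    by have := hF k; rewrite setTI.
move=> _ [[a b] _ <-] /=; rewrite setTI.
have -> : (fun x : 'rV[R]_d => x ord0 i) @^-1` `]a, b]%classic =
  [set x : 'rV[R]_d | x ord0 i <= b] `&` ~` [set x : 'rV[R]_d | x ord0 i <= a]; last first.
  by apply: osc_setI; [|apply: osc_setC]; exact: osc_halfspace.
apply/seteqP; split => x /=; rewrite in_itv/=.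
  by move=> /andP[h1 ->]; split => //; apply/negP; rewrite -ltNge.
by move=> [-> /negP]; rewrite -ltNge => ->.
Qed.

Import HBNNSimple.

(** Increasing simple functions converge to [f] in L^2, dominated by f^2, and each is a finite
    combination of indicators. *)
Lemma osc_small_ge0 (f : 'rV[R]_d -> R) : sqi mu f -> (forall x, 0 <= f x) ->
  osc_small f.
Proof.
move=> hf f0; have [mf hf2] := hf.
have mef : measurable_fun setT (EFin \o f) by exact/measurable_EFinP.
pose g := nnsfun_approx measurableT mef.
have cg x : g n x @[n --> \oo] --> f x.
  have f0e y : setT y -> (0 <= (EFin \o f) y)%E by rewrite lee_fin.
  exact: (fine_cvg (cvg_nnsfun_approx measurableT mef f0e I)).
have gf n x : g n x <= f x.
  rewrite -(cvg_lim _ (cg x))//; apply: nondecreasing_cvgn_le.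
    by move=> p q pq; exact/lefP/nd_nnsfun_approx.
  by apply/cvg_ex; exists (f x); exact: cg.
have g0 n x : 0 <= g n x by [].
have mg n : measurable_fun setT (g n) by [].
have hg n : sqi mu (g n).
  split => //; apply: itg_le hf2.
    exact: measurable_funX.
  by move=> x; rewrite !ger0_norm ?sqr_ge0// lerXn2r// nnegrE.
apply: osc_small_lim => // e e0.
pose D n x := (f x - g n x) ^+ 2.
have mD n : measurable_fun setT (D n) by apply: measurable_funX; exact: measurable_funB.
have cD : {ae mu, forall x, D n x @[n --> \oo] --> (0 : R)}.
  apply: aeW => x /=; rewrite -[X in _ --> X](expr0n _ 2) -[X in X ^+ 2](subrr (f x)).
  apply: (continuous_cvg _ (@exprn_continuous _ 2 _)).
  by apply: cvgB; [exact: cvg_cst|exact: cg].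
have bD : {ae mu, forall x, forall n, `|D n x| <= f x ^+ 2}.
  apply: aeW => x n; rewrite ger0_norm ?sqr_ge0// lerXn2r ?nnegrE ?subr_ge0//.
  by rewrite gerBl.
have [_] := Rint_dct mD (measurable_cst (0 : R)) cD hf2 bD.
rewrite Rint_cst => /cvgrPdist_le/(_ _ e0)[N _ /(_ N (leqnn N))/=].
rewrite sub0r normrN => h; exists (g N); last exact: le_trans (ler_norm _) h.
rewrite (_ : (g N : _ -> R) = fun x => \sum_(y <- finmap.enum_fset (fset_set (range (g N))))
    (y * \1_(g N @^-1` [set y]) x)); last first.
  by apply/funext => x; rewrite fimfunE fsbig_finite//; exact: fimfunP.
apply: osc_small_sum => y; apply: osc_smallZ.
by have [] := osc_set_measurable (measurable_funPTI (g N) (measurable_set1 y)).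
Qed.

Lemma osc_small_sqi (k : 'rV[R]_d -> R) : sqi mu k -> osc_small k.
Proof.
move=> hk; have [mk ik] := hk.
have bound (f : 'rV[R]_d -> R) : measurable_fun setT f ->
    (forall x, `|f x| <= `|k x|) -> sqi mu f.
  move=> mf fk; split => //; apply: itg_le ik; first exact: measurable_funX.
  by move=> x; rewrite !normrX lerXn2r// nnegrE.
have -> : k = fun x => Num.max (k x) 0 + -1 * Num.max (- k x) 0.
  apply/funext => x; rewrite mulN1r /Num.max oppr_lt0.
  by case: (ltgtP (k x) 0) => [||->]; rewrite ?opprK ?add0r ?oppr0 ?addr0.
apply: osc_smallD; last apply: osc_smallZ.
- apply: osc_small_ge0; last by move=> x; rewrite le_max lexx orbT.
  apply: bound; first by apply: measurable_maxr => //; exact: measurable_cst.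
  by move=> x; rewrite /Num.max; case: ifP => _; rewrite ?normr0.
- apply: osc_small_ge0; last by move=> x; rewrite le_max lexx orbT.
  apply: bound.
    by apply: measurable_maxr; [exact: measurableT_comp|exact: measurable_cst].
  by move=> x; rewrite /Num.max; case: ifP => _; rewrite ?normr0 ?normrN.
Qed.

(* [g] is the weak derivative of [u] in the direction [i], tested only against
   the kernels. *)
Definition ker_weak (i : 'I_d) (u g : 'rV[R]_d -> R) := [/\ sqi mu u, sqi mu g &
  forall n x, \int[mu]_y (u y * dker n i x y) = - \int[mu]_y (g y * ker n x y)].

Lemma ker_weakB i u g u' g' : ker_weak i u g -> ker_weak i u' g' ->
  ker_weak i (fun x => u x - u' x) (fun x => g x - g' x).
Proof.
move=> [hu hg h] [hu' hg' h']; split; [exact: sqiB|exact: sqiB|move=> n x].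
have [C hC] := ker_bounded R d n; have [C' hC'] := @dker_bounded R d n i.
have mk : measurable_fun setT (ker n x).
  exact: measurable_rV_continuous (@ker_continuous2 R d n x).
have mdk : measurable_fun setT (dker n i x).
  exact: measurable_rV_continuous (@dker_continuous2 R d n i x).
under eq_Rintegral do rewrite mulrBl.
under [in RHS]eq_Rintegral do rewrite mulrBl.
rewrite !RintB ?h ?h' ?opprD//.
- exact: itgM_bounded (sqi_itg hg) mk (hC x).
- exact: itgM_bounded (sqi_itg hg') mk (hC x).
- exact: itgM_bounded (sqi_itg hu) mdk (hC' x).
- exact: itgM_bounded (sqi_itg hu') mdk (hC' x).
Qed.

(* Both sides are limits of mollified pairings, computed by integrating
   [u x * w y * dker n i x y] in the two possible orders. *)
Lemma weak_integration_by_parts i u g w k : ker_weak i u g -> ker_weak i w k ->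
  \int[mu]_x (u x * k x) = - \int[mu]_x (g x * w x).
Proof.
move=> [hu hg ug] [hw hk wk].
have E n : \int[(mu \x mu)%E]_z (ker n z.1 z.2 * (u z.1 * k z.2)) =
    - \int[(mu \x mu)%E]_z (ker n z.1 z.2 * (g z.1 * w z.2)).
  have [C hC] := @dker_bounded R d n i.
  have iuw : itg (mu \x mu)%E (fun z => u z.1 * w z.2 * dker n i z.1 z.2).
    apply: (itgM_bounded (C := C)) => //.
      by apply: sqi_mul; [exact: sqi_fst|exact: sqi_snd].
    exact: measurable_rV2_continuous (@dker_continuous R d n i).
  have iuk : itg (mu \x mu)%E (fun z => ker n z.1 z.2 * (u z.1 * k z.2)).
    by apply: itg_ker_mul; apply: sqi_mul; [exact: sqi_fst|exact: sqi_snd].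
  have igw : itg (mu \x mu)%E (fun z => ker n z.1 z.2 * (g z.1 * w z.2)).
    by apply: itg_ker_mul; apply: sqi_mul; [exact: sqi_fst|exact: sqi_snd].
  have mk (x : 'rV[R]_d) : measurable_fun setT (ker n x).
    exact: measurable_rV_continuous (@ker_continuous2 R d n x).
  have mdk (x : 'rV[R]_d) : measurable_fun setT (dker n i x).
    exact: measurable_rV_continuous (@dker_continuous2 R d n i x).
  have [C' hC'] := ker_bounded R d n.
  have e1 := Rint_fubini1 iuw; have e2 := Rint_fubini2 iuw.
  have {e1} : \int[(mu \x mu)%E]_z (u z.1 * w z.2 * dker n i z.1 z.2) =
      - \int[(mu \x mu)%E]_z (ker n z.1 z.2 * (u z.1 * k z.2)).
    rewrite e1 (Rint_fubini1 iuk) -RintN; last exact: itg_fubini1 iuk.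
    apply: eq_Rintegral => x _ /=.
    transitivity (u x * \int[mu]_y (w y * dker n i x y)).
      rewrite -RintZ; last exact: itgM_bounded (sqi_itg hw) (mdk x) (hC x).
      by apply: eq_Rintegral => y _; rewrite mulrA.
    rewrite wk mulrN -RintZ; last exact: itgM_bounded (sqi_itg hk) (mk x) (hC' x).
    by congr (- _); apply: eq_Rintegral => y _; ring.
  have {e2} : \int[(mu \x mu)%E]_z (u z.1 * w z.2 * dker n i z.1 z.2) =
      \int[(mu \x mu)%E]_z (ker n z.1 z.2 * (g z.1 * w z.2)).
    rewrite e2 (Rint_fubini2 igw); apply: eq_Rintegral => y _ /=.
    (* Antisymmetry of [dker] makes x the differentiated variable, so that the hypothesis on [u]
       applies with center y. *)
    transitivity (- w y * \int[mu]_x (u x * dker n i y x)).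
      rewrite -RintZ; last exact: itgM_bounded (sqi_itg hu) (mdk y) (hC y).
      by apply: eq_Rintegral => x _; rewrite (dker_antisym n i x y); ring.
    rewrite ug mulrNN -RintZ; last exact: itgM_bounded (sqi_itg hg) (mk y) (hC' y).
    by apply: eq_Rintegral => x _; rewrite (ker_sym n x y); ring.
  by move=> <- ->; rewrite opprK.
apply/eqP; rewrite -subr_eq0 opprK -normr_le0; apply/ler_addgt0Pl => e e0.
have e2 : 0 < e / 2 by rewrite divr_gt0.
have [N hN] := osc_small_cvg hu (osc_small_sqi hk) e2.
have [N' hN'] := osc_small_cvg hg (osc_small_sqi hw) e2.
have := hN _ (leq_maxl N N'); have := hN' _ (leq_maxr N N'); rewrite E.
set a := \int[mu]_x _; set b := \int[mu]_x _; set c := \int[_]_z _.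
rewrite addr0 !ler_norml => /andP[h1 h2] /andP[h3 h4].
by apply/andP; split; lra.
Qed.

End density.

(** * Time slices of weak derivatives *)

Section cutoff.
Variable R : realType.
Implicit Types (f : R -> R) (x L C s r t : R).

Lemma is_derive_quadratic f x L C :
  (forall h, `|f (x + h) - f x - L * h| <= C * h ^+ 2) ->
  is_derive (x : R) (1 : R) f L.
Proof.
move=> hf.
have q : h^-1 *: ((f \o shift x) (h *: (1 : R)) - f x) @[h --> (0 : R)^'] --> L.
  apply/cvgrPdist_le => e e0; near=> h.
  have h0 : h != 0 by near: h; exact: nbhs_dnbhs_neq.
  have C1 : 0 < `|C| + 1 by rewrite ltr_wpDl.
  have he : `|h| <= e / (`|C| + 1).
    near: h; apply: nbhs_dnbhs; apply/nbhs_ballP; exists (e / (`|C| + 1)) => /=.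
      by rewrite divr_gt0.
    by move=> y; rewrite /ball/= sub0r normrN => /ltW.
  have := hf h; rewrite /= [h *: 1]mulr1 [h + x]addrC => hh.
  rewrite -(ler_pM2l (x := `|h|)) ?normr_gt0// -normrM mulrBr.
  rewrite [_ *: _]/(_ * _) mulrA mulfV// mul1r distrC (mulrC h).
  apply: (le_trans hh); rewrite -(real_normK (num_real h)) expr2 mulrCA.
  rewrite ler_wpM2l//; move: he; rewrite ler_pdivlMr// mulrDr mulr1 => he.
  rewrite (le_trans _ he)// (@le_trans _ _ (`|h| * `|C|)) ?lerDl//.
  by rewrite mulrC ler_wpM2l// ler_norm.
apply: DeriveDef; first by apply/cvg_ex; exists L.
exact: cvg_lim q.
Unshelve. all: by end_near. Qed.

(** A C^1 function vanishing on the negative half-line; C^1 is the regularity asked of test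
    functions in time. *)
Definition sqp x : R := Num.max 0 x ^+ 2.

Lemma is_derive_sqp x : is_derive (x : R) (1 : R) sqp (2 * Num.max 0 x).
Proof.
apply: (@is_derive_quadratic _ _ _ 1) => h; rewrite mul1r /sqp ler_norml.
by case: (leP 0 x) => x0; case: (leP 0 (x + h)) => xh; apply/andP; split; nra.
Qed.

Lemma sqp_ge0 x : 0 <= sqp x. Proof. exact: sqr_ge0. Qed.

Lemma sqp_neg x : x <= 0 -> sqp x = 0.
Proof. by move=> x0; rewrite /sqp; case: leP => // h; rewrite ?expr0n//; have -> : x = 0; [lra|rewrite expr0n]. Qed.

Lemma maxr_continuous (c : R) : continuous (fun x => Num.max c x).
Proof. by move=> x; apply: continuous_max; [exact: cvg_cst|exact: cvg_id]. Qed.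

(** An explicit C^1 bump: zero outside ]s, r[, with values in [0, 1], tending to 1 inside as n
    grows. *)
Definition cut (n : nat) s r t : R := 1 - expR (- (n%:R * (sqp (t - s) * sqp (r - t)))).

Definition dcut (n : nat) s r t : R :=
  n%:R * (2 * Num.max 0 (t - s) * sqp (r - t) - sqp (t - s) * (2 * Num.max 0 (r - t))) *
  expR (- (n%:R * (sqp (t - s) * sqp (r - t)))).

Lemma is_derive_cut n s r t : is_derive (t : R) (1 : R) (cut n s r) (dcut n s r t).
Proof.
have h1 : is_derive (t : R) (1 : R) (fun t => t - s) 1.
  have := is_deriveB (is_derive_id (t : R) (1 : R)) (is_derive_cst s t (1 : R)).
  by rewrite subr0.
have h2 : is_derive (t : R) (1 : R) (fun t => r - t) (-1).
  have := is_deriveB (is_derive_cst r t (1 : R)) (is_derive_id (t : R) (1 : R)).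
  by rewrite sub0r.
have h3 := @is_derive1_comp R sqp _ t _ _ (is_derive_sqp (t - s)) h1.
have h4 := @is_derive1_comp R sqp _ t _ _ (is_derive_sqp (r - t)) h2.
have h5 := is_deriveN (is_deriveZ n%:R (is_deriveM h3 h4)).
have h6 := @is_derive1_comp R expR _ t _ _ (is_derive_expR _) h5.
have h7 := is_deriveB (is_derive_cst (1 : R) t (1 : R)) h6.
apply: (is_derive_eq h7); rewrite /dcut /GRing.scale /=; ring.
Qed.

Lemma continuous_cut n s r : continuous (cut n s r).
Proof.
move=> t; apply: differentiable_continuous; apply/derivable1_diffP.
by have [] := is_derive_cut n s r t.
Qed.

Lemma sqp_continuous : continuous sqp.
Proof. exact: (continuousT_comp (@maxr_continuous 0) (@exprn_continuous _ 2)). Qed.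

Lemma continuous_dcut n s r : continuous (dcut n s r).
Proof.
have c1 : continuous (fun t => t - s).
  by move=> t; apply: cvgB; [exact: cvg_id|exact: cvg_cst].
have c2 : continuous (fun t => r - t).
  by move=> t; apply: cvgB; [exact: cvg_cst|exact: cvg_id].
have q1 := continuousT_comp c1 sqp_continuous.
have q2 := continuousT_comp c2 sqp_continuous.
have m1 := continuousT_comp c1 (@maxr_continuous 0).
have m2 := continuousT_comp c2 (@maxr_continuous 0).
move=> t; apply: cvgM.
  apply: cvgM; first exact: cvg_cst.
  apply: cvgB.
    by apply: cvgM; [apply: cvgM; [exact: cvg_cst|exact: m1]|exact: q2].
  by apply: cvgM; [exact: q1|apply: cvgM; [exact: cvg_cst|exact: m2]].
have ce : continuous (fun t => - (n%:R * (sqp (t - s) * sqp (r - t)))).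
  move=> u; apply: cvgN; apply: cvgM; first exact: cvg_cst.
  by apply: cvgM; [exact: q1|exact: q2].
exact: (continuousT_comp ce (@continuous_expR R)).
Qed.

Lemma cut_bound n s r t : 0 <= cut n s r t <= 1.
Proof.
rewrite /cut subr_ge0 gerBl expR_ge0 andbT -[leRHS]expR0 ler_expR oppr_le0.
by rewrite mulr_ge0// mulr_ge0// sqp_ge0.
Qed.

Lemma cut_out n s r t : t <= s \/ r <= t -> cut n s r t = 0.
Proof.
rewrite /cut => -[h|h].
  by rewrite (sqp_neg (x := t - s)) ?subr_le0// mul0r mulr0 oppr0 expR0 subrr.
by rewrite (sqp_neg (x := r - t)) ?subr_le0// mulr0 mulr0 oppr0 expR0 subrr.
Qed.

Lemma cut_lower n s r t c : 0 <= c -> c <= sqp (t - s) * sqp (r - t) ->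
  1 - (1 + n%:R * c)^-1 <= cut n s r t.
Proof.
move=> c0 hc; rewrite lerD2l lerN2 expRN.
have nc : 0 <= n%:R * c by rewrite mulr_ge0.
rewrite lef_pV2 ?posrE ?expR_gt0 ?ltr_pwDl//.
rewrite (le_trans _ (expR_ge1Dx _))// lerD2l.
by rewrite ler_wpM2l.
Qed.

Definition test1d (T : R) (eta : R -> R) := [/\ exists2 e, 0 < e &
    forall t, ~~ (e <= t <= T - e) -> eta t = 0,
  forall t, derivable eta (t : R) (1 : R) & continuous (derive1 eta)].

Lemma test1d_cut T n s r : 0 < s -> r < T -> test1d T (cut n s r).
Proof.
move=> s0 rT; split.
- exists (Num.min s (T - r)); first by rewrite lt_min s0 subr_gt0.
  move=> t; rewrite negb_and -!ltNge => /orP[h|h]; apply: cut_out.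
    by left; rewrite ltW// (lt_le_trans h)// ge_min lexx.
  right; rewrite ltW// (le_lt_trans _ h)// lerBrDr -lerBrDl.
  by rewrite ge_min lexx orbT.
- by move=> t; have [] := is_derive_cut n s r t.
- rewrite (_ : derive1 _ = dcut n s r); first exact: continuous_dcut.
  by apply/funext => t; rewrite derive1E; have [_ ->] := is_derive_cut n s r t.
Qed.

(** The left end r/(n + 2) keeps every cutoff supported away from 0 and tends to 0. Once it is below
    t / 2, the exponent is at least n c with c > 0 fixed, and exp x >= 1 + x gives the limit. *)
Lemma cut_cvg r t : 0 < r ->
  cut n (r / n.+2%:R) r t @[n --> \oo] --> (\1_(`]0, r[%classic : set R) t : R).
Proof.
move=> r0; rewrite indicE.
have [|h] := boolP (0 < t < r); last first.
  rewrite memNset/=; last by rewrite in_itv/=; exact/negP.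
  rewrite (_ : (fun _ => _) = fun=> 0); first exact: cvg_cst.
  apply/funext => n; apply: cut_out; move: h; rewrite negb_and -!leNgt => /orP[t0|rt]; [left|by right].
  by rewrite (le_trans t0)// divr_ge0// ltW.
move=> /andP[t0 tr]; rewrite mem_set/= ?in_itv/= ?t0//.
pose c := sqp (t / 2) * sqp (r - t).
have c0 : 0 < c.
  rewrite mulr_gt0// exprn_gt0//.
    by rewrite lt_max divr_gt0 ?orbT.
  by rewrite lt_max subr_gt0 tr orbT.
have p : 0 < t / 2 / r by rewrite !divr_gt0.
apply/cvgrPdist_le => e e0.
near=> n.
have nr : r / n.+2%:R <= t / 2.
  rewrite ler_pdivrMr//.
  have : (n.+1%:R)^-1 < t / 2 / r.
    by near: n; exact: (near_infty_natSinv_lt (PosNum p)).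
  rewrite ltr_pdivlMr// mulrC ltr_pdivrMr// => /ltW h; apply: (le_trans h).
  by apply: ler_wpM2l; [rewrite ltW// divr_gt0|rewrite ler_nat].
have hc : c <= sqp (t - r / n.+2%:R) * sqp (r - t).
  apply: ler_wpM2r; first exact: sqp_ge0.
  apply: (lerXn2r 2); [by rewrite nnegrE le_max lexx|by rewrite nnegrE le_max lexx|].
  rewrite ge_max !le_max lexx /=; move: nr; set q := r / _ => nr.
  by apply/orP; right; lra.
have /andP[_ h1] := cut_bound n (r / n.+2%:R) r t.
rewrite ger0_norm ?subr_ge0//.
have := cut_lower n (ltW c0) hc.
suff : (1 + n%:R * c)^-1 <= e by lra.
have nc : 0 <= n%:R * c by rewrite mulr_ge0// ltW.
rewrite invf_ple ?posrE ?ltr_pwDl//.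
rewrite (@le_trans _ _ (n%:R * c)) ?lerDr// -ler_pdivrMr//.
by near: n; exact: nbhs_infty_ger.
Unshelve. all: by end_near. Qed.

End cutoff.

(** * Fundamental lemma of the calculus of variations in time *)

Section fundamental_lemma.
Variables (R : realType) (T : R) (T0 : 0 < T).
Notation nu := (uniform_prob T0).
Notation leb := (@lebesgue_measure R).

Lemma itg_uniform (a : measurableTypeR R -> R) : itg nu a ->
  leb.-integrable `[0, T] (EFin \o a).
Proof.
move=> ha; have ma := itg_measurable ha.
apply/integrableP; split; first by apply/measurable_EFinP; exact: measurable_funTS.
move/integrableP : ha => [_]; rewrite integral_uniform//; last first.
  by apply: measurableT_comp => //; exact/measurable_EFinP.
rewrite subr0; set I := (\int[_]_(_ in _) _)%E.
by case: I => [x||] //=; rewrite ?ltry// gt0_muley// lte_fin invr_gt0.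
Qed.

Lemma ae_uniform (P : R -> Prop) :
  {ae leb, forall x, 0 < x < T -> P x} -> {ae nu, forall x, P x}.
Proof.
move=> [N [mN N0 hN]].
have h1 : {ae nu, forall x, ~ N x}.
  exists N; split => //; last by move=> x /= /contrapT.
  rewrite uniform_probE// (_ : leb _ = 0%E) ?mule0//.
  apply/eqP; rewrite eq_le measure_ge0 andbT -N0; apply: le_measure => //; rewrite ?inE//.
  by apply: measurableI => //; exact: measurable_itv.
have h2 : {ae nu, forall x, `]0, T[%classic x}.
  apply: ae_prob1; first exact: measurable_itv.
  apply: (etrans (uniform_prob_itv T0 false true (lexx 0) (ltW T0) (lexx T))).
  by rewrite divff// subr0 gt_eqF.
apply: filterS2 h1 h2 => x Nx /=; rewrite in_itv/= => xT.
by apply: contrapT => nPx; apply: Nx; apply: hN => /= /(_ xT).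
Qed.

Lemma ae_uniform_itv : {ae nu, forall t, 0 < t < T}.
Proof. by apply: ae_uniform; exact: aeW. Qed.

(** By dominated convergence the cutoffs may be replaced by indicators of ]0, r[, so the primitive
    of [a] vanishes; Lebesgue differentiation recovers [a] almost everywhere. *)
Lemma fundamental_lemma (a : measurableTypeR R -> R) : itg nu a ->
  (forall eta, test1d T eta -> \int[nu]_t (eta t * a t) = 0) ->
  {ae nu, forall t, a t = 0}.
Proof.
move=> ha h; have ma := itg_measurable ha.
have h1 r : 0 < r < T -> \int[nu]_t (\1_(`]0, r[%classic : set R) t * a t) = 0.
  move=> /andP[r0 rT].
  have mc n : measurable_fun [set: measurableTypeR R] (cut n (r / n.+2%:R) r).
    exact: measurable_R_continuous (@continuous_cut R n _ r).
  pose f_ n t := cut n (r / n.+2%:R) r t * a t.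
  have m1 n : measurable_fun [set: measurableTypeR R] (f_ n) by exact: measurable_funM.
  have m2 : measurable_fun [set: measurableTypeR R]
      (fun t => \1_(`]0, r[%classic : set R) t * a t).
    by apply: measurable_funM => //; exact: measurable_indic.
  have c1 : {ae nu, forall t, f_ n t @[n --> \oo] --> \1_(`]0, r[%classic : set R) t * a t}.
    by apply: aeW => t /=; apply: cvgM; [exact: cut_cvg|exact: cvg_cst].
  have b1 : {ae nu, forall t, forall n, `|f_ n t| <= `|a t|}.
    apply: aeW => t n; rewrite normrM ler_piMl//.
    by have /andP[c0 c1'] := cut_bound n (r / n.+2%:R) r t; rewrite ger0_norm.
  have [_ c] := Rint_dct m1 m2 c1 (itg_abs ha) b1.
  apply/esym; apply: cvg_unique c => //.
  rewrite (_ : (fun _ => _) = fun=> 0); first exact: cvg_cst.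
  by apply/funext => n; apply: h; apply: test1d_cut => //; rewrite divr_gt0.
have il := itg_uniform ha.
(* Extension by zero provides a function integrable on the whole line, as the differentiation
   theorem requires. *)
pose f := a \_ `[0, T]%classic.
have mI : measurable (`[0, T]%classic : set (measurableTypeR R)) by exact: measurable_itv.
have fl : leb.-integrable setT (EFin \o f).
  rewrite -restrict_EFin; apply/(integrable_restrict _ mI) => //.
  by rewrite setTI.
have loc : locally_integrable [set: R] f by exact: integrable_locally_restrict.
have fi y : leb.-integrable [set` Interval (BLeft 0) (BRight y)] (EFin \o f).
  apply: integrableS fl => //; exact: measurable_itv.
have := FTC1 fi loc; rewrite /=; pose F (x : R) := \int[leb]_(t in `[0, x]) f t.
rewrite -/F.
have F0 x : 0 < x < T -> F x = 0.
  move=> /andP[x0 xT].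
  have -> : F x = \int[leb]_(t in `]0, x[) f t.
    rewrite /F -Rintegral_itv_bndo_bndc; last first.
      by apply: integrableS fl => //; exact: measurable_itv.
    by rewrite -Rintegral_itv_obnd_cbnd//; apply: integrableS fl => //; exact: measurable_itv.
  have -> : \int[leb]_(t in `]0, x[) f t = \int[leb]_(t in `]0, x[) a t.
    apply: eq_Rintegral => t; rewrite inE/= in_itv/= => /andP[t0 tx].
    by rewrite /f patchE mem_set//= in_itv/= !ltW// (lt_trans tx).
  have := h1 x; rewrite x0 xT => /(_ isT).
  rewrite Rint_uniform; last by apply: measurable_funM => //; exact: measurable_indic.
  move/eqP; rewrite mulf_eq0 invr_eq0 subr0 gt_eqF//= => /eqP h0.
  apply: etrans h0.
  rewrite -[in LHS](@setIidl _ `]0, x[%classic `[0, T]%classic); last first.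
    by move=> t /=; rewrite !in_itv/= => /andP[t0 tx]; rewrite !ltW// (lt_trans tx).
  rewrite setIC Rintegral_mkcondr; apply: eq_Rintegral => t _.
  rewrite patchE indicE; case: ifPn => _; rewrite ?mul1r ?mul0r//.
move=> hF; apply: ae_uniform; move: hF.
apply: filterS; first exact: (ae_filter_ringOfSetsType leb).
move=> x hx xT.
have x0 : 0 < x by case/andP: xT.
have [|dF] := hx; first by rewrite lte_fin.
rewrite /f patchE mem_set/=; last by rewrite in_itv/=; case/andP: xT => ? ?; rewrite !ltW.
move=> <-; rewrite derive1E.
rewrite (@near_eq_derive _ _ _ F (cst 0))//; first by rewrite derive_cst.
near=> y; apply: F0; near: y.
have : \forall y \near x, y \in `]0, T[.
  by apply: near_in_itvoo; rewrite in_itv.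
by apply: filterS => y; rewrite in_itv.
Unshelve. all: by end_near. Qed.

End fundamental_lemma.

(** * Integrals over the cylinder *)

Section cylinder_integrals.
Variables (R : realType) (d : nat) (T : R) (T0 : 0 < T).
Notation nu := (uniform_prob T0).
Notation mu := (torus_leb R d).
Notation leb := (@lebesgue_measure R).
Notation Q := (@cylinder R d T).

Lemma measurable_cylinder : measurable Q.
Proof.
rewrite (_ : Q = `]0, T[%classic `*` setT).
  by apply: measurableX => //; exact: measurable_itv.
by apply/seteqP; split => -[t x] /=; rewrite in_itv/=; [move=> h; split|case].
Qed.

(** On the cylinder, [cyl_leb] is T times the probability nu x mu, so all later computations take
    place in a probability space. *)
Lemma cyl_ge0_integral (F : measurableTypeR R * 'rV[R]_d -> \bar R) :
  (forall z, 0 <= F z)%E -> measurable_fun Q F ->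
  (\int[@cyl_leb R d]_(z in Q) F z =
   T%:E * \int[(nu \x mu)%E]_z (F \_ Q) z)%E.
Proof.
move=> F0 mF; rewrite integral_mkcond.
have mF' : measurable_fun setT (F \_ Q) by apply/(measurable_restrictT _ measurable_cylinder).
have F'0 z : (0 <= (F \_ Q) z)%E by rewrite patchE; case: ifP.
rewrite /cyl_leb.
pose G t := (\int[mu]_x (F \_ Q) (t, x))%E.
have mG : measurable_fun [set: measurableTypeR R] G.
  exact: (measurable_fun_fubini_tonelli_F (m2 := mu) (F \_ Q) mF' F'0).
have G0 t : (0 <= G t)%E by exact: integral_ge0.
have -> : (\int[leb \x mu]_z (F \_ Q) z = \int[leb]_t G t)%E.
  by rewrite fubini_tonelli1.
have -> : (\int[nu \x mu]_z (F \_ Q) z = \int[nu]_t G t)%E.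
  by rewrite fubini_tonelli1.
rewrite integral_uniform// subr0 muleA -EFinM mulfV ?gt_eqF// mul1e.
rewrite [RHS]integral_mkcond; apply: eq_integral => t _; rewrite patchE.
case: ifPn => // /negP tT; rewrite /G; apply: integral0_eq => x _.
rewrite patchE memNset//= => /andP[t0 tT']; apply: tT.
by rewrite inE/= in_itv/= !ltW.
Qed.

Lemma cyl_Rintegral (f : R -> 'rV[R]_d -> R) :
  measurable_fun Q (fun z => f z.1 z.2) ->
  \int[@cyl_leb R d]_(z in Q) f z.1 z.2 =
  T * \int[(nu \x mu)%E]_z ((fun z => f z.1 z.2) \_ Q) z.
Proof.
move=> mf; rewrite /Rintegral integralE [in RHS]integralE.
have mfe : measurable_fun Q (fun z => (f z.1 z.2)%:E) by exact/measurable_EFinP.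
rewrite !cyl_ge0_integral//; last 2 first.
- exact: measurable_funeneg.
- exact: measurable_funepos.
have pE : ((fun z => (f z.1 z.2)%:E)^\+ \_ Q)%E =
    (fun z => (((fun z => f z.1 z.2) \_ Q) z)%:E)^\+%E.
  by rewrite -funepos_restrict; congr funepos; exact: restrict_EFin.
have nE : ((fun z => (f z.1 z.2)%:E)^\- \_ Q)%E =
    (fun z => (((fun z => f z.1 z.2) \_ Q) z)%:E)^\-%E.
  by rewrite -funeneg_restrict; congr funeneg; exact: restrict_EFin.
rewrite pE nE.
set u := (\int[_]_z _)%E; set v := (\int[_]_z _)%E.
have u0 : (0 <= u)%E by apply: integral_ge0 => z _; exact: funepos_ge0.
have v0 : (0 <= v)%E by apply: integral_ge0 => z _; exact: funeneg_ge0.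
move: u v u0 v0 => [u| |] [v| |] //= _ _;
  rewrite ?gt0_muley ?gt0_muleNy ?lte_fin//= ?mulr0//.
by rewrite -mulrBr.
Qed.

(** Functions on the cylinder are measurable there only; extension by zero makes them measurable
    everywhere. *)
Definition patch_cyl (f : R -> 'rV[R]_d -> R) : measurableTypeR R * 'rV[R]_d -> R :=
  (fun z => f z.1 z.2) \_ Q.

Lemma patch_cylE f t x : 0 < t < T -> patch_cyl f (t, x) = f t x.
Proof. by move=> tT; rewrite /patch_cyl patchE mem_set. Qed.

Lemma L2_sqi f : L2_QT T f -> sqi (nu \x mu)%E (patch_cyl f).
Proof.
move=> [mf foo].
have mp : measurable_fun setT (patch_cyl f).
  by apply/(measurable_restrictT _ measurable_cylinder).
split => //; apply: ge0_itg; [exact: measurable_funX|by move=> z; exact: sqr_ge0|].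
move: foo; rewrite cyl_ge0_integral; last 2 first.
- by move=> z; rewrite lee_fin sqr_ge0.
- by apply/measurable_EFinP; exact: measurable_funX.
rewrite (_ : ((fun z => (f z.1 z.2 ^+ 2)%:E) \_ Q)%E = fun z => (patch_cyl f z ^+ 2)%:E); last first.
  by apply/funext => z; rewrite /patch_cyl !patchE; case: ifP => //; rewrite expr0n.
by case: (integral _ _ _) => [r||]//=; rewrite ?ltry ?gt0_muley ?lte_fin.
Qed.

End cylinder_integrals.

Section scaling.
Variables (R : realType) (V : normedModType R).
Implicit Types (f : V -> R) (x v : V) (k : R).

Lemma derivable_mull k f x v : derivable f x v -> derivable (fun y => k * f y) x v.
Proof. by move=> df; exact: (derivableZ df). Qed.

Lemma derive_mull k f x v : derivable f x v ->
  'D_v (fun y => k * f y) x = k * 'D_v f x.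
Proof. by move=> df; exact: (deriveZ k df). Qed.

Lemma derive_mulr k f x v : derivable f x v ->
  'D_v (fun y => f y * k) x = 'D_v f x * k.
Proof. by move=> df; under eq_fun do rewrite mulrC; rewrite derive_mull// mulrC. Qed.

End scaling.

Lemma continuous_rV (R : realType) (d : nat) (X : topologicalType)
    (f : X -> 'rV[R]_d) :
  (forall i, continuous (fun x => f x ord0 i)) -> continuous f.
Proof.
move=> cf x; apply/cvg_ballP => e e0.
have h : \forall y \near x, forall i, ball (f x ord0 i) e (f y ord0 i).
  by apply: filter_forall => i; have /cvg_ballP/(_ _ e0) := cf i x.
by apply: filterS h => y hy; split=> // i j; rewrite !ord1; exact: hy.
Qed.

Section slices.
Variables (R : realType) (d : nat) (T : R) (T0 : 0 < T).
Notation nu := (uniform_prob T0).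
Notation mu := (torus_leb R d).
Notation Q := (@cylinder R d T).

Definition test_rV (phi : 'rV[R]_d -> R) := [/\ Zperiodic phi, continuous phi,
  has_partials phi & forall i, continuous ('D_(basis_vec R i) phi)].

Lemma test_C1_prod eta phi : test1d T eta -> test_rV phi ->
  test_C1 T (fun t x => eta t * phi x).
Proof.
move=> [[e e0 he] de cde] [pphi cphi dphi cdphi].
have ceta : continuous eta.
  by move=> t; apply: differentiable_continuous; apply/derivable1_diffP; exact: de.
split.
- by move=> t x k; rewrite pphi.
- by exists e => // t x /he ->; rewrite mul0r.
- move=> z; apply: cvgM.
    exact: (continuousT_comp (@continuousT_fst _ _) ceta).
  exact: (continuousT_comp (@continuousT_snd _ _) cphi).
- split=> [x t|].
    by apply: derivableM; [exact: de|exact: derivable_cst].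
  rewrite (_ : (fun _ => _) = fun z : R * 'rV[R]_d => derive1 eta z.1 * phi z.2).
    move=> z; apply: cvgM.
      exact: (continuousT_comp (@continuousT_fst _ _) cde).
    exact: (continuousT_comp (@continuousT_snd _ _) cphi).
  by apply/funext => z; rewrite !derive1E derive_mulr.
- split=> [t x i|]; first by apply: derivable_mull; exact: dphi.
  apply: continuous_rV => i.
  rewrite (_ : (fun _ => _) =
      fun z : R * 'rV[R]_d => eta z.1 * 'D_(basis_vec R i) phi z.2).
    move=> z; apply: cvgM.
      exact: (continuousT_comp (@continuousT_fst _ _) ceta).
    exact: (continuousT_comp (@continuousT_snd _ _) (cdphi i)).
  by apply/funext => z; rewrite !mxE derive_mull.
Qed.

Lemma test_rV_ker n x : test_rV (ker n x).
Proof.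
split.
- exact: Zperiodic_ker.
- exact: ker_continuous2.
- by move=> y i; exact: derivable_ker.
- move=> i; rewrite (_ : 'D__ _ = dker n i x); first exact: dker_continuous2.
  by apply/funext => y; exact: derive_ker.
Qed.

(** Tested on eta(t) phi(x), the weak identity says that the defect of the slice identity for [phi]
    is orthogonal to every eta. The exceptional null set of times depends on [phi]. *)
Lemma weak_dx_slice i v g phi : L2_QT T v -> L2_QT T g -> weak_dx T i v g ->
  test_rV phi -> {ae nu, forall t,
    \int[mu]_y (v t y * 'D_(basis_vec R i) phi y) = - \int[mu]_y (g t y * phi y)}.
Proof.
move=> Lv Lg w tphi; have [pphi cphi dphi cdphi] := tphi.
have sv := L2_sqi T0 Lv; have sg := L2_sqi T0 Lg.
have [C hC] := periodic_bounded cphi pphi.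
have [C' hC'] := periodic_bounded (cdphi i) (Zperiodic_derive (basis_vec R i) pphi).
have mphi : measurable_fun setT phi by exact: measurable_rV_continuous.
have mdphi : measurable_fun setT ('D_(basis_vec R i) phi) by exact: measurable_rV_continuous.
have mphi2 : measurable_fun setT (fun z : measurableTypeR R * 'rV[R]_d => phi z.2).
  by apply: (measurableT_comp mphi); exact: measurable_snd.
have mdphi2 : measurable_fun setT
    (fun z : measurableTypeR R * 'rV[R]_d => 'D_(basis_vec R i) phi z.2).
  by apply: (measurableT_comp mdphi); exact: measurable_snd.
pose f z := patch_cyl T v z * 'D_(basis_vec R i) phi z.2 + patch_cyl T g z * phi z.2.
have i1 : itg (nu \x mu)%E (fun z => patch_cyl T v z * 'D_(basis_vec R i) phi z.2).
  exact: itgM_bounded (sqi_itg sv) mdphi2 (fun z => hC' z.2).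
have i2 : itg (nu \x mu)%E (fun z => patch_cyl T g z * phi z.2).
  exact: itgM_bounded (sqi_itg sg) mphi2 (fun z => hC z.2).
have iff : itg (nu \x mu)%E f by exact: itgD.
pose a t := \int[mu]_y f (t, y).
have ia : itg nu a by exact: itg_fubini1.
have a0 : {ae nu, forall t, a t = 0}.
  apply: fundamental_lemma => // eta teta.
  have [[e e0 he] de cde] := teta.
  have ceta : continuous eta.
    by move=> t; apply: differentiable_continuous; apply/derivable1_diffP; exact: de.
  have := w _ (test_C1_prod teta tphi).
  have mQ := @measurable_cylinder R d T.
  have meta : measurable_fun setT (fun z : measurableTypeR R * 'rV[R]_d => eta z.1).
    by apply: (measurableT_comp (measurable_R_continuous ceta)); exact: measurable_fst.
  have eD (z : R * 'rV[R]_d) : 'D_(basis_vec R i) (fun x => eta z.1 * phi x) z.2 =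
      eta z.1 * 'D_(basis_vec R i) phi z.2 by rewrite derive_mull.
  under eq_Rintegral do rewrite eD.
  rewrite (cyl_Rintegral T0 (f := fun t x => v t x * (eta t * 'D_(basis_vec R i) phi x))); last first.
    apply: measurable_funM; first exact: Lv.1.
    by apply: measurable_funTS; exact: measurable_funM.
  rewrite (cyl_Rintegral T0 (f := fun t x => g t x * (eta t * phi x))); last first.
    apply: measurable_funM; first exact: Lg.1.
    by apply: measurable_funTS; exact: measurable_funM.
  rewrite -mulrN => /(mulfI (lt0r_neq0 T0)) h.
  have [B hB] : exists B, forall t, `|eta t| <= B.
    have [B [_ /(_ (B + 1))]] := compact_bounded (continuous_compact
      (continuous_subspaceT ceta) (@segment_compact R e (T - e))).
    rewrite ltrDl ltr01 => /(_ isT) hB; exists (`|B + 1|) => t.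
    have [te|te] := boolP (e <= t <= T - e); last by rewrite he ?normr0.
    by rewrite (le_trans (hB (eta t) _)) ?ler_norm//; exists t.
  have j1 : itg (nu \x mu)%E (fun z => patch_cyl T v z * 'D_(basis_vec R i) phi z.2 * eta z.1).
    exact: (itgM_bounded (C := B)).
  have j2 : itg (nu \x mu)%E (fun z => patch_cyl T g z * phi z.2 * eta z.1).
    exact: (itgM_bounded (C := B)).
  have -> : \int[nu]_t (eta t * a t) = \int[(nu \x mu)%E]_z (f z * eta z.1).
    rewrite Rint_fubini1; last exact: (itgM_bounded (C := B)).
    apply: Rint_ae.
    - by apply: measurable_funM; [exact: measurable_R_continuous|exact: itg_measurable ia].
    - exact: (itg_measurable (itg_fubini1 (itgM_bounded iff meta (fun z => hB z.1)))).
    apply: filterS (itg_section1 iff) => t ft /=.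
    by rewrite /a -RintZ//; apply: eq_Rintegral => y _; rewrite mulrC.
  rewrite (_ : (fun z => f z * eta z.1) = fun z =>
    patch_cyl T v z * 'D_(basis_vec R i) phi z.2 * eta z.1 +
    patch_cyl T g z * phi z.2 * eta z.1); last by apply/funext => z; rewrite /f mulrDl.
  rewrite RintD//; apply/eqP; rewrite addr_eq0; apply/eqP.
  transitivity (- \int[(nu \x mu)%E]_z
      ((fun z => g z.1 z.2 * (eta z.1 * phi z.2)) \_ Q) z).
    rewrite -h; apply: eq_Rintegral => z _; rewrite /patch_cyl !patchE.
    by case: ifP => _; [ring|rewrite !mul0r].
  congr (- _); apply: eq_Rintegral => z _; rewrite /patch_cyl !patchE.
  by case: ifP => _; [ring|rewrite !mul0r].
apply: filterS3 a0 (ae_uniform_itv T0) (filterI (itg_section1 i1) (itg_section1 i2)).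
move=> t at0 tT [h1 h2]; apply/eqP; rewrite -addr_eq0; apply/eqP.
move: at0; rewrite /a /f RintD// => <-.
by congr (_ + _); apply: eq_Rintegral => y _; rewrite patch_cylE.
Qed.

Lemma cvg_Rint_tube (P : probability 'rV[R]_d R) (u : 'rV[R]_d -> R)
    (X : topologicalType) (k : X -> 'rV[R]_d -> R) (x0 : X) :
  P (@unit_cube R d) = 1%E -> itg P u ->
  (forall x, itg P (fun y => u y * k x y)) ->
  (forall y, {for (x0, y), continuous (fun z : X * 'rV[R]_d => k z.1 z.2)}) ->
  \int[P]_y (u y * k x y) @[x --> x0] --> \int[P]_y (u y * k x0 y).
Proof.
move=> P1 iu iuk ck; apply/cvgrPdist_le => e e0.
pose A := \int[P]_y `|u y|.
have A0 : 0 <= A by exact: Rintegral_ge0.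
have A1 : 0 < A + 1 by rewrite ltr_wpDl.
have := tube_near (@tcube_compact R d) (fun y _ => ck y) (divr_gt0 e0 A1).
apply: filterS => x hx; rewrite -RintB//.
rewrite (le_trans (Rint_normr_le _))//; first exact: itgB.
have ia := itg_abs iu.
rewrite (@le_trans _ _ (\int[P]_y (e / (A + 1) * `|u y|)))//; last first.
  rewrite RintZ// -/A mulrAC ler_pdivrMr//.
  by rewrite ler_wpM2l ?lerDl// ltW.
apply: Rint_ae_le.
- by apply: itg_abs; exact: itgB.
- exact: itgZ.
apply: filterS (ae_unit_cube P1) => y /(@unit_cubeW R d) /hx /ltW hy.
by rewrite -mulrBr normrM mulrC ler_wpM2r.
Qed.

(** One null set must serve all kernels. It is taken for the countably many centers [e m k], and
    continuity of the kernel in its center reaches every x. *)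
Lemma ker_weak_slice i v g : L2_QT T v -> L2_QT T g -> weak_dx T i v g ->
  {ae nu, forall t, @ker_weak R d i (v t) (g t)}.
Proof.
move=> Lv Lg w.
have sv := L2_sqi T0 Lv; have sg := L2_sqi T0 Lg.
have [c [e [_ ce]]] := @cdisc_rV R d.
have h : {ae nu, forall t, forall n m k,
    \int[mu]_y (v t y * dker n i (e m k) y) = - \int[mu]_y (g t y * ker n (e m k) y)}.
  apply: ae_foralln => n; apply: ae_foralln => m; apply: ae_foralln => k.
  move: (weak_dx_slice Lv Lg w (test_rV_ker n (e m k))).
  apply: filterS; first exact: (ae_filter_ringOfSetsType nu).
  move=> t <-.
  by apply: eq_Rintegral => y _; rewrite derive_ker.
apply: filterS3 h (ae_uniform_itv T0) (filterI (sqi_section sv) (sqi_section sg)).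
  exact: (ae_filter_ringOfSetsType nu).
move=> t ht tT [h1 h2].
have pE f : (fun y => patch_cyl T f (t, y)) = f t.
  by apply/funext => y; rewrite patch_cylE.
rewrite !pE in h1 h2; split => // n x.
have mu1 := torus_unit_cube R d.
have [C hC] := ker_bounded R d n; have [C' hC'] := @dker_bounded R d n i.
have mk (y : 'rV[R]_d) : measurable_fun setT (ker n y).
  exact: measurable_rV_continuous (@ker_continuous2 R d n y).
have mdk (y : 'rV[R]_d) : measurable_fun setT (dker n i y).
  exact: measurable_rV_continuous (@dker_continuous2 R d n i y).
have c1 := cvg_Rint_tube mu1 (sqi_itg h1)
  (fun y => itgM_bounded (sqi_itg h1) (mdk y) (hC' y)) (fun y => @dker_continuous R d n i (x, y)).
have c2 := cvg_Rint_tube mu1 (sqi_itg h2)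
  (fun y => itgM_bounded (sqi_itg h2) (mk y) (hC y)) (fun y => @ker_continuous R d n (x, y)).
have d1 : (fun m => \int[mu]_y (v t y * dker n i (e m (c m x)) y)) @ \oo -->
    \int[mu]_y (v t y * dker n i x y).
  exact: cvg_comp (ce x) c1.
have d2 : (fun m => - \int[mu]_y (g t y * ker n (e m (c m x)) y)) @ \oo -->
    - \int[mu]_y (g t y * ker n x y).
  by apply: cvgN; exact: cvg_comp (ce x) c2.
have s12 : (fun m => \int[mu]_y (v t y * dker n i (e m (c m x)) y)) =
    (fun m => - \int[mu]_y (g t y * ker n (e m (c m x)) y)).
  by apply/funext => m; exact: ht.
by rewrite s12 in d1; exact: (cvg_unique _ d1 d2).
Qed.

End slices.

(** * Functions of probability measures *)

Section probability_ext.
Context {R : realType} {d : nat}.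
Notation P := (prob_torus R d).

(** Mixtures are compared as packed structures; all fields besides the set function are
    propositions, so proof irrelevance closes the gap. *)
Lemma probability_ext d' (X : measurableType d') (p q : probability X R) :
  (forall A, p A = q A) -> p = q.
Proof.
case: p => f c; case: q => f' c' /= /funext h; subst f'; congr Probability.Pack.
case: c => a1 a2 a3 a4 a5 a6 a7; case: c' => b1 b2 b3 b4 b5 b6 b7.
have e1 : a1 = b1 by case: (a1) => x y; case: (b1) => *; congr isContent.Axioms_; exact: Prop_irrelevance.
subst b1.
have e2 : a2 = b2 by case: (a2) => x; case: (b2) => *; congr Content_isMeasure.Axioms_; exact: Prop_irrelevance.
have e3 : a3 = b3 by case: (a3) => x; case: (b3) => *; congr isSFinite.Axioms_; exact: Prop_irrelevance.
have e4 : a4 = b4 by case: (a4) => x; case: (b4) => *; congr isSigmaFinite.Axioms_; exact: Prop_irrelevance.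
have e5 : a5 = b5 by case: (a5) => x; case: (b5) => *; congr isFinite.Axioms_; exact: Prop_irrelevance.
have e6 : a6 = b6 by case: (a6) => x; case: (b6) => *; congr isSubProbability.Axioms_; exact: Prop_irrelevance.
have e7 : a7 = b7 by case: (a7) => x; case: (b7) => *; congr isProbability.Axioms_; exact: Prop_irrelevance.
by subst b2 b3 b4 b5 b6 b7.
Qed.

Lemma prob_torus_ext (m m' : P) :
  (forall A, (m : probability _ _) A = (m' : probability _ _) A) -> m = m'.
Proof.
case: m => m m1; case: m' => m' m1' /= h.
have e := probability_ext h.
by subst m'; rewrite (Prop_irrelevance m1 m1').
Qed.

(** A point further along the segment is again a mixture starting from [mixture s m m']; a
    derivative at 0 thereby yields one at s. *)
Lemma mixture_comp (r s w : R) (m m' : P) : 0 <= r <= 1 -> 0 <= s <= 1 ->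
  w = s + r * (1 - s) -> mixture r (mixture s m m') m' = mixture w m m'.
Proof.
move=> /andP[r0 r1] /andP[s0 s1] we.
have w0 : 0 <= w by nra.
have w1 : w <= 1 by nra.
apply: prob_torus_ext => A /=; rewrite /mixture !mixture_measureE /= mixture_measureE.
rewrite !min_l// !max_r// we.
have -> : (1 - (s + r * (1 - s))) = (1 - r) * (1 - s) by ring.
have -> : (s + r * (1 - s)) = (1 - r) * s + r by ring.
rewrite ge0_muleDr ?mule_ge0 ?measure_ge0 ?lee_fin ?subr_ge0//.
rewrite [in RHS]EFinD ge0_muleDl ?lee_fin ?mulr_ge0 ?subr_ge0//.
by rewrite !EFinM -!muleA addeA.
Qed.

Lemma mixture_sym (r : R) (m m' : P) : 0 <= r <= 1 -> mixture r m m' = mixture (1 - r) m' m.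
Proof.
move=> /andP[r0 r1]; apply: prob_torus_ext => A /=; rewrite /mixture !mixture_measureE.
rewrite !min_l// ?lerBlDr ?lerDl// !max_r// ?subr_ge0//.
by rewrite subKr addeC.
Qed.

Lemma mixture0 (m m' : P) : mixture 0 m m' = m.
Proof.
apply: prob_torus_ext => A /=; rewrite /mixture mixture_measureE.
by rewrite min_l// max_r// subr0 mul1e mul0e adde0.
Qed.

Lemma mixture1 (m m' : P) : mixture 1 m m' = m'.
Proof. by rewrite mixture_sym ?ler01 ?lexx// subrr mixture0. Qed.

Lemma Rint_mixture (s : R) (m m' : P) f : 0 <= s <= 1 -> itg m f -> itg m' f ->
  \int[mixture s m m']_x f x = (1 - s) * (\int[m]_x f x) + s * \int[m']_x f x.
Proof.
move=> /andP[s0 s1] hf hf'; have mf := itg_measurable hf.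
have ge0E (g : 'rV[R]_d -> R) : measurable_fun setT g -> (forall x, 0 <= g x) ->
    (\int[mixture s m m']_x (g x)%:E =
     (1 - s)%:E * \int[m]_x (g x)%:E + s%:E * \int[m']_x (g x)%:E)%E.
  move=> mg g0.
  have mE : measurable_fun setT (fun x => (g x)%:E) by exact/measurable_EFinP.
  have gE x : setT x -> (0 <= (g x)%:E)%E by rewrite lee_fin.
  rewrite ge0_integral_measure_add// !ge0_integral_mscale//=.
  by rewrite min_l// max_r.
pose fp x := Num.max (f x) 0; pose fn x := Num.max (- f x) 0.
have mfp : measurable_fun setT fp by apply: measurable_maxr => //; exact: measurable_cst.
have mfn : measurable_fun setT fn.
  by apply: measurable_maxr; [exact: measurableT_comp|exact: measurable_cst].
have fp0 x : 0 <= fp x by rewrite le_max lexx orbT.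
have fn0 x : 0 <= fn x by rewrite le_max lexx orbT.
have fE : f = (fun x => fp x - fn x).
  apply/funext => x; rewrite /fp /fn; case/orP: (le_total (f x) 0) => h.
    by rewrite (max_r h) max_l ?oppr_ge0// sub0r opprK.
  by rewrite (max_l h) max_r ?oppr_le0// subr0.
have ip (p : probability 'rV[R]_d R) : itg p f -> itg p fp.
  move=> h; apply: (itg_le mfp _ h) => x; rewrite ger0_norm// /fp ge_max ler_norm.
  exact: normr_ge0.
have inn (p : probability 'rV[R]_d R) : itg p f -> itg p fn.
  move=> h; apply: (itg_le mfn _ h) => x; rewrite ger0_norm// /fn ge_max -normrN ler_norm.
  exact: normr_ge0.
have main (g : 'rV[R]_d -> R) : measurable_fun setT g -> (forall x, 0 <= g x) -> itg m g -> itg m' g ->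
    itg (mixture s m m') g /\
    \int[mixture s m m']_x g x = (1 - s) * (\int[m]_x g x) + s * \int[m']_x g x.
  move=> mg g0 h h'; have := ge0E _ mg g0.
  rewrite (itg_EFin h) (itg_EFin h') -!EFinM -EFinD => e.
  have ig : itg (mixture s m m') g by apply: ge0_itg => //; rewrite e ltry.
  by split => //; apply: EFin_inj; rewrite -itg_EFin.
have [i1 e1] := main _ mfp fp0 (ip _ hf) (ip _ hf').
have [i2 e2] := main _ mfn fn0 (inn _ hf) (inn _ hf').
rewrite fE !RintB ?e1 ?e2//; last first.
all: try by [apply: ip | apply: inn].
by ring.
Qed.

End probability_ext.

(** * Monge-Kantorovich distance and weak convergence *)

Section weak_convergence.
Context {R : realType} {d : nat}.
Notation P := (prob_torus R d).

Lemma normr_le_enorm (x : 'rV[R]_d) : `|x| <= enorm x.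
Proof.
have e0 : 0 <= enorm x by exact: sqrtr_ge0.
have [->//|/mx_norm_neq0[[i j] /=]] := eqVneq `|x| 0.
rewrite -[mx_norm x]/`|x| => ->.
rewrite /enorm -sqrtr_sqr ler_wsqrtr// (bigD1 i)//= (bigD1 j)//= -addrA lerDl.
rewrite addr_ge0//; first by apply: sumr_ge0 => *; exact: sqr_ge0.
by apply: sumr_ge0 => *; apply: sumr_ge0 => *; exact: sqr_ge0.
Qed.

Lemma continuous_dist (X : topologicalType) (f : X -> R) :
  (forall x e, 0 < e -> \forall y \near x, `|f x - f y| <= e) -> continuous f.
Proof. by move=> h x; apply/cvgrPdist_le => e e0; exact: h. Qed.

Lemma lip_continuous (f : 'rV[R]_d -> R) (L : R) :
  (forall x y, `|f x - f y| <= L * `|x - y|) -> continuous f.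
Proof.
move=> h; apply: continuous_dist => x e e0.
have L1 : 0 < `|L| + 1 by rewrite ltr_wpDl.
apply/nbhs_normP; exists (e / (`|L| + 1)) => [|y] /=; first exact: divr_gt0.
rewrite ltr_pdivlMr// mulrC => /ltW; apply: le_trans; apply: le_trans (h x y) _.
by rewrite ler_wpM2r// ler_wpDr// ler_norm.
Qed.

Lemma coord_le_norm m n (x : 'M[R]_(m, n)) i j : `|x i j| <= `|x|.
Proof.
by rewrite -[leRHS]/(mx_norm x) mx_normE -[leLHS]nngE num_le; exact: (le_bigmax _ _ (i, j)).
Qed.

Lemma enorm_le (x : 'rV[R]_d) : enorm x <= d%:R * `|x|.
Proof.
have h0 : 0 <= d%:R * `|x| by rewrite mulr_ge0.
rewrite -[leRHS]ger0_norm// -sqrtr_sqr ler_wsqrtr// big_ord1.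
apply: (@le_trans _ _ (\sum_(j < d) `|x| ^+ 2)).
  apply: ler_sum => j _; rewrite -(real_normK (num_real (x _ _))).
  by rewrite lerXn2r ?nnegrE// coord_le_norm.
rewrite sumr_const card_ord -[leLHS]mulr_natl exprMn; apply: ler_wpM2r; first exact: sqr_ge0.
by rewrite -natrX ler_nat; case: (d) => // n; rewrite leq_pmulr.
Qed.

Lemma enorm_lip_continuous (f : 'rV[R]_d -> R) :
  (forall x y, `|f x - f y| <= enorm (x - y)) -> continuous f.
Proof.
move=> h; apply: (@lip_continuous _ d%:R) => x y.
by rewrite (le_trans (h x y))// enorm_le.
Qed.

(* Inf-convolution: [n * phi x = inf_y (f y + n |x - y|)]. *)
Lemma lip1_approx (f : 'rV[R]_d -> R) (e : R) : continuous f -> Zperiodic f ->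
  0 < e -> exists n (phi : 'rV[R]_d -> R), [/\ 0 < n, lip1 phi, continuous phi &
    forall x, unit_cube x -> `|f x - n * phi x| <= e].
Proof.
move=> cf pf e0; have [B hB] := periodic_bounded cf pf.
have B0 : 0 <= B by rewrite (le_trans _ (hB 0)).
have : \forall w \near (0 : 'rV[R]_d), forall x, @tcube R d x ->
    `|f (x + 0) - f (x + w)| < e.
  apply: (@tube_near _ _ _ (@tcube R d) (fun w x => f (x + w)) 0 (@tcube_compact R d) _ _ e0).
  move=> x _; apply: (@continuousT_comp _ _ _ (fun z : 'rV[R]_d * 'rV[R]_d => z.2 + z.1) f _ cf).
  move=> z; apply: (@cvgD _ 'rV[R]_d); [exact: cvg_snd|exact: cvg_fst].
move=> /nbhs_normP[r /= r0 hr].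
(* For points at distance at least r the penalty is at least n r = 2 B + r, more than [f] can vary,
   so only points within r matter in the infimum. *)
pose n := 2 * B / r + 1; have n0 : 0 < n by rewrite ltr_wpDl// divr_ge0 ?mulr_ge0// ltW.
pose E x := [set f y + n * `|x - y| | y in [set: 'rV[R]_d]].
have E0 x : E x !=set0 by exists (f 0 + n * `|x - 0|); exists 0.
have Elb x : has_lbound (E x).
  exists (- B) => _ [y _ <-]; have := hB y; rewrite ler_norml => /andP[h _].
  by rewrite ler_wpDr// mulr_ge0// ltW.
have lipE (x y : 'rV[R]_d) : inf (E x) <= inf (E y) + n * `|x - y|.
  rewrite -lerBlDr; apply: lb_le_inf => // _ [z _ <-].
  rewrite lerBlDr; apply: (@le_trans _ _ (f z + n * `|x - z|)).
    by apply: ge_inf => //; exists z.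
  have tri : `|x - z| <= `|y - z| + `|x - y|.
    by have := ler_normD (y - z) (x - y); rewrite addrC subrKA.
  by rewrite -addrA -mulrDr lerD2l ler_wpM2l ?(ltW n0).
exists n, (fun x => n^-1 * inf (E x)).
have lip x y : `|n^-1 * inf (E x) - n^-1 * inf (E y)| <= `|x - y|.
  rewrite -mulrBr normrM gtr0_norm ?invr_gt0// ler_pdivrMl//.
  rewrite ler_norml; apply/andP; split.
    by have := lipE y x; rewrite (distrC y); lra.
  by have := lipE x y; lra.
split => //.
- split=> [x k|x y]; last by rewrite (le_trans (lip x y))// normr_le_enorm.
  congr (_ * inf _); apply/seteqP; split=> _ [y _ <-].
    exists (y - map_mx intr k) => //.
    by rewrite -(pf (y - _) k) subrK opprB addrA.
  exists (y + map_mx intr k) => //.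
  by rewrite pf opprD addrACA subrr addr0.
- by apply: (@lip_continuous _ 1) => x y; rewrite mul1r.
- move=> x /(@unit_cubeW R d) xK; rewrite mulrA divff ?mul1r ?gt_eqF//.
  have h1 : inf (E x) <= f x.
    by apply: ge_inf => //; exists x => //; rewrite subrr normr0 mulr0 addr0.
  rewrite ger0_norm ?subr_ge0// lerBlDl -lerBlDr; apply: lb_le_inf => // _ [y _ <-].
  have [xy|xy] := ltP `|x - y| r.
    have := hr (y - x) _ x xK; rewrite /= sub0r normrN distrC => /(_ xy).
    have -> : x + (y - x) = y by rewrite addrC subrK.
    rewrite addr0 ltr_norml => /andP[_].
    have : 0 <= n * `|x - y| by rewrite mulr_ge0// ltW.
    by lra.
  have : n * r <= n * `|x - y| by rewrite ler_wpM2l// ltW.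
  have -> : n * r = 2 * B + r by rewrite /n mulrDl mul1r divfK// gt_eqF.
  have := hB x; have := hB y; rewrite !ler_norml => /andP[? _] /andP[_ ?].
  by lra.
Qed.

Lemma mk_lip (phi : 'rV[R]_d -> R) (m m' : P) : lip1 phi ->
  ((\int[m]_y phi y - \int[m']_y phi y)%:E <= mk_dist m m')%E.
Proof. by move=> lphi; apply: ereal_sup_ubound; exists phi. Qed.

(** Up to e / 4, uniformly in the measure, [f] is n times a 1-Lipschitz function, whose integral
    moves by at most the distance of the measures. *)
Lemma cvg_Rint_prob_torus (f : 'rV[R]_d -> R) : continuous f -> Zperiodic f ->
  continuous (fun m : P => \int[m]_y f y).
Proof.
move=> cf pf; apply: continuous_dist => m e e0.
have e4 : 0 < e / 4 by rewrite divr_gt0.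
have [n [phi [n0 lphi cphi hphi]]] := lip1_approx cf pf e4.
have d0 : 0 < e / 4 / n by rewrite divr_gt0.
have near1 (p : P) : `|\int[p]_y f y - n * \int[p]_y phi y| <= e / 4.
  have pphi := lphi.1.
  have i1 : itg p f := itg_continuous_periodic p cf pf.
  have i2 : itg p phi := itg_continuous_periodic p cphi pphi.
  rewrite -RintZ// -RintB//; last exact: itgZ.
  rewrite (le_trans (Rint_normr_le _))//; first by apply: itgB => //; exact: itgZ.
  rewrite -[leRHS](@Rint_cst _ _ _ p); apply: Rint_ae_le.
  - by apply: itg_abs; apply: itgB => //; exact: itgZ.
  - exact: itg_cst.
  - by apply: filterS (ae_unit_cube (prob_torus_cube p)) => y /hphi.
apply/nbhs_ballP; exists (e / 4 / n) => //= m' hm'.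
have h1 : (mk_dist m m' < (e / 4 / n)%:E)%E := hm'.
have := le_lt_trans (mk_lip m m' lphi) h1.
rewrite mk_dist_sym in h1; have := le_lt_trans (mk_lip m' m lphi) h1.
rewrite !lte_fin !ltr_pdivlMr//.
have := near1 m; have := near1 m'; rewrite !ler_norml => /andP[a1 a2] /andP[a3 a4].
move=> b1 b2; apply/andP; split; nra.
Qed.

(** Integrals against m - mixture are s times those against m - m'. The intermediate measure of the
    mean value theorem thus stays in every ball around m containing m'. *)
Lemma mk_dist_mixture (s : R) (m m' : P) : 0 <= s <= 1 ->
  (mk_dist m (mixture s m m') <= mk_dist m m')%E.
Proof.
move=> s01; have /andP[s0 s1] := s01; apply: ge_ereal_sup => _ [phi lphi <-].
have [pphi l] := lphi; have cphi : continuous phi.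
  apply: (@enorm_lip_continuous phi) => x y; exact: l.
have i1 := itg_continuous_periodic m cphi pphi.
have i2 := itg_continuous_periodic m' cphi pphi.
rewrite Rint_mixture//; set A := \int[m]_y phi y; set B := \int[m']_y phi y.
have -> : A - ((1 - s) * A + s * B) = s * (A - B) by ring.
have h0 : (0 <= mk_dist m m')%E.
  have := @mk_lip (cst 0) m m'; rewrite !Rint_cst subrr; apply.
  by split=> // x y; rewrite subrr normr0 sqrtr_ge0.
have [AB|AB] := leP 0 (A - B); last first.
  by apply: le_trans h0; rewrite lee_fin mulr_ge0_le0// ltW.
apply: le_trans (mk_lip m m' lphi); rewrite lee_fin.
by rewrite ler_piMl.
Qed.

Lemma mixture_ball (s e : R) (m m' : P) : 0 <= s <= 1 -> ball m e m' ->
  ball m e (mixture s m m').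
Proof.
by move=> s01 h; apply: le_lt_trans (mk_dist_mixture m m' s01) _; exact: h.
Qed.

End weak_convergence.

Section epsilon.
Variable R : realType.
Implicit Types (f : R -> R) (x L : R).

Lemma is_derive_eps f x L :
  (forall e, 0 < e -> exists2 r, 0 < r &
     forall h, `|h| < r -> `|f (x + h) - f x - h * L| <= e * `|h|) ->
  is_derive (x : R) (1 : R) f L.
Proof.
move=> hf.
have q : h^-1 *: ((f \o shift x) (h *: (1 : R)) - f x) @[h --> (0 : R)^'] --> L.
  apply/cvgrPdist_le => e e0; near=> h.
  have h0 : h != 0 by near: h; exact: nbhs_dnbhs_neq.
  suff : `|f (x + h) - f x - h * L| <= e * `|h|.
    rewrite /= [h *: 1]mulr1 [h + x]addrC => hh.
    rewrite -(ler_pM2l (x := `|h|)) ?normr_gt0// -normrM mulrBr.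
    by rewrite [_ *: _]/(_ * _) mulrA mulfV// mul1r distrC [leRHS]mulrC.
  near: h; have [r r0 hr] := hf _ e0.
  apply: nbhs_dnbhs; apply/nbhs_ballP; exists r => // y.
  by rewrite /ball/= sub0r normrN => /hr.
apply: DeriveDef; first by apply/cvg_ex; exists L.
exact: cvg_lim q.
Unshelve. all: by end_near. Qed.

Lemma within_itv_continuous_eps f a b :
  (forall x, a <= x <= b -> forall e, 0 < e -> exists2 r, 0 < r &
     forall y, a <= y <= b -> `|y - x| < r -> `|f y - f x| <= e) ->
  {within `[a, b], continuous f}.
Proof.
move=> hf; apply/subspace_continuousP => x /=; rewrite in_itv/= => xab.
apply/cvgrPdist_le => e e0; have [r r0 hr] := hf _ xab _ e0.
apply/nbhs_ballP; exists r => //= y; rewrite /ball/= in_itv/= distrC => yr yab.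
by rewrite distrC; exact: hr.
Qed.

Lemma at_right_eps f L : f h @[h --> 0^'+] --> L -> forall e, 0 < e ->
  exists2 r, 0 < r & forall h, 0 < h < r -> `|L - f h| <= e.
Proof.
move=> /cvgrPdist_le h e /h /nbhs_ballP[r /= r0 hr]; exists r => // y /andP[y0 yr].
by apply: hr => //; rewrite /ball/= sub0r normrN gtr0_norm.
Qed.

End epsilon.

(** * Mean value theorem along segments of measures *)

Section measure_mean_value.
Context {R : realType} {d : nat}.
Notation P := (prob_torus R d).
Variables (Phi : P -> R) (delta : P -> 'rV[R]_d -> R) (lfdP : is_lfd Phi delta).

Lemma lfd_itg m (p : P) : itg p (delta m).
Proof.
have [pd cd _ _] := lfdP; apply: itg_continuous_periodic => //.
apply: (@continuousT_comp _ _ _ (fun y => (m, y)) _ _ cd).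
by apply: continuousT_pair; [exact: continuousT_cst|exact: continuousT_id].
Qed.

Let D (m m' : P) s := \int[m']_y delta (mixture s m m') y - \int[m]_y delta (mixture s m m') y.

(** Moving by h beyond s means mixing [mixture s m m'] with m' in proportion h / (1 - s), and m' -
    mixture = (1 - s) (m' - m): the two factors cancel. *)
Lemma lfd_right_derivative (m m' : P) s : 0 <= s < 1 -> forall e, 0 < e ->
  exists2 r, 0 < r & forall h, 0 < h < r ->
  `|Phi (mixture (s + h) m m') - Phi (mixture s m m') - h * D m m' s| <= e * h.
Proof.
move=> /andP[s0 s1] e e0; have [_ _ dl n0] := lfdP.
have s01 : 0 <= s <= 1 by rewrite s0 ltW.
have q0 : 0 < 1 - s by rewrite subr_gt0.
have := at_right_eps (dl (mixture s m m') m') (mulr_gt0 e0 q0).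
rewrite (@Rint_mixture _ _ _ m m')//; try exact: lfd_itg.
set A := \int[m']_y _; set B := \int[m]_y _; move=> [r r0 hr].
exists (Num.min r 1 * (1 - s)) => [|h /andP[h0 hh]].
  by rewrite mulr_gt0// lt_min r0 ltr01.
have hs0 : 0 < h / (1 - s) by rewrite divr_gt0.
have : h / (1 - s) < Num.min r 1 by rewrite ltr_pdivrMr.
rewrite lt_min => /andP[hs1 hs2].
have := hr (h / (1 - s)); rewrite hs0 hs1 => /(_ isT).
have hs3 : 0 <= h / (1 - s) <= 1 by rewrite !ltW.
rewrite (@mixture_comp _ _ _ _ (s + h) m m' hs3 s01); last by rewrite divfK// gt_eqF.
have -> : D m m' s = A - B by [].
set X := Phi _; set Y := Phi _ => hXY.
have h2 : `|X - Y - h * (A - B)| = `|A - ((1 - s) * B + s * A) -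
    (h / (1 - s))^-1 * (X - Y)| * (h / (1 - s)).
  rewrite -[X in _ = _ * X](gtr0_norm hs0) -normrM distrC; congr `|_|.
  by field; rewrite !gt_eqF.
have -> : e * h = e * (1 - s) * (h / (1 - s)) by field; rewrite gt_eqF.
by rewrite h2 ler_wpM2r// ltW.
Qed.

Lemma lfd_left_derivative (m m' : P) s : 0 < s <= 1 -> forall e, 0 < e ->
  exists2 r, 0 < r & forall h, 0 < h < r ->
  `|Phi (mixture (s - h) m m') - Phi (mixture s m m') + h * D m m' s| <= e * h.
Proof.
move=> /andP[s0 s1] e e0.
have s' : 0 <= 1 - s < 1 by rewrite subr_ge0 s1 ltrBlDr ltrDl.
have [r r0 hr] := lfd_right_derivative m' m s' e0.
exists (Num.min r s) => [|h]; first by rewrite lt_min r0.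
rewrite lt_min => /and3P[h0 h1 h2]; have := hr h; rewrite h0 h1 => /(_ isT).
have -> : D m' m (1 - s) = - D m m' s.
  by rewrite /D (@mixture_sym _ _ s) ?(ltW s0)// opprB.
rewrite (@mixture_sym _ _ s) ?(ltW s0)// (@mixture_sym _ _ (s - h)); last first.
  by rewrite subr_ge0 ltW//= (le_trans _ s1)// lerBlDr lerDl ltW.
have -> : 1 - (s - h) = 1 - s + h by ring.
by rewrite mulrN opprK.
Qed.

Lemma lfd_is_derive (m m' : P) s : 0 < s < 1 ->
  is_derive (s : R) (1 : R) (fun s => Phi (mixture s m m')) (D m m' s).
Proof.
move=> /andP[s0 s1]; apply: is_derive_eps => e e0.
have [|r1 r10 h1] := @lfd_right_derivative m m' s _ _ e0; first by rewrite ltW.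
have [|r2 r20 h2] := @lfd_left_derivative m m' s _ _ e0; first by rewrite s0 ltW.
exists (Num.min r1 r2) => [|h]; first by rewrite lt_min r10.
rewrite lt_min => /andP[hr1 hr2].
have [hp|hn|<-] := ltgtP 0 h.
- by move: hr1; rewrite gtr0_norm// => hr1; apply: h1; rewrite hp.
- move: hr2; rewrite ltr0_norm// => hr2.
  have := h2 (- h); rewrite oppr_gt0 hn hr2 => /(_ isT).
  by rewrite opprK mulNr.
- by rewrite addr0 subrr mul0r subrr normr0 mulr0.
Qed.

(* Only a right derivative at [s = 0] is given; reversing the segment from [m] to [m']
   provides the left derivatives. *)
Lemma lfd_mean_value (m m' : P) : exists2 s, 0 <= s <= 1 &
  Phi m' - Phi m = \int[m']_y delta (mixture s m m') y - \int[m]_y delta (mixture s m m') y.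
Proof.
have der s : s \in `]0, 1[ -> is_derive (s : R) (1 : R) (fun s => Phi (mixture s m m')) (D m m' s).
  by rewrite in_itv /=; exact: lfd_is_derive.
have cont : {within `[0, 1], continuous (fun s => Phi (mixture s m m'))}.
  apply: within_itv_continuous_eps => s /andP[s0 s1] e e0.
  have right : exists2 r, 0 < r & forall y, 0 <= y <= 1 -> s < y -> y - s < r ->
      `|Phi (mixture y m m') - Phi (mixture s m m')| <= e.
    have [s1'|] := ltP s 1; last first.
      move=> s1'; exists 1 => // y /andP[_ y1] sy; exfalso.
      by have := lt_le_trans sy y1; rewrite ltNge s1'.
    have s01' : 0 <= s < 1 by rewrite s0.
    have [r r0 hr] := @lfd_right_derivative m m' s s01' 1 ltr01.
    pose C := 1 + `|D m m' s|; have C0 : 0 < C by rewrite ltr_pwDl.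
    exists (Num.min r (e / C)) => [|y _ sy]; first by rewrite lt_min r0 divr_gt0.
    rewrite lt_min => /andP[yr ye]; have ys : 0 < y - s by rewrite subr_gt0.
    have := hr (y - s); rewrite ys yr => /(_ isT).
    have -> : s + (y - s) = y by rewrite addrC subrK.
    rewrite mul1r => hh.
    move: ye; rewrite ltr_pdivlMr// /C mulrDr mulr1 => ye.
    rewrite (le_trans _ (ltW ye))// -lerBlDr (le_trans _ hh)//.
    by rewrite -{1}(gtr0_norm ys) -normrM lerB_dist.
  have left : exists2 r, 0 < r & forall y, 0 <= y <= 1 -> y < s -> s - y < r ->
      `|Phi (mixture y m m') - Phi (mixture s m m')| <= e.
    have [s0'|] := ltP 0 s; last first.
      move=> s0'; exists 1 => // y /andP[y0 _] sy; exfalso.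
      by have := le_lt_trans y0 sy; rewrite ltNge s0'.
    have s01' : 0 < s <= 1 by rewrite s0'.
    have [r r0 hr] := @lfd_left_derivative m m' s s01' 1 ltr01.
    pose C := 1 + `|D m m' s|; have C0 : 0 < C by rewrite ltr_pwDl.
    exists (Num.min r (e / C)) => [|y _ sy]; first by rewrite lt_min r0 divr_gt0.
    rewrite lt_min => /andP[yr ye]; have ys : 0 < s - y by rewrite subr_gt0.
    have := hr (s - y); rewrite ys yr => /(_ isT); rewrite subKr mul1r => hh.
    move: ye; rewrite ltr_pdivlMr// /C mulrDr mulr1 => ye.
    rewrite (le_trans _ (ltW ye))// -lerBlDr (le_trans _ hh)//.
    rewrite -{1}(gtr0_norm ys) -normrM -[X in _ <= `|_ + X|]opprK.
    by rewrite (le_trans _ (lerB_dist _ _))// normrN.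
  have [r1 r10 h1] := right; have [r2 r20 h2] := left.
  exists (Num.min r1 r2) => [|y y01]; first by rewrite lt_min r10.
  rewrite lt_min => /andP[hr1 hr2].
  have [ys|sy|->] := ltgtP y s; last by rewrite subrr normr0 ltW.
  - by apply: h2 => //; move: hr2; rewrite distrC gtr0_norm// subr_gt0.
  - by apply: h1 => //; move: hr1; rewrite gtr0_norm// subr_gt0.
have [s] := MVT ltr01 der cont.
rewrite in_itv /= => /andP[s0 s1]; rewrite mixture0 mixture1 subr0 mulr1 => ->.
by exists s => //; rewrite !ltW.
Qed.

End measure_mean_value.

Section tube_integral.
Context {R : realType} {d : nat}.
Notation P := (prob_torus R d).

(** The integrand changes uniformly on the cube, and the measure changes against a fixed continuous
    integrand. *)
Lemma continuous_Rint_tube (Z : topologicalType) (k : Z -> 'rV[R]_d -> R) (N : Z -> P) :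
  continuous (fun w : Z * 'rV[R]_d => k w.1 w.2) -> (forall z, Zperiodic (k z)) ->
  continuous N -> continuous (fun z => \int[N z]_y k z y).
Proof.
move=> ck pk cN; apply: continuous_dist => z0 e e0.
have ckz z : continuous (k z).
  apply: (@continuousT_comp _ _ _ (fun y => (z, y)) _ _ ck).
  by apply: continuousT_pair; [exact: continuousT_cst|exact: continuousT_id].
have ik z (p : P) : itg p (k z) := itg_continuous_periodic p (ckz z) (pk z).
have e2 : 0 < e / 2 by rewrite divr_gt0.
have h1 := @tube_near _ _ _ (@tcube R d) k z0 (@tcube_compact R d) (fun y _ => ck (z0, y)) _ e2.
have h2 : \forall z \near z0, `|\int[N z0]_y k z0 y - \int[N z]_y k z0 y| <= e / 2.
  have := continuousT_comp cN (cvg_Rint_prob_torus (ckz z0) (pk z0)).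
  by move=> /(_ z0) /cvgrPdist_le /(_ _ e2).
apply: filterS2 h1 h2 => z h1 h2.
rewrite (le_trans (ler_distD (\int[N z]_y k z0 y) _ _))// (splitr e) lerD//.
rewrite -RintB// (le_trans (Rint_normr_le _))//; first exact: itgB.
rewrite -[leRHS](@Rint_cst _ _ _ (N z)); apply: Rint_ae_le.
- by apply: itg_abs; exact: itgB.
- exact: itg_cst.
- apply: filterS (ae_unit_cube (prob_torus_cube (N z))) => y /(@unit_cubeW R d) yK.
  by rewrite ltW// h1.
Qed.

End tube_integral.

Section clip.
Variables (R : realType) (T : R) (T0 : 0 <= T).

(* Composing with [clip] extends a function of t in [0, T] to all of R, and turns
   continuity within [0, T] into plain continuity. *)
Definition clip (t : R) : R := Num.max 0 (Num.min T t).

Lemma clip_itv t : 0 <= clip t <= T.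
Proof. by rewrite le_max lexx ge_max T0 ge_min lexx. Qed.

Lemma clip_id t : 0 <= t <= T -> clip t = t.
Proof. by move=> /andP[t0 tT]; rewrite /clip min_r// max_r. Qed.

Lemma clip_continuous : continuous clip.
Proof.
move=> t; apply: (@continuous_comp _ _ _ (fun t => Num.min T t) (fun t => Num.max 0 t)).
  exact: (@continuous_min _ _ (fun=> T) id t (cvg_cst _) cvg_id).
exact: maxr_continuous.
Qed.

End clip.

Lemma continuous_comp_within (X Y Z : topologicalType) (A : set Y) (g : Y -> Z) (k : X -> Y) :
  {within A, continuous g} -> continuous k -> (forall x, A (k x)) -> continuous (g \o k).
Proof.
move=> /subspace_continuousP cg ck Ak x; apply: cvg_comp (cg _ (Ak x)).
move=> B /= hB; have := ck x _ hB; rewrite /= => h.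
have {}h : nbhs x (fun t => A (k t) -> B (k t)) by [].
by apply: (@filterS _ _ (nbhs_filter x) _ _ _ h) => t ht; exact: ht (Ak t).
Qed.

Section clip_txm.
Variables (R : realType) (d : nat) (T : R) (T0 : 0 <= T).
Notation P := (prob_torus R d).

Lemma cont_txm_clip (S : topologicalType) (f : R -> 'rV[R]_d -> P -> S) :
  cont_txm T f -> continuous (fun z : R * 'rV[R]_d * P => f (clip T z.1.1) z.1.2 z.2).
Proof.
move=> cf; pose k (z : R * 'rV[R]_d * P) := ((clip T z.1.1, z.1.2), z.2).
apply: (@continuous_comp_within _ _ _ _ _ k cf) => [|z] /=; last exact: clip_itv.
apply: continuousT_pair; last exact: continuousT_snd.
apply: continuousT_pair; last exact: continuousT_comp (@continuousT_fst _ _) (@continuousT_snd _ _).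
apply: continuousT_comp (@clip_continuous _ _).
exact: continuousT_comp (@continuousT_fst _ _) (@continuousT_fst _ _).
Qed.

Lemma cont_txmy_clip (S : topologicalType) (f : R -> 'rV[R]_d -> P -> 'rV[R]_d -> S) :
  cont_txmy T f -> continuous (fun z : R * 'rV[R]_d * P * 'rV[R]_d =>
    f (clip T z.1.1.1) z.1.1.2 z.1.2 z.2).
Proof.
move=> cf; pose k (z : R * 'rV[R]_d * P * 'rV[R]_d) := (((clip T z.1.1.1, z.1.1.2), z.1.2), z.2).
apply: (@continuous_comp_within _ _ _ _ _ k cf) => [|z] /=; last exact: clip_itv.
apply: continuousT_pair; last exact: continuousT_snd.
have c1 := @continuousT_fst (R * 'rV[R]_d * P)%type 'rV[R]_d.
apply: continuousT_pair; last exact: continuousT_comp c1 (@continuousT_snd _ _).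
have c2 := continuousT_comp c1 (@continuousT_fst _ _).
apply: continuousT_pair; last exact: continuousT_comp c2 (@continuousT_snd _ _).
apply: continuousT_comp (@clip_continuous _ _).
exact: continuousT_comp c2 (@continuousT_fst _ _).
Qed.

End clip_txm.

(** * The flow of measures and the chain rule *)

Section primitives.
Variables (R : realType) (T : R) (T0 : 0 < T).
Notation nu := (uniform_prob T0).
Notation leb := (@lebesgue_measure R).

Lemma Rint_uniform_FTC2 (f F : R -> R) : continuous f ->
  (forall x, 0 < x < T -> is_derive (x : R) (1 : R) F (f x)) ->
  {within `[0, T], continuous F} ->
  \int[nu]_x f x = T^-1 * (F T - F 0).
Proof.
move=> cf dF cF; rewrite Rint_uniform; last exact: continuous_measurable_fun.
rewrite subr0; congr (_ * _).
have [_ F0 FT] := (continuous_within_itvP F T0).1 cF.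
rewrite /Rintegral (@continuous_FTC2 _ f F)//.
- exact: continuous_subspaceT.
- by split => // x; rewrite in_itv/= => /dF [].
- by move=> x; rewrite in_itv/= => /dF [h <-]; rewrite derive1E.
Qed.

(** The base point -1 lies strictly to the left of [0, T], so the primitive has a two-sided
    derivative at 0 as well. *)
Lemma is_derive_primitive (f : R -> R) t : continuous f -> - 1 < t ->
  is_derive (t : R) (1 : R) (fun x => \int[leb]_(s in `[- 1, x]) f s) (f t).
Proof.
move=> cf t1; have tt : t < t + 1 by rewrite ltrDl.
have [|d1 d2] := @continuous_FTC1_closed R f (- 1) t (t + 1) tt _ t1 (cf t).
  by apply: continuous_compact_integrable; [exact: segment_compact|exact: continuous_subspaceT].
apply: DeriveDef; first exact: d1.
by rewrite -derive1E; exact: d2.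
Qed.

Lemma Rint_uniform_itv (a : R -> R) : measurable_fun setT a ->
  \int[leb]_(t in `]0, T[) a t = T * \int[nu]_t a t.
Proof.
move=> ma; rewrite Rint_uniform// subr0 mulrA divff ?mul1r ?gt_eqF//.
rewrite /Rintegral integral_itv_bndo_bndc; last first.
  by apply/measurable_EFinP; exact: measurable_funTS.
rewrite integral_itv_obnd_cbnd//.
by apply/measurable_EFinP; exact: measurable_funTS.
Qed.

Lemma ae_uniform_eq0 (f : R -> R) : continuous f -> {ae nu, forall t, f t = 0} ->
  forall t, 0 < t < T -> f t = 0.
Proof.
move=> cf [N [mN N0 hN]] t /andP[t0 tT]; apply: contrapT => ft.
have ft0 : 0 < `|f t| by rewrite normr_gt0; apply/eqP.
have /nbhs_ballP[r /= r0 hr] : \forall s \near t, f s != 0.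
  have := cf t => /cvgrPdist_lt /(_ _ ft0); apply: filterS => s.
  by apply: contraTneq => ->; rewrite subr0 ltxx.
pose a := Num.max (t / 2) (t - r / 2); pose b := t.
have ab : a < b by rewrite gt_max !ltrBlDr ltrDl divr_gt0// gtr_pMr// invf_lt1// ltr1n.
have a0 : 0 <= a by rewrite le_max divr_ge0// ltW.
have e1 := uniform_prob_itv T0 true false a0 (ltW ab) (ltW tT).
have : (nu `[a, b]%classic <= nu N)%E.
  apply: le_measure; rewrite ?inE//.
  move=> s /=; rewrite in_itv/= => /andP[as_ sb]; apply: hN => /= fs.
  have : f s != 0.
    apply: hr; rewrite /ball/= ger0_norm ?subr_ge0//.
    have : t - r / 2 <= s by apply: le_trans as_; rewrite le_max lexx orbT.
    by lra.
  by rewrite fs eqxx.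
rewrite N0 e1 lee_fin; apply/negP; rewrite -ltNge subr0 divr_gt0// subr_gt0//.
Qed.

Lemma test1d_continuous eta : test1d T eta -> continuous eta.
Proof.
by move=> [_ de _] t; apply: differentiable_continuous; apply/derivable1_diffP; exact: de.
Qed.

(** Mean zero is what makes the primitive vanish again near T, hence compactly supported in (0,
    T). *)
Lemma test1d_primitive (xi : R -> R) : test1d T xi -> \int[nu]_t xi t = 0 ->
  exists2 eta, test1d T eta & derive1 eta = xi.
Proof.
move=> txi xi0; have cxi := test1d_continuous txi.
have [[e e0 he] _ _] := txi.
pose eta t := \int[leb]_(s in `[- 1, t]) xi s.
have etaL t : t < e -> eta t = 0.
  move=> te; rewrite /eta; under eq_Rintegral => s.
    rewrite inE/= in_itv/= => /andP[_ st].
    rewrite he; last by rewrite negb_and -ltNge (le_lt_trans st te).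
  over.
  by rewrite Rintegral_cst//= mul0r.
have dpos t : - 1 < t -> is_derive (t : R) (1 : R) eta (xi t) by exact: is_derive_primitive.
have cpos t : - 1 < t -> {for t, continuous eta}.
  by move=> t1; apply: differentiable_continuous; apply/derivable1_diffP; case: (dpos t t1).
have cwith a b : - 1 < a -> {within `[a, b], continuous eta}.
  move=> a1; apply: continuous_in_subspaceT => t; rewrite inE/= in_itv/= => /andP[at_ _].
  by apply: cpos; exact: lt_le_trans at_.
have etaT : eta T = 0.
  have : \int[nu]_t xi t = T^-1 * (eta T - eta 0).
    apply: Rint_uniform_FTC2 => //; last by apply: cwith; rewrite ltrN10.
    by move=> t /andP[t0 _]; apply: dpos; rewrite (lt_trans _ t0)// ltrN10.
  rewrite xi0 (etaL 0)// subr0 => /esym/eqP; rewrite mulf_eq0 invr_eq0 gt_eqF//=.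
  by move/eqP.
have xiL t : t < e -> xi t = 0 by move=> te; rewrite he// negb_and -ltNge te.
have etaR t : T - e < t -> eta t = 0.
  move=> tT.
  have [te|te] := ltP t e; first exact: etaL.
  have t1 : - 1 < t by rewrite (lt_le_trans _ te)// (lt_trans _ e0)// ltrN10.
  have T1 : - 1 < T by rewrite (lt_trans _ T0)// ltrN10.
  have key a b : - 1 < a -> T - e < a -> a < b -> eta a = eta b.
    move=> a1 aT ab.
    have [|c] := MVT ab _ (cwith a b a1) (df := xi).
      move=> c; rewrite in_itv/= => /andP[ac _]; apply: dpos; exact: lt_trans ac.
    rewrite in_itv/= => /andP[ac _].
    rewrite (he c) ?mul0r; first by move/eqP; rewrite subr_eq0 => /eqP ->.
    by rewrite negb_and -!ltNge (lt_trans aT ac) orbT.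
  have TT : T - e < T by rewrite ltrBlDr ltrDl.
  have [tT'|Tt|tT'] := ltgtP t T; last by rewrite tT'.
  - by rewrite (key t T).
  - by rewrite -(key T t).
have deta t : is_derive (t : R) (1 : R) eta (xi t).
  have [t1|t1] := ltP (- 1) t; first exact: dpos.
  (* Below the base point -1 the integral is over an empty interval; there the primitive is locally
     zero, like [xi]. *)
  have te : t < 0 by rewrite (le_lt_trans t1)// ltrN10.
  rewrite xiL ?(lt_trans te)//; apply: is_derive_eps => c c0; exists e => // h he'.
  rewrite !etaL ?(lt_trans te)//; first by rewrite mulr0 !subrr normr0 mulr_ge0// ltW.
  rewrite -[ltRHS]add0r ltrD//.
  by rewrite (le_lt_trans (ler_norm h)).
have dE : derive1 eta = xi by apply/funext => t; rewrite derive1E; case: (deta t).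
exists eta => //; split.
- exists e => // t; rewrite negb_and -!ltNge => /orP[h|h]; [exact: etaL|exact: etaR].
- by move=> t; case: (deta t).
- by rewrite dE.
Qed.

Lemma test1d_lin (k : R) f g : test1d T f -> test1d T g -> test1d T (fun t => f t - k * g t).
Proof.
move=> [[e e0 he] df cf] [[e' e0' he'] dg cg]; split.
- exists (Num.min e e') => [|t]; first by rewrite lt_min e0.
  rewrite negb_and -!ltNge lt_min ltrBlDr => h.
  have [h1 h2] : (t < e) || (T - e < t) /\ (t < e') || (T - e' < t).
    move: h => /orP[/andP[-> ->]//|h].
    split; apply/orP; right; rewrite ltrBlDr (lt_le_trans h)// lerD2l ge_min lexx ?orbT//.
  by rewrite he ?he' ?mulr0 ?subr0// negb_and -!ltNge.
- by move=> t; apply: derivableB => //; exact: derivable_mull.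
- rewrite (_ : derive1 _ = fun t => derive1 f t - k * derive1 g t).
    by move=> t; apply: cvgB; [exact: cf|apply: cvgM; [exact: cvg_cst|exact: cg]].
  apply/funext => t; rewrite !derive1E deriveB//; last exact: derivable_mull.
  by rewrite derive_mull.
Qed.

(** Otherwise every test function has mean zero, and the fundamental lemma applied to the constant 1
    gives 1 = 0. *)
Lemma exists_test1d : exists2 z, test1d T z & \int[nu]_t z t != 0.
Proof.
apply: contrapT => h.
have h1 : {ae nu, forall t, (1 : R) = 0}.
  apply: (@fundamental_lemma _ _ T0 (fun=> 1)); first exact: itg_cst.
  move=> eta teta; apply/eqP; apply: contra_notT h => h0.
  by exists eta => //; move: h0; under eq_Rintegral do rewrite mulr1.
have c1 : continuous (fun _ : R => 1 : R) by exact: continuousT_cst.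
have T2 : 0 < T / 2 < T by rewrite divr_gt0//= ltr_pdivrMr// ltr_pMr// ltr1n.
by have /eqP := ae_uniform_eq0 c1 h1 T2; rewrite oner_eq0.
Qed.

Lemma itg_uniform_continuous (f : R -> R) : continuous f -> itg nu f.
Proof.
move=> cf; have mf : measurable_fun setT f by exact: continuous_measurable_fun.
apply/integrableP; split; first exact/measurable_EFinP.
rewrite integral_uniform//; last by apply/measurable_EFinP; exact: measurableT_comp.
have /integrableP[_ h] := continuous_compact_integrable (@segment_compact R 0 T)
  (continuous_subspaceT cf).
by rewrite lte_mul_pinfty// ?lee_fin ?invr_ge0 ?subr_ge0// ltW.
Qed.

(** A minus a primitive of L is orthogonal to all test functions of mean zero, hence constant: this
    turns a continuous weak derivative into a classical one. *)
Lemma du_Bois_Reymond (A L : R -> R) : continuous A -> continuous L ->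
  (forall eta, test1d T eta -> \int[nu]_t (derive1 eta t * A t + eta t * L t) = 0) ->
  forall t, 0 < t < T -> is_derive (t : R) (1 : R) A (L t).
Proof.
move=> cA cL h.
pose B t := \int[leb]_(s in `[- 1, t]) L s.
have N1 (t : R) : 0 <= t -> - 1 < t by move=> t0; rewrite (lt_le_trans _ t0)// ltrN10.
have dB t : - 1 < t -> is_derive (t : R) (1 : R) B (L t) by exact: is_derive_primitive.
have cpos t : - 1 < t -> {for t, continuous B}.
  by move=> t1; apply: differentiable_continuous; apply/derivable1_diffP; case: (dB t t1).
(* Clipping stays within the region where [B] is differentiable, so [Bc] is continuous on the whole
   line. *)
pose Bc t := B (clip T t).
have cl t : 0 <= clip T t by have /andP[] := clip_itv (ltW T0) t.
have cBc : continuous Bc.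
  move=> t; apply: (@continuous_comp _ _ _ (clip T) B); first exact: (@clip_continuous _ T).
  by apply: cpos; exact: N1.
have dBc t : 0 < t < T -> is_derive (t : R) (1 : R) Bc (L t).
  move=> /andP[t0 tT]; have := dB t (N1 _ (ltW t0)).
  apply: near_eq_is_derive => //.
  near=> s; rewrite /Bc clip_id//.
  have s0 : 0 < s by near: s; exact: lt_nbhsr.
  have sT : s < T by near: s; exact: lt_nbhsl.
  by rewrite !ltW.
pose D t := A t - Bc t.
have cD : continuous D by move=> t; apply: cvgB; [exact: cA|exact: cBc].
have ic := itg_uniform_continuous.
have cM (f g : R -> R) : continuous f -> continuous g -> continuous (fun t => f t * g t).
  by move=> cf cg t; apply: cvgM; [exact: cf|exact: cg].
have hD xi : test1d T xi -> \int[nu]_t xi t = 0 -> \int[nu]_t (xi t * D t) = 0.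
  move=> txi xi0; have [eta teta de] := test1d_primitive txi xi0.
  have ceta := test1d_continuous teta; have cxi := test1d_continuous txi.
  have [[e e0 he] deta _] := teta.
  have hA := h _ teta; rewrite de in hA.
  have hB : \int[nu]_t (xi t * Bc t + eta t * L t) = 0.
    have cxB : continuous (fun t => xi t * Bc t + eta t * L t).
      by move=> t; apply: cvgD; [exact: (cM _ _ cxi cBc)|exact: (cM _ _ ceta cL)].
    have dxB t : 0 < t < T ->
        is_derive (t : R) (1 : R) (fun t => eta t * Bc t) (xi t * Bc t + eta t * L t).
      move=> tT; have [d1 d2] := dBc t tT.
      apply: DeriveDef; first exact: (derivableM (deta t) d1).
      rewrite (deriveM (deta t) d1) d2 -derive1E de /= addrC; congr (_ + _); exact: mulrC.
    rewrite (Rint_uniform_FTC2 cxB dxB); last first.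
      by apply: continuous_subspaceT; exact: cM.
    rewrite (he 0) ?(he T) ?mul0r ?subr0 ?mulr0//.
      by rewrite negb_and -!ltNge ltrBlDr ltrDl e0 orbT.
    by rewrite negb_and -!ltNge e0.
  rewrite /D; under eq_Rintegral => t _.
    have -> : xi t * (A t - Bc t) = (xi t * A t + eta t * L t) - (xi t * Bc t + eta t * L t) by ring.
  over.
  rewrite RintB ?hA ?hB ?subr0//; apply: itgD; apply: ic; exact: cM.
have [z0 tz0 nz0] := exists_test1d.
pose k := (\int[nu]_t (z0 t * D t)) / \int[nu]_t z0 t.
have cz0 := test1d_continuous tz0.
have h0 : {ae nu, forall t, D t - k = 0}.
  apply: fundamental_lemma => [|z tz].
    by apply: ic => t; apply: cvgB; [exact: cD|exact: cvg_cst].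
  have cz := test1d_continuous tz.
  (* Subtracting c z0 makes an arbitrary test function mean zero; the constant [k] is fixed by the
     pairing with [z0]. *)
  pose c := (\int[nu]_t z t) / \int[nu]_t z0 t.
  have := hD _ (test1d_lin c tz tz0).
  rewrite RintB; [|exact: ic|by apply: itgZ; exact: ic].
  rewrite RintZ; last exact: ic.
  rewrite divfK// subrr => /(_ erefl).
  under eq_Rintegral => t _.
    have -> : (z t - c * z0 t) * D t = z t * D t - c * (z0 t * D t) by ring.
  over.
  rewrite RintB; [|by apply: ic; exact: cM|by apply: itgZ; apply: ic; exact: cM].
  rewrite RintZ; last by apply: ic; exact: cM.
  move=> e1; under eq_Rintegral => t _.
    have -> : z t * (D t - k) = z t * D t - k * z t by ring.
  over.
  rewrite RintB; [|by apply: ic; exact: cM|by apply: itgZ; exact: ic].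
  rewrite RintZ; last exact: ic.
  rewrite -[RHS]e1 /k /c; congr (_ - _).
  set X := \int[nu]_x z0 x; set Y := \int[nu]_x z x; set Z := \int[nu]_x _.
  by rewrite mulrAC [in RHS]mulrAC (mulrC Z).
have cDk : continuous (fun t => D t - k) by move=> t; apply: cvgB; [exact: cD|exact: cvg_cst].
have hk := ae_uniform_eq0 cDk h0.
move=> t tT; have [d1 d2] := dBc t tT.
have dk : is_derive (t : R) (1 : R) (fun s => Bc s + k) (L t).
  have d3 : derivable (cst k : R -> R) t 1 by exact: derivable_cst.
  apply: DeriveDef; first exact: (derivableD d1 d3).
  by rewrite (deriveD d1 d3) d2 derive_cst addr0.
move: dk; apply: near_eq_is_derive => //.
move: tT => /andP[t0 tT]; near=> s.
have s0 : 0 < s by near: s; exact: lt_nbhsr.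
have sT : s < T by near: s; exact: lt_nbhsl.
have := hk s; rewrite s0 sT => /(_ isT) /eqP; rewrite /D subr_eq0 subr_eq => /eqP ->.
exact: addrC.
Unshelve. all: by end_near. Qed.

End primitives.

Lemma eq_continuousT (X Y : topologicalType) (f g : X -> Y) : f =1 g ->
  continuous f -> continuous g.
Proof. by move=> /funext ->. Qed.

Section calculus_facts.
Context {R : realType} {d : nat}.
Implicit Types (f g : 'rV[R]_d -> R) (k : R).

Lemma dotE (u v : 'rV[R]_d) : dot u v = \sum_i u ord0 i * v ord0 i.
Proof. by rewrite /dot mxE; apply: eq_bigr => i _; rewrite mxE. Qed.

Lemma dotZl k (u v : 'rV[R]_d) : dot (k *: u) v = k * dot u v.
Proof. by rewrite /dot -scalemxAl mxE. Qed.

Lemma lap_hess f x : lap f x = \sum_i hess f x i i.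
Proof. by apply: eq_bigr => i _; rewrite mxE. Qed.

Lemma dvg_grad f x : dvg (grad f) x = lap f x.
Proof.
apply: eq_bigr => i _.
have e : (fun y => grad f y ord0 i) = 'D_(basis_vec R i) f by apply/funext => y; rewrite mxE.
by rewrite e.
Qed.

Lemma derive_mull_fun k f i : has_partials f ->
  'D_(basis_vec R i) (fun y => k * f y) = (fun y => k * 'D_(basis_vec R i) f y).
Proof. by move=> hf; apply/funext => y; rewrite derive_mull. Qed.

Lemma grad_mull k f x : has_partials f -> grad (fun y => k * f y) x = k *: grad f x.
Proof. move=> hf; apply/rowP => i; rewrite !mxE; exact: (derive_mull k (hf x i)). Qed.

Lemma hess_mull k f x : has_partials2 f -> hess (fun y => k * f y) x = k *: hess f x.
Proof.
move=> [hf h2]; apply/matrixP => i j; rewrite [LHS]mxE [RHS]mxE [in RHS]mxE.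
by rewrite -(derive_mull k (h2 i x j)) -(derive_mull_fun k i hf).
Qed.

Lemma lap_mull k f x : has_partials2 f -> lap (fun y => k * f y) x = k * lap f x.
Proof.
move=> hf; rewrite !lap_hess hess_mull// mulr_sumr.
by apply: eq_bigr => i _; rewrite mxE.
Qed.

Lemma has_partials2_mull k f : has_partials2 f -> has_partials2 (fun y => k * f y).
Proof.
move=> [hf h2]; split=> [x i|i x j]; first exact: derivable_mull.
by rewrite derive_mull_fun//; apply: derivable_mull; exact: h2.
Qed.

Lemma Zperiodic_grad f : Zperiodic f -> Zperiodic (grad f).
Proof. by move=> pf x k; apply/rowP => i; rewrite !mxE Zperiodic_derive. Qed.

Lemma Zperiodic_hess f : Zperiodic f -> Zperiodic (hess f).
Proof.
move=> pf x k; apply/matrixP => i j; rewrite [LHS]mxE [RHS]mxE.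
exact: (Zperiodic_derive _ (Zperiodic_derive (basis_vec R i) pf)).
Qed.

Lemma Zperiodic_lap f : Zperiodic f -> Zperiodic (lap f).
Proof. by move=> pf x k; rewrite !lap_hess Zperiodic_hess. Qed.

End calculus_facts.

Section entry_continuity.
Variables (R : realType) (X : topologicalType) (m n : nat).

Lemma continuous_entry (f : X -> 'M[R]_(m, n)) i j : continuous f ->
  continuous (fun x => f x i j).
Proof.
move=> cf; apply: (@continuousT_comp _ _ _ f (fun M : 'M[R]_(m, n) => M i j) cf).
exact: coord_continuous.
Qed.

End entry_continuity.

Section operator_continuity.
Variables (R : realType) (d : nat) (X : topologicalType).

Lemma continuous_dot (u v : X -> 'rV[R]_d) : continuous u -> continuous v ->
  continuous (fun x => dot (u x) (v x)).
Proof.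
move=> cu cv; under eq_fun do rewrite dotE.
apply: continuous_sum_fun => i x.
by apply: cvgM; [exact: continuous_entry cu x|exact: continuous_entry cv x].
Qed.

Lemma continuous_trace (h : X -> 'M[R]_d) : continuous h ->
  continuous (fun x => \sum_i h x i i).
Proof. by move=> ch; apply: continuous_sum_fun => i; exact: continuous_entry. Qed.

Lemma continuousT_add (f g : X -> R) : continuous f -> continuous g ->
  continuous (fun x => f x + g x).
Proof. by move=> cf cg x; apply: cvgD; [exact: cf|exact: cg]. Qed.

Lemma continuousT_sub (f g : X -> R) : continuous f -> continuous g ->
  continuous (fun x => f x - g x).
Proof. by move=> cf cg x; apply: cvgB; [exact: cf|exact: cg]. Qed.

Lemma continuousT_mul (f g : X -> R) : continuous f -> continuous g ->
  continuous (fun x => f x * g x).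
Proof. by move=> cf cg x; apply: cvgM; [exact: cf|exact: cg]. Qed.

End operator_continuity.

(** The order of a and b is left open, since the increments along the flow may have either sign; the
    intermediate point is strictly nearer to a than b is. *)
Lemma MVT_between (R : realType) (f df : R -> R) (T a b : R) :
  {within `[0, T], continuous f} ->
  (forall t, 0 < t < T -> is_derive (t : R) (1 : R) f (df t)) ->
  0 <= a <= T -> 0 <= b <= T -> a != b ->
  exists c, [/\ 0 < c < T, `|c - a| < `|b - a| & f b - f a = (b - a) * df c].
Proof.
move=> cf dff.
have main a' b' : 0 <= a' -> b' <= T -> a' < b' -> exists c,
    [/\ 0 < c < T, a' < c < b' & f b' - f a' = (b' - a') * df c].
  move=> a0 bT ab.
  have [||c] := MVT ab (f := f) (df := df) _ (continuous_subspaceW _ cf).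
  - move=> c; rewrite in_itv/= => /andP[ac cb]; apply: dff.
    by rewrite (le_lt_trans a0)// (lt_le_trans cb).
  - by move=> c /=; rewrite !in_itv/= => /andP[ac cb]; rewrite (le_trans a0)// (le_trans cb).
  - rewrite in_itv/= => /andP[ac cb] ->; exists c; rewrite ac cb mulrC; split => //.
    by rewrite (le_lt_trans a0)// (lt_le_trans cb).
move=> /andP[a0 aT] /andP[b0 bT] ab; have [lab|lab] : a < b \/ b < a.
    by apply/orP; rewrite -neq_lt.
- have [c [c1 /andP[c2 c3] c4]] := main a b a0 bT lab; exists c; split => //.
  by rewrite !gtr0_norm ?subr_gt0// ltrD2r.
- have [c [c1 /andP[c2 c3] c4]] := main b a b0 aT lab; exists c; split => //.
    by rewrite distrC (distrC b) !gtr0_norm ?subr_gt0// ltrD2l ltrN2.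
  by rewrite -opprB c4 -mulNr opprB.
Qed.

(** * The Fokker-Planck equation against functions of space *)

Section fokker_planck.
Context {R : realType} {d : nat}.
Variables (T : R) (T0 : 0 < T) (b : R -> 'rV[R]_d -> prob_torus R d -> 'rV[R]_d)
  (m0 : prob_torus R d) (m1 : R -> prob_torus R d) (rho : R -> 'rV[R]_d -> R).
Notation P := (prob_torus R d).
Notation nu := (uniform_prob T0).
Notation clp := (clip T).
Hypotheses (cb : cont_txm T b) (pb : forall t m, 0 <= t <= T -> Zperiodic (fun y => b t y m))
  (flow : density_flow T b m0 m1 rho).

Let T0' : 0 <= T. Proof. exact: ltW. Qed.

Definition flow_clip t := m1 (clp t).

Lemma flow_clip_continuous : continuous flow_clip.
Proof.
have h (t : R) : `[0, T]%classic (clip T t) by rewrite /= in_itv /=; exact: clip_itv.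
exact: (@continuous_comp_within _ _ _ _ m1 (clip T) (df_continuous flow) (@clip_continuous _ T) h).
Qed.

Definition test2 (psi : 'rV[R]_d -> R) := [/\ Zperiodic psi, continuous psi,
  has_partials2 psi, continuous (grad psi) & continuous (hess psi)].

Definition FPgen (psi : 'rV[R]_d -> R) t y :=
  lap psi y - dot (grad psi y) (b (clp t) y (flow_clip t)).

Lemma b_clip_continuous :
  continuous (fun z : R * 'rV[R]_d => b (clp z.1) z.2 (flow_clip z.1)).
Proof.
have cb' := cont_txm_clip T0' cb.
apply: (@continuousT_comp _ _ _ (fun z : R * 'rV[R]_d => (z, flow_clip z.1)) _ _ cb').
apply: continuousT_pair; first exact: continuousT_id.
exact: (continuousT_comp (@continuousT_fst _ _) flow_clip_continuous).
Qed.

(** The flow equation is tested on eta(t) psi(x). Both integrals are continuous in t because the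
    flow is continuous for the Monge-Kantorovich distance. *)
Lemma FP_derive psi : test2 psi -> forall t, 0 < t < T ->
  is_derive (t : R) (1 : R) (fun t => \int[flow_clip t]_y psi y)
    (\int[flow_clip t]_y FPgen psi t y).
Proof.
move=> [ppsi cpsi d2psi cg ch]; have [dpsi _] := d2psi.
have cF : continuous (fun z : R * 'rV[R]_d => FPgen psi z.1 z.2).
  have cd : continuous (fun z : R * 'rV[R]_d =>
      dot (grad psi z.2) (b (clp z.1) z.2 (flow_clip z.1))).
    apply: continuous_dot; last exact: b_clip_continuous.
    exact: (continuousT_comp (@continuousT_snd _ _) cg).
  move=> z; apply: cvgB; last exact: cd.
    apply: (@continuousT_comp _ _ _ (fun z : R * 'rV[R]_d => z.2) (lap psi)).
      exact: continuousT_snd.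
    by rewrite (_ : lap psi = fun y => \sum_i hess psi y i i); [exact: continuous_trace|
      apply/funext => y; exact: lap_hess].
have pF t : Zperiodic (FPgen psi t).
  move=> x k; rewrite /FPgen Zperiodic_lap// Zperiodic_grad//.
  by rewrite (pb _ (clip_itv T0' t)).
have cL := continuous_Rint_tube cF pF flow_clip_continuous.
have cA := continuousT_comp flow_clip_continuous (cvg_Rint_prob_torus cpsi ppsi).
have cFt t : continuous (FPgen psi t).
  apply: (@continuousT_comp _ _ _ (fun y => (t, y)) _ _ cF).
  by apply: continuousT_pair; [exact: continuousT_cst|exact: continuousT_id].
apply: (@du_Bois_Reymond _ _ T0 (fun t => \int[flow_clip t]_y psi y)
  (fun t => \int[flow_clip t]_y FPgen psi t y) cA cL) => eta teta.
have ceta := test1d_continuous teta.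
have test : test_C12 T (fun t x => eta t * psi x).
  split.
  - apply: test_C1_prod => //; split => // i.
    have := continuous_entry (i := ord0) (j := i) cg.
    by under eq_fun do rewrite mxE.
  - by move=> t; exact: has_partials2_mull.
  - rewrite (_ : (fun _ => _) = fun z : R * 'rV[R]_d => eta z.1 *: hess psi z.2).
      move=> z; apply: cvgZ.
        exact: (continuousT_comp (@continuousT_fst _ _) ceta).
      exact: (continuousT_comp (@continuousT_snd _ _) ch).
    by apply/funext => z; exact: hess_mull.
have [_ deta cdeta] := teta.
have h0 := df_equation flow test.
have : \int[lebesgue_measure]_(t in `]0, T[) (derive1 eta t * (\int[flow_clip t]_y psi y) +
    eta t * \int[flow_clip t]_y FPgen psi t y) = 0.
  rewrite -[RHS]h0; apply: eq_Rintegral.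
  move=> t; rewrite inE/= in_itv/= => /andP[t0 tT].
  have tc : clp t = t by rewrite clip_id// !ltW.
  have ip : itg (flow_clip t) psi := itg_continuous_periodic _ cpsi ppsi.
  have iF : itg (flow_clip t) (FPgen psi t) := itg_continuous_periodic _ (cFt t) (pF t).
  rewrite -RintZ// -RintZ// -RintD; [|exact: itgZ|exact: itgZ].
  rewrite /flow_clip tc; apply: eq_Rintegral => y _.
  rewrite lap_mull// grad_mull// dotZl /FPgen /flow_clip tc [in RHS]derive1E derive_mulr// -derive1E.
  by ring.
rewrite Rint_uniform_itv.
  by move=> /eqP; rewrite mulf_eq0 gt_eqF//= => /eqP.
apply: continuous_measurable_fun => t; apply: cvgD.
  by apply: cvgM; [exact: cdeta|exact: cA].
by apply: cvgM; [exact: ceta|exact: cL].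
Qed.

End fokker_planck.

Lemma lfdP (R : realType) (d : nat) (Phi : prob_torus R d -> R) : C1_measure Phi ->
  is_lfd Phi (lfd Phi).
Proof. by move=> h; exact: xgetPex. Qed.

(** * The chain rule along the flow *)

Section chain_rule.
Context {R : realType} {d : nat}.
Variables (T : R) (T0 : 0 < T) (b : R -> 'rV[R]_d -> prob_torus R d -> 'rV[R]_d)
  (m0 : prob_torus R d) (m1 : R -> prob_torus R d) (rho : R -> 'rV[R]_d -> R).
Notation P := (prob_torus R d).
Notation nu := (uniform_prob T0).
Notation clp := (clip T).
Hypotheses (cb : cont_txm T b) (pb : forall t m, 0 <= t <= T -> Zperiodic (fun y => b t y m))
  (flow : density_flow T b m0 m1 rho).
Variable V : R -> 'rV[R]_d -> P -> R.
Hypotheses (VC1 : C1_time T V) (VC2 : C1_measure_C2 T V).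
Notation mc := (flow_clip T m1).

Let T0' : 0 <= T. Proof. exact: ltW. Qed.
Let cl t : 0 <= clp t <= T. Proof. exact: clip_itv. Qed.

Definition along (t : R) (x : 'rV[R]_d) : R := V (clp t) x (mc t).

(** The measure [n] of the linear derivative and the time [tau] of the drift are independent
    arguments, because two mean value theorems evaluate them at unrelated points. *)
Definition lfd_gen t x n tau y : R :=
  lap (lfd (V t x) n) y - dot (grad (lfd (V t x) n) y) (b (clp tau) y (mc tau)).

Lemma lfd_test2 t x n : 0 <= t <= T -> test2 (lfd (V t x) n).
Proof.
move=> tT; have [VC V2 cl0 cg ch] := VC2.
have [pl _ _ _] := lfdP (VC t x tT).
have cmap : continuous (fun y : 'rV[R]_d => (((t, x), n), y)).
  by apply: continuousT_pair; [exact: continuousT_cst|exact: continuousT_id].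
split => //.
- by have := continuousT_comp cmap (cont_txmy_clip T0' cl0); rewrite /= clip_id.
- exact: V2.
- by have := continuousT_comp cmap (cont_txmy_clip T0' cg); rewrite /= clip_id.
- by have := continuousT_comp cmap (cont_txmy_clip T0' ch); rewrite /= clip_id.
Qed.

Lemma continuous_lfd_gen : continuous (fun z : R * 'rV[R]_d * P * R * 'rV[R]_d =>
  lfd_gen (clp z.1.1.1.1) z.1.1.1.2 z.1.1.2 z.1.2 z.2).
Proof.
have [_ _ _ cg ch] := VC2.
have c1 := @continuousT_fst (R * 'rV[R]_d * P * R)%type 'rV[R]_d.
have c11 := continuousT_comp c1 (@continuousT_fst _ _).
have c12 := continuousT_comp c1 (@continuousT_snd _ _).
have cm : continuous (fun z : R * 'rV[R]_d * P * R * 'rV[R]_d => (z.1.1, z.2)).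
  by apply: continuousT_pair; [exact: c11|exact: continuousT_snd].
have cn : continuous (fun z : R * 'rV[R]_d * P * R * 'rV[R]_d => (z.1.2, z.2)).
  by apply: continuousT_pair; [exact: c12|exact: continuousT_snd].
have h1 := continuousT_comp cm (cont_txmy_clip T0' ch).
have h2 := continuousT_comp cm (cont_txmy_clip T0' cg).
have h3 := continuousT_comp cn (b_clip_continuous T0 cb flow).
have h4 := continuous_trace h1; have h5 := continuous_dot h2 h3.
apply: (eq_continuousT _ (continuousT_sub h4 h5)) => z /=.
by rewrite /lfd_gen lap_hess.
Qed.

Lemma Zperiodic_lfd_gen t x n tau : 0 <= t <= T -> Zperiodic (lfd_gen t x n tau).
Proof.
move=> tT y k; have [pl _ _ _ _] := lfd_test2 x n tT.
by rewrite /lfd_gen Zperiodic_lap// Zperiodic_grad// pb.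
Qed.

(** The expansion is one-sided at 0 and T, so it also gives continuity up to the ends. An increment
    splits into a change of time at a fixed measure and a change of measure at a fixed time; joint
    continuity of the derivatives then absorbs the intermediate points. *)
Lemma along_derivative : exists D : R -> 'rV[R]_d -> R,
  [/\ continuous (fun z : R * 'rV[R]_d => D z.1 z.2),
      forall t x, 0 < t < T -> D t x = Dbeta b V t x (m1 t) &
      forall t x, 0 <= t <= T -> forall e, 0 < e -> exists2 r, 0 < r &
        forall h, 0 <= t + h <= T -> `|h| < r ->
        `|along (t + h) x - along t x - h * D t x| <= e * `|h|].
Proof.
have [Vcont Vder [dV cdV dVE]] := VC1.
have cmc : continuous mc := flow_clip_continuous T0 flow.
pose k (z : R * 'rV[R]_d * P * R) := lfd_gen (clp z.1.1.1) z.1.1.2 z.1.2 z.2.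
have ck : continuous (fun z : R * 'rV[R]_d * P * R * 'rV[R]_d => k z.1 z.2).
  exact: continuous_lfd_gen.
have pk z : Zperiodic (k z) by exact: Zperiodic_lfd_gen.
pose J (z : R * 'rV[R]_d * P * R) := \int[mc z.2]_y k z y.
have cJ : continuous J.
  apply: continuous_Rint_tube => //.
  exact: continuousT_comp (@continuousT_snd _ _) cmc.
have cdV' := cont_txm_clip T0' cdV.
pose D t x := dV (clp t) x (mc t) + J (((t, x), mc t), t).
exists D; split.
- have c1 : continuous (fun z : R * 'rV[R]_d => (z, mc z.1)).
    apply: continuousT_pair; first exact: continuousT_id.
    exact: (continuousT_comp (@continuousT_fst _ _) cmc).
  have c2 : continuous (fun z : R * 'rV[R]_d => ((z, mc z.1), z.1)).
    by apply: continuousT_pair; [exact: c1|exact: continuousT_fst].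
  have h1 := continuousT_comp c1 cdV'; have h2 := continuousT_comp c2 cJ.
  by apply: (eq_continuousT _ (continuousT_add h1 h2)) => -[].
- move=> t x /andP[t0 tT]; have tc : clp t = t by rewrite clip_id// !ltW.
  have tT' : 0 <= t <= T by rewrite !ltW.
  rewrite /D /Dbeta dVE ?t0//; rewrite /flow_clip tc -addrA; congr (_ + _).
  have [pl cl0 d2 cg ch] := lfd_test2 x (m1 t) tT'.
  have i1 : itg (m1 t) (lap (lfd (V t x) (m1 t))).
    apply: itg_continuous_periodic; last exact: Zperiodic_lap.
    by apply: (eq_continuousT _ (continuous_trace ch)) => y; rewrite lap_hess.
  have iF : itg (m1 t) (lfd_gen t x (m1 t) t).
    have := continuousT_comp (continuousT_pair (@continuousT_cst _ _ (((t, x), m1 t), t))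
      (@continuousT_id _)) ck.
    rewrite /k /= tc => h; apply: itg_continuous_periodic => //.
    exact: Zperiodic_lfd_gen.
  rewrite /J /k /= /flow_clip tc.
  have -> : (fun y => dvg (Dm (V t x) (m1 t)) y) = lap (lfd (V t x) (m1 t)).
    by apply/funext => y; exact: dvg_grad.
  rewrite -RintB//.
    by apply: eq_Rintegral => y _; rewrite /lfd_gen /flow_clip tc.
  have -> : (fun y => dot (Dm (V t x) (m1 t) y) (b t y (m1 t))) =
     (fun y => lap (lfd (V t x) (m1 t)) y - lfd_gen t x (m1 t) t y).
    apply/funext => y; rewrite /lfd_gen /flow_clip tc /Dm.
    by rewrite opprB addrC subrK.
  exact: itgB.
- move=> t x tT e e0; have e2 : 0 < e / 2 by rewrite divr_gt0.
  have tc : clp t = t by rewrite clip_id.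
  have [r1 r10 h1] : exists2 r, 0 < r & forall tau n, `|tau - t| < r -> ball (mc t) r n ->
      `|dV (clp tau) x n - dV (clp t) x (mc t)| <= e / 2.
    have c0 : continuous (fun z : R * P => ((z.1, x), z.2)).
      apply: continuousT_pair; last exact: continuousT_snd.
      by apply: continuousT_pair; [exact: continuousT_fst|exact: continuousT_cst].
    have := continuousT_comp c0 cdV'.
    move=> /(_ (t, mc t)) /cvgrPdist_le /(_ _ e2) /nbhs_ballP[r /= r0 hr].
    exists r => // tau n h h'; rewrite distrC; apply: (hr (tau, n)); split => //=.
    by rewrite /ball/= distrC.
  have [r2 r20 h2] : exists2 r, 0 < r & forall tau n, `|tau - t| < r -> ball (mc t) r n ->
      `|J (((t, x), n), tau) - J (((t, x), mc t), t)| <= e / 2.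
    have c0 : continuous (fun z : R * P => (((t, x), z.2), z.1)).
      apply: continuousT_pair; last exact: continuousT_fst.
      by apply: continuousT_pair; [exact: continuousT_cst|exact: continuousT_snd].
    have := continuousT_comp c0 cJ.
    move=> /(_ (t, mc t)) /cvgrPdist_le /(_ _ e2) /nbhs_ballP[r /= r0 hr].
    exists r => // tau n h h'; rewrite distrC; apply: (hr (tau, n)); split => //=.
    by rewrite /ball/= distrC.
  have r12 : 0 < Num.min r1 r2 by rewrite lt_min r10.
  have [r3 r30 h3] : exists2 r, 0 < r & forall s, `|s - t| < r -> ball (mc t) (Num.min r1 r2) (mc s).
    have := cmc t _ (nbhsx_ballx (mc t) _ r12).
    move=> /nbhs_ballP[r /= r0 hr]; exists r => // s hs; apply: hr.
    by rewrite /ball/= distrC.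
  exists (Num.min (Num.min r1 r2) r3) => [|h thT]; first by rewrite lt_min r12.
  rewrite !lt_min => /andP[/andP[hr1 hr2] hr3].
  have [->|h0] := eqVneq h 0; first by rewrite addr0 subrr mul0r subrr normr0 mulr0.
  set s := t + h; have sc : clp s = s by rewrite clip_id.
  have sth : s - t = h by rewrite /s addrC addKr.
  have ts : t != s by rewrite -subr_eq0 -opprB sth oppr_eq0.
  have ballms : ball (mc t) (Num.min r1 r2) (mc s) by apply: h3; rewrite sth.
  have dVt n tau : 0 < tau < T -> is_derive (tau : R) (1 : R) (fun s => V s x n) (dV tau x n).
    move=> tauT; apply: DeriveDef; first exact: Vder.
    by rewrite -derive1E; exact: dVE.
  (* Three mean values: [tau1] for V in time, [n] for V along the segment of measures, and [tau2]
     for the integral of the linear derivative at [n] along the flow. *)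
  have [tau1 [t1T t1t e1]] := MVT_between (Vcont x (mc s)) (dVt (mc s)) tT thT ts.
  have [VC _ _ _ _] := VC2.
  have [w w01 e3] := lfd_mean_value (lfdP (VC t x tT)) (mc t) (mc s).
  set n := mixture w (mc t) (mc s) in e3.
  have balln : ball (mc t) (Num.min r1 r2) n by exact: mixture_ball.
  have tst := lfd_test2 x n tT; have [pl cl0 _ _ _] := tst.
  have ca : continuous (fun tau => \int[mc tau]_y lfd (V t x) n y).
    exact: continuousT_comp cmc (cvg_Rint_prob_torus cl0 pl).
  have [tau2 [t2T t2t e4]] := MVT_between (continuous_subspaceT ca)
    (FP_derive T0 cb pb flow tst) tT thT ts.
  have -> : along s x - along t x = h * (dV tau1 x (mc s) + J (((t, x), n), tau2)).
    rewrite /along tc sc.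
    have -> : V s x (mc s) - V t x (mc t) =
      (V s x (mc s) - V t x (mc s)) + (V t x (mc s) - V t x (mc t)) by ring.
    have JE : J (((t, x), n), tau2) =
        \int[mc tau2]_y FPgen T b m1 (lfd (V t x) n) tau2 y.
      by rewrite /J /k [(t, x, n, tau2).1.1.1]/= tc.
    rewrite sth in e1 e4; rewrite e1 e3 e4 -JE.
    by rewrite [RHS]mulrDr.
  rewrite -mulrBr normrM mulrC ler_wpM2r// /D.
  have -> : dV tau1 x (mc s) + J (t, x, n, tau2) - (dV (clp t) x (mc t) + J (t, x, mc t, t)) =
    (dV (clp tau1) x (mc s) - dV (clp t) x (mc t)) + (J (t, x, n, tau2) - J (t, x, mc t, t)).
    have /andP[a1 a2] := t1T; have -> : clp tau1 = tau1 by rewrite clip_id// !ltW.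
    by ring.
  rewrite (le_trans (ler_normD _ _))// (splitr e) lerD//.
    apply: h1; first by rewrite (lt_trans t1t)// sth.
    by apply: le_ball ballms; rewrite ge_min lexx.
  apply: h2; first by rewrite (lt_trans t2t)// sth.
  by apply: le_ball balln; rewrite ge_min lexx orbT.
Qed.

Lemma along_C1 : exists D : R -> 'rV[R]_d -> R,
  [/\ continuous (fun z : R * 'rV[R]_d => D z.1 z.2),
      forall t x, 0 < t < T -> D t x = Dbeta b V t x (m1 t),
      forall t x, 0 < t < T -> is_derive (t : R) (1 : R) (along^~ x) (D t x)
      & forall x, continuous (along^~ x)].
Proof.
have [D [cD DE hD]] := along_derivative.
exists D; split => //.
- move=> t x /andP[t0 tT]; apply: is_derive_eps => e e0.
  have [|r r0 hr] := hD t x _ _ e0; first by rewrite !ltW.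
  have m0' : 0 < Num.min t (T - t) by rewrite lt_min t0 subr_gt0.
  exists (Num.min r (Num.min t (T - t))) => [|h]; first by rewrite lt_min r0.
  rewrite !lt_min => /and3P[h1 h2 h3]; apply: hr => //.
  move: h2 h3; rewrite !ltr_norml => /andP[h2 _] /andP[_ h3].
  by rewrite !ltW//; lra.
- move=> x.
  (* The expansion gives continuity within [0, T], ends included; composition with [clip] extends it
     to the line. *)
  have wc : {within `[0, T], continuous (along^~ x)}.
    apply: within_itv_continuous_eps => t tT e e0.
    have [r r0 hr] := hD t x tT 1 ltr01.
    pose C := 1 + `|D t x|; have C0 : 0 < C by rewrite ltr_pwDl.
    exists (Num.min r (e / C)) => [|s sT]; first by rewrite lt_min r0 divr_gt0.
    rewrite lt_min => /andP[sr se].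
    have ts : t + (s - t) = s by rewrite addrC subrK.
    have := hr (s - t); rewrite ts => /(_ sT sr); rewrite mul1r => hh.
    move: se; rewrite ltr_pdivlMr// /C mulrDr mulr1 -normrM => se.
    rewrite (le_trans _ (ltW se))// -lerBlDr (le_trans _ hh)//.
    exact: lerB_dist.
  have h (t : R) : `[0, T]%classic (clp t) by rewrite /= in_itv /=; exact: clip_itv.
  apply: (eq_continuousT _ (@continuous_comp_within _ _ _ _ (along^~ x) (clip T) wc
    (@clip_continuous _ T) h)) => t; rewrite /= /along /flow_clip.
  by have -> : clp (clp t) = clp t by rewrite clip_id.
Qed.

End chain_rule.

(** * Bounds on the coefficients *)

Lemma ae_mono2 (R : realType) d (X : measurableType d) (m : {measure set X -> \bar R})
    (P Q S : X -> Prop) : {ae m, forall x, P x} -> {ae m, forall x, Q x} ->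
  (forall x, P x -> Q x -> S x) -> {ae m, forall x, S x}.
Proof. by move=> h1 h2 h; apply: filterS2 h1 h2 => x; exact: h. Qed.

Section finite_dimension.
Context {R : realType}.

Lemma enorm_ge0 m n (A : 'M[R]_(m, n)) : 0 <= enorm A.
Proof. exact: sqrtr_ge0. Qed.

Lemma enorm_sqr m n (A : 'M[R]_(m, n)) : enorm A ^+ 2 = \sum_i \sum_j A i j ^+ 2.
Proof.
by rewrite sqr_sqrtr//; apply: sumr_ge0 => i _; apply: sumr_ge0 => j _; exact: sqr_ge0.
Qed.

Lemma enorm_row_sqr n (u : 'rV[R]_n) : enorm u ^+ 2 = \sum_i u ord0 i ^+ 2.
Proof. by rewrite enorm_sqr big_ord1. Qed.

Lemma sum_CauchySchwarz n (u v : 'I_n -> R) :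
  (\sum_i u i * v i) ^+ 2 <= (\sum_i u i ^+ 2) * (\sum_i v i ^+ 2).
Proof.
set A := \sum_i u i ^+ 2; set B := \sum_i u i * v i; set C := \sum_i v i ^+ 2.
have C0 : 0 <= C by apply: sumr_ge0 => i _; exact: sqr_ge0.
have key (s : R) : 0 <= A - 2 * s * B + s ^+ 2 * C.
  rewrite (_ : A - _ + _ = \sum_i (u i - s * v i) ^+ 2).
    by apply: sumr_ge0 => i _; exact: sqr_ge0.
  rewrite /A /B /C !mulr_sumr -sumrB -big_split; apply: eq_bigr => i _ /=; ring.
have [C1|C1] := eqVneq C 0.
  have h i : v i = 0.
    have /eqP : v i ^+ 2 = 0.
      apply/eqP; rewrite eq_le sqr_ge0 andbT -C1 /C (bigD1 i)//= lerDl.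
      by apply: sumr_ge0 => j _; exact: sqr_ge0.
    by rewrite sqrf_eq0 => /eqP.
  by rewrite /B big1 ?expr0n ?C1 ?mulr0//= => i _; rewrite h mulr0.
have Cp : 0 < C by rewrite lt_def C1.
have := key (B / C).
rewrite (_ : A - _ + _ = A - B ^+ 2 / C); last by field.
by rewrite subr_ge0 ler_pdivrMr.
Qed.

Lemma dot_CauchySchwarz n (u v : 'rV[R]_n) : dot u v ^+ 2 <= enorm u ^+ 2 * enorm v ^+ 2.
Proof. by rewrite dotE !enorm_row_sqr; exact: sum_CauchySchwarz. Qed.

Lemma normr_dot_le n (u v : 'rV[R]_n) : `|dot u v| <= enorm u * enorm v.
Proof.
rewrite -(@ler_pXn2r _ 2)// ?nnegrE ?mulr_ge0 ?enorm_ge0//.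
by rewrite exprMn real_normK ?num_real// dot_CauchySchwarz.
Qed.

Lemma enorm_mulmx_le n p (u : 'rV[R]_n) (A : 'M[R]_(n, p)) :
  enorm (u *m A) <= enorm u * enorm A.
Proof.
rewrite -(@ler_pXn2r _ 2)// ?nnegrE ?mulr_ge0 ?enorm_ge0// exprMn.
rewrite enorm_row_sqr (enorm_sqr A) exchange_big/= mulr_sumr; apply: ler_sum => j _.
by rewrite mxE enorm_row_sqr; exact: sum_CauchySchwarz.
Qed.

Lemma bilinear_form_le n (u v : 'rV[R]_n) (A : 'M[R]_n) :
  `|(u *m A *m v^T) ord0 ord0| <= enorm u * enorm A * enorm v.
Proof.
rewrite -[X in `|X|]/(dot (u *m A) v) (le_trans (normr_dot_le _ _))//.
by rewrite ler_wpM2r ?enorm_ge0// enorm_mulmx_le.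
Qed.

Lemma continuous_enorm (X : topologicalType) m n (f : X -> 'M[R]_(m, n)) :
  (forall i j, continuous (fun x => f x i j)) -> continuous (fun x => enorm (f x)).
Proof.
move=> cf; apply: (@continuousT_comp _ _ _ (fun x => \sum_i \sum_j f x i j ^+ 2) Num.sqrt);
  last exact: sqrt_continuous.
apply: continuous_sum_fun => i; apply: continuous_sum_fun => j.
under eq_fun do rewrite expr2.
by apply: continuousT_mul; exact: cf.
Qed.

End finite_dimension.

(** * From essential bounds to pointwise bounds *)

Section essential_bounds.
Context {R : realType} {d : nat}.
Variables (T : R) (T0 : 0 < T).
Notation mu := (torus_leb R d).
Notation leb := (@lebesgue_measure R).
Notation clp := (clip T).

Lemma Lnorm_pinfty_bound d1 (X : measurableType d1) (m : {measure set X -> \bar R})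
    (f : X -> R) (Q B : set X) (M : R) :
  measurable B -> B `<=` Q -> (0 < m B)%E ->
  (Lnorm m +oo%E ((fun z => (f z)%:E) \_ Q) <= M%:E)%E ->
  exists2 z, B z & `|f z| <= M.
Proof.
move=> mB BQ B0; rewrite unlock ifT; last first.
  by apply: lt_le_trans B0 _; apply: le_measure; rewrite ?inE.
move=> /ess_sup_inf.ess_supP[N [mN N0 hN]]; apply: contrapT => h.
have BN : B `<=` N.
  move=> z Bz; apply: hN => /= hz; apply: h; exists z => //.
  by move: hz; rewrite patchE mem_set; last exact: BQ.
have := lt_le_trans B0 (le_measure m (mem_set mB) (mem_set mN) BN).
by move=> /gt_eqF/eqP; apply; exact: N0.
Qed.

(** A box placed above [x0] and inside the cube, since the torus measure charges nothing outside. It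
    is never empty for [x0] in the half-open cube, even when [x0] lies on a face. *)
Definition above_box (x0 : 'rV[R]_d) (r : R) : set 'rV[R]_d :=
  [set x : 'rV[R]_d | forall j, x0 ord0 j < x ord0 j < Num.min 1 (x0 ord0 j + r)].

Lemma above_box_measurable x0 r : measurable (above_box x0 r).
Proof.
rewrite (_ : above_box x0 r = \bigcap_(i in [set: 'I_d])
    ((fun x : 'rV[R]_d => x ord0 i) @^-1` `]x0 ord0 i, (Num.min 1 (x0 ord0 i + r))[)).
  apply: fin_bigcap_measurable => // i _; rewrite -[X in measurable X]setTI.
  by apply: (@measurable_coord R d i measurableT); exact: measurable_itv.
apply/seteqP; split => [x h i _|x h i] /=; first by rewrite in_itv/=; exact: h.
by have := h i I; rewrite /= in_itv.
Qed.

Lemma above_box_gt0 x0 r : 0 < r -> unit_cube x0 -> (0 < mu (above_box x0 r))%E.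
Proof.
move=> r0 hx; apply: torus_open_box => j; have /andP[h1 h2] := hx j.
by rewrite lt_min h2 ltrDl r0 ge_min lexx.
Qed.

Lemma cyl_box_gt0 (t u : R) x0 r : t < u -> 0 < r -> unit_cube x0 ->
  (0 < @cyl_leb R d (`]t, u[%classic `*` above_box x0 r))%E.
Proof.
move=> tu r0 hx.
have mA : measurable (`]t, u[%classic : set (measurableTypeR R)) by exact: measurable_itv.
have e := @product_measure1E _ _ _ _ _ leb mu _ _ mA (above_box_measurable x0 r).
rewrite -[cyl_leb _]/((leb \x mu)%E _) [X in (_ < X)%E]e mule_gt0 ?above_box_gt0//.
have e2 : leb (`]t, u[%classic : set R) = (u - t)%:E by rewrite lebesgue_measure_itv /= lte_fin tu.
by rewrite [X in (_ < X)%E]e2 lte_fin subr_gt0.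
Qed.

Lemma above_box_ball x0 r x : 0 < r -> above_box x0 r x -> ball x0 r x.
Proof.
move=> r0 h; split => // i j; rewrite !ord1 /ball/=.
have /andP[h1] := h j; rewrite lt_min => /andP[_ h2].
by rewrite distrC gtr0_norm ?subr_gt0// ltrBlDl.
Qed.

(** A violation at one point would, by continuity, hold on a box of positive measure; periodicity
    first brings that point into the cube. *)
Lemma Linf_QT_bound (F : R -> 'rV[R]_d -> R) (M : R) :
  continuous (fun z : R * 'rV[R]_d => F (clp z.1) z.2) ->
  (forall t, 0 < t < T -> Zperiodic (F t)) ->
  (Linf_QT T F <= M%:E)%E -> forall t x, 0 < t < T -> `|F t x| <= M.
Proof.
move=> cF pF hL t x0 tT; rewrite leNgt; apply/negP => Mlt.
have [k kx] := unit_cube_repr x0; rewrite -(pF t tT x0 k) in Mlt.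
set x := x0 + _ in kx Mlt; have /andP[t0 tT'] := tT.
have ct s : 0 < s < T -> clp s = s by move=> /andP[? ?]; rewrite clip_id// !ltW.
have /nbhs_ballP[r /= r0 hr] : \forall z \near (t, x), M < `|F (clp z.1) z.2|.
  have e0 : 0 < `|F t x| - M by rewrite subr_gt0.
  have := cF (t, x) => /cvgrPdist_lt /(_ _ e0); apply: filterS => z /=.
  rewrite (ct t)// => h; have := lerB_dist (F t x) (F (clp z.1) z.2); lra.
pose u := Num.min T (t + r).
have tu : t < u by rewrite lt_min tT' ltrDl.
have mA : measurable (`]t, u[%classic : set (measurableTypeR R)) by exact: measurable_itv.
have mB := above_box_measurable x r.
have [|||[s y] [/= hs hy] hM] :=
    @Lnorm_pinfty_bound _ _ (@cyl_leb R d) (fun z => F z.1 z.2) (@cylinder R d T) (`]t, u[%classic `*` above_box x r) _ _ _ _ hL.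
- exact: measurableX.
- move=> [s y] [/=]; rewrite in_itv/= lt_min => /andP[ts /andP[sT _]] _.
  by rewrite /cylinder/= (lt_trans t0 ts) sT.
- exact: cyl_box_gt0.
move: hs; rewrite in_itv/= lt_min => /andP[ts /andP[sT sr]].
have := hr (s, y); rewrite /= ct ?sT ?(lt_trans t0)// ltNge hM => /(_ _) h.
have : false by apply: h; split => /=; [rewrite /ball/= distrC gtr0_norm ?subr_gt0// ltrBlDl|exact: above_box_ball].
by [].
Qed.

Lemma Linf_QT_Td_bound (F : R -> 'rV[R]_d -> 'rV[R]_d -> R) (M : R) :
  continuous (fun z : R * 'rV[R]_d * 'rV[R]_d => F (clp z.1.1) z.1.2 z.2) ->
  (forall t y, 0 < t < T -> Zperiodic (fun x => F t x y)) ->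
  (forall t x, 0 < t < T -> Zperiodic (F t x)) ->
  (Linf_QT_Td T F <= M%:E)%E -> forall t x y, 0 < t < T -> `|F t x y| <= M.
Proof.
move=> cF pF pF' hL t x0 y0 tT; rewrite leNgt; apply/negP => Mlt.
have [k kx] := unit_cube_repr x0; rewrite -(pF t y0 tT x0 k) in Mlt.
have [k' ky] := unit_cube_repr y0; rewrite -(pF' t _ tT y0 k') in Mlt.
set x := x0 + _ in kx Mlt; set y := y0 + _ in ky Mlt; have /andP[t0 tT'] := tT.
have ct s : 0 < s < T -> clp s = s by move=> /andP[? ?]; rewrite clip_id// !ltW.
have /nbhs_ballP[r /= r0 hr] : \forall z \near (t, x, y), M < `|F (clp z.1.1) z.1.2 z.2|.
  have e0 : 0 < `|F t x y| - M by rewrite subr_gt0.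
  have := cF (t, x, y) => /cvgrPdist_lt /(_ _ e0); apply: filterS => z /=.
  rewrite (ct t)// => h; have := lerB_dist (F t x y) (F (clp z.1.1) z.1.2 z.2); lra.
pose u := Num.min T (t + r).
have tu : t < u by rewrite lt_min tT' ltrDl.
have mA : measurable (`]t, u[%classic : set (measurableTypeR R)) by exact: measurable_itv.
have mB := above_box_measurable x r; have mC := above_box_measurable y r.
have mAB : measurable (`]t, u[%classic `*` above_box x r) by exact: measurableX.
have [|||[[s x'] y'] [/= [hs hx] hy] hM] :=
    @Lnorm_pinfty_bound _ _ (@cyl_leb R d \x torus_leb R d)%E
      (fun z => F z.1.1 z.1.2 z.2) [set z | cylinder T z.1]
      ((`]t, u[%classic `*` above_box x r) `*` above_box y r) _ _ _ _ hL.
- exact: measurableX.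
- move=> [[s x'] y'] [/= [/=]]; rewrite in_itv/= lt_min => /andP[ts /andP[sT _]] _ _.
  by rewrite /cylinder/= (lt_trans t0 ts) sT.
- have e := @product_measure1E _ _ _ _ _ (@cyl_leb R d) mu _ _ mAB mC.
  by rewrite [X in (_ < X)%E]e mule_gt0 ?above_box_gt0// cyl_box_gt0.
move: hs; rewrite in_itv/= lt_min => /andP[ts /andP[sT sr]].
have := hr (s, x', y'); rewrite /= ct ?sT ?(lt_trans t0)// ltNge hM => /(_ _) h.
have : false.
  apply: h; split => /=; last exact: above_box_ball.
  split => /=; last exact: above_box_ball.
  by rewrite /ball/= distrC gtr0_norm ?subr_gt0// ltrBlDl.
by [].
Qed.

End essential_bounds.

Lemma continuous_Rint01 (R : realType) (Z : topologicalType) (k : Z -> R -> R) :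
  continuous (fun w : Z * R => k w.1 w.2) ->
  continuous (fun z => \int[@lebesgue_measure R]_(s in `[0, 1]) k z s).
Proof.
move=> ck.
have ckz z : continuous (k z).
  apply: (@continuousT_comp _ _ _ (fun y => (z, y)) _ _ ck).
  by apply: continuousT_pair; [exact: continuousT_cst|exact: continuousT_id].
have ik z : itg (uniform_prob (@ltr01 R)) (k z) by exact: itg_uniform_continuous.
have kE z : \int[@lebesgue_measure R]_(s in `[0, 1]) k z s =
    \int[uniform_prob (@ltr01 R)]_s k z s.
  by rewrite Rint_uniform ?subr0 ?invr1 ?mul1r//; exact: itg_measurable (ik z).
apply: continuous_dist => z0 e e0.
have := @tube_near R Z R (`[0, 1]%classic : set R) k z0 (@segment_compact R 0 1) (fun y _ => ck (z0, y)) _ e0.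
apply: filterS => z hz; rewrite !kE -RintB// (le_trans (Rint_normr_le _))//; first exact: itgB.
rewrite -[leRHS](@Rint_cst _ _ _ (uniform_prob (@ltr01 R))); apply: Rint_ae_le.
- by apply: itg_abs; exact: itgB.
- exact: itg_cst.
- move: (ae_uniform_itv (@ltr01 R)).
  apply: filterS; first exact: (ae_filter_ringOfSetsType (uniform_prob (@ltr01 R))).
  move=> s /andP[s0 s1].
  by rewrite ltW// hz//= in_itv/= !ltW.
Qed.

Section coefficients.
Context {R : realType} {d : nat}.
Variables (T : R) (T0 : 0 < T) (H : 'rV[R]_d -> 'rV[R]_d -> R)
  (U1 U2 : R -> 'rV[R]_d -> prob_torus R d -> R).
Notation P := (prob_torus R d).
Notation mu := (torus_leb R d).
Notation clp := (clip T).
Hypotheses (hH : hamiltonian H) (pU1 : forall t, Zperiodic (U1 t))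
  (pU2 : forall t, Zperiodic (U2 t)) (C1 : C2_space T U1) (C2 : C2_space T U2)
  (Cm2 : C1_measure_C2 T U2).
Notation Ud := (Udiff U1 U2).

Let T0' : 0 <= T. Proof. exact: ltW. Qed.

Lemma Dx_Udiff t x m : 0 <= t <= T -> Dx Ud t x m = Dx U1 t x m - Dx U2 t x m.
Proof.
move=> tT; have [h1 _ _] := C1; have [h2 _ _] := C2.
apply/rowP => i; rewrite !mxE.
exact: (deriveB ((h1 t m tT).1 x i) ((h2 t m tT).1 x i)).
Qed.

Lemma Zperiodic_U (U : R -> 'rV[R]_d -> P -> R) : (forall t, Zperiodic (U t)) ->
  forall t m, Zperiodic (fun x => U t x m).
Proof. by move=> pU t m x k; rewrite pU. Qed.

Lemma Zperiodic_Dx (U : R -> 'rV[R]_d -> P -> R) : (forall t, Zperiodic (U t)) ->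
  forall t m, Zperiodic (fun x => Dx U t x m).
Proof. by move=> pU t m; apply: Zperiodic_grad; exact: Zperiodic_U. Qed.

Lemma Zperiodic_Ud t : Zperiodic (Ud t).
Proof. by move=> x k; rewrite /Udiff pU1 pU2. Qed.

Lemma continuous_segment : continuous (fun z : R * 'rV[R]_d * P * R =>
  Dx U2 (clp z.1.1.1) z.1.1.2 z.1.2 + z.2 *: Dx Ud (clp z.1.1.1) z.1.1.2 z.1.2).
Proof.
have [_ c1 _] := C1; have [_ c2 _] := C2.
have c0 := @continuousT_fst (R * 'rV[R]_d * P)%type R.
have c1' := continuousT_comp c0 (cont_txm_clip T0' c1).
have c2' := continuousT_comp c0 (cont_txm_clip T0' c2).
apply: continuous_rV => i.
have e1 := continuous_entry (i := ord0) (j := i) c1'; have e2 := continuous_entry (i := ord0) (j := i) c2'.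
apply: (eq_continuousT _ (continuousT_add e2 (continuousT_mul
  (@continuousT_snd (R * 'rV[R]_d * P)%type R) (continuousT_sub e1 e2)))) => z.
by rewrite Dx_Udiff ?clip_itv// !mxE.
Qed.

Lemma continuous_bhat i : continuous (fun z : R * 'rV[R]_d * P =>
  bhat H U1 U2 (clp z.1.1) z.1.2 z.2 ord0 i).
Proof.
have [_ _ cp _] := hH.
under eq_fun do rewrite mxE.
apply: (@continuous_Rint01 _ _ (fun z s => DpH H z.1.2
  (Dx U2 (clp z.1.1) z.1.2 z.2 + s *: Dx Ud (clp z.1.1) z.1.2 z.2) ord0 i)).
apply: continuous_entry.
have c : continuous (fun z : R * 'rV[R]_d * P * R => z.1.1.2).
  have c0 := @continuousT_fst (R * 'rV[R]_d * P)%type R.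
  exact: continuousT_comp (continuousT_comp c0 (@continuousT_fst _ _)) (@continuousT_snd _ _).
exact: (continuousT_comp (continuousT_pair c continuous_segment) cp).
Qed.

Lemma continuous_Ahat i j : continuous (fun z : R * 'rV[R]_d * P =>
  Ahat H U1 U2 (clp z.1.1) z.1.2 z.2 i j).
Proof.
have [_ _ _ cp] := hH.
under eq_fun do rewrite mxE.
apply: (@continuous_Rint01 _ _ (fun z s => DppH H z.1.2
  (Dx U2 (clp z.1.1) z.1.2 z.2 + s *: Dx Ud (clp z.1.1) z.1.2 z.2) i j)).
apply: continuous_entry.
have c : continuous (fun z : R * 'rV[R]_d * P * R => z.1.1.2).
  have c0 := @continuousT_fst (R * 'rV[R]_d * P)%type R.
  exact: continuousT_comp (continuousT_comp c0 (@continuousT_fst _ _)) (@continuousT_snd _ _).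
exact: (continuousT_comp (continuousT_pair c continuous_segment) cp).
Qed.

Lemma Zperiodic_bhat t m : Zperiodic (fun x => bhat H U1 U2 t x m).
Proof.
have [pH _ _ _] := hH; move=> x k; apply/rowP => i; rewrite [LHS]mxE [RHS]mxE.
apply: eq_Rintegral => s _.
by rewrite /DpH pH (Zperiodic_Dx pU2) (Zperiodic_Dx Zperiodic_Ud).
Qed.

Lemma Zperiodic_Ahat t m : Zperiodic (fun x => Ahat H U1 U2 t x m).
Proof.
have [pH _ _ _] := hH; move=> x k; apply/matrixP => i j; rewrite [LHS]mxE [RHS]mxE.
apply: eq_Rintegral => s _.
by rewrite /DppH pH (Zperiodic_Dx pU2) (Zperiodic_Dx Zperiodic_Ud).
Qed.

(** For each m the essential bound has its own null set of times, while along the flow m = m1(t)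
    changes with t. Bounds at every point are therefore needed. The four nonnegative terms are
    separated first. *)
Lemma coefficient_bounds (M : R) (rho : R -> 'rV[R]_d -> R) (m0 : P) :
  (ereal_sup (range (fun m =>
      Linf_QT T (fun t x => enorm (bhat H U1 U2 t x m))))
   + ereal_sup (range (fun m =>
      Linf_QT T (fun t y => enorm (Ahat H U1 U2 t y m))))
   + ereal_sup (range (fun m =>
      Linf_QT_Td T (fun t x y => enorm (Dm (U2 t x) m y))))
   + Linf_QT T rho <= M%:E)%E ->
  forall t, 0 < t < T ->
  [/\ forall x m, enorm (bhat H U1 U2 t x m) <= M,
      forall x m, enorm (Ahat H U1 U2 t x m) <= M &
      forall x m y, enorm (Dm (U2 t x) m y) <= M].
Proof.
set X := ereal_sup _; set Y := ereal_sup _; set Z := ereal_sup _; set W := Linf_QT _ _.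
move=> hM.
have sup0 (f : P -> \bar R) : (forall m, 0 <= f m)%E -> (0 <= ereal_sup (range f))%E.
  by move=> f0; apply: (le_trans (f0 m0)); apply: ereal_sup_ubound; exists m0.
have X0 : (0 <= X)%E by apply: sup0 => m; exact: Lnorm_ge0.
have Y0 : (0 <= Y)%E by apply: sup0 => m; exact: Lnorm_ge0.
have Z0 : (0 <= Z)%E by apply: sup0 => m; exact: Lnorm_ge0.
have W0 : (0 <= W)%E by exact: Lnorm_ge0.
have hX : (X <= M%:E)%E.
  by apply: le_trans hM; rewrite -!addeA leeDl// !adde_ge0.
have hY : (Y <= M%:E)%E.
  by apply: le_trans hM; rewrite (addeC X) -!addeA leeDl// !adde_ge0.
have hZ : (Z <= M%:E)%E.
  by apply: le_trans hM; rewrite (addeC _ Z) -!addeA leeDl// !adde_ge0.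
have le1 (f : P -> \bar R) m : (ereal_sup (range f) <= M%:E)%E -> (f m <= M%:E)%E.
  by apply: le_trans; apply: ereal_sup_ubound; exists m.
have cm (m : P) : continuous (fun z : R * 'rV[R]_d => (z, m)).
  by apply: continuousT_pair; [exact: continuousT_id|exact: continuousT_cst].
move=> t tT; split.
- move=> x m; rewrite -[leLHS]ger0_norm ?enorm_ge0//.
  pose F t x := enorm (bhat H U1 U2 t x m).
  have cF : continuous (fun z : R * 'rV[R]_d => F (clp z.1) z.2).
    apply: continuous_enorm => i j; rewrite (ord1 i : i = ord0).
    exact: continuousT_comp (cm m) (@continuous_bhat j).
  have pF s : 0 < s < T -> Zperiodic (F s) by move=> _ y k; rewrite /F Zperiodic_bhat.
  have hF := le1 (fun m => Linf_QT T (fun t x => enorm (bhat H U1 U2 t x m))) m hX.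
  exact: (@Linf_QT_bound R d T F M cF pF hF t x tT).
- move=> x m; rewrite -[leLHS]ger0_norm ?enorm_ge0//.
  pose F t x := enorm (Ahat H U1 U2 t x m).
  have cF : continuous (fun z : R * 'rV[R]_d => F (clp z.1) z.2).
    apply: continuous_enorm => i j.
    exact: continuousT_comp (cm m) (@continuous_Ahat i j).
  have pF s : 0 < s < T -> Zperiodic (F s) by move=> _ y k; rewrite /F Zperiodic_Ahat.
  have hF := le1 (fun m => Linf_QT T (fun t x => enorm (Ahat H U1 U2 t x m))) m hY.
  exact: (@Linf_QT_bound R d T F M cF pF hF t x tT).
- move=> x m y; rewrite -[leLHS]ger0_norm ?enorm_ge0//.
  have [VC _ _ cg _] := Cm2.
  pose F t x y := enorm (Dm (U2 t x) m y).
  have cF : continuous (fun z : R * 'rV[R]_d * 'rV[R]_d => F (clp z.1.1) z.1.2 z.2).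
    apply: continuous_enorm => i j; apply: continuous_entry.
    have c : continuous (fun z : R * 'rV[R]_d * 'rV[R]_d => ((z.1, m), z.2)).
      apply: continuousT_pair; last exact: continuousT_snd.
      by apply: continuousT_pair; [exact: continuousT_fst|exact: continuousT_cst].
    exact: (continuousT_comp c (cont_txmy_clip T0' cg)).
  have pF s z : 0 < s < T -> Zperiodic (fun x => F s x z).
    by move=> _ y' k; rewrite /F pU2.
  have pF' s z : 0 < s < T -> Zperiodic (F s z).
    move=> /andP[s0 sT] y' k; have sT' : 0 <= s <= T by rewrite !ltW.
    have [pl _ _ _] := lfdP (VC s z sT').
    by rewrite /F /Dm Zperiodic_grad.
  have hF := le1 (fun m => Linf_QT_Td T (fun t x y => enorm (Dm (U2 t x) m y))) m hZ.
  exact: (@Linf_QT_Td_bound R d T F M cF pF pF' hF t x y tT).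
Qed.

End coefficients.

(** * Domination of the flow by Lebesgue measure *)

Section flow_density_bound.
Context {R : realType} {d : nat}.
Variables (T : R) (T0 : 0 < T) (b : R -> 'rV[R]_d -> prob_torus R d -> 'rV[R]_d)
  (m0 : prob_torus R d) (m1 : R -> prob_torus R d) (rho : R -> 'rV[R]_d -> R) (M : R).
Notation P := (prob_torus R d).
Notation nu := (uniform_prob T0).
Notation mu := (torus_leb R d).
Notation leb := (@lebesgue_measure R).
Hypotheses (M0 : 0 < M) (flow : density_flow T b m0 m1 rho) (rhoM : (Linf_QT T rho <= M%:E)%E).

(** The density bound fails only on a null set of the product; for almost every t its section at t
    is null, so the bound integrates over every measurable set. *)
Lemma flow_le : {ae nu, forall t, forall A, measurable A -> (m1 t A <= M%:E * mu A)%E}.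
Proof.
have [N [mN N0 hN]] : {ae (leb \x mu)%E, forall z : measurableTypeR R * 'rV[R]_d,
    0 < z.1 < T -> `|rho z.1 z.2| <= M}.
  move: rhoM; rewrite /Linf_QT unlock; case: ifPn => [_|c0 _].
    move=> /ess_sup_inf.ess_supP; apply: filterS => -[t x] /= + tT.
    by rewrite patchE mem_set.
  (* The remaining branch of [Lnorm] is that of a null space, where every property holds almost
     everywhere. *)
  have h : cyl_leb [set: measurableTypeR R * 'rV[R]_d] = 0%E.
    by apply/eqP; rewrite eq_le measure_ge0 andbT leNgt.
  by exists setT; split.
have mxN t : measurable (xsection N t) by exact: measurable_xsection.
have hx : {ae leb, forall t, mu (xsection N t) = 0%E}.
  have h0 : (\int[leb]_t mu (xsection N t) = 0)%E by exact: N0.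
  have := @ae_eq_integral_abs _ _ _ leb setT measurableT (fun t => mu (xsection N t))
    (measurable_fun_xsection _ mN).
  under eq_integral do rewrite gee0_abs//.
  move=> [+ _]; rewrite h0 => /(_ erefl).
  move=> [N' [mN' N0' hN']]; exists N'; split => // s /= hs; apply: hN' => /= h.
  by apply: hs; exact: h I.
have ae1 : {ae nu, forall t, mu (xsection N t) = 0%E}.
  apply: ae_uniform; have [N' [mN' N0' hN']] := hx; exists N'; split => // s /= hs.
  by apply: hN' => /= h; apply: hs.
apply: (ae_mono2 ae1 (ae_uniform_itv T0)).
move=> t Nt /andP[t0 tT] A mA; have tT' : 0 <= t <= T by rewrite !ltW.
rewrite (df_density flow tT' mA).
have mr : measurable_fun setT (fun x => (rho t x)%:E).
  have mt : measurable_fun setT (fun x : 'rV[R]_d => ((t : measurableTypeR R), x)).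
    by apply: measurable_fun_pair; [exact: measurable_cst|exact: measurable_id].
  have mS : measurable [set z : measurableTypeR R * 'rV[R]_d | 0 <= z.1 <= T].
    rewrite (_ : [set _ | _] = `[0, T]%classic `*` setT).
      by apply: measurableX => //; exact: measurable_itv.
    by apply/seteqP; split => -[s x] /=; rewrite in_itv/=; [move=> h; split|case].
  apply/measurable_EFinP.
  by apply: (measurable_comp mS _ (df_measurable flow) mt) => _ [x _ <-].
have -> : (M%:E * mu A = \int[mu]_(x in A) M%:E)%E by rewrite integral_cst.
apply: ae_ge0_le_integral => //.
- by move=> x _; rewrite lee_fin (df_ge0 flow).
- exact: measurable_funTS.
- by move=> x _; rewrite lee_fin ltW.
- exists (xsection N t); split => // x /= h; rewrite /xsection/= inE; apply: hN => /= h2; apply: h => _.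
  by rewrite lee_fin (le_trans (ler_norm _))// h2// t0.
Qed.

Section one_time.
Variable m : P.
Hypothesis mM : forall A, measurable A -> (m A <= M%:E * mu A)%E.

Lemma flow_ge0_integral (f : 'rV[R]_d -> \bar R) : (forall x, 0 <= f x)%E ->
  measurable_fun setT f -> (\int[m]_x f x <= M%:E * \int[mu]_x f x)%E.
Proof.
move=> f0 mf; have M0' : 0 <= M by exact: ltW.
rewrite -[M]/((NngNum M0')%:num) -ge0_integral_mscale//.
apply: ge0_le_measure_integral => // A mA; rewrite /= /mscale /=; exact: mM.
Qed.

Lemma flow_itg f : itg mu f -> itg m f.
Proof.
move=> hf; have mf := itg_measurable hf; apply/integrableP; split; first exact/measurable_EFinP.
apply: le_lt_trans (flow_ge0_integral _ _) _ => //.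
  by apply/measurable_EFinP; exact: measurableT_comp.
by rewrite (itg_EFin (itg_abs hf)) -EFinM ltry.
Qed.

Lemma flow_Rint f : (forall x, 0 <= f x) -> itg mu f ->
  \int[m]_x f x <= M * \int[mu]_x f x.
Proof.
move=> f0 hf; rewrite -lee_fin EFinM -!itg_EFin//; last exact: flow_itg.
apply: flow_ge0_integral; first by move=> x; rewrite lee_fin.
by apply/measurable_EFinP; exact: itg_measurable hf.
Qed.

Lemma measurable_enorm (G : 'rV[R]_d -> 'rV[R]_d) :
  (forall i, measurable_fun setT (fun x => G x ord0 i)) ->
  measurable_fun setT (fun x => enorm (G x)).
Proof.
move=> mG; have -> : (fun x => enorm (G x)) = Num.sqrt \o (fun x => \sum_j G x ord0 j ^+ 2).
  by apply/funext => x /=; rewrite /enorm big_ord1.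
apply: measurableT_comp; first exact: continuous_measurable_fun (@sqrt_continuous R).
by apply: measurable_sum => i; exact: measurable_funX.
Qed.

Lemma nonlocal_bound (DU : 'rV[R]_d -> 'rV[R]_d) (A : 'rV[R]_d -> 'M[R]_d)
    (G : 'rV[R]_d -> 'rV[R]_d) :
  (forall i, continuous (fun y => DU y ord0 i)) ->
  (forall i j, continuous (fun y => A y i j)) ->
  (forall y, enorm (DU y) <= M) -> (forall y, enorm (A y) <= M) ->
  (forall i, sqi mu (fun y => G y ord0 i)) ->
  (\int[m]_y (DU y *m A y *m (G y)^T) ord0 ord0) ^+ 2 <=
    M ^+ 6 * \int[mu]_y (enorm (G y) ^+ 2).
Proof.
move=> cDU cA DUM AM sG; have M0' : 0 <= M by exact: ltW.
have sG2 : sqi mu (fun y => enorm (G y)).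
  split; first by apply: measurable_enorm => i; exact: (sG i).1.
  rewrite (_ : (fun _ => _) = fun y => \sum_i G y ord0 i ^+ 2); last first.
    by apply/funext => y; exact: enorm_row_sqr.
  by apply: itg_sum => i; exact: (sG i).2.
have iG := sqi_itg sG2.
set q := fun y => _.
have qE : q = fun y => \sum_j (\sum_i DU y ord0 i * A y i j) * G y ord0 j.
  by apply/funext => y; rewrite /q mxE; apply: eq_bigr => j _; rewrite !mxE.
have mq : measurable_fun setT q.
  rewrite qE; apply: measurable_sum => j; apply: measurable_funM; last exact: (sG j).1.
  apply: measurable_rV_continuous; apply: continuous_sum_fun => i.
  by apply: continuousT_mul.
have qle y : `|q y| <= M ^+ 2 * enorm (G y).
  rewrite /q (le_trans (bilinear_form_le _ _ _))// ler_wpM2r ?enorm_ge0// expr2.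
  by rewrite ler_pM ?enorm_ge0.
have iG' := itgZ (M ^+ 2) iG.
have iq : itg mu q.
  apply: (itg_le mq _ iG') => y; rewrite [leRHS]ger0_norm ?mulr_ge0 ?sqr_ge0 ?enorm_ge0//.
have imq := flow_itg iq.
have h1 : `|\int[m]_y q y| <= M ^+ 3 * \int[mu]_y enorm (G y).
  rewrite (le_trans (Rint_normr_le imq))//.
  rewrite (le_trans (flow_Rint _ (itg_abs iq)))//.
  rewrite exprS -mulrA ler_wpM2l// -RintZ//.
  by apply: Rint_le => //; exact: itg_abs.
rewrite -(real_normK (num_real (\int[m]_y q y))).
have h2 : 0 <= M ^+ 3 * \int[mu]_y enorm (G y).
  by rewrite mulr_ge0 ?exprn_ge0// Rintegral_ge0// => y _; exact: enorm_ge0.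
rewrite (@le_trans _ _ ((M ^+ 3 * \int[mu]_y enorm (G y)) ^+ 2))//.
  by rewrite lerXn2r ?nnegrE.
rewrite exprMn -exprM ler_wpM2l ?exprn_ge0//.
exact: sqr_Rint_le.
Qed.

End one_time.

End flow_density_bound.

(** * The weighted energy estimate *)

Lemma exists_of_ae (R : realType) d (X : measurableType d) (P : probability X R)
    (Q : X -> Prop) : {ae P, forall x, Q x} -> exists x, Q x.
Proof.
move=> [N [mN N0 hN]]; apply: contrapT => h.
have NT : N = setT by apply/seteqP; split => // s _; apply: hN => /= hs; apply: h; exists s.
have := probability_setT P; rewrite -NT => e; move: N0; rewrite e => /eqP.
by rewrite onee_eq0.
Qed.

Lemma ae_forall_ord (R : realType) d (X : measurableType d) (m : {measure set X -> \bar R})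
    n (Q : 'I_n -> X -> Prop) : (forall i, {ae m, forall x, Q i x}) ->
  {ae m, forall x, forall i, Q i x}.
Proof.
move=> h; have : {ae m, forall x, forall k : nat,
    if insub k is Some i then Q i x else True}.
  apply: ae_foralln => k; case: insubP => [i _ _|_]; first exact: h.
  exact: aeW.
by apply: filterS => x hx i; have := hx i; rewrite valK.
Qed.

Lemma is_derive_mul_sqr (R : realType) (w u : R -> R) (t dw du : R) :
  is_derive (t : R) (1 : R) w dw -> is_derive (t : R) (1 : R) u du ->
  is_derive (t : R) (1 : R) (fun t => w t * u t ^+ 2) (dw * u t ^+ 2 + w t * (2 * (u t * du))).
Proof.
move=> [d1 d2] [d3 d4]; under eq_fun do rewrite expr2.
have d5 : derivable (fun t => u t * u t) t 1 by exact: (derivableM d3 d3).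
apply: DeriveDef; first exact: (derivableM d1 d5).
by rewrite (deriveM d1 d5) (deriveM d3 d3) d2 d4 /GRing.scale /=; ring.
Qed.

Section energy.
Context {R : realType} {d : nat}.
Variables (T : R) (T0 : 0 < T).
Notation nu := (uniform_prob T0).
Notation mu := (torus_leb R d).
Notation pm := (nu \x mu)%E.
Notation patch := (patch_cyl T).
Notation clp := (clip T).

Let T0' : 0 <= T. Proof. exact: ltW. Qed.
Let clipT : clp T = T. Proof. by rewrite clip_id// T0' lexx. Qed.
Let clip0 : clp 0 = 0. Proof. by rewrite clip_id// T0' lexx. Qed.

Variables (v D : R -> 'rV[R]_d -> R) (K : R).
Hypotheses (sv : sqi pm (patch v)) (cD : continuous (fun z : R * 'rV[R]_d => D z.1 z.2))
  (DK : forall t x, `|D t x| <= K)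
  (dv : forall x, @tcube R d x -> forall t, 0 < t < T -> is_derive (t : R) (1 : R) (v^~ x) (D t x))
  (cv : forall x, @tcube R d x -> continuous (v^~ x)).

Lemma patch_cyl_out (f : R -> 'rV[R]_d -> R) t x : ~~ (0 < t < T) -> patch f (t, x) = 0.
Proof. by move=> h; rewrite /patch_cyl patchE memNset//; exact/negP. Qed.

Lemma patch_section (f : R -> 'rV[R]_d -> R) t : measurable_fun setT (patch f) -> 0 < t < T ->
  measurable_fun setT (f t).
Proof.
move=> mf tT; rewrite (_ : f t = fun x => patch f ((t : measurableTypeR R), x)).
  apply: (measurableT_comp mf).
  by apply: measurable_fun_pair; [exact: measurable_cst|exact: measurable_id].
by apply/funext => x; rewrite patch_cylE.
Qed.

Lemma ae_tcube : {ae mu, forall x, @tcube R d x}.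
Proof. by apply: filterS (ae_unit_cube (torus_unit_cube R d)) => x /(@unit_cubeW R d). Qed.

Lemma v_lipschitz x t s : @tcube R d x -> 0 <= t <= T -> 0 <= s <= T ->
  `|v s x - v t x| <= K * `|s - t|.
Proof.
move=> xK tT sT; have [->|ts] := eqVneq t s; first by rewrite !subrr normr0 mulr0.
have [c [_ _ ->]] := MVT_between (continuous_subspaceT (cv xK)) (dv xK) tT sT ts.
by rewrite normrM mulrC ler_wpM2r.
Qed.

(** Joint measurability is known on the open cylinder only; slices at 0 and T are limits of interior
    slices. *)
Lemma measurable_slice (t : R) : 0 <= t <= T -> (forall x, continuous (v^~ x)) ->
  measurable_fun setT (v t).
Proof.
move=> tT cva; have mv := sv.1.
(* Moving towards T / 2 gives times strictly inside (0, T) even when t is an endpoint. *)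
pose s n := t + (T / 2 - t) / n.+1%:R.
have sT n : 0 < s n < T.
  have n0 : (0 : R) < n.+1%:R^-1 by rewrite invr_gt0.
  have n1 : n.+1%:R^-1 <= (1 : R) by rewrite invf_le1// ler1n.
  have /andP[t0 t1] := tT; rewrite /s; set q := _^-1 in n0 n1 *.
  apply/andP; split.
    have : 0 <= t * (1 - q) by rewrite mulr_ge0// subr_ge0.
    have : 0 < T * q by rewrite mulr_gt0.
    by lra.
  have : 0 <= (T - t) * (1 - q) by rewrite mulr_ge0// subr_ge0.
  have : 0 < T * q by rewrite mulr_gt0.
  by lra.
have sct : s n @[n --> \oo] --> t.
  rewrite -[X in _ --> X]addr0; apply: cvgD; first exact: cvg_cst.
  rewrite -[X in _ --> X](mulr0 (T / 2 - t)); apply: cvgM; first exact: cvg_cst.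
  exact: cvg_harmonic.
have key (x : 'rV[R]_d) : v (s n) x @[n --> \oo] --> v t x.
  exact: (cvg_comp _ _ sct (cva x t)).
apply: (@measurable_fun_cvg _ _ _ _ (fun n => v (s n))).
  by move=> n; exact: patch_section.
by move=> x _; exact: key.
Qed.

(** Fubini gives one square integrable interior slice, and every other slice differs from it by at
    most K T on the cube. *)
Lemma sqi_slice t : 0 <= t <= T -> measurable_fun setT (v t) -> sqi mu (v t).
Proof.
move=> tT mt.
have [s [sT [ms is2]]] : exists s, 0 < s < T /\ sqi mu (v s).
  apply: (@exists_of_ae _ _ _ nu).
  apply: (ae_mono2 (sqi_section sv) (ae_uniform_itv T0)) => s + sT.
  rewrite (_ : (fun y => patch v (s, y)) = v s)//.
  by apply/funext => y; rewrite patch_cylE.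
have sT' : 0 <= s <= T by have /andP[? ?] := sT; rewrite !ltW.
have sd : sqi mu (fun x => v s x + K * T).
  by apply: sqiD => //; exact: sqi_cst.
split => //.
have h2 : itg mu (fun x => 2 * v s x ^+ 2 + 2 * (K * T) ^+ 2).
  by apply: itgD; [exact: itgZ|exact: itg_cst].
apply/integrableP; split; first by apply/measurable_EFinP; exact: measurable_funX.
apply: le_lt_trans (_ : (\int[mu]_x `|(2 * v s x ^+ 2 + 2 * (K * T) ^+ 2)%:E| < +oo)%E); last first.
  by case/integrableP : h2.
apply: ae_ge0_le_integral => //.
- apply/measurable_EFinP; apply: measurableT_comp => //; exact: measurable_funX.
- by apply/measurable_EFinP; apply: measurableT_comp => //; exact: itg_measurable h2.
apply: filterS ae_tcube => x xK _.
have r0 : 0 <= 2 * v s x ^+ 2 + 2 * (K * T) ^+ 2.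
  by apply: addr_ge0; apply: mulr_ge0 => //; exact: sqr_ge0.
rewrite lee_fin (ger0_norm (sqr_ge0 _)) (ger0_norm r0).
have h := v_lipschitz xK sT' tT.
have K0 : 0 <= K by rewrite (le_trans _ (DK 0 0)).
have h' : `|v t x - v s x| <= K * T.
  rewrite (le_trans h)// ler_wpM2l// ler_norml.
  by have /andP[? ?] := sT'; have /andP[? ?] := tT; apply/andP; split; lra.
have h3 : (v t x - v s x) ^+ 2 <= (K * T) ^+ 2.
  by rewrite -(real_normK (num_real (_ - _))) lerXn2r ?nnegrE// mulr_ge0.
have : 0 <= (v t x - 2 * v s x) ^+ 2 by exact: sqr_ge0.
nra.
Qed.

Variables (g : R -> 'rV[R]_d -> 'rV[R]_d) (tr : R -> 'rV[R]_d -> R).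
Notation gi i := (patch (fun t x => g t x ord0 i)).
Hypotheses (sg : forall i, sqi pm (gi i)) (str : sqi pm (patch tr))
  (hid : {ae nu, forall t, \sum_i \int[mu]_x (g t x ord0 i ^+ 2) =
    - \int[mu]_x (v t x * tr t x)}).

(** Minus the time derivative and minus the Laplacian of [v], with [tr] as the Laplacian. Only its
    integrated identity [hid] with the gradient enters, so [tr] can be the trace of a weak Hessian
    or a classical Laplacian. *)
Definition source t x : R := - D t x - tr t x.

Lemma measurable_patch_continuous (f : R -> 'rV[R]_d -> R) :
  continuous (fun z : R * 'rV[R]_d => f z.1 z.2) -> measurable_fun setT (patch f).
Proof.
move=> cf; apply/(measurable_restrictT _ (@measurable_cylinder R d T)).
by apply: measurable_funTS; exact: measurable_RrV_continuous cf.
Qed.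

Lemma source_patch : patch source = (fun z => - patch D z - patch tr z).
Proof.
apply/funext => -[t x]; have [tT|tT] := boolP (0 < t < T); first by rewrite !patch_cylE.
by rewrite !patch_cyl_out// subr0 oppr0.
Qed.

Lemma sqi_source : sqi pm (patch source).
Proof.
rewrite source_patch; apply: sqiB => //; apply: sqiN.
apply: (@sqi_bounded _ _ _ _ _ K); first exact: measurable_patch_continuous.
move=> [t x]; have [tT|tT] := boolP (0 < t < T); first by rewrite patch_cylE.
by rewrite patch_cyl_out// normr0 (le_trans _ (DK 0 0)).
Qed.

Variables (W psi : R -> R) (kappa : R) (vT : 'rV[R]_d -> R).
Hypotheses (cW : continuous (fun t => W (clp t))) (cpsi : continuous (fun t => psi (clp t)))
  (W0 : forall t, 0 < W t) (k0 : 0 < kappa)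
  (dW : forall t, 0 < t < T -> is_derive (t : R) (1 : R) W (2 * psi t * W t))
  (psik : forall t, 0 < t < T -> kappa <= psi t)
  (svT : sqi mu vT) (vTE : forall x, @tcube R d x -> vT x = v T x).

Notation Wz := (fun z : measurableTypeR R * 'rV[R]_d => W (clp z.1)).

Lemma clip_bounded (f : R -> R) : continuous (fun t => f (clp t)) ->
  exists C, forall t, `|f (clp t)| <= C.
Proof.
move=> cf; have /compact_bounded[C [_ /(_ (C + 1))]] :=
  continuous_compact (continuous_subspaceT (A := `[0, T]%classic) cf) (@segment_compact R 0 T).
rewrite ltrDl ltr01 => /(_ isT) h; exists (C + 1) => t.
apply: h; exists (clp t) => /=; first by rewrite in_itv/=; exact: clip_itv.
by rewrite (@clip_id _ T (clp t))// clip_itv.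
Qed.

Lemma measurable_weight (f : R -> R) : continuous (fun t => f (clp t)) ->
  measurable_fun setT (fun z : measurableTypeR R * 'rV[R]_d => f (clp z.1)).
Proof.
move=> cf; apply: (measurableT_comp (f := fun t : measurableTypeR R => f (clp t))).
  exact: continuous_measurable_fun.
exact: measurable_fst.
Qed.

Lemma itg_weight F : itg pm F -> itg pm (fun z => Wz z * F z).
Proof.
move=> hF; have [C hC] := clip_bounded cW.
under eq_fun do rewrite mulrC.
by apply: (@itgM_bounded _ _ _ _ _ _ C) => //; exact: measurable_weight.
Qed.

Notation g2 := (fun z => \sum_i gi i z ^+ 2).

Lemma itg_g2 : itg pm g2.
Proof. by apply: itg_sum => i; exact: (sg i).2. Qed.

(** The weight is constant in x, so the spatial identity [hid] may be multiplied by it at almost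
    every time. *)
Lemma weighted_cross :
  \int[pm]_z (Wz z * (patch v z * patch tr z)) = - \int[pm]_z (Wz z * g2 z).
Proof.
have i1 := itg_weight (sqi_mul sv str); have i2 := itg_weight itg_g2.
rewrite -RintN// !Rint_fubini1//; last exact: itgN.
apply: Rint_ae.
- exact: itg_measurable (itg_fubini1 i1).
- exact: itg_measurable (itg_fubini1 (itgN i2)).
have aeg : {ae nu, forall t, forall i, itg mu (fun x => gi i (t, x) ^+ 2)}.
  apply: ae_forall_ord => i.
  exact: (itg_section1 (sg i).2).
apply: (ae_mono2 (ae_mono2 hid (ae_uniform_itv T0) (fun t a b => conj a b))
  (ae_mono2 (itg_section1 (sqi_mul sv str)) aeg (fun t a b => conj a b))).
move=> t [ht tT] [h1 h2] /=.
rewrite RintZ// RintN; last by apply: itgZ; exact: itg_sum.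
rewrite RintZ; last exact: itg_sum.
rewrite Rint_sum// -mulrN; congr (_ * _).
under eq_Rintegral do rewrite !patch_cylE//.
apply/eqP; rewrite eq_sym eqr_oppLR -ht; apply/eqP; apply: eq_bigr => i _.
by apply: eq_Rintegral => x _; rewrite patch_cylE.
Qed.

(** At fixed x the fundamental theorem of calculus is applied to W v^2, with W' = 2 psi W and psi >=
    kappa. The factor 1/T reflects that time carries the uniform probability. *)
Lemma weighted_energy :
  2 * (\int[pm]_z (Wz z * g2 z)) + 2 * kappa * (\int[pm]_z (Wz z * patch v z ^+ 2))
   <= T^-1 * (W T * \int[mu]_x (vT x ^+ 2))
     + 2 * \int[pm]_z (Wz z * (patch v z * patch source z)).
Proof.
have sf := sqi_source.
have iv := itg_weight sv.2; have ig := itg_weight itg_g2.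
have ic := itg_weight (sqi_mul sv str); have is_ := itg_weight (sqi_mul sv sf).
pose psiz (z : measurableTypeR R * 'rV[R]_d) := psi (clp z.1).
have ip : itg pm (fun z => Wz z * patch v z ^+ 2 * psiz z).
  have [C hC] := clip_bounded cpsi.
  apply: (itgM_bounded (C := C) iv (measurable_weight cpsi)) => z; exact: hC.
(* The time derivative of W v^2, with the derivative of [v] written as - source - tr. *)
pose J z := 2 * (Wz z * patch v z ^+ 2 * psiz z) - 2 * (Wz z * (patch v z * patch source z))
  - 2 * (Wz z * (patch v z * patch tr z)).
have iJ : itg pm J by apply: itgB; [apply: itgB|]; exact: itgZ.
have JE : \int[pm]_z J z = 2 * (\int[pm]_z (Wz z * patch v z ^+ 2 * psiz z))
    - 2 * (\int[pm]_z (Wz z * (patch v z * patch source z))) + 2 * \int[pm]_z (Wz z * g2 z).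
  rewrite RintB; [|by apply: itgB; exact: itgZ|exact: itgZ].
  rewrite RintB; [|exact: itgZ|exact: itgZ].
  by rewrite !RintZ// weighted_cross mulrN opprK.
have h1 : kappa * (\int[pm]_z (Wz z * patch v z ^+ 2)) <=
    \int[pm]_z (Wz z * patch v z ^+ 2 * psiz z).
  rewrite -RintZ//; apply: Rint_le => //; first exact: itgZ.
  move=> [t x]; have [tT|tT] := boolP (0 < t < T); last first.
    by rewrite patch_cyl_out// expr0n/= !mulr0 mul0r.
  rewrite mulrC; apply: ler_wpM2l.
    by apply: mulr_ge0; [exact: ltW (W0 _)|exact: sqr_ge0].
  rewrite /psiz /= clip_id; first exact: psik.
  by have /andP[? ?] := tT; rewrite !ltW.
have h2 : \int[pm]_z J z <= T^-1 * (W T * \int[mu]_x (vT x ^+ 2)).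
  have -> : T^-1 * (W T * \int[mu]_x (vT x ^+ 2)) = \int[mu]_x (T^-1 * (W T * vT x ^+ 2)).
    by rewrite RintZ; [rewrite RintZ//; exact: svT.2|apply: itgZ; exact: svT.2].
  rewrite Rint_fubini2//.
  apply: Rint_ae_le; [exact: itg_fubini2|by do 2 apply: itgZ; exact: svT.2|].
  apply: filterS ae_tcube => x xK.
  pose Ix t := W (clp t) * (2 * psi (clp t) * v t x ^+ 2 + 2 * (v t x * D t x)).
  have cvx := cv xK.
  have cDx : continuous (D^~ x).
    apply: (@continuousT_comp _ _ _ (fun t => (t, x)) _ _ cD).
    by apply: continuousT_pair; [exact: continuousT_id|exact: continuousT_cst].
  have cI : continuous Ix.
    apply: continuousT_mul => //; apply: continuousT_add.
      apply: continuousT_mul.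
        by apply: continuousT_mul => //; exact: continuousT_cst.
      by under eq_fun do rewrite expr2; exact: continuousT_mul.
    by apply: continuousT_mul; [exact: continuousT_cst|exact: continuousT_mul].
  have -> : \int[nu]_t J (t, x) = \int[nu]_t Ix t.
    apply: Rint_ae.
    - apply: (measurableT_comp (itg_measurable iJ)).
      by apply: measurable_fun_pair; [exact: measurable_id|exact: measurable_cst].
    - exact: continuous_measurable_fun.
    apply: ae_mono2 (ae_uniform_itv T0) (ae_uniform_itv T0) _ => t tT _.
    rewrite /J /Ix /psiz !patch_cylE//= /source; ring.
  have dF t : 0 < t < T ->
      is_derive (t : R) (1 : R) (fun t => W (clp t) * v t x ^+ 2) (Ix t).
    move=> tT; have /andP[t0 tT'] := tT.
    have dWc : is_derive (t : R) (1 : R) (fun t => W (clp t)) (2 * psi t * W t).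
      have := dW tT; apply: near_eq_is_derive => //; near=> s; rewrite clip_id//.
      have s0 : 0 < s by near: s; exact: lt_nbhsr.
      have sT : s < T by near: s; exact: lt_nbhsl.
      by rewrite !ltW.
    have tc : clp t = t by rewrite clip_id// !ltW.
    have := is_derive_mul_sqr dWc (dv xK tT); congr is_derive.
    by rewrite /Ix tc; ring.
  have cF : {within `[0, T], continuous (fun t => W (clp t) * v t x ^+ 2)}.
    apply: continuous_subspaceT; apply: continuousT_mul => //.
    by under eq_fun do rewrite expr2; exact: continuousT_mul.
  rewrite (Rint_uniform_FTC2 T0 cI dF cF) clipT clip0 -(vTE xK) ler_wpM2l ?invr_ge0//.
  (* The value at time 0 enters with a negative sign and is dropped. *)
  by rewrite lerBlDr lerDl mulr_ge0 ?sqr_ge0// ltW.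
lra.
Unshelve. all: by end_near. Qed.

(** Young's inequality with parameter kappa spends half of the zero-order term on the left and
    leaves 1/kappa in front of the source. *)
Lemma carleman_energy :
  2 * (\int[pm]_z (Wz z * g2 z)) + kappa * (\int[pm]_z (Wz z * patch v z ^+ 2))
   <= T^-1 * (W T * \int[mu]_x (vT x ^+ 2))
     + kappa^-1 * \int[pm]_z (Wz z * patch source z ^+ 2).
Proof.
have sf := sqi_source.
have iv := itg_weight sv.2; have if_ := itg_weight sf.2; have ivf := itg_weight (sqi_mul sv sf).
have h : 2 * (\int[pm]_z (Wz z * (patch v z * patch source z))) <=
    kappa * (\int[pm]_z (Wz z * patch v z ^+ 2)) + kappa^-1 * \int[pm]_z (Wz z * patch source z ^+ 2).
  rewrite -!RintZ// -RintD; [|exact: itgZ|exact: itgZ].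
  apply: Rint_le; [exact: itgZ|by apply: itgD; exact: itgZ|].
  move=> z; set p := patch v z; set q := patch source z; set w := Wz z.
  have w0 : 0 <= w by exact: ltW (W0 _).
  have e : kappa * (w * p ^+ 2) + kappa^-1 * (w * q ^+ 2) - 2 * (w * (p * q)) =
    w * kappa * (p - q / kappa) ^+ 2 by field; rewrite gt_eqF.
  rewrite -subr_ge0 e; apply: mulr_ge0; last exact: sqr_ge0.
  by apply: mulr_ge0 => //; exact: ltW.
have := weighted_energy; lra.
Qed.

End energy.

(** * Lower bound for a source of unknown measurability *)

Section lower_integral.
Local Open Scope ereal_scope.
Context {R : realType} {d : measure_display} {X : measurableType d}.
Variable m : {measure set X -> \bar R}.
Import HBNNSimple.

(* No measurability is assumed: the integral of a nonnegative function is the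
   supremum of the integrals of the simple functions below it. *)
Lemma ge0_le_lower_integral (D : set X) (f1 f2 : X -> \bar R) :
  (forall x, D x -> 0 <= f1 x) -> (forall x, D x -> f1 x <= f2 x) ->
  \int[m]_(x in D) f1 x <= \int[m]_(x in D) f2 x.
Proof.
move=> f10 f12.
have f20 x : D x -> 0 <= f2 x by move=> Dx; rewrite (le_trans (f10 x Dx))// f12.
rewrite !ge0_integralE//= ge_ereal_sup// => _ [h/= hf] <-.
apply: ereal_sup_ubound; exists h => //= x; apply: le_trans (hf x) _.
by rewrite !patchE; case: ifPn => //; rewrite inE; exact: f12.
Qed.

End lower_integral.

Section weighted_lower_bound.
Context {R : realType} {d : nat}.
Variables (T : R) (T0 : 0 < T).
Notation nu := (uniform_prob T0).
Notation mu := (torus_leb R d).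
Notation pm := (nu \x mu)%E.
Notation patch := (patch_cyl T).
Notation clp := (clip T).
Notation Q := (@cylinder R d T).
Variables (W : R -> R) (f : R -> 'rV[R]_d -> R) (g2 : measurableTypeR R * 'rV[R]_d -> R).
Hypotheses (cW : continuous (fun t => W (clp t))) (W0 : forall t, 0 < W t)
  (sf : sqi pm (patch f)) (ig : itg pm g2).
Notation Wz := (fun z : measurableTypeR R * 'rV[R]_d => W (clp z.1)).

Lemma cyl_leb_Rint (F : R -> 'rV[R]_d -> R) : (forall t x, 0 <= F t x) -> itg pm (patch F) ->
  (\int[@cyl_leb R d]_(z in Q) (F z.1 z.2)%:E = (T * \int[pm]_z patch F z)%:E)%E.
Proof.
move=> F0 hF; have mp := itg_measurable hF.
rewrite cyl_ge0_integral; last 2 first.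
- by move=> z; rewrite lee_fin.
- by apply/measurable_EFinP; apply/(measurable_restrictT _ (@measurable_cylinder R d T)).
rewrite EFinM -itg_EFin//; congr (_ * _)%E; apply: eq_integral => z _.
by rewrite /patch_cyl !patchE; case: ifP.
Qed.

(** [p] stands for PV along the flow, with no measurability available. The pointwise inequality
    provides a measurable minorant of W p^2, and the integral of a nonnegative function dominates
    that of any such minorant. *)
Lemma weighted_lower (p : R -> 'rV[R]_d -> R) (c1 c6 : R) :
  {ae nu, forall t, forall x, unit_cube x ->
    patch f (t, x) ^+ 2 <= 3 * (p t x ^+ 2 + c1 * g2 (t, x) + c6 * \int[mu]_y g2 (t, y))} ->
  ((T * ((\int[pm]_z (Wz z * patch f z ^+ 2)) / 3 -
     (c1 + c6) * \int[pm]_z (Wz z * g2 z)))%:E <=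
   \int[@cyl_leb R d]_(z in Q) (W z.1 * p z.1 z.2 ^+ 2)%:E)%E.
Proof.
move=> [N [mN N0 hN]].
pose I (t : R) := \int[mu]_y g2 (t, y).
have iI : itg pm (fun z => I z.1).
  by apply: itg_fst; exact: itg_fubini1 ig.
pose l (z : measurableTypeR R * 'rV[R]_d) := patch f z ^+ 2 / 3 - c1 * g2 z - c6 * I z.1.
have il : itg pm l.
  apply: itgB; last exact: itgZ.
  apply: itgB; last exact: itgZ.
  by under eq_fun do rewrite mulrC; apply: itgZ; exact: sf.2.
have iWl : itg pm (fun z => Wz z * l z) by exact: itg_weight.
have iWf := itg_weight cW sf.2; have iWg := itg_weight cW ig; have iWI := itg_weight cW iI.
have El : \int[pm]_z (Wz z * l z) =
    (\int[pm]_z (Wz z * patch f z ^+ 2)) / 3 - (c1 + c6) * \int[pm]_z (Wz z * g2 z).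
  (* Averaging over x before or after weighting is the same, the weight being a function of time. *)
  have e1 : \int[pm]_z (Wz z * I z.1) = \int[pm]_z (Wz z * g2 z).
    rewrite (Rint_fubini1 iWI) (Rint_fubini1 iWg); apply: Rint_ae.
    - exact: itg_measurable (itg_fubini1 iWI).
    - exact: itg_measurable (itg_fubini1 iWg).
    apply: (ae_mono2 (itg_section1 ig) (itg_section1 ig)) => t ht _ /=.
    by rewrite Rint_cst RintZ.
  rewrite mulrDl -{2}e1 [X in X - _]mulrC -!RintZ// opprD addrA.
  rewrite -RintB; [|exact: itgZ|exact: itgZ].
  rewrite -RintB; [|by apply: itgB; exact: itgZ|exact: itgZ].
  by apply: eq_Rintegral => z _; rewrite /l; ring.
(* The exceptional times form a subset of a measurable null set; off [good] the minorant is set to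
   0, which is below W p^2 everywhere. *)
pose good := [set z : measurableTypeR R * 'rV[R]_d | [/\ ~ N z.1, 0 < z.1 < T & unit_cube z.2]].
have mgood : measurable good.
  rewrite (_ : good = (~` N `&` `]0, T[%classic) `*` @unit_cube R d).
    apply: measurableX; last exact: measurable_unit_cube.
    by apply: measurableI; [exact: measurableC|exact: measurable_itv].
  by apply/seteqP; split => -[t x] /=; rewrite in_itv/=; [case|case=> -[]].
pose L z := Num.max 0 (Wz z * l z).
pose Lg (t : R) (x : 'rV[R]_d) := (L \_ good) ((t : measurableTypeR R), x).
have L0 z : 0 <= L z by rewrite le_max lexx.
have Lg0 t x : 0 <= Lg t x by rewrite /Lg patchE; case: ifP.
have iL : itg pm L.
  apply: (itg_le _ _ iWl).
    by apply: measurable_maxr; [exact: measurable_cst|exact: itg_measurable iWl].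
  by move=> z; rewrite (ger0_norm (L0 z)) ge_max normr_ge0 ler_norm.
have iLg : itg pm (L \_ good).
  apply: (itg_le _ _ iL).
    apply/(measurable_restrictT _ mgood); apply: measurable_funTS; exact: itg_measurable iL.
  by move=> z; rewrite patchE; case: ifP => // _; rewrite normr0.
have patchLg : patch Lg = L \_ good.
  apply/funext => -[t x]; rewrite /patch_cyl patchE; case: ifPn => //.
  move=> /negP h; rewrite patchE memNset// => -[_ tT _]; apply: h.
  by rewrite inE.
apply: (@le_trans _ _ (\int[@cyl_leb R d]_(z in Q) (Lg z.1 z.2)%:E)%E); last first.
  apply: ge0_le_lower_integral => -[t x] /= tT; first by rewrite lee_fin.
  rewrite lee_fin /Lg patchE; case: ifPn => [|_]; last by rewrite mulr_ge0 ?sqr_ge0// ltW.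
  rewrite inE => -[/= Nt _ xc].
  have tc : clp t = t by rewrite clip_id//; move: tT => /andP[? ?]; rewrite !ltW.
  have w0 : 0 <= W t by exact: ltW.
  rewrite ge_max mulr_ge0 ?sqr_ge0//= tc ler_wpM2l//.
  have h : patch f (t, x) ^+ 2 <= 3 * (p t x ^+ 2 + c1 * g2 (t, x) + c6 * I t).
    by apply: contrapT => h; apply: Nt; apply: hN => /= /(_ x xc).
  by rewrite /l /=; lra.
rewrite cyl_leb_Rint// ?patchLg// lee_fin ler_wpM2l ?(ltW T0)// -El.
have -> : \int[pm]_z (L \_ good) z = \int[pm]_z L z.
  have aeN : {ae nu, forall t, ~ N t}.
    by exists N; split => // t /= /contrapT.
  rewrite (Rint_fubini1 iLg) (Rint_fubini1 iL); apply: Rint_ae.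
  - exact: itg_measurable (itg_fubini1 iLg).
  - exact: itg_measurable (itg_fubini1 iL).
  apply: (ae_mono2 aeN (ae_uniform_itv T0)) => t Nt tT /=.
  have mp : measurable_fun setT (fun x : 'rV[R]_d => ((t : measurableTypeR R), x)).
    by apply: measurable_fun_pair; [exact: measurable_cst|exact: measurable_id].
  apply: Rint_ae.
  - exact: (measurableT_comp (itg_measurable iLg) mp).
  - exact: (measurableT_comp (itg_measurable iL) mp).
  apply: filterS (ae_unit_cube (torus_unit_cube R d)) => x xc.
  by rewrite patchE mem_set.
by apply: Rint_le => // z; rewrite le_max lexx orbT.
Qed.

End weighted_lower_bound.

(** * The weight and the constants *)

Section weight.
Context {R : realType}.
Variables (T a nu lambda : R).
Hypotheses (T0 : 0 < T) (a0 : 0 < a) (nu1 : 1 < nu) (l0 : 0 < lambda).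

(* The minimum over t >= 0 of the derivative of [(t + a) `^ nu]. *)
Definition phase_rate : R := nu * a `^ (nu - 1).

Lemma phase_rate_gt0 : 0 < phase_rate.
Proof. by rewrite mulr_gt0 ?powR_gt0// (lt_trans ltr01). Qed.

Lemma is_derive_phase (r t : R) : 0 < t + a ->
  is_derive (t : R) (1 : R) (fun t => (t + a) `^ r) (r * (t + a) `^ (r - 1)).
Proof.
move=> ta; have d1 : is_derive (t : R) (1 : R) (fun t : R => t + a) 1.
  apply: DeriveDef; first by apply: derivableD.
  by rewrite deriveD// derive_id derive_cst addr0.
have := @is_derive1_comp _ (fun s : R => s `^ r) (fun t => t + a) t _ _ (is_derive1_powR r ta) d1.
by rewrite mulr1.
Qed.

Lemma continuous_phase_clip (r : R) : continuous (fun t => (clip T t + a) `^ r).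
Proof.
move=> t; apply: (@continuous_comp _ _ _ (clip T) (fun s => (s + a) `^ r)).
  exact: (@clip_continuous _ T).
have h : 0 < clip T t + a.
  by have /andP[h _] := clip_itv (ltW T0) t; rewrite ltr_wpDl.
by apply: differentiable_continuous; apply/derivable1_diffP; case: (is_derive_phase r h).
Qed.

Lemma is_derive_weight t : 0 < t < T ->
  is_derive (t : R) (1 : R) (carleman_weight lambda a nu)
    (2 * (lambda * (nu * (t + a) `^ (nu - 1))) * carleman_weight lambda a nu t).
Proof.
move=> /andP[t0 tT]; have ta : 0 < t + a by rewrite addr_gt0.
have [d1 d2] := is_derive_phase nu ta.
have d3 : is_derive (t : R) (1 : R) (fun t => 2 * lambda * (t + a) `^ nu)
    (2 * lambda * (nu * (t + a) `^ (nu - 1))).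
  by apply: DeriveDef; [exact: derivable_mull|rewrite derive_mull// d2].
have := @is_derive1_comp _ expR (fun t => 2 * lambda * (t + a) `^ nu) t _ _
  (is_derive_expR _) d3.
congr is_derive; rewrite /carleman_weight; ring.
Qed.

Lemma continuous_weight_clip : continuous (fun t => carleman_weight lambda a nu (clip T t)).
Proof.
apply: (@continuousT_comp _ _ _ (fun t => 2 * lambda * (clip T t + a) `^ nu) expR);
  last exact: continuous_expR.
by apply: continuousT_mul; [exact: continuousT_cst|exact: continuous_phase_clip].
Qed.

Lemma phase_rate_le t : 0 < t < T ->
  lambda * phase_rate <= lambda * (nu * (t + a) `^ (nu - 1)).
Proof.
move=> /andP[t0 tT]; rewrite ler_wpM2l ?(ltW l0)// ler_wpM2l//.
  by rewrite ltW// (lt_trans ltr01).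
apply: ge0_ler_powR; rewrite ?nnegrE ?subr_ge0 ?(ltW nu1) ?(ltW a0)//.
  by rewrite addr_ge0 ?ltW.
by rewrite lerDr ltW.
Qed.

End weight.

(** The value beyond which 3 (M^2 + M^6) <= lambda * [phase_rate a nu], so that the gradient terms
    hidden in the source cost at most one copy of the gradient integral. *)
Definition carleman_lambda0 {R : realType} (a nu M : R) : R :=
  3 * (M ^+ 2 + M ^+ 6) / phase_rate a nu.

(** With c the phase rate, the estimate first comes with lambda^2 c in front of v^2 and 3/c in front
    of the source: the first factor turns lambda^2 c into lambda^2, the second covers 3/c. *)
Definition carleman_constant {R : realType} (a nu : R) : R :=
  (1 + (phase_rate a nu)^-1) * (1 + 3 / phase_rate a nu).

Section carleman_estimate.
Context {R : realType} {d : nat}.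
Variables (T a nu M : R).
Hypotheses (T0 : 0 < T) (a0 : 0 < a) (nu1 : 1 < nu) (M0 : 0 < M).
Notation nT := (uniform_prob T0).
Notation mu := (torus_leb R d).
Notation pm := (nT \x mu)%E.
Notation patch := (patch_cyl T).

Lemma carleman_estimate (v D : R -> 'rV[R]_d -> R) (K : R)
    (g : R -> 'rV[R]_d -> 'rV[R]_d) (tr p : R -> 'rV[R]_d -> R)
    (gT : 'rV[R]_d -> 'rV[R]_d) :
  sqi pm (patch v) -> continuous (fun z : R * 'rV[R]_d => D z.1 z.2) ->
  (forall t x, `|D t x| <= K) ->
  (forall x, @tcube R d x -> forall t, 0 < t < T -> is_derive (t : R) (1 : R) (v^~ x) (D t x)) ->
  (forall x, continuous (v^~ x)) ->
  (forall i, sqi pm (patch (fun t x => g t x ord0 i))) -> sqi pm (patch tr) ->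
  {ae nT, forall t, \sum_i \int[mu]_x (g t x ord0 i ^+ 2) = - \int[mu]_x (v t x * tr t x)} ->
  {ae nT, forall t, forall x, unit_cube x ->
    (- D t x - tr t x) ^+ 2 <= 3 * (p t x ^+ 2 + M ^+ 2 * enorm (g t x) ^+ 2 +
      M ^+ 6 * \int[mu]_y (enorm (g t y) ^+ 2))} ->
  forall lambda, carleman_lambda0 a nu M <= lambda ->
  (lambda%:E * weighted_QT T lambda a nu (fun t x => enorm (g t x))
    + (lambda ^+ 2)%:E * weighted_QT T lambda a nu v
    <= (carleman_constant a nu)%:E * weighted_QT T lambda a nu p
       + (carleman_constant a nu * carleman_weight lambda a nu T)%:E *
         \int[mu]_x (enorm (gT x) ^+ 2 + lambda * v T x ^+ 2)%:E)%E.
Proof.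
move=> sv cD DK dv cv sg str hid hp lambda hl.
have c0 := phase_rate_gt0 a0 nu1; set c := phase_rate a nu in c0.
have l0 : 0 < lambda.
  apply: lt_le_trans hl; rewrite divr_gt0// mulr_gt0// addr_gt0// exprn_gt0//.
pose W := carleman_weight lambda a nu.
have W0 t : 0 < W t by exact: expR_gt0.
pose g2 z := \sum_i patch (fun t x => g t x ord0 i) z ^+ 2.
have ig2 : itg pm g2 by apply: itg_sum => i; exact: (sg i).2.
have g2E t x : 0 < t < T -> g2 (t, x) = enorm (g t x) ^+ 2.
  by move=> tT; rewrite enorm_row_sqr; apply: eq_bigr => i _; rewrite patch_cylE.
have g20 z : 0 <= g2 z by apply: sumr_ge0 => i _; exact: sqr_ge0.
have TT : 0 <= T <= T by rewrite (ltW T0) lexx.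
have mvT := measurable_slice sv TT cv.
have svT := sqi_slice sv DK dv (fun x _ => cv x) TT mvT.
have k0 : 0 < lambda * c by rewrite mulr_gt0.
pose psi t := lambda * (nu * (t + a) `^ (nu - 1)).
have cW : continuous (fun t => W (clip T t)) by exact: continuous_weight_clip.
have cpsi : continuous (fun t => psi (clip T t)).
  apply: continuousT_mul; first exact: continuousT_cst.
  by apply: continuousT_mul; [exact: continuousT_cst|exact: continuous_phase_clip].
have dW t : 0 < t < T -> is_derive (t : R) (1 : R) W (2 * psi t * W t).
  by move=> tT; exact: is_derive_weight tT.
have psik t : 0 < t < T -> lambda * c <= psi t by move=> tT; exact: phase_rate_le tT.
have cv' x : @tcube R d x -> continuous (v^~ x) by move=> _; exact: cv.
have en : 2 * (\int[pm]_z (W (clip T z.1) * g2 z)) + _ <= _ := carleman_energy sv cD DK dv cv' sg str hid cW cpsi W0 k0 dW psik svT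
  (fun x _ => erefl).
have hp' : {ae nT, forall t, forall x, unit_cube x ->
    patch (source D tr) (t, x) ^+ 2 <=
    3 * (p t x ^+ 2 + M ^+ 2 * g2 (t, x) + M ^+ 6 * \int[mu]_y g2 (t, y))}.
  apply: (ae_mono2 hp (ae_uniform_itv T0)) => t h tT x xc.
  rewrite patch_cylE// g2E//; under eq_Rintegral do rewrite g2E//.
  exact: h.
have sf := sqi_source cD DK str.
have lw := weighted_lower cW W0 sf ig2 hp'.
set A := \int[pm]_z (_ * patch v z ^+ 2) in en.
set B := \int[pm]_z (_ * g2 z) in en lw.
set F := \int[pm]_z (_ * patch (source D tr) z ^+ 2) in en lw.
set E := \int[mu]_x _ in en.
(* Each weighted integral over the cylinder is T times an integral against the product probability,
   hence finite. *)
have wE (q : R -> 'rV[R]_d -> R) Z : (forall t x, 0 < t < T -> Z (t, x) = q t x ^+ 2) ->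
    (forall t x, ~~ (0 < t < T) -> Z (t, x) = 0) ->
    (forall z, 0 <= Z z) -> itg pm Z -> weighted_QT T lambda a nu q =
    (T * \int[pm]_z (W (clip T z.1) * Z z))%:E.
  move=> Zq Zout Z0 iZ; have iWZ := itg_weight cW iZ.
  pose F0 (t : R) (x : 'rV[R]_d) := W (clip T t) * Z ((t : measurableTypeR R), x).
  have pF0 : patch F0 = (fun z => W (clip T z.1) * Z z).
    apply/funext => -[t x]; have [tT|tT] := boolP (0 < t < T); first by rewrite patch_cylE.
    by rewrite patch_cyl_out// Zout// mulr0.
  rewrite -pF0 -cyl_leb_Rint ?pF0//; last by move=> t x; rewrite mulr_ge0// ltW.
  apply: eq_integral => -[t x]; rewrite inE /cylinder [(t, x).1]/= => /= tT.
  have tc : clip T t = t by rewrite clip_id//; move: tT => /andP[? ?]; rewrite !ltW.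
  by rewrite /F0 tc (Zq _ _ tT).
have wv : weighted_QT T lambda a nu v = (T * A)%:E.
  apply: (wE v (fun z => patch v z ^+ 2)); last exact: sv.2.
  - by move=> t x tT; rewrite patch_cylE.
  - by move=> t x tT; rewrite patch_cyl_out// expr0n.
  - by move=> z; exact: sqr_ge0.
have wg : weighted_QT T lambda a nu (fun t x => enorm (g t x)) = (T * B)%:E.
  apply: (wE _ g2 g2E _ g20 ig2) => t x tT.
  by rewrite /g2 big1// => i _; rewrite patch_cyl_out// expr0n.
(* The gradient at the final time is discarded; the comparison is one of lower integrals, as [gT] is
   arbitrary here. *)
have hE : (\int[mu]_x (enorm (gT x) ^+ 2 + lambda * v T x ^+ 2)%:E >= (lambda * E)%:E)%E.
  rewrite EFinM /E -(itg_EFin svT.2) -ge0_integralZl//; last 3 first.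
  - by apply/measurable_EFinP; exact: measurable_funX.
  - by move=> x _; rewrite lee_fin sqr_ge0.
  - by rewrite lee_fin ltW.
  apply: ge0_le_lower_integral => x _; rewrite -EFinM lee_fin.
    by rewrite mulr_ge0 ?sqr_ge0// ltW.
  by rewrite lerDr sqr_ge0.
have C0 : 0 < carleman_constant a nu.
  by rewrite mulr_gt0// ltr_pwDl// ?divr_ge0 ?invr_ge0// ltW.
rewrite wv wg; set X := weighted_QT T lambda a nu p.
have {}lw : ((T * (F / 3 - (M ^+ 2 + M ^+ 6) * B))%:E <= X)%E := lw.
have X0 : (0 <= X)%E by apply: integral_ge0 => z _; rewrite lee_fin mulr_ge0 ?sqr_ge0// ltW.
apply: (@le_trans _ _ ((carleman_constant a nu)%:E * X +
   (carleman_constant a nu * W T)%:E * (lambda * E)%:E)%E); last first.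
  by rewrite leeD2l// lee_wpmul2l// lee_fin mulr_ge0 ?(ltW C0)// ltW.
have E0 : 0 <= E by apply: Rintegral_ge0 => x _; exact: sqr_ge0.
(* An infinite source integral makes the right-hand side infinite. *)
move: X X0 lw => [X| |]//= X0 lw; last first.
  by rewrite gt0_muley ?lte_fin// -[X in (_ <= _ + X)%E]EFinM addye// leey.
rewrite -!EFinM -!EFinD !lee_fin in lw X0 *.
have A0 : 0 <= A by apply: Rintegral_ge0 => z _; rewrite mulr_ge0 ?sqr_ge0// ltW.
have B0 : 0 <= B by apply: Rintegral_ge0 => z _; rewrite mulr_ge0// ltW.
set w := W T in en *.
have w0 : 0 < w by exact: W0.
have h1 : F <= 3 * (T^-1 * X) + 3 * (M ^+ 2 + M ^+ 6) * B.
  have : T^-1 * (T * (F / 3 - (M ^+ 2 + M ^+ 6) * B)) <= T^-1 * X by rewrite ler_wpM2l// invr_ge0 ltW.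
  rewrite mulKf ?gt_eqF//; lra.
have h2 : 3 * (M ^+ 2 + M ^+ 6) <= lambda * c.
  by move: hl; rewrite /carleman_lambda0 ler_pdivrMr.
have h3 : (lambda * c)^-1 * F <= (lambda * c)^-1 * (3 * (T^-1 * X)) + B.
  have k1 : 0 <= (lambda * c)^-1 by rewrite invr_ge0 ltW.
  apply: (le_trans (ler_wpM2l k1 h1)); rewrite mulrDr lerD2l mulrA -[leRHS]mul1r ler_wpM2r//.
  by rewrite mulrC ler_pdivrMr// mul1r.
(* One of the two copies of the gradient integral absorbs the one returned by the source. *)
have h4 : B + lambda * c * A <= T^-1 * (w * E) + (lambda * c)^-1 * (3 * (T^-1 * X)) by lra.
(* Multiplication by lambda T restores the powers of lambda and cancels every 1/T. *)
have h5 : lambda * (T * B) + lambda ^+ 2 * c * (T * A) <= lambda * (w * E) + 3 / c * X.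
  have lT : 0 <= lambda * T by rewrite mulr_ge0 ?ltW.
  have := ler_wpM2l lT h4; rewrite !mulrDr.
  have -> : lambda * T * (T^-1 * (w * E)) = lambda * (w * E) by field; rewrite gt_eqF.
  have -> : lambda * T * ((lambda * c)^-1 * (3 * (T^-1 * X))) = 3 / c * X by field; rewrite !gt_eqF.
  have -> : lambda * T * (lambda * c * A) = lambda ^+ 2 * c * (T * A) by ring.
  by rewrite -[lambda * T * B]mulrA.
set G := T * B in h5 *; set Vv := T * A in h5 *.
have G0 : 0 <= G by rewrite mulr_ge0 ?(ltW T0).
have V0 : 0 <= Vv by rewrite mulr_ge0 ?(ltW T0).
have ci : 0 <= c^-1 by rewrite invr_ge0 ltW.
apply: (@le_trans _ _ ((1 + c^-1) * (lambda * G + lambda ^+ 2 * c * Vv))).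
  rewrite mulrDl mul1r mulrDr.
  have -> : c^-1 * (lambda ^+ 2 * c * Vv) = lambda ^+ 2 * Vv by field; rewrite gt_eqF.
  have : 0 <= c^-1 * (lambda * G) by apply: mulr_ge0 => //; apply: mulr_ge0 => //; exact: ltW.
  have : 0 <= lambda ^+ 2 * c * Vv.
    by apply: mulr_ge0 => //; apply: mulr_ge0; [exact: sqr_ge0|exact: ltW].
  by lra.
rewrite [leRHS](_ : _ = (1 + c^-1) * ((1 + 3 / c) * (X + w * (lambda * E)))); last first.
  by rewrite /carleman_constant -/c; ring.
rewrite ler_wpM2l//; first by rewrite addr_ge0.
apply: (le_trans h5).
have -> : w * (lambda * E) = lambda * (w * E) by ring.
set Y := lambda * (w * E); have Y0 : 0 <= Y.
  by apply: mulr_ge0; [exact: ltW|apply: mulr_ge0 => //; exact: ltW].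
have : 0 <= 3 * (c^-1 * Y) by apply: mulr_ge0 => //; exact: mulr_ge0.
have -> : (1 + 3 / c) * (X + Y) = X + Y + 3 / c * X + 3 * (c^-1 * Y) by ring.
by lra.
Qed.

End carleman_estimate.

(** * Trace at the final time *)

Section L2_limit.
Context {R : realType} {d0 : measure_display} {X : measurableType d0}.
Variable P : probability X R.

Lemma geo_partial_le (q : R) n : 0 <= q -> q <= 2^-1 -> \sum_(k < n) q ^+ k <= 2.
Proof.
move=> q0 q1; suff : \sum_(k < n) q ^+ k <= 2 - 2 * q ^+ n.
  have : 0 <= q ^+ n by exact: exprn_ge0.
  by lra.
elim: n => [|n IH]; first by rewrite big_ord0 expr0; lra.
rewrite big_ord_recr /= exprS; have : 0 <= q ^+ n by exact: exprn_ge0.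
nra.
Qed.

(* [s] bounds [sum_k 4^k (f k.+1 - f k)^2], so the increments are dominated by
   the summable sequence [2^-k s]. *)
Lemma fast_cauchy_cvg (f : nat -> R) (s : R) : 0 <= s ->
  (forall k, `|f k.+1 - f k| <= s * 2^-1 ^+ k) ->
  cvgn f /\ forall n, `|limn f - f n| <= 2 * s * 2^-1 ^+ n.
Proof.
move=> s0 h.
(* Two adjacent monotone sequences: 2 s 2^-n is the sum of all increments still to come. *)
pose u n := f n + 2 * s * 2^-1 ^+ n; pose w n := f n - 2 * s * 2^-1 ^+ n.
have g0 n : 0 <= 2 * s * 2^-1 ^+ n by rewrite !mulr_ge0// exprn_ge0.
have du : nonincreasing_seq u.
  apply/nonincreasing_seqP => n; rewrite /u exprS; have := h n.
  by rewrite ler_norml => /andP[_]; lra.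
have dw : nondecreasing_seq w.
  apply/nondecreasing_seqP => n; rewrite /w exprS; have := h n.
  by rewrite ler_norml => /andP[+ _]; lra.
have cu : cvgn u.
  apply: nonincreasing_is_cvgn => //; exists (w 0%N) => _ [n _ <-].
  apply: (@le_trans _ _ (w n)); first exact: dw.
  by rewrite /w /u; have := g0 n; lra.
have c0 : 2 * s * 2^-1 ^+ n @[n --> \oo] --> (0 : R).
  rewrite -[X in _ --> X](mulr0 (2 * s)); apply: cvgM; first exact: cvg_cst.
  by apply: cvg_expr; rewrite ger0_norm// invf_lt1// ltr1n.
have fE : f = (fun n => u n - 2 * s * 2^-1 ^+ n) by apply/funext => n; rewrite /u addrK.
have cf : f @ \oo --> limn u.
  by rewrite fE -[X in _ --> X]subr0; apply: cvgB.
have wE : w = (fun n => f n - 2 * s * 2^-1 ^+ n) by [].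
have cw : w @ \oo --> limn u by rewrite wE -[X in _ --> X]subr0; apply: cvgB.
split; first by apply/cvg_ex; exists (limn u).
have lf : limn f = limn u by exact: cvg_lim cf.
move=> n; have h1 := nonincreasing_cvgn_ge du cu n.
have h2 := nondecreasing_cvgn_le dw (cvgP _ cw) n.
rewrite (cvg_lim _ cw)// in h2; rewrite lf ler_norml /u /w in h1 h2 *.
by apply/andP; split; lra.
Qed.

(** The sum of 4^k (f k.+1 - f k)^2 has integral at most 2 C, because 4/16 = 1/4. It is finite
    almost everywhere, and its square root controls the increments pointwise. *)
Lemma L2_fast_limit (f : nat -> X -> R) (C : R) : (forall n, sqi P (f n)) ->
  (forall n, \int[P]_x ((f n.+1 x - f n x) ^+ 2) <= C * 16^-1 ^+ n) ->
  exists2 F, sqi P F & forall (phi : X -> R) (B : R), measurable_fun setT phi -> (forall x, `|phi x| <= B) ->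
    \int[P]_x (f n x * phi x) @[n --> \oo] --> \int[P]_x (F x * phi x).
Proof.
move=> sf hf.
have sb n : sqi P (fun x => f n.+1 x - f n x) by exact: sqiB.
pose b n x := 4 ^+ n * (f n.+1 x - f n x) ^+ 2.
have b0 n x : 0 <= b n x by rewrite mulr_ge0 ?sqr_ge0// exprn_ge0.
have ib n : itg P (b n) by apply: itgZ; exact: (sb n).2.
pose S n x := \sum_(k < n) b k x.
have iS n : itg P (S n) by exact: itg_sum.
have S0 n x : 0 <= S n x by apply: sumr_ge0.
have SS n x : S n x <= S n.+1 x by rewrite /S big_ord_recr /= lerDl.
have ndS x : nondecreasing_seq (S ^~ x) by apply/nondecreasing_seqP.
have ndSe x : nondecreasing_seq (fun n => (S n x)%:E).
  by move=> m n mn; rewrite lee_fin; exact: ndS.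
have C0 : 0 <= C.
  have := hf 0%N; rewrite expr0 mulr1; apply: le_trans.
  by apply: Rintegral_ge0 => x _; exact: sqr_ge0.
have intS n : \int[P]_x S n x <= C * 2.
  rewrite /S Rint_sum//; apply: (@le_trans _ _ (\sum_(k < n) C * 4^-1 ^+ k)).
    apply: ler_sum => k _; rewrite RintZ; last exact: (sb k).2.
    apply: (le_trans (ler_wpM2l _ (hf k))); first by rewrite exprn_ge0.
    by rewrite mulrCA -exprMn (_ : 4 * 16^-1 = 4^-1 :> R)//; field.
  rewrite -mulr_sumr ler_wpM2l// geo_partial_le//; lra.
pose Sl x := limn (fun n => (S n x)%:E).
have mSe n : measurable_fun setT (fun x => (S n x)%:E).
  by apply/measurable_EFinP; exact: itg_measurable (iS n).
have Sl_le n x : ((S n x)%:E <= Sl x)%E.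
  rewrite /Sl (cvg_lim _ (ereal_nondecreasing_cvgn (ndSe x)))//.
  by apply: ereal_sup_ubound; exists n.
have Sl0 x : (0 <= Sl x)%E by apply: le_trans (Sl_le 0%N x); rewrite lee_fin.
have mSl : measurable_fun setT Sl.
  apply: (emeasurable_fun_cvg (fun n x => (S n x)%:E)) => // x _.
  exact: ereal_nondecreasing_is_cvgn.
have Sl_int : (\int[P]_x Sl x = limn (fun n => \int[P]_x (S n x)%:E))%E.
  apply: monotone_convergence => //.
  by move=> n x _; rewrite lee_fin.
have iSl : (\int[P]_x Sl x <= (C * 2)%:E)%E.
  rewrite Sl_int; apply: lime_le.
    apply: ereal_nondecreasing_is_cvgn => m n mn.
    by apply: ge0_le_integral => // x _; rewrite ?lee_fin//; exact: ndS.
  by near=> n; rewrite itg_EFin// lee_fin.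
have iSli : P.-integrable setT Sl.
  apply/integrableP; split => //; under eq_integral do rewrite gee0_abs//.
  by apply: le_lt_trans iSl _; rewrite ltry.
(* Off this set of full measure the functions are replaced by 0. There [s] is 0 as well, since
   [fine] sends infinity to 0, so the increment bound holds at every point. *)
pose A := [set x | Sl x \is a fin_num].
have mA : measurable A.
  by have := emeasurable_fin_num measurableT mSl; rewrite setTI.
have aeA : {ae P, forall x, A x}.
  by have := integrable_ae measurableT iSli; apply: filterS => x; apply.
pose s x := Num.sqrt (fine (Sl x)).
have s0 x : 0 <= s x by exact: sqrtr_ge0.
have s2 x : s x ^+ 2 = fine (Sl x) by rewrite sqr_sqrtr// fine_ge0.
pose ft n := f n \_ A.
have fb x k : `|ft k.+1 x - ft k x| <= s x * 2^-1 ^+ k.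
  rewrite /ft !patchE; case: ifPn => [|_]; last first.
    by rewrite subrr normr0 mulr_ge0// exprn_ge0.
  rewrite inE => Ax.
  rewrite -(@ler_pXn2r _ 2)// ?nnegrE ?mulr_ge0 ?exprn_ge0//.
  rewrite real_normK ?num_real// exprMn s2 exprAC -(@ler_pM2l _ (4 ^+ k)) ?exprn_gt0//.
  rewrite [leRHS]mulrCA -exprMn (_ : 4 * 2^-1 ^+ 2 = 1 :> R); last by field.
  rewrite expr1n mulr1 -lee_fin fineK//; apply: le_trans (Sl_le k.+1 x).
  by rewrite lee_fin /S big_ord_recr /= lerDr; apply: sumr_ge0.
have key x := fast_cauchy_cvg (s0 x) (fb x).
pose F x := limn (ft ^~ x).
have mft n : measurable_fun setT (ft n).
  apply/(measurable_restrictT _ mA); apply: measurable_funTS; exact: (sf n).1.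
have mF : measurable_fun setT F.
  by apply: (@measurable_fun_cvg _ _ _ _ ft) => // x _; exact: (key x).1.
have sft n : sqi P (ft n).
  split => //; apply: (itg_le _ _ (sf n).2); first exact: measurable_funX.
  move=> x; rewrite /ft patchE; case: ifP => // _; by rewrite expr0n normr0.
have ms : measurable_fun setT s.
  apply: measurableT_comp; first exact: continuous_measurable_fun (@sqrt_continuous R).
  by apply: measurableT_comp.
have ss : sqi P s.
  split => //; rewrite (_ : (fun _ => _) = fine \o Sl); last by apply/funext => x; exact: s2.
  apply: (le_integrable measurableT _ _ iSli).
    by apply/measurable_EFinP; exact: measurableT_comp.
  by move=> x _ /=; case: (Sl x) => //=; rewrite ?normr0 ?leey.
have sD : sqi P (fun x => F x - ft 0%N x).
  split; first by apply: measurable_funB.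
  have sc : itg P (fun x => 4 * s x ^+ 2) by apply: itgZ; exact: ss.2.
  apply: (itg_le _ _ sc); first by apply: measurable_funX; exact: measurable_funB.
  move=> x; have := (key x).2 0%N; rewrite expr0 mulr1 => h.
  rewrite [leRHS]ger0_norm ?mulr_ge0 ?sqr_ge0// normrX.
  rewrite (_ : 4 * _ = (2 * s x) ^+ 2); last by ring.
  by rewrite lerXn2r// nnegrE// mulr_ge0.
have sF : sqi P F.
  have := sqiD sD (sft 0%N); rewrite (_ : (fun _ => _) = F)//.
  by apply/funext => x; rewrite subrK.
exists F => // phi B mphi phiB.
have B0 : 0 <= B.
  by have [x _] := exists_of_ae aeA; rewrite (le_trans _ (phiB x)).
have fE n : \int[P]_x (f n x * phi x) = \int[P]_x (ft n x * phi x).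
  apply: Rint_ae.
  - by apply: measurable_funM => //; exact: (sf n).1.
  - exact: measurable_funM.
  - by apply: filterS aeA => x Ax; rewrite /ft patchE mem_set.
have is_ := sqi_itg ss.
have bnd n : `|\int[P]_x (F x * phi x) - \int[P]_x (f n x * phi x)| <=
    (2 * B * \int[P]_x s x) * 2^-1 ^+ n.
  have i1 := itgM_bounded (sqi_itg sF) mphi phiB.
  have i2 := itgM_bounded (sqi_itg (sft n)) mphi phiB.
  rewrite fE -RintB// (le_trans (Rint_normr_le _))//; first exact: itgB.
  rewrite -mulrA mulrCA [X in _ <= X]mulrC.
  rewrite (_ : _ * _ = \int[P]_x (2 * B * 2^-1 ^+ n * s x)).
    apply: Rint_le; [by apply: itg_abs; exact: itgB|exact: itgZ|].
    move=> x; rewrite -mulrBl normrM.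
    apply: (@le_trans _ _ (2 * s x * 2^-1 ^+ n * B)).
      by apply: ler_pM => //; exact: (key x).2.
    by rewrite le_eqVlt; apply/orP; left; apply/eqP; ring.
  by rewrite RintZ//; ring.
apply/cvgrPdist_le => e e0.
have c0 : (2 * B * \int[P]_x s x) * 2^-1 ^+ n @[n --> \oo] --> (0 : R).
  rewrite -[X in _ --> X](mulr0 (2 * B * \int[P]_x s x)); apply: cvgM; first exact: cvg_cst.
  by apply: cvg_expr; rewrite ger0_norm// invf_lt1// ltr1n.
move/cvgrPdist_le : c0 => /(_ _ e0); apply: filterS => n hn.
rewrite (le_trans (bnd n))// (le_trans _ hn)// sub0r normrN ler_norm//.
Unshelve. all: by end_near. Qed.

End L2_limit.

Section good_times.
Context {R : realType} {d : nat}.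
Variables (T : R) (T0 : 0 < T).
Notation nu := (uniform_prob T0).
Notation mu := (torus_leb R d).
Notation pm := (nu \x mu)%E.
Notation patch := (patch_cyl T).

(** Chebyshev: [T - r, T] has probability r / T, so a larger [Q] at almost all its times would make
    the mean of [Q] at least its own value plus 1. *)
Lemma good_time (Q : measurableTypeR R -> R) (G : R -> Prop) r : itg nu Q -> (forall t, 0 <= Q t) ->
  {ae nu, forall t, G t} -> 0 < r -> r <= T ->
  exists t, [/\ T - r <= t <= T, G t & Q t <= T / r * (\int[nu]_t Q t + 1)].
Proof.
move=> iQ Q0 aeG r0 rT; apply: contrapT => no.
set I := \int[nu]_t Q t in no; pose c := T / r * (I + 1).
pose A : set (measurableTypeR R) := `[T - r, T]%classic.
have mA : measurable A by exact: measurable_itv.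
have i1 : itg nu (\1_A : _ -> R).
  apply: (@itg_bounded _ _ _ nu _ 1); first exact: measurable_indic.
  by move=> x; rewrite ger0_norm// indicE; case: (x \in A).
have h1 : \int[nu]_t (\1_A t : R) = r / T.
  have e : nu A = ((T - (T - r)) / (T - 0))%:E by apply: uniform_prob_itv => //; lra.
  rewrite /Rintegral integral_indic// setIT (_ : _ A = ((T - (T - r)) / (T - 0))%:E); last exact: e.
  by rewrite /= subr0; congr (_ / _); ring.
have : \int[nu]_t (c * \1_A t) <= I.
  apply: Rint_ae_le => //; first exact: itgZ.
  apply: (ae_mono2 aeG aeG) => t Gt _; rewrite indicE; case: (asboolP (A t)) => At.
    rewrite mem_set// mulr1 leNgt; apply/negP => h; apply: no; exists t.
    by split => //; exact: ltW.
  by rewrite memNset// mulr0.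
rewrite RintZ// h1 /c mulrAC (_ : T / r * (r / T) = 1); first by lra.
by field; apply/andP; split; rewrite gt_eqF.
Qed.

(* [|g t - g s|^2 <= |v t - v s| |h t - h s|] in L^2, where [v] is Lipschitz in time.
   Along times [t_n] at distance at most [T 256^-n] from [T] such that
   [|h t_n|^2 <= C 256^n], the functions [g t_n] therefore form a fast Cauchy sequence. *)
Lemma trace_exists (i : 'I_d) (v D g h : R -> 'rV[R]_d -> R) (K : R) :
  sqi pm (patch v) -> continuous (fun z : R * 'rV[R]_d => D z.1 z.2) ->
  (forall t x, `|D t x| <= K) ->
  (forall x, @tcube R d x -> forall t, 0 < t < T -> is_derive (t : R) (1 : R) (v^~ x) (D t x)) ->
  (forall x, continuous (v^~ x)) ->
  sqi pm (patch h) ->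
  (forall phi, test_rV phi -> {ae nu, forall t,
    \int[mu]_y (v t y * 'D_(basis_vec R i) phi y) = - \int[mu]_y (g t y * phi y)}) ->
  {ae nu, forall t, @ker_weak R d i (v t) (g t)} ->
  {ae nu, forall t, @ker_weak R d i (g t) (h t)} ->
  exists2 gT, sqi mu gT & forall phi, test_rV phi ->
    \int[mu]_y (v T y * 'D_(basis_vec R i) phi y) = - \int[mu]_y (gT y * phi y).
Proof.
move=> sv cD DK dv cv sh wv kv kg.
have K0 : 0 <= K by rewrite (le_trans _ (DK 0 0)).
pose Q t := \int[mu]_x (patch h (t, x) ^+ 2).
have iQ : itg nu Q by exact: (itg_fubini1 sh.2).
have Q0 t : 0 <= Q t by apply: Rintegral_ge0 => x _; exact: sqr_ge0.
pose I := \int[nu]_t Q t.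
have I0 : 0 <= I by apply: Rintegral_ge0.
pose G t := [/\ 0 < t < T, @ker_weak R d i (v t) (g t) & @ker_weak R d i (g t) (h t)].
have aeG : {ae nu, forall t, G t}.
  apply: (ae_mono2 (ae_uniform_itv T0) (ae_mono2 kv kg (fun t p q => conj p q))) => t tT [? ?].
  by split.
have QE t : 0 < t < T -> Q t = \int[mu]_x (h t x ^+ 2).
  by move=> tT; apply: eq_Rintegral => x _; rewrite patch_cylE.
(* 256 = 16^2. The squared estimate decays like 256^(-2n) from [v] times 256^n from [h]; its square
   root is the rate 16^-n that [L2_fast_limit] asks for. *)
have [p [q [q0 q4 qp pE]]] : exists p q : R, [/\ 0 < q, q <= 4^-1, q = p^-1 & p = 256].
  by exists 256, 256^-1; split; [lra|lra|reflexivity|reflexivity].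
have q1 : q <= 1 by lra.
have p1 : 1 <= p by rewrite pE ler1n.
pose r n : R := T * q ^+ n.
have r0 n : 0 < r n by rewrite mulr_gt0// exprn_gt0.
have rT n : r n <= T.
  rewrite /r -[leRHS]mulr1; apply: ler_wpM2l; first exact: ltW.
  by apply: exprn_ile1 => //; exact: ltW.
have rS n : r n.+1 <= r n.
  rewrite /r exprS; apply: ler_wpM2l; first exact: ltW.
  by apply: ler_piMl => //; apply: exprn_ge0; exact: ltW.
have good n (G' : R -> Prop) : {ae nu, forall t, G' t} ->
    exists t, [/\ T - r n <= t, G t, G' t & Q t <= (I + 1) * p ^+ n].
  move=> aeG'.
  have [t [/andP[t1 _] [Gt G't] Qt]] := good_time iQ Q0 (ae_mono2 aeG aeG' (fun t p q => conj p q)) (r0 n) (rT n).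
  exists t; split => //; rewrite (le_trans Qt)// mulrC -/I le_eqVlt; apply/orP; left; apply/eqP; congr (_ * _).
  by rewrite /r invfM mulrA divff ?gt_eqF// mul1r qp exprVn invrK.
(* 32^2 = 4 * 256, with 4 from the two values of [h] and 256 from the exponent n + 1. The bound I +
   1 <= (I + 1)^2 avoids a square root. *)
pose C := 32 * (K * T * (I + 1)).
have KT0 : 0 <= K * T by apply: mulr_ge0 => //; exact: ltW.
have C0 : 0 <= C by apply: mulr_ge0 => //; apply: mulr_ge0 => //; lra.
(* The exponent n + 1 allows two consecutive times of the sequence to be compared at the same
   level. *)
have close n t s : G t -> G s -> T - r n <= t -> T - r n <= s ->
    Q t <= (I + 1) * p ^+ n.+1 -> Q s <= (I + 1) * p ^+ n.+1 ->
    \int[mu]_x (g t x - g s x) ^+ 2 <= C * 16^-1 ^+ n.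
  move=> [tT vt gt] [sT vs gs] rt rs Qt Qs.
  have [su sa e1] := ker_weakB vt vs; have [_ sk e2] := ker_weakB gt gs.
  have ibp := weak_integration_by_parts (ker_weakB vt vs) (ker_weakB gt gs).
  have e : \int[mu]_x (g t x - g s x) ^+ 2 = - \int[mu]_x ((v t x - v s x) * (h t x - h s x)).
    by rewrite ibp opprK; apply: eq_Rintegral => x _; rewrite expr2.
  have := Rint_CauchySchwarz su sk; rewrite -sqrrN -e.
  have a0 : 0 <= \int[mu]_x (g t x - g s x) ^+ 2 by apply: Rintegral_ge0 => x _; exact: sqr_ge0.
  have u2 : \int[mu]_x (v t x - v s x) ^+ 2 <= (K * r n) ^+ 2.
    rewrite -[leRHS](@Rint_cst _ _ _ mu); apply: Rint_ae_le; [exact: su.2|exact: itg_cst|].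
    apply: filterS ae_tcube => x xK.
    have /andP[? ?] := tT; have /andP[? ?] := sT.
    have hl : `|v t x - v s x| <= K * r n.
      apply: (le_trans (v_lipschitz DK dv (fun x _ => cv x) xK _ _)).
      - by rewrite !ltW.
      - by rewrite !ltW.
      by apply: (ler_wpM2l K0); rewrite ler_norml; apply/andP; split; lra.
    by rewrite -(real_normK (num_real (_ - _))) lerXn2r ?nnegrE// mulr_ge0// ltW.
  have st (t' : R) : G t' -> sqi mu (h t') by move=> [_ _ []].
  have sht := st t (And3 tT vt gt); have shs := st s (And3 sT vs gs).
  have k2 : \int[mu]_x (h t x - h s x) ^+ 2 <= 4 * ((I + 1) * p ^+ n.+1).
    apply: (@le_trans _ _ (\int[mu]_x (2 * h t x ^+ 2 + 2 * h s x ^+ 2))).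
      apply: Rint_le; [exact: sk.2| |].
        by apply: itgD; apply: itgZ; [exact: sht.2|exact: shs.2].
      move=> x; have : 0 <= (h t x + h s x) ^+ 2 by exact: sqr_ge0.
      by nra.
    rewrite RintD ?RintZ -?QE//; [lra|exact: shs.2|exact: sht.2| |].
      by apply: itgZ; exact: sht.2.
    by apply: itgZ; exact: shs.2.
  move=> cs; rewrite -(@ler_pXn2r _ 2)// ?nnegrE; last by apply: mulr_ge0 => //; exact: exprn_ge0.
  apply: (le_trans cs); apply: (@le_trans _ _ ((K * r n) ^+ 2 * (4 * ((I + 1) * p ^+ n.+1)))).
    by apply: ler_pM => //; apply: Rintegral_ge0 => x _; exact: sqr_ge0.
  rewrite /r /C (exprS p n).
  have z0 : 0 <= (16^-1 : R) ^+ n by exact: exprn_ge0.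
  have -> : q ^+ n = 16^-1 ^+ n ^+ 2.
    by rewrite exprAC; congr (_ ^+ n); rewrite qp pE; field.
  have : (16^-1 : R) ^+ n ^+ 2 * p ^+ n = 1.
    by rewrite exprAC -exprMn (_ : _ * _ = 1 :> R) ?expr1n// pE; field.
  set z := 16^-1 ^+ n; set w := p ^+ n => zw.
  rewrite (_ : _ * _ = 4 * p * (K * T * z) ^+ 2 * (I + 1) * (z ^+ 2 * w)); last by ring.
  have X0 : 0 <= (K * T * z) ^+ 2 * ((I + 1) * I).
    by apply: mulr_ge0; [exact: sqr_ge0|apply: mulr_ge0 => //; lra].
  rewrite zw mulr1 pE; lra.
pose tn n := projT1 (cid (good n (fun=> True) (aeW _ (fun _ => Logic.I)))).
have tnP n : [/\ T - r n <= tn n, G (tn n) & Q (tn n) <= (I + 1) * p ^+ n].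
  by rewrite /tn; case: cid => t [].
have up n t : Q t <= (I + 1) * p ^+ n -> Q t <= (I + 1) * p ^+ n.+1.
  move=> /le_trans; apply; apply: ler_wpM2l; first lra.
  by rewrite exprS ler_peMl// exprn_ge0//; lra.
have sg t : G t -> sqi mu (g t) by move=> [_ []].
have [n|n|F sF hF] := @L2_fast_limit _ _ _ mu (fun n => g (tn n)) C.
- by apply: sg; have [] := tnP n.
- have [a1 a2 a3] := tnP n.+1; have [b1 b2 b3] := tnP n.
  by apply: (close n _ _ a2 b2 _ b1 a3 (up _ _ b3)); have := rS n; lra.
exists F => // phi tphi; have [pphi cphi dphi cdphi] := tphi.
have [B hB] := periodic_bounded cphi pphi.
have [B' hB'] := periodic_bounded (cdphi i) (Zperiodic_derive (basis_vec R i) pphi).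
have mphi : measurable_fun setT phi by exact: measurable_rV_continuous.
have mdphi : measurable_fun setT ('D_(basis_vec R i) phi) by exact: measurable_rV_continuous.
have B0 : 0 <= B by rewrite (le_trans _ (hB 0)).
have B'0 : 0 <= B' by rewrite (le_trans _ (hB' 0)).
have TT : 0 <= T <= T by rewrite lexx ltW.
have svT : sqi mu (v T) by apply: (sqi_slice sv DK dv (fun x _ => cv x) TT); exact: (measurable_slice sv TT cv).
have lim1 := hF phi B mphi hB.
have lim2 : \int[mu]_x (g (tn n) x * phi x) @[n --> \oo] -->
    - \int[mu]_y (v T y * 'D_(basis_vec R i) phi y).
  apply/cvgrPdist_le => e e0.
  have c0 : (B' * K * T + (C + 1) * (B + 1)) * 4^-1 ^+ n @[n --> \oo] --> (0 : R).
    rewrite -[X in _ --> X](mulr0 (B' * K * T + (C + 1) * (B + 1))); apply: cvgM; first exact: cvg_cst.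
    by apply: cvg_expr; rewrite ger0_norm// invf_lt1// ltr1n.
  move/cvgrPdist_le : c0 => /(_ _ e0); apply: filterS => n; rewrite sub0r normrN => hn.
  apply: le_trans (le_trans (ler_norm _) hn).
  (* The times [tn] are fixed before [phi], whose weak identity may fail at them. It holds at
     another time s as close to T, where the gradient is close to that at [tn n]. *)
  have [t1 Gt Qt] := tnP n; have [s [s1 Gs ws Qs]] := good n _ (wv _ tphi).
  have [sT vs _] := Gs; have [svs _ _] := vs.
  have i1 (u : 'rV[R]_d -> R) : sqi mu u -> itg mu (fun y => u y * phi y).
    by move=> su; exact: itgM_bounded (sqi_itg su) mphi hB.
  have i2 (u : 'rV[R]_d -> R) : sqi mu u -> itg mu (fun y => u y * 'D_(basis_vec R i) phi y).
    by move=> su; exact: itgM_bounded (sqi_itg su) mdphi hB'.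
  have -> : - (\int[mu]_y (v T y * 'D_(basis_vec R i) phi y)) - (\int[mu]_x (g (tn n) x * phi x)) =
     (\int[mu]_y ((v s y - v T y) * 'D_(basis_vec R i) phi y)) -
     (\int[mu]_x ((g (tn n) x - g s x) * phi x)).
    have eB (u w k : 'rV[R]_d -> R) : itg mu (fun y => u y * k y) -> itg mu (fun y => w y * k y) ->
        \int[mu]_y ((u y - w y) * k y) = (\int[mu]_y (u y * k y)) - (\int[mu]_y (w y * k y)).
      by move=> a1 a2; rewrite -RintB//; apply: eq_Rintegral => y _; rewrite mulrBl.
    rewrite (eB _ _ _ (i2 _ svs) (i2 _ svT)) (eB _ _ _ (i1 _ (sg _ Gt)) (i1 _ (sg _ Gs))) ws.
    by ring.
  have z0 : 0 <= (4^-1 : R) ^+ n by exact: exprn_ge0.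
  rewrite mulrDl; apply: (le_trans (ler_normB _ _)); apply: lerD.
    apply: (le_trans (Rint_normr_le _)); first by apply: i2; exact: sqiB.
    rewrite -[leRHS](@Rint_cst _ _ _ mu); apply: Rint_ae_le.
    - by apply: itg_abs; apply: i2; exact: sqiB.
    - exact: itg_cst.
    apply: filterS ae_tcube => x xK; rewrite normrM.
    have /andP[? ?] := sT.
    have hl : `|v s x - v T x| <= K * r n.
      apply: (le_trans (v_lipschitz DK dv (fun x _ => cv x) xK TT _)).
        by rewrite !ltW.
      by apply: (ler_wpM2l K0); rewrite ler_norml; apply/andP; split; lra.
    apply: (@le_trans _ _ (K * r n * B')); first exact: ler_pM.
    rewrite [leLHS](_ : _ = B' * K * T * q ^+ n); last by rewrite /r; ring.
    apply: ler_wpM2l; first by rewrite -mulrA; exact: mulr_ge0.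
    by apply: lerXn2r; rewrite ?nnegrE//; exact: ltW.
  have sd : sqi mu (fun x => g (tn n) x - g s x) by apply: sqiB; exact: sg.
  have r0' : 0 <= (C + 1) * (B + 1) * 4^-1 ^+ n by apply: mulr_ge0 z0; apply: mulr_ge0; lra.
  rewrite -(@ler_pXn2r _ 2 _ _ _ (normr_ge0 _) r0') //.
  rewrite (real_normK (num_real _)).
  have sphi : sqi mu phi by exact: (sqi_bounded mu mphi hB).
  apply: (le_trans (Rint_CauchySchwarz sd sphi)).
  have cl := close n _ _ Gt Gs t1 s1 (up _ _ Qt) (up _ _ Qs).
  have h2 : \int[mu]_x (phi x ^+ 2) <= B ^+ 2.
    rewrite -[leRHS](@Rint_cst _ _ _ mu); apply: Rint_le.
    - exact: sphi.2.
    - exact: itg_cst.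
    by move=> x; rewrite -(real_normK (num_real (phi x))) lerXn2r ?nnegrE.
  apply: (@le_trans _ _ (C * 16^-1 ^+ n * B ^+ 2)).
    by apply: ler_pM => //; apply: Rintegral_ge0 => x _; exact: sqr_ge0.
  have -> : (16^-1 : R) ^+ n = 4^-1 ^+ n ^+ 2 by rewrite exprAC; congr (_ ^+ n); field.
  rewrite exprMn mulrAC; apply: ler_wpM2r; first exact: sqr_ge0.
  rewrite exprMn; apply: ler_pM => //; [exact: sqr_ge0|nra|nra].
have := cvg_unique _ lim1 lim2.
move=> /(_ (@norm_hausdorff _ _)) ->; by rewrite opprK.
Qed.

End good_times.

(** * The equation of the difference *)

Section line_calculus.
Context {R : realType}.

Lemma MVT_zero (F dF : R -> R) (b : R) :
  (forall s, is_derive (s : R) (1 : R) F (dF s)) ->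
  exists2 c, `|c| <= `|b| & F b - F 0 = b * dF c.
Proof.
move=> dFF.
have cF : continuous F.
  by move=> x; apply: differentiable_continuous; apply/derivable1_diffP; case: (dFF x).
have [b0|b0|b0] := ltgtP 0 b; last by exists 0; rewrite -b0 ?subrr ?mul0r.
- have [//|c + ->] := @MVT _ F dF 0 b b0 (fun x _ => dFF x); first exact: continuous_subspaceT.
  rewrite in_itv/= subr0 => /andP[c0 cb]; exists c; last by rewrite mulrC.
  by rewrite !gtr0_norm// ltW.
- have [//|c + e] := @MVT _ F dF b 0 b0 (fun x _ => dFF x); first exact: continuous_subspaceT.
  rewrite in_itv/= => /andP[bc c0]; exists c; last by rewrite -opprB e; ring.
  by rewrite !ltr0_norm// lerN2 ltW.
Qed.

Variable d : nat.
Implicit Types (f : 'rV[R]_d -> R) (p v : 'rV[R]_d).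

(** Partial derivatives alone give no expansion in the direction v. Changing one coordinate at a
    time, the mean value theorem produces partial derivatives at points near p, where the gradient
    is close to its value at p. *)
Lemma continuous_gradient_expansion f p v : has_partials f -> {for p, continuous (grad f)} ->
  forall e, 0 < e -> exists2 r, 0 < r & forall h, `|h| < r ->
    `|f (p + h *: v) - f p - h * dot (grad f p) v| <= e * `|h|.
Proof.
move=> pf cg e e0.
(* v truncated to its first k coordinates; the increment telescopes over k. *)
pose tr k : 'rV[R]_d := \row_j (if (j < k)%N then v ord0 j else 0).
pose S := \sum_j `|v ord0 j|.
have S0 : 0 <= S by apply: sumr_ge0.
have S1 : 0 < S + 1 by lra.
have e1 : 0 < e / (S + 1) by rewrite divr_gt0.
have : \forall q \near p, forall k, `|grad f p ord0 k - grad f q ord0 k| <= e / (S + 1).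
  have h k : \forall q \near p, `|grad f p ord0 k - grad f q ord0 k| <= e / (S + 1); last first.
    exact: (filter_forall _ h).
  have ck : grad f q ord0 k @[q --> p] --> grad f p ord0 k.
    apply: (@cvg_comp _ _ _ (grad f) (fun M : 'rV[R]_d => M ord0 k) _ _ _ cg).
    exact: (@coord_continuous _ _ _ ord0 k (grad f p)).
  by move/cvgrPdist_le : ck; exact.
move=> /nbhs_ballP[r /= r0 hr].
exists (r / (S + 1)) => [|h hh]; first by rewrite divr_gt0.
have hS : `|h| * (S + 1) < r by rewrite -ltr_pdivlMr.
have vS j : `|v ord0 j| <= S.
  by rewrite /S (bigD1 j)//= lerDl sumr_ge0.
have tr_step (k : 'I_d) : p + h *: tr k.+1 = (p + h *: tr k) + (h * v ord0 k) *: basis_vec R k.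
  apply/rowP => j; rewrite !mxE eqxx /= ltnS leq_eqVlt.
  have [->|jk] := eqVneq j k; first by rewrite eqxx /= ltnn; ring.
  have -> : (nat_of_ord j == nat_of_ord k) = false by apply/negbTE; exact: jk.
  by rewrite mulr0 addr0.
have trd : tr d = v by apply/rowP => j; rewrite mxE ltn_ord.
have tr0 : tr 0 = 0 by apply/rowP => j; rewrite !mxE.
have step (k : 'I_d) : exists2 q, ball p r q &
    f (p + h *: tr k.+1) - f (p + h *: tr k) = h * v ord0 k * grad f q ord0 k.
  have dF s : is_derive (s : R) (1 : R) (fun s => f (p + h *: tr k + s *: basis_vec R k))
      ('D_(basis_vec R k) f (p + h *: tr k + s *: basis_vec R k)).
    apply: DeriveDef; first by apply: derivable_line; exact: pf.
    by rewrite derive_line derive1E.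
  have [c cb ec] := MVT_zero (h * v ord0 k) dF.
  exists (p + h *: tr k + c *: basis_vec R k); last first.
    by rewrite tr_step [in RHS]mxE -ec scale0r addr0.
  split => // i j; rewrite !ord1 /ball /= !mxE eqxx /=.
  apply: le_lt_trans hS; rewrite -addrA opprD addrA subrr sub0r normrN.
  apply: (@le_trans _ _ (`|h| * `|v ord0 j|)); last first.
    by apply: ler_wpM2l => //; have := vS j; lra.
  have [->|jk] := eqVneq j k; first by rewrite ltnn mulr0 add0r mulr1 -normrM.
  by rewrite mulr0 addr0 normrM; case: ifP => // _; rewrite normr0 mulr0 mulr_ge0.
have tele : f (p + h *: v) - f p = \sum_(k < d) (f (p + h *: tr k.+1) - f (p + h *: tr k)).
  rewrite -(big_mkord xpredT (fun k => f (p + h *: tr k.+1) - f (p + h *: tr k))).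
  by rewrite telescope_sumr// trd tr0 scaler0 addr0.
rewrite tele dotE mulr_sumr -sumrB.
apply: (le_trans (ler_norm_sum _ _ _)).
apply: (@le_trans _ _ (\sum_(k < d) `|h| * `|v ord0 k| * (e / (S + 1)))).
  apply: ler_sum => k _; have [q bq ->] := step k.
  rewrite (_ : _ - _ = h * v ord0 k * - (grad f p ord0 k - grad f q ord0 k)); last by ring.
  rewrite normrM normrN normrM ler_wpM2l ?mulr_ge0//; exact: hr.
rewrite -mulr_suml -mulr_sumr -/S mulrC.
rewrite [leLHS](_ : _ = e * `|h| * (S / (S + 1))); last by field; rewrite gt_eqF.
by apply: ler_piMr; [rewrite mulr_ge0// ltW|rewrite ler_pdivrMr// mul1r; lra].
Qed.

Lemma is_derive_line f p v s : has_partials f -> continuous (grad f) ->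
  is_derive (s : R) (1 : R) (fun s => f (p + s *: v)) (dot (grad f (p + s *: v)) v).
Proof.
move=> pf cg; apply: is_derive_eps => e e0.
have [r r0 hr] := continuous_gradient_expansion v pf (cg (p + s *: v)) e0.
by exists r => // h /hr; rewrite scalerDl addrA.
Qed.

(** Applied to H(x, .) it explains [bhat], and applied to the partial derivatives of H(x, .) it
    explains [Ahat]. *)
Lemma segment_integral f p v : has_partials f -> continuous (grad f) ->
  f (p + v) - f p =
  \sum_i (\int[@lebesgue_measure R]_(s in `[0, 1]) grad f (p + s *: v) ord0 i) * v ord0 i.
Proof.
move=> pf cg.
have cl : continuous (fun s : R => p + s *: v).
  move=> s; apply: cvgD; first exact: cvg_cst.
  by apply: cvgZ; [exact: cvg_id|exact: cvg_cst].
have cgl : continuous (fun s : R => grad f (p + s *: v)) by exact: (continuousT_comp cl cg).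
have cgi i : continuous (fun s : R => grad f (p + s *: v) ord0 i).
  exact: (continuous_entry (i := ord0) (j := i) cgl).
have cd : continuous (fun s : R => dot (grad f (p + s *: v)) v).
  apply: continuous_dot => //; exact: continuousT_cst.
have := Rint_uniform_derive (@ltr01 R) cd (F := fun s => f (p + s *: v)).
rewrite subr0 invr1 mul1r scale1r scale0r addr0 => <-; last first.
  by move=> s; have [h1 h2] := is_derive_line p v s pf cg; rewrite derive1E.
under eq_Rintegral do rewrite dotE.
rewrite Rint_sum; last first.
  move=> i; rewrite (_ : (fun _ => _) = fun s : R => v ord0 i * grad f (p + s *: v) ord0 i).
    by apply: itgZ; exact: itg_uniform_continuous.
  by apply/funext => s; rewrite mulrC.
apply: eq_bigr => i _; under eq_Rintegral do rewrite mulrC.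
rewrite RintZ; last exact: itg_uniform_continuous.
rewrite mulrC Rint_uniform ?subr0 ?invr1 ?mul1r//.
exact: continuous_measurable_fun.
Qed.

End line_calculus.

Section subtraction.
Context {R : realType} {d : nat}.
Notation P := (prob_torus R d).
Implicit Types (f g : 'rV[R]_d -> R) (Phi Psi : P -> R).

Lemma dotBl (u v w : 'rV[R]_d) : dot (u - v) w = dot u w - dot v w.
Proof. by rewrite /dot mulmxBl mxE [X in _ + X]mxE. Qed.

Lemma dotBr (u v w : 'rV[R]_d) : dot u (v - w) = dot u v - dot u w.
Proof. by rewrite /dot linearB /= mulmxBr mxE [X in _ + X]mxE. Qed.

Lemma derive_sub_fun f g i : has_partials f -> has_partials g ->
  'D_(basis_vec R i) (fun y => f y - g y) =
  (fun y => 'D_(basis_vec R i) f y - 'D_(basis_vec R i) g y).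
Proof. by move=> hf hg; apply/funext => y; exact: (deriveB (hf y i) (hg y i)). Qed.

Lemma has_partialsB f g : has_partials f -> has_partials g -> has_partials (fun y => f y - g y).
Proof. by move=> hf hg x i; exact: (derivableB (hf x i) (hg x i)). Qed.

Lemma has_partials2B f g : has_partials2 f -> has_partials2 g ->
  has_partials2 (fun y => f y - g y).
Proof.
move=> [hf hf2] [hg hg2]; split=> [|i]; first exact: has_partialsB.
have -> := derive_sub_fun i hf hg; exact: (has_partialsB (hf2 i) (hg2 i)).
Qed.

Lemma gradB f g x : has_partials f -> has_partials g ->
  grad (fun y => f y - g y) x = grad f x - grad g x.
Proof.
move=> hf hg; apply/rowP => i; rewrite !mxE.
exact: (deriveB (hf x i) (hg x i)).
Qed.

Lemma hessB f g x : has_partials2 f -> has_partials2 g ->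
  hess (fun y => f y - g y) x = hess f x - hess g x.
Proof.
move=> [hf hf2] [hg hg2]; apply/matrixP => i j; rewrite [LHS]mxE derive_sub_fun//.
rewrite [RHS]mxE [X in _ = _ + X]mxE [X in _ = X - _]mxE [X in _ = _ - X]mxE.
exact: (deriveB (hf2 i x j) (hg2 i x j)).
Qed.

Lemma lapB f g x : has_partials2 f -> has_partials2 g ->
  lap (fun y => f y - g y) x = lap f x - lap g x.
Proof.
move=> hf hg; rewrite !lap_hess hessB// -sumrB.
by apply: eq_bigr => i _; rewrite mxE [X in _ + X = _]mxE.
Qed.

Lemma dirac_cube (x : 'rV[R]_d) : unit_cube x ->
  (dirac x : probability 'rV[R]_d R) (@unit_cube R d) = 1%E.
Proof. by move=> hx; rewrite /= diracE mem_set. Qed.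

(** Going towards the Dirac mass at z, the derivative is delta(m, z) minus the mean of delta(m, .)
    under m, and the normalization makes that mean zero. *)
Lemma lfd_unique Phi delta delta' : is_lfd Phi delta -> is_lfd Phi delta' -> delta = delta'.
Proof.
move=> [p1 c1 l1 n1] [p2 c2 l2 n2].
have slice (f : P -> 'rV[R]_d -> R) m : continuous (fun z : P * 'rV[R]_d => f z.1 z.2) ->
    continuous (f m).
  move=> cf; apply: (@continuousT_comp _ _ _ (fun y => (m, y)) _ _ cf).
  by apply: continuousT_pair; [exact: continuousT_cst|exact: continuousT_id].
apply/funext => m; apply/funext => y; have [k hk] := unit_cube_repr y.
rewrite -(p1 m y k) -(p2 m y k); set z := _ + _ in hk *.
have dz (f : 'rV[R]_d -> R) : continuous f -> \int[dirac z]_y f y = f z.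
  move=> cf; rewrite /Rintegral integral_dirac//; last first.
    by apply/measurable_EFinP; exact: measurable_rV_continuous.
  by rewrite diracT mul1e.
have h1 := l1 m (ProbTorus (dirac_cube hk)); have h2 := l2 m (ProbTorus (dirac_cube hk)).
have := cvg_unique _ h1 h2; rewrite n1 n2 !subr0 /= !dz; [|exact: slice|exact: slice].
by apply; exact: norm_hausdorff.
Qed.

Lemma is_lfdB Phi Psi delta delta' : is_lfd Phi delta -> is_lfd Psi delta' ->
  is_lfd (fun m => Phi m - Psi m) (fun m y => delta m y - delta' m y).
Proof.
move=> [p1 c1 l1 n1] [p2 c2 l2 n2].
have slice (f : P -> 'rV[R]_d -> R) m : continuous (fun z : P * 'rV[R]_d => f z.1 z.2) ->
    continuous (f m).
  move=> cf; apply: (@continuousT_comp _ _ _ (fun y => (m, y)) _ _ cf).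
  by apply: continuousT_pair; [exact: continuousT_cst|exact: continuousT_id].
have i1 m (n : P) : itg n (delta m) by apply: itg_continuous_periodic; [exact: slice|exact: p1].
have i2 m (n : P) : itg n (delta' m) by apply: itg_continuous_periodic; [exact: slice|exact: p2].
split.
- by move=> m y k; rewrite p1 p2.
- exact: continuousT_sub.
- move=> m m'; rewrite !RintB//.
  have -> : (fun s => s^-1 * (Phi (mixture s m m') - Psi (mixture s m m') - (Phi m - Psi m))) =
     (fun s => s^-1 * (Phi (mixture s m m') - Phi m) - s^-1 * (Psi (mixture s m m') - Psi m)).
    by apply/funext => s; ring.
  rewrite [X in _ --> X](_ : _ = (\int[m']_y delta m y - \int[m]_y delta m y) -
    (\int[m']_y delta' m y - \int[m]_y delta' m y)); last by ring.
  by apply: cvgB; [exact: l1|exact: l2].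
- by move=> m; rewrite RintB// n1 n2 subrr.
Qed.

Lemma lfdB Phi Psi : C1_measure Phi -> C1_measure Psi ->
  lfd (fun m => Phi m - Psi m) = (fun m y => lfd Phi m y - lfd Psi m y).
Proof.
move=> /lfdP h1 /lfdP h2; apply: (lfd_unique _ (is_lfdB h1 h2)).
by apply: lfdP; exists (fun m y => lfd Phi m y - lfd Psi m y); exact: is_lfdB.
Qed.

End subtraction.

Section difference_equation.
Context {R : realType} {d : nat}.
Variables (T : R) (T0 : 0 < T) (H : 'rV[R]_d -> 'rV[R]_d -> R)
  (F G1 G2 : 'rV[R]_d -> prob_torus R d -> R)
  (U1 U2 : R -> 'rV[R]_d -> prob_torus R d -> R).
Notation P := (prob_torus R d).
Notation Ud := (Udiff U1 U2).
Hypotheses (hH : hamiltonian H) (S1 : classical_solution T H F G1 U1)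
  (S2 : classical_solution T H F G2 U2).

Let T0' : 0 <= T. Proof. exact: ltW. Qed.

Lemma dot_bhat t x m : 0 <= t <= T ->
  dot (bhat H U1 U2 t x m) (Dx Ud t x m) = H x (Dx U1 t x m) - H x (Dx U2 t x m).
Proof.
move=> tT; have [_ pH cH _] := hH.
have cg : continuous (grad (H x)).
  apply: (@continuousT_comp _ _ _ (fun p => (x, p)) _ _ cH).
  by apply: continuousT_pair; [exact: continuousT_cst|exact: continuousT_id].
have e : Dx U1 t x m = Dx U2 t x m + Dx Ud t x m.
  by rewrite (Dx_Udiff (cs_C2_space S1) (cs_C2_space S2) _ _ tT) addrC subrK.
rewrite e (segment_integral _ _ (pH x).1 cg) dotE.
by apply: eq_bigr => i _; rewrite [X in X * _]mxE.
Qed.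

Lemma Ahat_increment t y m : 0 <= t <= T ->
  Ahat H U1 U2 t y m *m (Dx Ud t y m)^T = (beta H U1 t y m - beta H U2 t y m)^T.
Proof.
move=> tT; have [_ pH _ cH] := hH.
have ch : continuous (hess (H y)).
  apply: (@continuousT_comp _ _ _ (fun p => (y, p)) _ _ cH).
  by apply: continuousT_pair; [exact: continuousT_cst|exact: continuousT_id].
have e : Dx U1 t y m = Dx U2 t y m + Dx Ud t y m.
  by rewrite (Dx_Udiff (cs_C2_space S1) (cs_C2_space S2) _ _ tT) addrC subrK.
apply/matrixP => i j; rewrite (ord1 j) [RHS]mxE [RHS]mxE [X in _ = _ + X]mxE.
rewrite [X in _ = X + _]mxE [X in _ = _ - X]mxE e.
have pf := (pH y).2 i.
have cg : continuous (grad ('D_(basis_vec R i) (H y))).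
  apply: continuous_rV => k; apply: (eq_continuousT _ (continuous_entry (i := i) (j := k) ch)) => p.
  by rewrite [LHS]mxE [RHS]mxE.
rewrite (segment_integral _ _ pf cg) mxE.
apply: eq_bigr => k _; rewrite [X in X * _]mxE [X in _ * X]mxE; congr (_ * _).
by apply: eq_Rintegral => s _; rewrite [LHS]mxE [RHS]mxE.
Qed.

(** The mixed term, the integral of D_m U2 . beta1, appears with opposite signs in the transport
    part and in the nonlocal part. What is left is the difference of the two equations. *)
Lemma Pop_Udiff t x m : 0 < t < T -> Pop H U1 U2 Ud (Dx Ud) (Lapx Ud) t x m = 0.
Proof.
move=> tT; have tT' : 0 <= t <= T by have /andP[? ?] := tT; rewrite !ltW.
have [p1 _ [_ dt1 _] [sp1 cx1 _] [m1 l1 cl1 cg1 ch1] me1 _] := S1.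
have [p2 _ [_ dt2 _] [sp2 cx2 _] [m2 l2 cl2 cg2 ch2] me2 _] := S2.
have alg (a1 a2 b1 b2 c1 c2 v1 v2 q11 q21 q22 f : R) :
    - a1 - b1 + c1 - v1 + q11 = f -> - a2 - b2 + c2 - v2 + q22 = f ->
    - (a1 - a2 + (v1 - v2) - (q11 - q21)) - (b1 - b2) + (c1 - c2) + (q21 - q22) = 0.
  by move=> <- /eqP; rewrite -subr_eq0 => /eqP h; rewrite -[RHS]oppr0 -[in RHS]h; ring.
have eq_beta G U : classical_solution T H F G U -> - Dt U t x m - Lapx U t x m + H x (Dx U t x m)
    - (\int[m]_y dvg (Dm (U t x) m) y)
    + (\int[m]_y dot (Dm (U t x) m y) (beta H U t y m)) = F x m by move=> S; exact: (cs_equation S).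
have e1 := eq_beta _ _ S1; have e2 := eq_beta _ _ S2.
have [pH _ cH _] := hH.
have cmap : continuous (fun y : 'rV[R]_d => (((t, x), m), y)).
  by apply: continuousT_pair; [exact: continuousT_cst|exact: continuousT_id].
have cmapx : continuous (fun y : 'rV[R]_d => ((t, y), m)).
  apply: continuousT_pair; last exact: continuousT_cst.
  by apply: continuousT_pair; [exact: continuousT_cst|exact: continuousT_id].
have dtE : Dt Ud t x m = Dt U1 t x m - Dt U2 t x m.
  by rewrite /Dt !derive1E; exact: (deriveB (dt1 t x m tT) (dt2 t x m tT)).
have lapE : Lapx Ud t x m = Lapx U1 t x m - Lapx U2 t x m.
  exact: (lapB _ (sp1 t m tT') (sp2 t m tT')).
have lfdE : lfd (Ud t x) m = fun y => lfd (U1 t x) m y - lfd (U2 t x) m y.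
  exact: (congr1 (fun f => f m) (lfdB (m1 t x tT') (m2 t x tT'))).
have DmE y : Dm (Ud t x) m y = Dm (U1 t x) m y - Dm (U2 t x) m y.
  by rewrite /Dm lfdE; exact: (gradB _ (l1 t x m tT').1 (l2 t x m tT').1).
have [q1 _ _ _] := lfdP (m1 t x tT'); have [q2 _ _ _] := lfdP (m2 t x tT').
have dvgE (U : R -> 'rV[R]_d -> P -> R) : dvg (Dm (U t x) m) = lap (lfd (U t x) m).
  by apply/funext => y; exact: dvg_grad.
have lapi (U : R -> 'rV[R]_d -> P -> R) :
    cont_txmy T (fun t x m => hess (lfd (U t x) m)) -> Zperiodic (lfd (U t x) m) ->
    itg m (lap (lfd (U t x) m)).
  move=> ch pl; apply: itg_continuous_periodic; last exact: Zperiodic_lap.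
  have := continuousT_comp cmap (cont_txmy_clip T0' ch); rewrite /= clip_id// => ch'.
  by apply: (eq_continuousT _ (continuous_trace ch')) => y; rewrite lap_hess.
have cDm (U : R -> 'rV[R]_d -> P -> R) : cont_txmy T (fun t x => Dm (U t x)) ->
    continuous (Dm (U t x) m).
  by move=> cg; have := continuousT_comp cmap (cont_txmy_clip T0' cg); rewrite /= clip_id.
have cb (U : R -> 'rV[R]_d -> P -> R) : cont_txm T (Dx U) ->
    continuous (fun y => beta H U t y m).
  move=> cx; have := continuousT_comp cmapx (cont_txm_clip T0' cx); rewrite /= clip_id// => cx'.
  exact: (continuousT_comp (continuousT_pair (@continuousT_id _) cx') cH).
have pb (U : R -> 'rV[R]_d -> P -> R) : (forall t, Zperiodic (U t)) ->
    Zperiodic (fun y => beta H U t y m).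
  by move=> pU y k; rewrite /beta /DpH pH (Zperiodic_Dx pU).
have idot (u w : 'rV[R]_d -> 'rV[R]_d) : continuous u -> continuous w -> Zperiodic u ->
    Zperiodic w -> itg m (fun y => dot (u y) (w y)).
  move=> cu cw pu pw; apply: itg_continuous_periodic; first exact: continuous_dot.
  by move=> y k; rewrite pu pw.
have pD1 : Zperiodic (Dm (U1 t x) m) by exact: Zperiodic_grad.
have pD2 : Zperiodic (Dm (U2 t x) m) by exact: Zperiodic_grad.
have cD1 := cDm _ cg1; have cD2 := cDm _ cg2.
have i11 := idot _ _ cD1 (cb _ cx1) pD1 (pb _ p1).
have i21 := idot _ _ cD2 (cb _ cx1) pD2 (pb _ p1).
have i22 := idot _ _ cD2 (cb _ cx2) pD2 (pb _ p2).
have dvgI : \int[m]_y dvg (Dm (Ud t x) m) y =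
    (\int[m]_y dvg (Dm (U1 t x) m) y) - (\int[m]_y dvg (Dm (U2 t x) m) y).
  rewrite !dvgE -RintB; [|exact: lapi|exact: lapi].
  apply: eq_Rintegral => y _; rewrite lfdE.
  exact: (lapB _ (l1 t x m tT') (l2 t x m tT')).
have dotI : \int[m]_y dot (Dm (Ud t x) m y) (beta H U1 t y m) =
    (\int[m]_y dot (Dm (U1 t x) m y) (beta H U1 t y m)) -
    (\int[m]_y dot (Dm (U2 t x) m y) (beta H U1 t y m)).
  rewrite -RintB//; apply: eq_Rintegral => y _; rewrite DmE.
  exact: dotBl.
have AI : \int[m]_y (Dm (U2 t x) m y *m Ahat H U1 U2 t y m *m (Dx Ud t y m)^T) ord0 ord0 =
    (\int[m]_y dot (Dm (U2 t x) m y) (beta H U1 t y m)) -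
    (\int[m]_y dot (Dm (U2 t x) m y) (beta H U2 t y m)).
  rewrite -RintB//; apply: eq_Rintegral => y _; rewrite -mulmxA (Ahat_increment _ _ tT').
  exact: dotBr.
rewrite /Pop /Dbeta dtE lapE dvgI dotI AI dot_bhat//.
exact: alg e1 e2.
Qed.

Lemma C1_time_Udiff : C1_time T Ud.
Proof.
have [c1 d1 [D1 cD1 e1]] := cs_C1_time S1; have [c2 d2 [D2 cD2 e2]] := cs_C1_time S2.
split.
- move=> x m; have h := c1 x m; have h' := c2 x m.
  by move=> t; apply: (@cvgB _ _ _ _ _ _ _ _ _ (h t) (h' t)).
- by move=> t x m tT; exact: (derivableB (d1 t x m tT) (d2 t x m tT)).
exists (fun t x m => D1 t x m - D2 t x m).
  by move=> z; exact: (cvgB (cD1 z) (cD2 z)).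
move=> t x m tT; rewrite -e1// -e2// /Dt !derive1E.
exact: (deriveB (d1 t x m tT) (d2 t x m tT)).
Qed.

Lemma within_continuousB (X : topologicalType) (V : normedModType R) (A : set X) (f g : X -> V) :
  {within A, continuous f} -> {within A, continuous g} ->
  {within A, continuous (fun x => f x - g x)}.
Proof. by move=> cf cg z; exact: (cvgB (cf z) (cg z)). Qed.

Lemma within_eq_continuous (X Y : topologicalType) (A : set X) (f g : X -> Y) :
  {in A, f =1 g} -> {within A, continuous f} -> {within A, continuous g}.
Proof. exact: subspace_eq_continuous. Qed.

Lemma C1_measure_C2_Udiff : C1_measure_C2 T Ud.
Proof.
have [m1 l1 cl1 cg1 ch1] := cs_C1_measure S1; have [m2 l2 cl2 cg2 ch2] := cs_C1_measure S2.
have lfdE t x : 0 <= t <= T -> lfd (Ud t x) = fun m y => lfd (U1 t x) m y - lfd (U2 t x) m y.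
  by move=> tT; exact: (lfdB (m1 t x tT) (m2 t x tT)).
split.
- move=> t x tT; have := is_lfdB (lfdP (m1 t x tT)) (lfdP (m2 t x tT)).
  by move=> h; eexists; exact: h.
- by move=> t x m tT; rewrite lfdE//; apply: has_partials2B; [exact: l1|exact: l2].
- apply: within_eq_continuous (within_continuousB cl1 cl2) => -[[[t x] m] y].
  by rewrite inE /= => tT; rewrite lfdE.
- apply: within_eq_continuous (within_continuousB cg1 cg2) => -[[[t x] m] y].
  rewrite inE /= => tT; rewrite /Dm lfdE//.
  by rewrite (gradB _ (l1 t x m tT).1 (l2 t x m tT).1).
- apply: within_eq_continuous (within_continuousB ch1 ch2) => -[[[t x] m] y].
  by rewrite inE /= => tT; rewrite lfdE// (hessB _ (l1 t x m tT) (l2 t x m tT)).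
Qed.

End difference_equation.

(** * The Carleman estimate along the flow *)

Section uniform_bounds.
Context {R : realType} {d : nat} {T : R}.
Hypothesis T0 : 0 < T.
Notation clp := (clip T).

Lemma clip_tcube_bounded (f : R -> 'rV[R]_d -> R) :
  continuous (fun z : R * 'rV[R]_d => f (clp z.1) z.2) ->
  exists K, forall t x, @tcube R d x -> `|f (clp t) x| <= K.
Proof.
move=> cf; have cpt : compact (`[0, T]%classic `*` @tcube R d).
  by apply: compact_setX; [exact: segment_compact|exact: tcube_compact].
have /compact_bounded[C [_ /(_ (C + 1))]] := continuous_compact (continuous_subspaceT cf) cpt.
rewrite ltrDl ltr01 => /(_ isT) h; exists (C + 1) => t x xK.
apply: h; exists (clp t, x) => /=; last by rewrite (@clip_id _ T (clp t))// clip_itv// ltW.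
by split => //=; rewrite in_itv/=; apply: clip_itv; exact: ltW.
Qed.

Lemma clip_periodic_bounded (f : R -> 'rV[R]_d -> R) :
  continuous (fun z : R * 'rV[R]_d => f (clp z.1) z.2) -> (forall t, Zperiodic (f t)) ->
  exists K, forall t x, `|f (clp t) x| <= K.
Proof.
move=> cf pf; have [K hK] := clip_tcube_bounded cf; exists K => t x.
have [k hk] := unit_cube_repr x; rewrite -(pf (clp t) x k); apply: hK.
exact: unit_cubeW.
Qed.

Lemma sqi_patch_continuous (f : R -> 'rV[R]_d -> R) :
  continuous (fun z : R * 'rV[R]_d => f (clp z.1) z.2) -> (forall t, Zperiodic (f t)) ->
  sqi (uniform_prob T0 \x torus_leb R d)%E (patch_cyl T f).
Proof.
move=> cf pf; have [K hK] := clip_periodic_bounded cf pf.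
have -> : patch_cyl T f = patch_cyl T (fun t => f (clp t)).
  apply/funext => -[t x]; have [tT|tT] := boolP (0 < t < T); last by rewrite !patch_cyl_out.
  by have /andP[? ?] := tT; rewrite !patch_cylE// clip_id// !ltW.
apply: (@sqi_bounded _ _ _ _ _ K); first exact: measurable_patch_continuous.
move=> [t x]; have [tT|tT] := boolP (0 < t < T); first by rewrite patch_cylE.
by rewrite patch_cyl_out// normr0 (le_trans _ (hK 0 0)).
Qed.

End uniform_bounds.

Section weighted_congruence.
Context {R : realType} {d : nat}.
Implicit Types f g : R -> 'rV[R]_d -> R.

Lemma eq_weighted_QT T lambda a nu f g :
  (forall t x, 0 < t < T -> f t x = g t x) ->
  weighted_QT T lambda a nu f = weighted_QT T lambda a nu g.
Proof. by move=> fg; apply: eq_integral => -[t x]; rewrite inE => tT /=; rewrite fg. Qed.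

Lemma weighted_QT0 T lambda a nu f :
  (forall t x, 0 < t < T -> f t x = 0) -> weighted_QT T lambda a nu f = 0%E.
Proof.
move=> f0; apply: integral0_eq => -[t x] tT /=.
by rewrite f0// expr0n mulr0.
Qed.

End weighted_congruence.

Lemma within_continuous_pair (X Y Z : topologicalType) (A : set X) (f : X -> Y) (g : X -> Z) :
  {within A, continuous f} -> {within A, continuous g} ->
  {within A, continuous (fun x => (f x, g x))}.
Proof. by move=> cf cg z; exact: (cvg_pair (cf z) (cg z)). Qed.

Section solutions.
Context {R : realType} {d : nat}.
Variables (T : R) (T0 : 0 < T) (H : 'rV[R]_d -> 'rV[R]_d -> R)
  (U : R -> 'rV[R]_d -> prob_torus R d -> R).
Hypotheses (hH : hamiltonian H) (pU : forall t, Zperiodic (U t)) (C2U : C2_space T U).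

Lemma cont_beta : cont_txm T (beta H U).
Proof.
have [_ cx _] := C2U; have [_ _ cH _] := hH.
have c1 : {within [set z : R * 'rV[R]_d * prob_torus R d | 0 <= z.1.1 <= T],
    continuous (fun z => z.1.2)}.
  apply: continuous_subspaceT.
  exact: (continuousT_comp (@continuousT_fst (R * 'rV[R]_d)%type (prob_torus R d)) (@continuousT_snd R 'rV[R]_d)).
exact: (continuousT_comp (within_continuous_pair c1 cx) cH).
Qed.

Lemma Zperiodic_beta t m : Zperiodic (fun y => beta H U t y m).
Proof.
by have [pH _ _ _] := hH; move=> y k; rewrite /beta /DpH pH (Zperiodic_Dx pU).
Qed.

End solutions.

Section carleman_along_flow.
Context {R : realType} {d : nat}.
Variables (T a nu M : R).
Hypotheses (T0 : 0 < T) (a0 : 0 < a) (nu1 : 1 < nu) (M0 : 0 < M).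
Variables (H : 'rV[R]_d -> 'rV[R]_d -> R) (U1 U2 : R -> 'rV[R]_d -> prob_torus R d -> R)
  (m0 : prob_torus R d) (m1 : R -> prob_torus R d) (rho : R -> 'rV[R]_d -> R).
Hypotheses (hH : hamiltonian H) (pU1 : forall t, Zperiodic (U1 t))
  (pU2 : forall t, Zperiodic (U2 t)) (C1 : C2_space T U1) (C2 : C2_space T U2)
  (Cm2 : C1_measure_C2 T U2) (flow : density_flow T (beta H U1) m0 m1 rho).
Hypothesis hM : (ereal_sup (range (fun m =>
      Linf_QT T (fun t x => enorm (bhat H U1 U2 t x m))))
   + ereal_sup (range (fun m =>
      Linf_QT T (fun t y => enorm (Ahat H U1 U2 t y m))))
   + ereal_sup (range (fun m =>
      Linf_QT_Td T (fun t x y => enorm (Dm (U2 t x) m y))))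
   + Linf_QT T rho <= M%:E)%E.
Notation P := (prob_torus R d).
Notation nT := (uniform_prob T0).
Notation mu := (torus_leb R d).
Notation pm := (nT \x mu)%E.
Notation patch := (patch_cyl T).
Notation clp := (clip T).

Let T0' : 0 <= T. Proof. exact: ltW. Qed.

Lemma density_bound : (Linf_QT T rho <= M%:E)%E.
Proof.
have sup0 (f : P -> \bar R) : (forall m, 0 <= f m)%E -> (0 <= ereal_sup (range f))%E.
  by move=> f0; apply: (le_trans (f0 m0)); apply: ereal_sup_ubound; exists m0.
apply: le_trans hM; rewrite leeDr//.
by apply: adde_ge0; [apply: adde_ge0|]; apply: sup0 => m; exact: Lnorm_ge0.
Qed.

Variables (V : R -> 'rV[R]_d -> P -> R).
Hypotheses (VC1 : C1_time T V) (VC2 : C1_measure_C2 T V).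
Notation v := (along T m1 V).

Lemma along_eq t x : 0 <= t <= T -> v t x = V t x (m1 t).
Proof. by move=> tT; rewrite /along /flow_clip clip_id. Qed.

(* The derivative along the flow is bounded only over the fundamental cube, outside
   of which [D] is a truncation of it. *)
Lemma along_bounded_derivative : exists D K, [/\
  continuous (fun z : R * 'rV[R]_d => D z.1 z.2) : Prop,
  forall t x, `|D t x : R| <= K,
  forall x, tcube x -> forall t, 0 < t < T -> D t x = Dbeta (beta H U1) V t x (m1 t),
  forall x, tcube x -> forall t, 0 < t < T -> is_derive (t : R) (1 : R) (v^~ x) (D t x)
  & forall x, continuous (v^~ x)].
Proof.
have [D [cD DE dv cv]] := along_C1 T0 (cont_beta hH C1)
  (fun t m _ => Zperiodic_beta hH pU1 t m) flow VC1 VC2.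
have cDc : continuous (fun z : R * 'rV[R]_d => D (clp z.1) z.2).
  apply: (@continuousT_comp _ _ _ (fun z : R * 'rV[R]_d => (clp z.1, z.2)) _ _ cD).
  apply: continuousT_pair; last exact: continuousT_snd.
  exact: continuousT_comp (@continuousT_fst _ _) (@clip_continuous _ _).
have [K hK] := clip_tcube_bounded T0 cDc.
(* Truncation to the interval from -|K| to |K|: the inner expression is the minimum of |K| and D. *)
pose D' t x := Num.max (- `|K|) (- Num.max (- `|K|) (- D t x)).
have D'E x t : @tcube R d x -> 0 < t < T -> D' t x = D t x.
  move=> xK tT; have := hK t x xK; rewrite clip_id; last by have /andP[? ?] := tT; rewrite !ltW.
  move=> /le_trans/(_ (ler_norm K)); rewrite ler_norml => /andP[h1 h2].
  by rewrite /D' (max_r (_ : - `|K| <= - D t x)) ?opprK ?max_r// lerN2.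
exists D', `|K|; split => //.
- apply: (@continuousT_comp _ _ _ _ (fun u : R => Num.max (- `|K|) (- Num.max (- `|K|) (- u))) cD).
  have cm : continuous (fun u : R => Num.max (- `|K|) u) by exact: maxr_continuous.
  have cn : continuous (fun u : R => - u) by exact: opp_continuous.
  exact: (continuousT_comp (continuousT_comp (continuousT_comp cn cm) cn) cm).
- move=> t x; rewrite ler_norml /D' le_max lexx /= ge_max ge0_cp//= lerNl.
  by rewrite le_max lexx.
- by move=> x xK t tT; rewrite D'E// DE.
- by move=> x xK t tT; rewrite D'E//; exact: dv.
Qed.

(** [g] and [tr] are constrained only by square integrability and the integrated identity, so weak
    and classical derivatives are treated at once. *)
Lemma carleman_along (g : R -> 'rV[R]_d -> 'rV[R]_d) (tr : R -> 'rV[R]_d -> R)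
    (gT : 'rV[R]_d -> 'rV[R]_d) lambda :
  sqi pm (patch v) -> (forall i, sqi pm (patch (fun t x => g t x ord0 i))) -> sqi pm (patch tr) ->
  {ae nT, forall t, \sum_i \int[mu]_x (g t x ord0 i ^+ 2) = - \int[mu]_x (v t x * tr t x)} ->
  carleman_lambda0 a nu M <= lambda ->
  (lambda%:E * weighted_QT T lambda a nu (fun t x => enorm (g t x))
    + (lambda ^+ 2)%:E * weighted_QT T lambda a nu (fun t x => V t x (m1 t))
    <= (carleman_constant a nu)%:E * weighted_QT T lambda a nu (fun t x =>
         Pop H U1 U2 V (fun s y _ => g s y) (fun s y _ => tr s y) t x (m1 t))
       + (carleman_constant a nu * carleman_weight lambda a nu T)%:E *
         \int[mu]_x (enorm (gT x) ^+ 2 + lambda * V T x (m1 T) ^+ 2)%:E)%E.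
Proof.
move=> sv sg str hid hl.
have [D [K [cD DK DE dv cv]]] := along_bounded_derivative.
have vE : weighted_QT T lambda a nu (fun t x => V t x (m1 t)) = weighted_QT T lambda a nu v.
  by apply: eq_weighted_QT => t x /andP[t1 t2]; rewrite along_eq// !ltW.
have TE x : V T x (m1 T) = v T x by rewrite along_eq// T0' lexx.
under eq_integral do rewrite TE.
rewrite vE; apply: (@carleman_estimate R d T a nu M T0 a0 nu1 M0 v D K g tr (fun t x =>
  Pop H U1 U2 V (fun s y _ => g s y) (fun s y _ => tr s y) t x (m1 t)) gT) => //.
have aesg : {ae nT, forall t, forall i, sqi mu (fun y => patch (fun t x => g t x ord0 i) (t, y))}.
  by apply: ae_forall_ord => i; exact: sqi_section (sg i).
apply: (ae_mono2 (ae_mono2 aesg (flow_le T0 M0 flow density_bound) (fun t p q => conj p q))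
  (ae_uniform_itv T0)) => t [sgt mM] tT x xc.
have [bM AM UM] := coefficient_bounds T0 hH pU1 pU2 C1 C2 Cm2 m0 hM tT.
have tT' : 0 <= t <= T by have /andP[? ?] := tT; rewrite !ltW.
have sG i : sqi mu (fun y => g t y ord0 i).
  rewrite (_ : (fun _ => _) = fun y => patch (fun t x => g t x ord0 i) (t, y)) //.
  by apply/funext => y; rewrite patch_cylE.
have cU2 i : continuous (fun y => Dm (U2 t x) (m1 t) y ord0 i).
  have [_ _ _ cg _] := Cm2; apply: continuous_entry.
  have cmap : continuous (fun y : 'rV[R]_d => (((t, x), m1 t), y)).
    by apply: continuousT_pair; [exact: continuousT_cst|exact: continuousT_id].
  by have := continuousT_comp cmap (cont_txmy_clip T0' cg); rewrite /= clip_id.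
have cA i j : continuous (fun y => Ahat H U1 U2 t y (m1 t) i j).
  have cmap : continuous (fun y : 'rV[R]_d => ((t, y), m1 t)).
    apply: continuousT_pair; last exact: continuousT_cst.
    by apply: continuousT_pair; [exact: continuousT_cst|exact: continuousT_id].
  have cAh : continuous (fun z : R * 'rV[R]_d * P => Ahat H U1 U2 (clp z.1.1) z.1.2 z.2 i j).
    exact: continuous_Ahat.
  by have := continuousT_comp cmap cAh; rewrite /= clip_id.
have nb := nonlocal_bound M0 (mM : forall A, measurable A -> _) cU2 cA (fun y => UM x (m1 t) y)
  (fun y => AM y (m1 t)) sG.
set N := \int[_]_y _ in nb.
rewrite DE//; last exact: unit_cubeW.
have db : dot (bhat H U1 U2 t x (m1 t)) (g t x) ^+ 2 <= M ^+ 2 * enorm (g t x) ^+ 2.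
  rewrite -exprMn -(real_normK (num_real (dot _ _))).
  rewrite lerXn2r ?nnegrE ?mulr_ge0 ?enorm_ge0 ?(ltW M0)//.
  by rewrite (le_trans (normr_dot_le _ _))// ler_wpM2r ?enorm_ge0.
move: nb db; rewrite /Pop -/N; set p := dot _ _; set q := Dbeta _ _ _ _ _; set r := tr t x.
set X := M ^+ 2 * _; set Y := M ^+ 6 * _ => nb db.
have h3 (u w z : R) : (u - w - z) ^+ 2 <= 3 * (u ^+ 2 + w ^+ 2 + z ^+ 2).
  have : 0 <= (u + w) ^+ 2 + (u + z) ^+ 2 + (w - z) ^+ 2 by rewrite !addr_ge0// sqr_ge0.
  by move=> h; nra.
(* - D - tr is PV minus the drift term minus the nonlocal term; the square of three terms costs the
   factor 3. *)
rewrite [X in X ^+ 2 <= _](_ : _ = (- q - r + p + N) - p - N); last by ring.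
by apply: (le_trans (h3 _ _ _)); rewrite ler_wpM2l// !lerD.
Qed.

(** The trace of the weak Hessian plays the Laplacian. The time slices of the weak derivatives give
    the integrated identity at almost every time, and [trace_exists] gives the final gradient
    coordinate by coordinate. *)
Lemma carleman_weak (g : R -> 'rV[R]_d -> 'rV[R]_d) (h : R -> 'rV[R]_d -> 'M[R]_d) :
  L2H2_H1L2 T (fun t x => V t x (m1 t)) g h ->
  exists2 gT : 'rV[R]_d -> 'rV[R]_d,
    H1_torus (fun x => V T x (m1 T)) gT &
  forall lambda : R, carleman_lambda0 a nu M <= lambda ->
  (lambda%:E * weighted_QT T lambda a nu (fun t x => enorm (g t x))
    + (lambda ^+ 2)%:E * weighted_QT T lambda a nu (fun t x => V t x (m1 t))
    <= (carleman_constant a nu)%:E * weighted_QT T lambda a nu (fun t x =>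
         Pop H U1 U2 V (fun s y _ => g s y) (fun s y _ => \tr (h s y)) t x (m1 t))
       + (carleman_constant a nu * carleman_weight lambda a nu T)%:E *
         \int[mu]_x (enorm (gT x) ^+ 2 + lambda * V T x (m1 T) ^+ 2)%:E)%E.
Proof.
move=> [Lv Lg Lh _].
have vE t : 0 < t < T -> v t = (fun x => V t x (m1 t)).
  by move=> /andP[t0 t1]; apply/funext => x; rewrite along_eq// !ltW.
have pE : patch v = patch (fun t x => V t x (m1 t)).
  apply/funext => -[t x]; have [tT|tT] := boolP (0 < t < T); last by rewrite !patch_cyl_out.
  by rewrite !patch_cylE// vE.
have sv : sqi pm (patch v) by rewrite pE; exact: L2_sqi.
have sg i : sqi pm (patch (fun t x => g t x ord0 i)) by apply: L2_sqi; exact: (Lg i).1.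
have sh i j : sqi pm (patch (fun t x => h t x i j)) by apply: L2_sqi; exact: (Lh i j).1.
have str : sqi pm (patch (fun t x => \tr (h t x))).
  rewrite (_ : patch _ = fun z => \sum_i patch (fun t x => h t x i i) z); first exact: sqi_sum.
  apply/funext => -[t x]; have [tT|tT] := boolP (0 < t < T).
    by rewrite patch_cylE//; apply: eq_bigr => i _; rewrite patch_cylE.
  by rewrite patch_cyl_out// big1// => i _; rewrite patch_cyl_out.
have kv i : {ae nT, forall t, @ker_weak R d i (v t) (fun x => g t x ord0 i)}.
  apply: (ae_mono2 (ker_weak_slice T0 Lv (Lg i).1 (Lg i).2) (ae_uniform_itv T0)) => t + tT.
  by rewrite vE.
have kg i : {ae nT, forall t, @ker_weak R d i (fun x => g t x ord0 i) (fun x => h t x i i)}.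
  exact: ker_weak_slice (Lg i).1 (Lh i i).1 (Lh i i).2.
have wv i phi : test_rV phi -> {ae nT, forall t,
    \int[mu]_y (v t y * 'D_(basis_vec R i) phi y) = - \int[mu]_y (g t y ord0 i * phi y)}.
  move=> tphi.
  apply: (ae_mono2 (weak_dx_slice T0 Lv (Lg i).1 (Lg i).2 tphi) (ae_uniform_itv T0)) => t + tT.
  by rewrite vE.
have hid : {ae nT, forall t, \sum_i \int[mu]_x (g t x ord0 i ^+ 2) =
    - \int[mu]_x (v t x * \tr (h t x))}.
  apply: (ae_mono2 (ae_forall_ord kv) (ae_forall_ord kg)) => t kvt kgt.
  have e i : \int[mu]_x (g t x ord0 i ^+ 2) = - \int[mu]_x (v t x * h t x i i).
    by rewrite (weak_integration_by_parts (kvt i) (kgt i)) opprK.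
  have iv i : itg mu (fun x => v t x * h t x i i).
    by have [s1 _ _] := kvt i; have [_ s2 _] := kgt i; exact: sqi_mul.
  under eq_bigr do rewrite e.
  rewrite sumrN -Rint_sum//; congr (- _); apply: eq_Rintegral => x _.
  by rewrite /mxtrace mulr_sumr.
have [D [K [cD DK DE dv cv]]] := along_bounded_derivative.
have tre i : exists gi : 'rV[R]_d -> R, sqi mu gi /\ forall phi, test_rV phi ->
    \int[mu]_y (v T y * 'D_(basis_vec R i) phi y) = - \int[mu]_y (gi y * phi y).
  have [gi h1 h2] := trace_exists sv cD DK dv cv (sh i i) (wv i) (kv i) (kg i).
  by exists gi.
pose gT (x : 'rV[R]_d) : 'rV[R]_d := \row_i projT1 (cid (tre i)) x.
have gTE i : (fun x => gT x ord0 i) = projT1 (cid (tre i)).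
  by apply/funext => x; rewrite mxE.
have TT : 0 <= T <= T by rewrite T0' lexx.
have TE : (fun x => V T x (m1 T)) = v T by apply/funext => x; rewrite along_eq.
have svT : sqi mu (v T).
  by apply: (sqi_slice sv DK dv (fun x _ => cv x) TT); exact: (measurable_slice sv TT cv).
have sqi_lty (f : 'rV[R]_d -> R) : sqi mu f -> (\int[mu]_x (f x ^+ 2)%:E < +oo)%E.
  by move=> [_ sf]; rewrite itg_EFin// ltry.
exists gT.
  split.
  - by rewrite TE; exact: svT.1.
  - by have := sqi_lty _ svT; rewrite -TE.
  - by move=> i; rewrite gTE; case: cid => gi [[]].
  - by move=> i; apply: sqi_lty; rewrite gTE; case: cid => gi [].
  - move=> i phi pphi dphi cphi cgphi; have tphi : test_rV phi.
      split => // j; apply: (eq_continuousT _ (continuous_entry (i := ord0) (j := j) cgphi)) => x.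
      by rewrite mxE.
    have TE' x : V T x (m1 T) = v T x by rewrite along_eq.
    under eq_Rintegral do rewrite TE'.
    have gTE' x : gT x ord0 i = projT1 (cid (tre i)) x by rewrite mxE.
    under [in RHS]eq_Rintegral do rewrite gTE'.
    by case: cid => gi /= [_]; exact.
by move=> lambda; exact: (carleman_along _ sv sg str hid).
Qed.

End carleman_along_flow.

(** The classical counterpart of the weak integration by parts, valid at every time for a difference
    of classical solutions. *)
Lemma torus_green (R : realType) (d : nat) (u : 'rV[R]_d -> R) : test2 u ->
  \sum_i \int[torus_leb R d]_x (grad u x ord0 i ^+ 2) =
  - \int[torus_leb R d]_x (u x * lap u x).
Proof.
move=> [pu cu [du du2] cg ch].
have cgi i : continuous ('D_(basis_vec R i) u).
  apply: (eq_continuousT _ (continuous_entry (i := ord0) (j := i) cg)) => x.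
  by rewrite mxE.
have chi i : continuous ('D_(basis_vec R i) ('D_(basis_vec R i) u)).
  apply: (eq_continuousT _ (continuous_entry (i := i) (j := i) ch)) => x.
  by rewrite mxE.
have pui i := Zperiodic_derive (basis_vec R i) pu.
have puii i := Zperiodic_derive (basis_vec R i) (pui i).
have i1 i : itg (torus_leb R d) (fun x => u x * 'D_(basis_vec R i) ('D_(basis_vec R i) u) x).
  apply: itg_continuous_periodic; first exact: (continuousT_mul cu (chi i)).
  by move=> x k; rewrite pu puii.
have i2 i : itg (torus_leb R d) (fun x => 'D_(basis_vec R i) u x ^+ 2).
  apply: itg_continuous_periodic; first exact: (continuousT_mul (cgi i) (cgi i)).
  by move=> x k; rewrite pui.
have key i : \int[torus_leb R d]_x ('D_(basis_vec R i) u x ^+ 2) =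
    - \int[torus_leb R d]_x (u x * 'D_(basis_vec R i) ('D_(basis_vec R i) u) x).
  (* The derivative of u times its partial derivative has mean zero on the torus. *)
  pose q x := u x * 'D_(basis_vec R i) u x.
  have dq x : derivable q x (basis_vec R i) by exact: (derivableM (du x i) (du2 i x i)).
  have dqE : 'D_(basis_vec R i) q = (fun x => u x * 'D_(basis_vec R i) ('D_(basis_vec R i) u) x +
      'D_(basis_vec R i) u x ^+ 2).
    by apply/funext => x; rewrite (deriveM (du x i) (du2 i x i)) expr2.
  have := @torus_int_derive R d i q (continuousT_mul cu (cgi i)) _ dq _.
  rewrite dqE RintD// => h; apply/eqP; rewrite -subr_eq0 opprK addrC; apply/eqP; apply: h.
    by move=> x k; rewrite /q pu pui.
  exact: (continuousT_add (continuousT_mul cu (chi i)) (continuousT_mul (cgi i) (cgi i))).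
transitivity (\sum_i - \int[torus_leb R d]_x (u x * 'D_(basis_vec R i) ('D_(basis_vec R i) u) x)).
  apply: eq_bigr => i _; rewrite -key; apply: eq_Rintegral => x _; by rewrite mxE.
rewrite sumrN -Rint_sum//; congr (- _); apply: eq_Rintegral => x _.
by rewrite /lap mulr_sumr.
Qed.

Section classical_difference.
Context {R : realType} {d : nat}.
Variables (T a nu M : R).
Hypotheses (T0 : 0 < T) (a0 : 0 < a) (nu1 : 1 < nu) (M0 : 0 < M).
Variables (H : 'rV[R]_d -> 'rV[R]_d -> R) (F G1 G2 : 'rV[R]_d -> prob_torus R d -> R)
  (U1 U2 : R -> 'rV[R]_d -> prob_torus R d -> R)
  (m0 : prob_torus R d) (m1 : R -> prob_torus R d) (rho : R -> 'rV[R]_d -> R).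
Hypotheses (hH : hamiltonian H) (S1 : classical_solution T H F G1 U1)
  (S2 : classical_solution T H F G2 U2) (flow : density_flow T (beta H U1) m0 m1 rho).
Hypothesis hM : (ereal_sup (range (fun m =>
      Linf_QT T (fun t x => enorm (bhat H U1 U2 t x m))))
   + ereal_sup (range (fun m =>
      Linf_QT T (fun t y => enorm (Ahat H U1 U2 t y m))))
   + ereal_sup (range (fun m =>
      Linf_QT_Td T (fun t x y => enorm (Dm (U2 t x) m y))))
   + Linf_QT T rho <= M%:E)%E.
Notation Ud := (Udiff U1 U2).
Notation mu := (torus_leb R d).
Notation clp := (clip T).

Let T0' : 0 <= T. Proof. exact: ltW. Qed.

Lemma cont_Udiff : [/\ cont_txm T Ud, cont_txm T (Dx Ud) & cont_txm T (Dxx Ud)].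
Proof.
have [h1 cx1 cxx1] := cs_C2_space S1; have [h2 cx2 cxx2] := cs_C2_space S2.
split; first exact: (within_continuousB (cs_continuous S1) (cs_continuous S2)).
  apply: within_eq_continuous (within_continuousB cx1 cx2) => -[[t x] m].
  by rewrite inE /= => tT; rewrite (Dx_Udiff (cs_C2_space S1) (cs_C2_space S2)).
apply: within_eq_continuous (within_continuousB cxx1 cxx2) => -[[t x] m].
by rewrite inE /= => tT; rewrite /Dxx (hessB _ (h1 t m tT) (h2 t m tT)).
Qed.

Lemma continuous_along_flow (S : topologicalType) (f : R -> 'rV[R]_d -> prob_torus R d -> S) :
  cont_txm T f -> continuous (fun z : R * 'rV[R]_d => f (clp z.1) z.2 (m1 (clp z.1))).
Proof.
move=> cf; have cf' := cont_txm_clip T0' cf.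
apply: (@continuousT_comp _ _ _ (fun z : R * 'rV[R]_d => (z, flow_clip T m1 z.1)) _ _ cf').
apply: continuousT_pair; first exact: continuousT_id.
exact: (continuousT_comp (@continuousT_fst _ _) (flow_clip_continuous T0 flow)).
Qed.

(** The conclusion concerns the classical gradients, including the one at time T, so the estimate is
    applied directly with them instead of through weak gradients, which are determined only almost
    everywhere. *)
Lemma carleman_Udiff (lambda : R) : carleman_lambda0 a nu M <= lambda ->
  (lambda%:E * weighted_QT T lambda a nu (fun t x => enorm (Dx Ud t x (m1 t)))
    + (lambda ^+ 2)%:E * weighted_QT T lambda a nu (fun t x => Ud t x (m1 t))
    <= (carleman_constant a nu * carleman_weight lambda a nu T)%:E *
         \int[mu]_x (enorm (Dx Ud T x (m1 T)) ^+ 2 + lambda * Ud T x (m1 T) ^+ 2)%:E)%E.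
Proof.
move=> hl; have pU1 := cs_periodic S1; have pU2 := cs_periodic S2.
have pU := Zperiodic_Ud pU1 pU2.
have [cU cx cxx] := cont_Udiff.
have cUf := continuous_along_flow cU; have cxf := continuous_along_flow cx.
have cxxf := continuous_along_flow cxx.
have tcl (t : R) : 0 < t < T -> 0 <= t <= T by move=> /andP[? ?]; rewrite !ltW.
have sv : sqi (uniform_prob T0 \x mu)%E (patch_cyl T (along T m1 Ud)).
  apply: sqi_patch_continuous.
    apply: (eq_continuousT _ cUf) => z.
    by rewrite /along /flow_clip (clip_id (clip_itv T0' z.1)).
  by move=> t x k; rewrite /along pU.
have sg i : sqi (uniform_prob T0 \x mu)%E (patch_cyl T (fun t x => Dx Ud t x (m1 t) ord0 i)).
  apply: sqi_patch_continuous; first exact: (continuous_entry (i := ord0) (j := i) cxf).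
  by move=> t x k; rewrite (Zperiodic_Dx pU).
have str : sqi (uniform_prob T0 \x mu)%E (patch_cyl T (fun t x => Lapx Ud t x (m1 t))).
  apply: sqi_patch_continuous.
    by apply: (eq_continuousT _ (continuous_trace cxxf)) => z; rewrite /Lapx lap_hess.
  by move=> t x k; rewrite /Lapx Zperiodic_lap//; exact: Zperiodic_U.
have [h1 _ _] := cs_C2_space S1; have [h2 _ _] := cs_C2_space S2.
have hid : {ae uniform_prob T0, forall t, \sum_i \int[mu]_x (Dx Ud t x (m1 t) ord0 i ^+ 2) =
    - \int[mu]_x (along T m1 Ud t x * Lapx Ud t x (m1 t))}.
  apply: (ae_mono2 (ae_uniform_itv T0) (ae_uniform_itv T0)) => t tT _.
  have cmap : continuous (fun y : 'rV[R]_d => (t, y)).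
    by apply: continuousT_pair; [exact: continuousT_cst|exact: continuousT_id].
  have clt : clp t = t by rewrite clip_id// tcl.
  have tu : test2 (fun x => Ud t x (m1 t)).
    split.
    - exact: Zperiodic_U.
    - by have := continuousT_comp cmap cUf; rewrite /= clt.
    - by apply: has_partials2B; [exact: h1 (tcl t tT)|exact: h2 (tcl t tT)].
    - by have := continuousT_comp cmap cxf; rewrite /= clt.
    - by have := continuousT_comp cmap cxxf; rewrite /= clt.
  rewrite [LHS](torus_green tu); congr (- _); apply: eq_Rintegral => x _.
  by rewrite along_eq// tcl.
have := carleman_along a0 nu1 M0 hH pU1 pU2 (cs_C2_space S1) (cs_C2_space S2)
  (cs_C1_measure S2) flow hM (C1_time_Udiff S1 S2) (C1_measure_C2_Udiff S1 S2)
  (fun x => Dx Ud T x (m1 T)) sv sg str hid hl.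
rewrite [X in (_ <= _ * X + _)%E]weighted_QT0 ?mule0 ?add0e//.
move=> t x tT; have := Pop_Udiff T0 hH S1 S2 x (m1 t) tT; rewrite /Pop; exact.
Qed.

End classical_difference.

Lemma carleman_lambda0_gt0 (R : realType) (a nu M : R) : 0 < a -> 1 < nu -> 0 < M ->
  0 < carleman_lambda0 a nu M.
Proof.
move=> a0 nu1 M0; rewrite divr_gt0 ?phase_rate_gt0//.
by rewrite mulr_gt0// addr_gt0// exprn_gt0.
Qed.

Lemma carleman_constant_gt0 (R : realType) (a nu : R) : 0 < a -> 1 < nu ->
  0 < carleman_constant a nu.
Proof.
move=> a0 nu1; have c0 := phase_rate_gt0 a0 nu1.
by rewrite mulr_gt0// ltr_wpDr// ltW// ?invr_gt0// divr_gt0.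
Qed.

Unset Implicit Arguments.

Theorem theorem3p1 (R : realType) (d : nat) (T a nu M : R)
  (d_gt0 : (0 < d)%N) (T_gt0 : 0 < T) (a_gt0 : 0 < a) (nu_gt1 : 1 < nu)
  (M_gt0 : 0 < M) :
  exists lambda0 C : R, 0 < lambda0 /\ 0 < C /\
  forall (H : 'rV[R]_d -> 'rV[R]_d -> R)
    (F G1 G2 : 'rV[R]_d -> prob_torus R d -> R)
    (U1 U2 : R -> 'rV[R]_d -> prob_torus R d -> R)
    (m0 : prob_torus R d) (m1 : R -> prob_torus R d)
    (rho : R -> 'rV[R]_d -> R),
  hamiltonian H ->
  classical_solution T H F G1 U1 ->
  classical_solution T H F G2 U2 ->
  density_flow T (beta H U1) m0 m1 rho ->
  (ereal_sup (range (fun m =>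
      Linf_QT T (fun t x => enorm (bhat H U1 U2 t x m))))
   + ereal_sup (range (fun m =>
      Linf_QT T (fun t y => enorm (Ahat H U1 U2 t y m))))
   + ereal_sup (range (fun m =>
      Linf_QT_Td T (fun t x y => enorm (Dm (U2 t x) m y))))
   + Linf_QT T rho <= M%:E)%E ->
  (forall (V : R -> 'rV[R]_d -> prob_torus R d -> R)
     (g : R -> 'rV[R]_d -> 'rV[R]_d) (h : R -> 'rV[R]_d -> 'M[R]_d),
   (forall t, Zperiodic (V t)) ->
   C1_time T V ->
   C1_measure_C2 T V ->
   L2H2_H1L2 T (fun t x => V t x (m1 t)) g h ->
   exists2 gT : 'rV[R]_d -> 'rV[R]_d,
     H1_torus (fun x => V T x (m1 T)) gT &
   forall lambda : R, lambda0 <= lambda ->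
   (lambda%:E * weighted_QT T lambda a nu (fun t x => enorm (g t x))
    + (lambda ^+ 2)%:E *
      weighted_QT T lambda a nu (fun t x => V t x (m1 t))
    <= C%:E * weighted_QT T lambda a nu (fun t x =>
         Pop H U1 U2 V (fun s y _ => g s y) (fun s y _ => \tr (h s y))
           t x (m1 t))
       + (C * carleman_weight lambda a nu T)%:E *
         \int[torus_leb R d]_x
           (enorm (gT x) ^+ 2 + lambda * V T x (m1 T) ^+ 2)%:E)%E) /\
  (forall t x m, 0 < t < T ->
     Pop H U1 U2 (Udiff U1 U2) (Dx (Udiff U1 U2)) (Lapx (Udiff U1 U2))
       t x m = 0) /\
  (forall lambda : R, lambda0 <= lambda ->
   (lambda%:E * weighted_QT T lambda a nu (fun t x =>
       enorm (Dx (Udiff U1 U2) t x (m1 t)))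
    + (lambda ^+ 2)%:E *
      weighted_QT T lambda a nu (fun t x => Udiff U1 U2 t x (m1 t))
    <= (C * carleman_weight lambda a nu T)%:E *
       \int[torus_leb R d]_x
         (enorm (Dx (Udiff U1 U2) T x (m1 T)) ^+ 2
          + lambda * Udiff U1 U2 T x (m1 T) ^+ 2)%:E)%E).
Proof.
exists (carleman_lambda0 a nu M), (carleman_constant a nu).
split; first exact: carleman_lambda0_gt0.
split; first exact: carleman_constant_gt0.
move=> H F G1 G2 U1 U2 m0 m1 rho hH S1 S2 flow hM; split; [|split].
- move=> V g h _ VC1 VC2 hV.
  exact: (carleman_weak T_gt0 a_gt0 nu_gt1 M_gt0 hH (cs_periodic S1) (cs_periodic S2)
    (cs_C2_space S1) (cs_C2_space S2) (cs_C1_measure S2) flow hM VC1 VC2 hV).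
- by move=> t x m tT; exact: (Pop_Udiff T_gt0 hH S1 S2 x m tT).
- by move=> lambda hl; exact: (carleman_Udiff T_gt0 a_gt0 nu_gt1 M_gt0 hH S1 S2 flow hM hl).
Qed.
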